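(* Let $N\ge1$ and $u_0,\ldots,u_N\in\mathbb{C}$ with $u_j\notin\Lambda_\tau$ and $u_j/\tau\notin\Lambda_{-1/\tau}$, and let $u=u_0+\cdots+u_N$. Then (i) $M_N(u_0,\ldots,u_N;\tau)=e^{\pi iN/4}\big[\delta_{jk}(-1)^k\zeta_{2N}^{k^2}\big]_{j,k=0}^{N-1}M_N(u_0,\ldots,u_N;\tau+1)$; (ii) $$M_N(u_0,\ldots,u_N;\tau)=\frac{(-i)^{N+1}e^{\pi iu^2/(N\tau)}}{\sqrt N\sqrt{-i\tau}}\big[\zeta_N^{-jk}\big]_{j,k=0}^{N-1}M_N\!\left(\tfrac{u_0}{\tau},\ldots,\tfrac{u_N}{\tau};-\tfrac1\tau\right)-\frac{(-1)^Ni}{2}\Big[(-1)^ke^{-2\pi iku/N}q^{-k^2/(2N)}h\!\left(u+k\tau-\tfrac{N-1}{2};N\tau\right)\Big]_{k=0}^{N-1},$$ where $\sqrt{-i\tau}$ is the principal branch.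
   Context: Fix $\tau$ with $\operatorname{Im}\tau>0$, $q=e^{2\pi i\tau}$, $q^c:=e^{2\pi ic\tau}$, $\Lambda_\tau=\mathbb{Z}+\tau\mathbb{Z}$, $\zeta_M=e^{2\pi i/M}$. $\vartheta(u;\tau)=\sum_{\nu\in\mathbb{Z}+1/2}e^{2\pi i\nu(u+1/2)}q^{\nu^2/2}$. Zwegers' multivariable $\mu$-function: $\mu_N(u_0,\ldots,u_N;\tau)=\sum_{n\in\mathbb{Z}^N}\frac{e^{\pi iu_0}}{1-e^{2\pi iu_0}q^{|n|}}\prod_{j=1}^N\frac{(-1)^{n_j}e^{-2\pi in_ju_j}q^{n_j(n_j+1)/2}}{\vartheta(u_j;\tau)}$, $|n|=n_1+\cdots+n_N$. $M_N(u_0,\ldots,u_N;\tau)=\big[(-1)^ke^{-2\pi iku/N-\pi ik^2\tau/N}\mu_N(u_0+k\tau,u_1,\ldots,u_N;\tau)\big]_{k=0}^{N-1}$ (column vector; in a matrix $[A_{jk}]$ the index $j$ is the row). The Mordell integral is $h(w;\tau)=\int_{-\infty}^{\infty}\frac{e^{\pi ix^2\tau-2\pi xw}}{\cosh(\pi x)}dx$. *)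

(* Defs.v *)
From Stdlib Require Import Reals ZArith List.
From Coquelicot Require Import Coquelicot.
Open Scope R_scope.

Definition cexp (z : C) : C :=
  (exp (Re z) * cos (Im z), exp (Re z) * sin (Im z)).

Definition ee (z : C) : C := cexp (2 * PI * Ci * z)%C.

Fixpoint Cpown (z : C) (n : nat) : C :=
  match n with O => RtoC 1 | S n' => (z * Cpown z n')%C end.

Definition msign (k : Z) : C := if Z.even k then RtoC 1 else RtoC (-1).

Definition qpow (tau : C) (c : R) : C := ee (RtoC c * tau)%C.

Definition zeta (M : nat) : C := ee (RtoC (/ INR M)).

(* principal square root (branch cut on (-oo,0], arg in (-pi,pi]) *)
Definition Csqrt (z : C) : C :=
  (sqrt ((Cmod z + Re z) / 2),
   (if Rlt_dec (Im z) 0 then -1 else 1) * sqrt ((Cmod z - Re z) / 2)).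

Definition Clim (s : nat -> C) : C :=
  (real (Lim_seq (fun K => Re (s K))), real (Lim_seq (fun K => Im (s K)))).

Fixpoint Csum_from (f : Z -> C) (a : Z) (n : nat) : C :=
  match n with
  | O => RtoC 0
  | S n' => (f a + Csum_from f (a + 1)%Z n')%C
  end.

Definition Zpart (f : Z -> C) (K : nat) : C :=
  Csum_from f (- Z.of_nat K)%Z (2 * K + 1).

Fixpoint boxsum (d : nat) (K : nat) (f : list Z -> C) : C :=
  match d with
  | O => f nil
  | S d' => Zpart (fun m => boxsum d' K (fun l => f (m :: l))) K
  end.

(* sum over Z^d (limit of box partial sums; the sums below are absolutely
   convergent, so this is the usual sum) *)
Definition sumZd (d : nat) (f : list Z -> C) : C :=
  Clim (fun K => boxsum d K f).

Definition sumZ (f : Z -> C) : C := Clim (Zpart f).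

Definition Cintegral_R (f : R -> C) : C :=
  (RInt_gen (fun x => Re (f x)) (Rbar_locally m_infty) (Rbar_locally p_infty),
   RInt_gen (fun x => Im (f x)) (Rbar_locally m_infty) (Rbar_locally p_infty)).

Definition vartheta (u tau : C) : C :=
  sumZ (fun m =>
    let nu := (IZR m + / 2)%R in
    (ee (RtoC nu * (u + RtoC (/ 2)))%C * qpow tau (nu ^ 2 / 2))%C).

Definition Zlsum (n : list Z) : Z := fold_right Z.add 0%Z n.

(* prod_{j} (-1)^{n_j} e^{-2 pi i n_j u_j} q^{n_j (n_j+1)/2} / vartheta(u_j;tau),
   where the list n = [n_j; n_{j+1}; ...] and u_j = us j *)
Fixpoint mu_prod (us : nat -> C) (tau : C) (j : nat) (n : list Z) : C :=
  match n with
  | nil => RtoC 1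
  | m :: n' =>
      (msign m * ee (- (RtoC (IZR m) * us j))%C
        * qpow tau (IZR m * (IZR m + 1) / 2) / vartheta (us j) tau
        * mu_prod us tau (S j) n')%C
  end.

Definition muN (N : nat) (us : nat -> C) (tau : C) : C :=
  sumZd N (fun n =>
    (cexp (PI * Ci * us 0%nat)%C
      / (RtoC 1 - ee (us 0%nat) * qpow tau (IZR (Zlsum n)))
      * mu_prod us tau 1 n)%C).

Fixpoint usum (N : nat) (us : nat -> C) : C :=
  match N with
  | O => us 0%nat
  | S N' => (usum N' us + us N)%C
  end.

Definition shift0 (us : nat -> C) (a : C) : nat -> C :=
  fun j => if Nat.eqb j 0 then (us 0%nat + a)%C else us j.

(* k-th entry (0 <= k <= N-1) of the column vector M_N(u_0,...,u_N;tau):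
   (-1)^k e^{-2 pi i k u / N - pi i k^2 tau / N} mu_N(u_0 + k tau, u_1, ..., u_N; tau) *)
Definition MN (N : nat) (us : nat -> C) (tau : C) (k : nat) : C :=
  let u := usum N us in
  let kk := RtoC (INR k) in
  (msign (Z.of_nat k)
    * cexp (- (2 * PI * Ci * kk * u / RtoC (INR N))
            - PI * Ci * kk * kk * tau / RtoC (INR N))%C
    * muN N (shift0 us (kk * tau)%C) tau)%C.

Definition mordell_h (w tau : C) : C :=
  Cintegral_R (fun x =>
    (cexp (PI * Ci * RtoC (x ^ 2) * tau - 2 * PI * RtoC x * w)
      / RtoC (cosh (PI * x)))%C).

Definition in_lattice (t z : C) : Prop :=
  exists a b : Z, z = (RtoC (IZR a) + RtoC (IZR b) * t)%C.

Fixpoint Csumn (n : nat) (f : nat -> C) : C :=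
  match n with O => RtoC 0 | S n' => (Csumn n' f + f n')%C end.

(* Main.v *)
Require Import Defs.
From Stdlib Require Import Reals ZArith List Lra Lia Psatz.
From Coquelicot Require Import Coquelicot.
Open Scope R_scope.

(* Expanding the product of the [N] theta-like series in [mu_N] by the total degree
   [|n| = m] gives a sequence [c_m] for which [c_{m+N}] is a Gaussian multiple of [c_m]. Hence
   [mu_N] is a combination, with coefficients [c_0, ..., c_{N-1}], of [N] level-one
   Appell-Lerch sums of modulus [N tau].

   At level one, the two sides of the inversion formula are multiplied by the theta
   functions in their denominators. The difference is an entire function of the elliptic
   variable [v], being a superposition of exponentials; it is 1-periodic and picks up the
   factor [e^{2 pi i u}] under a translation by [tau]. As [u] is not a lattice point, this kills
   every Fourier coefficient. The two functional equations of the Mordell integral used here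
   follow from the Gaussian integral and from a growth bound, up to a constant which the
   simple poles at [u = 0] determine.

   The sums over the residues modulo [N] at [tau] and at [-1/tau] are matched by comparing
   the Fourier coefficients of the inverted product of theta functions. That theta vanishes
   only on the lattice follows from the finite Jacobi triple product. *)

(** The classical route moves contours across the poles of 1/cosh and divides by theta functions.
    Here the analytic identities are brought to a form without poles in the running variable and are
    tested on Fourier coefficients over unit segments; 1/cosh is met on the real line only, and the
    residue it would contribute is replaced by one unknown constant. Division by theta functions is
    postponed to the last step. The passage between the moduli -1/(N tau) and -1/tau rests on a
    finite geometric sum: summing e^(-2 pi i k y) over k < N turns the kernel 1/sin(pi N y) into
    1/sin(pi y). The quadratic phase in the k-th entry of M_N is what cancels the k^2 produced by
    the inverted theta product, so that a geometric sum is left. Formula (ii) has to be proved for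
    the entry 0 only: the entry j is the same formula at u_0 + j tau, and the cross term of the
    Gaussian then yields zeta_N^(-jk). The factor sqrt N is the ratio of the roots of -i N tau and
    -i tau, and (-i)^N comes from inverting N theta functions. *)

(** * Complex numbers and exponentials *)

Notation zc k := (RtoC (IZR k)).

Lemma zc_plus (a b : Z) : zc (a + b) = (zc a + zc b)%C.
Proof. now rewrite plus_IZR, RtoC_plus. Qed.

Lemma zc_opp (a : Z) : zc (- a) = (- zc a)%C.
Proof. now rewrite opp_IZR, RtoC_opp. Qed.

Lemma zc_mult (a b : Z) : zc (a * b) = (zc a * zc b)%C.
Proof. now rewrite mult_IZR, RtoC_mult. Qed.

Lemma zc_minus (a b : Z) : zc (a - b) = (zc a - zc b)%C.
Proof. now rewrite minus_IZR, RtoC_minus. Qed.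

Lemma Ci2 : (Ci * Ci = - RtoC 1)%C.
Proof. unfold Ci, Cmult, Copp, RtoC; simpl; f_equal; ring. Qed.

Lemma Ci_neq0 : Ci <> RtoC 0.
Proof. intros H; injection H; lra. Qed.

Lemma RtoC_neq (x y : R) : x <> y -> RtoC x <> RtoC y.
Proof. intros H E; apply H; now injection E. Qed.

Lemma Cneq_mult (a b : C) : a <> RtoC 0 -> b <> RtoC 0 -> (a * b)%C <> RtoC 0.
Proof.
  intros Ha Hb. apply Cmod_gt_0. rewrite Cmod_mult.
  apply Rmult_lt_0_compat; now apply Cmod_gt_0.
Qed.

Lemma Ceq_minus (a b : C) : (a - b = RtoC 0)%C -> a = b.
Proof. intros H. replace a with ((a - b) + b)%C by ring. rewrite H. ring. Qed.

Lemma Cmult_neq_inv_l (a b c : C) : a <> RtoC 0 -> (a * b = a * c)%C -> b = c.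
Proof.
  intros Ha H. replace b with (/ a * (a * b))%C by (field; exact Ha).
  rewrite H. field; exact Ha.
Qed.

Lemma cexp_plus (a b : C) : cexp (a + b) = (cexp a * cexp b)%C.
Proof.
  unfold cexp, Re, Im, Cplus, Cmult; simpl.
  rewrite exp_plus, cos_plus, sin_plus. f_equal; ring.
Qed.

Lemma cexp_0 : cexp 0 = 1.
Proof.
  unfold cexp, Re, Im, RtoC; simpl.
  rewrite exp_0, cos_0, sin_0. f_equal; ring.
Qed.

Lemma Cmod_cexp (z : C) : Cmod (cexp z) = exp (Re z).
Proof.
  unfold Cmod, cexp; simpl.
  replace (exp (Re z) * cos (Im z) * (exp (Re z) * cos (Im z) * 1) +
    exp (Re z) * sin (Im z) * (exp (Re z) * sin (Im z) * 1))
    with (Rsqr (exp (Re z)) * (Rsqr (sin (Im z)) + Rsqr (cos (Im z))))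
    by (unfold Rsqr; ring).
  rewrite sin2_cos2, Rmult_1_r. apply sqrt_Rsqr. left; apply exp_pos.
Qed.

(** With the period 2 instead of 1, signs (-1)^k, half-integral powers of q and the factors e^(pi i
    u) all become values at simple arguments. Products of exponentials are merged into one [epi],
    and what remains is a [ring] or [field] identity between exponents, taken modulo 2. *)
Definition epi (z : C) : C := cexp (PI * Ci * z)%C.

Lemma epi_plus (a b : C) : epi (a + b) = (epi a * epi b)%C.
Proof.
  unfold epi. rewrite <- cexp_plus. f_equal. ring.
Qed.

Lemma epi_0 : epi 0 = 1.
Proof. unfold epi. rewrite <- cexp_0. f_equal. ring. Qed.

Lemma Cmod_epi (z : C) : Cmod (epi z) = exp (- PI * Im z).
Proof.
  unfold epi. rewrite Cmod_cexp. f_equal.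
  unfold Re, Im, Cmult, RtoC, Ci; simpl. ring.
Qed.

Lemma epi_neq0 (z : C) : epi z <> RtoC 0.
Proof. apply Cmod_gt_0. rewrite Cmod_epi. apply exp_pos. Qed.

Lemma epi_opp (z : C) : epi (- z) = (/ epi z)%C.
Proof.
  assert (H : (epi z * epi (- z) = 1)%C).
  { rewrite <- epi_plus. rewrite <- epi_0. f_equal. ring. }
  replace (epi (- z)) with (/ epi z * (epi z * epi (- z)))%C
    by (field; apply epi_neq0).
  rewrite H. field. apply epi_neq0.
Qed.

Lemma epi_minus (a b : C) : epi (a - b) = (epi a / epi b)%C.
Proof. unfold Cminus. rewrite epi_plus, epi_opp. reflexivity. Qed.

Lemma epi_real (x : R) : epi (RtoC x) = (cos (PI * x), sin (PI * x)).
Proof.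
  unfold epi, cexp.
  replace (PI * Ci * x)%C with ((0, PI * x) : C)
    by (unfold Cmult, RtoC, Ci; simpl; f_equal; ring).
  unfold Re, Im; simpl. rewrite exp_0. f_equal; ring.
Qed.

Lemma epi_1 : epi 1 = (- (1))%C.
Proof.
  rewrite epi_real, Rmult_1_r, cos_PI, sin_PI.
  unfold Copp, RtoC; simpl. f_equal; ring.
Qed.

Lemma epi_half : epi (RtoC (/ 2)) = Ci.
Proof.
  rewrite epi_real. change (PI * / 2) with (PI / 2). now rewrite cos_PI2, sin_PI2.
Qed.

Lemma epi_2 : epi 2 = 1.
Proof.
  replace (RtoC 2) with (RtoC 1 + RtoC 1)%C by (rewrite <- RtoC_plus; f_equal; ring).
  rewrite epi_plus, epi_1. ring.
Qed.

Lemma epi_even_nat (n : nat) : epi (2 * RtoC (INR n)) = 1.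
Proof.
  induction n as [|n IH].
  - simpl. rewrite Cmult_0_r. apply epi_0.
  - rewrite S_INR, RtoC_plus.
    replace (2 * (RtoC (INR n) + 1))%C with (2 * RtoC (INR n) + 2)%C by ring.
    rewrite epi_plus, IH, epi_2. ring.
Qed.

Lemma epi_even (k : Z) : epi (2 * zc k) = 1.
Proof.
  destruct (Z_le_dec 0 k) as [H|H].
  - rewrite <- (Z2Nat.id k H), <- INR_IZR_INZ. apply epi_even_nat.
  - assert (Hk : (k = - Z.of_nat (Z.to_nat (- k)))%Z) by lia.
    rewrite Hk, zc_opp, <- INR_IZR_INZ.
    replace (2 * - RtoC (INR (Z.to_nat (- k))))%C
      with (- (2 * RtoC (INR (Z.to_nat (- k)))))%C by ring.
    rewrite epi_opp, epi_even_nat. field.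
Qed.

Lemma epi_periodic (z : C) (k : Z) : epi (z + 2 * zc k) = epi z.
Proof. rewrite epi_plus, epi_even. ring. Qed.

Lemma epi_congr (a b : C) (k : Z) : (a = b + 2 * zc k)%C -> epi a = epi b.
Proof. intros ->. apply epi_periodic. Qed.

Lemma msign_epi (k : Z) : msign k = epi (zc k).
Proof.
  unfold msign. destruct (Z.even k) eqn:Hk.
  - apply Z.even_spec in Hk. destruct Hk as [m ->].
    rewrite zc_mult, epi_even. reflexivity.
  - assert (Hk' : Z.odd k = true) by (rewrite <- Z.negb_even, Hk; reflexivity).
    apply Z.odd_spec in Hk'. destruct Hk' as [m ->].
    rewrite zc_plus, zc_mult, epi_plus, epi_even, epi_1.
    rewrite Cmult_1_l. now rewrite <- RtoC_opp.
Qed.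

Lemma epi_sqr (z : C) : epi (2 * z) = (epi z * epi z)%C.
Proof. rewrite <- epi_plus. f_equal. ring. Qed.

Lemma epi_zc_sqr (k : Z) : (epi (zc k) * epi (zc k) = 1)%C.
Proof. now rewrite <- epi_sqr, epi_even. Qed.

Lemma ee_epi (z : C) : ee z = epi (2 * z).
Proof. unfold ee, epi. f_equal. ring. Qed.

(** The modulus forces z to be real, the sine forces it to be an integer, and the sign rules out odd
    integers. This converts a vanishing denominator into membership in the lattice. *)
Lemma epi_eq1 (z : C) : epi z = 1 -> exists k : Z, z = (2 * zc k)%C.
Proof.
  intros H.
  assert (Hm := f_equal Cmod H). rewrite Cmod_epi, Cmod_1 in Hm.
  assert (Him : Im z = 0).
  { assert (E : - PI * Im z = 0) by (apply exp_inv; now rewrite exp_0).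
    pose proof PI_RGT_0. nra. }
  destruct z as [x y]; simpl in Him; subst y.
  change (epi (RtoC x) = 1) in H. rewrite epi_real in H. injection H as H1 H2.
  destruct (sin_eq_0_0 _ H2) as [k Hk].
  assert (Hx : x = IZR k) by (pose proof PI_RGT_0; nra).
  subst x.
  assert (Hev := msign_epi k). unfold msign in Hev.
  destruct (Z.even k) eqn:Ek.
  - apply Z.even_spec in Ek. destruct Ek as [m ->].
    exists m. fold (zc (2 * m)). now rewrite <- zc_mult.
  - exfalso.
    assert (E : epi (zc k) = 1).
    { now rewrite epi_real, H1, H2. }
    rewrite E in Hev. injection Hev; lra.
Qed.

Lemma Cmod_le_abs (z : C) : Cmod z <= Rabs (Re z) + Rabs (Im z).
Proof.
  destruct z as [x y]. unfold Re, Im; simpl.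
  replace (x, y) with (RtoC x + RtoC y * Ci)%C
    by (unfold Cplus, Cmult, RtoC, Ci; simpl; f_equal; ring).
  eapply Rle_trans; [apply Cmod_triangle|].
  rewrite Cmod_mult, Cmod_Ci, !Cmod_R. lra.
Qed.

Lemma im_le_Cmod (c : C) : Rabs (Im c) <= Cmod c.
Proof.
  eapply Rle_trans; [|apply Rmax_Cmod]. apply Rmax_r.
Qed.

Lemma Cmod_triangle_rev (a b : C) : Cmod a - Cmod b <= Cmod (a - b).
Proof.
  pose proof (Cmod_triangle (a - b) b).
  replace (a - b + b)%C with a in H by ring. lra.
Qed.

Lemma Cmod_minus_sym (a b : C) : Cmod (a - b) = Cmod (b - a).
Proof. rewrite <- Cmod_opp. f_equal. ring. Qed.

Lemma Cmod_small_0 (z : C) : (forall eps, 0 < eps -> Cmod z <= eps) -> z = 0.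
Proof.
  intros H. apply Cmod_eq_0.
  destruct (Rle_lt_dec (Cmod z) 0) as [Hz|Hz].
  - pose proof (Cmod_ge_0 z). lra.
  - pose proof (H (Cmod z / 2)). lra.
Qed.

(** * Absolutely convergent sums over the integers *)

Fixpoint Rsum_from (g : Z -> R) (a : Z) (n : nat) : R :=
  match n with
  | O => 0
  | S n' => g a + Rsum_from g (a + 1)%Z n'
  end.

Lemma Csum_from_ext (f g : Z -> C) (a : Z) (n : nat) :
  (forall m, (a <= m < a + Z.of_nat n)%Z -> f m = g m) ->
  Csum_from f a n = Csum_from g a n.
Proof.
  revert a; induction n as [|n IH]; intros a H; simpl; [reflexivity|].
  rewrite (H a) by lia. rewrite IH; [reflexivity|]. intros m Hm; apply H; lia.
Qed.

Lemma Csum_from_plus (f g : Z -> C) (a : Z) (n : nat) :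
  Csum_from (fun m => f m + g m)%C a n = (Csum_from f a n + Csum_from g a n)%C.
Proof.
  revert a; induction n as [|n IH]; intros a; simpl; [ring|]. rewrite IH; ring.
Qed.

Lemma Csum_from_scal (c : C) (f : Z -> C) (a : Z) (n : nat) :
  Csum_from (fun m => c * f m)%C a n = (c * Csum_from f a n)%C.
Proof.
  revert a; induction n as [|n IH]; intros a; simpl; [ring|]. rewrite IH; ring.
Qed.

Lemma Csum_from_app (f : Z -> C) (a : Z) (n p : nat) :
  Csum_from f a (n + p) = (Csum_from f a n + Csum_from f (a + Z.of_nat n) p)%C.
Proof.
  revert a; induction n as [|n IH]; intros a.
  - simpl. rewrite Z.add_0_r. ring.
  - cbn [Csum_from Nat.add]. rewrite IH.
    replace (a + 1 + Z.of_nat n)%Z with (a + Z.of_nat (S n))%Z by lia. ring.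
Qed.

Lemma Csum_from_shift (f : Z -> C) (d a : Z) (n : nat) :
  Csum_from (fun m => f (m + d)%Z) a n = Csum_from f (a + d) n.
Proof.
  revert a; induction n as [|n IH]; intros a; simpl; [reflexivity|].
  rewrite IH. do 2 f_equal. lia.
Qed.

Lemma Rsum_from_app (g : Z -> R) (a : Z) (n p : nat) :
  Rsum_from g a (n + p) = Rsum_from g a n + Rsum_from g (a + Z.of_nat n) p.
Proof.
  revert a; induction n as [|n IH]; intros a.
  - simpl. rewrite Z.add_0_r. ring.
  - cbn [Rsum_from Nat.add]. rewrite IH.
    replace (a + 1 + Z.of_nat n)%Z with (a + Z.of_nat (S n))%Z by lia. ring.
Qed.

Lemma Rsum_from_le (g h : Z -> R) (a : Z) (n : nat) :
  (forall m, g m <= h m) -> Rsum_from g a n <= Rsum_from h a n.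
Proof.
  intros H; revert a; induction n as [|n IH]; intros a; simpl; [lra|].
  pose proof (H a); pose proof (IH (a + 1)%Z); lra.
Qed.

Lemma Rsum_from_nonneg (g : Z -> R) (a : Z) (n : nat) :
  (forall m, 0 <= g m) -> 0 <= Rsum_from g a n.
Proof.
  intros H; revert a; induction n as [|n IH]; intros a; simpl; [lra|].
  pose proof (H a); pose proof (IH (a + 1)%Z); lra.
Qed.

Lemma Rsum_from_scal (c : R) (g : Z -> R) (a : Z) (n : nat) :
  Rsum_from (fun m => c * g m) a n = c * Rsum_from g a n.
Proof.
  revert a; induction n as [|n IH]; intros a; simpl; [ring|]. rewrite IH; ring.
Qed.

Lemma Rsum_from_plus (g h : Z -> R) (a : Z) (n : nat) :
  Rsum_from (fun m => g m + h m) a n = Rsum_from g a n + Rsum_from h a n.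
Proof.
  revert a; induction n as [|n IH]; intros a; simpl; [ring|]. rewrite IH; ring.
Qed.

Lemma Rsum_from_shift (g : Z -> R) (d a : Z) (n : nat) :
  Rsum_from (fun m => g (m + d)%Z) a n = Rsum_from g (a + d) n.
Proof.
  revert a; induction n as [|n IH]; intros a; simpl; [reflexivity|].
  rewrite IH. do 2 f_equal. lia.
Qed.

Lemma Cmod_Csum_from_le (f : Z -> C) (g : Z -> R) (a : Z) (n : nat) :
  (forall m, Cmod (f m) <= g m) -> Cmod (Csum_from f a n) <= Rsum_from g a n.
Proof.
  intros H; revert a; induction n as [|n IH]; intros a; simpl.
  - rewrite Cmod_0; lra.
  - eapply Rle_trans; [apply Cmod_triangle|].
    pose proof (H a); pose proof (IH (a + 1)%Z); lra.
Qed.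

Definition Zsum (f : Z -> C) (A B : nat) : C := Csum_from f (- Z.of_nat A) (A + B).

(** The two ends go to infinity independently, which makes the notion stable under translation,
    reflection and splitting into residue classes; symmetric windows as in [sumZ] are recovered as a
    special case. *)
Definition is_zsum (f : Z -> C) (l : C) : Prop :=
  forall eps, 0 < eps -> exists K : nat, forall A B : nat,
    (K <= A)%nat -> (K <= B)%nat -> Cmod (Zsum f A B - l) < eps.

(** The bound is uniform over all windows, wherever they lie, so that a shift of the index preserves
    it without any estimate. *)
Definition major (g : Z -> R) : Prop :=
  (forall m, 0 <= g m) /\ exists b, forall a n, Rsum_from g a n <= b.

Definition dom (f : Z -> C) (g : Z -> R) : Prop := forall m, Cmod (f m) <= g m.

Definition zsummable (f : Z -> C) : Prop := major (fun m => Cmod (f m)).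

Lemma Rsum_from_incl (g : Z -> R) (A B A' B' : nat) :
  (forall m, 0 <= g m) -> (A <= A')%nat -> (B <= B')%nat ->
  Rsum_from g (- Z.of_nat A) (A + B) <= Rsum_from g (- Z.of_nat A') (A' + B').
Proof.
  intros Hg HA HB.
  replace (A' + B')%nat with ((A' - A) + ((A + B) + (B' - B)))%nat by lia.
  rewrite !Rsum_from_app.
  replace (- Z.of_nat A' + Z.of_nat (A' - A))%Z with (- Z.of_nat A)%Z by lia.
  pose proof (Rsum_from_nonneg g (- Z.of_nat A') (A' - A) Hg).
  pose proof (Rsum_from_nonneg g (- Z.of_nat A + Z.of_nat (A + B)) (B' - B) Hg).
  lra.
Qed.

Lemma Zsum_diff_le (f : Z -> C) (g : Z -> R) (K A B : nat) :
  dom f g -> (K <= A)%nat -> (K <= B)%nat ->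
  Cmod (Zsum f A B - Zsum f K K) <=
  Rsum_from g (- Z.of_nat A) (A + B) - Rsum_from g (- Z.of_nat K) (K + K).
Proof.
  intros Hd HA HB. unfold Zsum.
  replace (A + B)%nat with ((A - K) + ((K + K) + (B - K)))%nat by lia.
  rewrite !Rsum_from_app, !Csum_from_app.
  replace (- Z.of_nat A + Z.of_nat (A - K))%Z with (- Z.of_nat K)%Z by lia.
  pose proof (Cmod_Csum_from_le f g (- Z.of_nat A) (A - K) Hd).
  pose proof (Cmod_Csum_from_le f g (- Z.of_nat K + Z.of_nat K + Z.of_nat K) (B - K) Hd).
  match goal with |- Cmod ?x <= _ =>
    replace x with (Csum_from f (- Z.of_nat A) (A - K) +
      Csum_from f (- Z.of_nat K + Z.of_nat K + Z.of_nat K) (B - K))%C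
  end.
  - eapply Rle_trans; [apply Cmod_triangle|].
    replace (- Z.of_nat K + Z.of_nat (K + K))%Z with
      (- Z.of_nat K + Z.of_nat K + Z.of_nat K)%Z by lia. lra.
  - replace (- Z.of_nat K + Z.of_nat (K + K))%Z with
      (- Z.of_nat K + Z.of_nat K + Z.of_nat K)%Z by lia. ring.
Qed.

(** Some symmetric window comes within [eps] of the supremum of all of them, and no larger window
    can exceed that supremum. *)
Lemma major_tail (g : Z -> R) : major g ->
  forall eps, 0 < eps -> exists K : nat, forall A B : nat,
    (K <= A)%nat -> (K <= B)%nat ->
    Rsum_from g (- Z.of_nat A) (A + B) - Rsum_from g (- Z.of_nat K) (K + K) < eps.
Proof.
  intros [Hg [b Hb]] eps Heps.
  set (E := fun x => exists n : nat, x = Rsum_from g (- Z.of_nat n) (n + n)).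
  destruct (completeness E) as [M [HM1 HM2]].
  - exists b. intros x [n ->]. apply Hb.
  - exists (Rsum_from g (- Z.of_nat 0) (0 + 0)). now exists O.
  - assert (HK : exists K : nat, M - eps < Rsum_from g (- Z.of_nat K) (K + K)).
    { apply Classical_Prop.NNPP. intros Hn.
      assert (M <= M - eps); [|lra].
      apply HM2. intros x [n ->].
      destruct (Rle_lt_dec (Rsum_from g (- Z.of_nat n) (n + n)) (M - eps)) as [h|h];
        [exact h|]. exfalso; apply Hn; now exists n. }
    destruct HK as [K HK]. exists K. intros A B HA HB.
    assert (Rsum_from g (- Z.of_nat A) (A + B) <= M).
    { eapply Rle_trans; [|apply HM1; now exists (Nat.max A B)].
      apply Rsum_from_incl; [exact Hg| lia | lia]. }
    lra.
Qed.

Lemma is_zsum_unique (f : Z -> C) (l l' : C) : is_zsum f l -> is_zsum f l' -> l = l'.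
Proof.
  intros H H'. apply Ceq_minus, Cmod_small_0. intros eps Heps.
  destruct (H (eps / 2)) as [K HK]; [lra|].
  destruct (H' (eps / 2)) as [K' HK']; [lra|].
  pose proof (HK (Nat.max K K') (Nat.max K K') ltac:(lia) ltac:(lia)).
  pose proof (HK' (Nat.max K K') (Nat.max K K') ltac:(lia) ltac:(lia)).
  set (z := Zsum f (Nat.max K K') (Nat.max K K')) in *.
  replace (l - l')%C with ((z - l') - (z - l))%C by ring.
  eapply Rle_trans; [apply Cmod_triangle|]. rewrite Cmod_opp. lra.
Qed.

(** [Clim] is total and yields a default value where there is no limit. Its values are identified
    through this criterion, whose hypothesis supplies the convergence. *)
Lemma Clim_of (s : nat -> C) (l : C) :
  (forall eps, 0 < eps -> exists K : nat, forall n, (K <= n)%nat -> Cmod (s n - l) < eps) ->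
  Clim s = l.
Proof.
  intros H. unfold Clim. destruct l as [x y].
  f_equal.
  - erewrite is_lim_seq_unique with (l := Finite x); [reflexivity|].
    apply is_lim_seq_spec. intros eps. destruct (H eps (cond_pos eps)) as [K HK].
    exists K. intros n Hn. eapply Rle_lt_trans; [|apply (HK n Hn)].
    eapply Rle_trans; [|apply re_le_Cmod]. right. f_equal.
  - erewrite is_lim_seq_unique with (l := Finite y); [reflexivity|].
    apply is_lim_seq_spec. intros eps. destruct (H eps (cond_pos eps)) as [K HK].
    exists K. intros n Hn. eapply Rle_lt_trans; [|apply (HK n Hn)].
    eapply Rle_trans; [|apply im_le_Cmod]. right. f_equal.
Qed.

(** [Zsum f A B] covers -A <= m < B, whereas the window of [Zpart] is closed at K; hence the
    successor. *)
Lemma Zpart_Zsum (f : Z -> C) (K : nat) : Zpart f K = Zsum f K (S K).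
Proof. unfold Zpart, Zsum. f_equal. lia. Qed.

Lemma is_zsum_sumZ (f : Z -> C) (l : C) : is_zsum f l -> sumZ f = l.
Proof.
  intros H. apply Clim_of. intros eps Heps. destruct (H eps Heps) as [K HK].
  exists K. intros n Hn. rewrite Zpart_Zsum. apply HK; lia.
Qed.

Lemma C_complete (s : nat -> C) :
  (forall eps, 0 < eps -> exists K : nat, forall n, (K <= n)%nat -> Cmod (s n - s K) < eps) ->
  exists l, forall eps, 0 < eps -> exists K : nat, forall n, (K <= n)%nat -> Cmod (s n - l) < eps.
Proof.
  intros H.
  assert (Hc : forall p : C -> R,
    (forall z w, Rabs (p z - p w) <= Cmod (z - w)) -> exists x, Un_cv (fun n => p (s n)) x).
  { intros p Hp.
    assert (HC : Cauchy_crit (fun n => p (s n))).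
    { intros eps Heps. destruct (H (eps / 2)) as [K HK]; [lra|].
      exists K. intros n m Hn Hm. unfold Rdist.
      pose proof (HK n Hn). pose proof (HK m Hm).
      pose proof (Hp (s n) (s m)).
      assert (Cmod (s n - s m) <= Cmod (s n - s K) + Cmod (s m - s K)).
      { rewrite (Cmod_minus_sym (s m)).
        replace (s n - s m)%C with ((s n - s K) + (s K - s m))%C by ring.
        apply Cmod_triangle. }
      lra. }
    destruct (Rcomplete.R_complete _ HC) as [x Hx]. now exists x. }
  destruct (Hc (fun z => Re z)) as [x Hx].
  { intros z w. eapply Rle_trans; [|apply re_le_Cmod]. right; f_equal. }
  destruct (Hc (fun z => Im z)) as [y Hy].
  { intros z w. eapply Rle_trans; [|apply im_le_Cmod]. right; f_equal. }
  exists (x, y). intros eps Heps.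
  destruct (Hx (eps / 2)) as [K1 H1]; [lra|].
  destruct (Hy (eps / 2)) as [K2 H2]; [lra|].
  exists (Nat.max K1 K2). intros n Hn.
  eapply Rle_lt_trans; [apply Cmod_le_abs|].
  pose proof (H1 n ltac:(lia)). pose proof (H2 n ltac:(lia)).
  unfold Rdist in *. 
  replace (Re (s n - (x, y))) with (Re (s n) - x) by (unfold Re; simpl; ring).
  replace (Im (s n - (x, y))) with (Im (s n) - y) by (unfold Im; simpl; ring).
  lra.
Qed.

(** The rate [K] is chosen from the majorant before [f]: this is the Weierstrass test, and the
    source of Tannery's theorem, of Fubini and of termwise integration. *)
Lemma zsum_uniform (g : Z -> R) : major g ->
  forall eps, 0 < eps -> exists K : nat, forall f, dom f g ->
    forall A B : nat, (K <= A)%nat -> (K <= B)%nat ->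
    Cmod (Zsum f A B - sumZ f) <= eps.
Proof.
  intros Hg eps Heps.
  assert (Hex : forall f, dom f g -> is_zsum f (sumZ f)).
  { intros f Hf.
    (* A limit exists along symmetric windows; windows with independent ends are then compared with
       them through the common core of radius [K2]. *)
    destruct (C_complete (fun n => Zsum f n n)) as [l Hl].
    - intros e He. destruct (major_tail g Hg e He) as [K HK].
      exists K. intros n Hn. eapply Rle_lt_trans; [apply (Zsum_diff_le f g); auto|].
      now apply HK.
    - assert (Hl' : is_zsum f l).
      { intros e He. destruct (Hl (e / 2)) as [K1 H1]; [lra|].
        destruct (major_tail g Hg (e / 4)) as [K2 H2]; [lra|].
        exists (Nat.max K1 K2). intros A B HA HB.
        pose proof (H1 (Nat.max K1 K2) ltac:(lia)) as E1.
        pose proof (Zsum_diff_le f g K2 A B Hf ltac:(lia) ltac:(lia)) as E2.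
        pose proof (Zsum_diff_le f g K2 (Nat.max K1 K2) (Nat.max K1 K2) Hf
          ltac:(lia) ltac:(lia)) as E3.
        pose proof (H2 A B ltac:(lia) ltac:(lia)) as E4.
        pose proof (H2 (Nat.max K1 K2) (Nat.max K1 K2) ltac:(lia) ltac:(lia)) as E5.
        set (M := Nat.max K1 K2) in *.
        replace (Zsum f A B - l)%C with ((Zsum f A B - Zsum f K2 K2)
          + ((- (Zsum f M M - Zsum f K2 K2)) + (Zsum f M M - l)))%C by ring.
        eapply Rle_lt_trans; [apply Cmod_triangle|].
        eapply Rle_lt_trans; [apply Rplus_le_compat_l, Cmod_triangle|].
        rewrite Cmod_opp. lra. }
      now rewrite (is_zsum_sumZ _ _ Hl'). }
  destruct (major_tail g Hg (eps / 2)) as [K HK]; [lra|].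
  exists K. intros f Hf A B HA HB.
  apply Rle_plus_epsilon. intros e He.
  destruct (Hex f Hf e He) as [K' HK'].
  set (M := Nat.max K K').
  pose proof (HK' M M ltac:(lia) ltac:(lia)) as E1.
  pose proof (Zsum_diff_le f g K A B Hf ltac:(lia) ltac:(lia)) as E2.
  pose proof (Zsum_diff_le f g K M M Hf ltac:(lia) ltac:(lia)) as E3.
  pose proof (HK A B ltac:(lia) ltac:(lia)) as E4.
  pose proof (HK M M ltac:(lia) ltac:(lia)) as E5.
  replace (Zsum f A B - sumZ f)%C with ((Zsum f A B - Zsum f K K)
          + ((- (Zsum f M M - Zsum f K K)) + (Zsum f M M - sumZ f)))%C by ring.
  eapply Rle_trans; [apply Cmod_triangle|].
  eapply Rle_trans; [apply Rplus_le_compat_l, Cmod_triangle|].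
  rewrite Cmod_opp. lra.
Qed.

Lemma major_le (g h : Z -> R) : (forall m, 0 <= g m <= h m) -> major h -> major g.
Proof.
  intros H [Hh [b Hb]]. split; [intros m; apply H|].
  exists b. intros a n. eapply Rle_trans; [|apply (Hb a n)].
  apply Rsum_from_le. intros m; apply H.
Qed.

Lemma dom_summable (f : Z -> C) (g : Z -> R) : dom f g -> major g -> zsummable f.
Proof.
  intros Hd. apply major_le. intros m; split; [apply Cmod_ge_0|apply Hd].
Qed.

Lemma sumZ_correct (f : Z -> C) : zsummable f -> is_zsum f (sumZ f).
Proof.
  intros Hf eps Heps.
  destruct (zsum_uniform _ Hf (eps / 2)) as [K HK]; [lra|].
  exists K. intros A B HA HB.
  eapply Rle_lt_trans; [apply HK; auto; intros m; lra|lra].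
Qed.

Lemma sumZ_ext (f g : Z -> C) : (forall m, f m = g m) -> sumZ f = sumZ g.
Proof.
  intros H. unfold sumZ, Clim.
  assert (E : forall K, Zpart f K = Zpart g K).
  { intros K. apply Csum_from_ext. auto. }
  f_equal; f_equal; apply Lim_seq_ext; intros n; now rewrite E.
Qed.

Lemma zsummable_ext (f g : Z -> C) : (forall m, f m = g m) -> zsummable f -> zsummable g.
Proof.
  intros H Hf. eapply dom_summable; [|exact Hf]. intros m. rewrite H. lra.
Qed.

Lemma is_zsum_plus (f g : Z -> C) (l l' : C) :
  is_zsum f l -> is_zsum g l' -> is_zsum (fun m => f m + g m)%C (l + l').
Proof.
  intros H H' eps Heps.
  destruct (H (eps / 2)) as [K HK]; [lra|].
  destruct (H' (eps / 2)) as [K' HK']; [lra|].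
  exists (Nat.max K K'). intros A B HA HB.
  pose proof (HK A B ltac:(lia) ltac:(lia)).
  pose proof (HK' A B ltac:(lia) ltac:(lia)).
  unfold Zsum in *. rewrite Csum_from_plus.
  match goal with |- Cmod (?a + ?b - _) < _ =>
    replace (a + b - (l + l'))%C with ((a - l) + (b - l'))%C by ring end.
  eapply Rle_lt_trans; [apply Cmod_triangle|]. lra.
Qed.

Lemma is_zsum_scal (c : C) (f : Z -> C) (l : C) :
  is_zsum f l -> is_zsum (fun m => c * f m)%C (c * l).
Proof.
  intros H eps Heps.
  assert (Hc : 0 < Cmod c + 1) by (pose proof (Cmod_ge_0 c); lra).
  destruct (H (eps / (Cmod c + 1))) as [K HK].
  { apply Rdiv_lt_0_compat; lra. }
  exists K. intros A B HA HB. unfold Zsum in *. rewrite Csum_from_scal.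
  specialize (HK A B HA HB).
  set (z := Csum_from f (- Z.of_nat A) (A + B)) in *.
  replace (c * z - c * l)%C with (c * (z - l))%C by ring.
  rewrite Cmod_mult.
  apply Rle_lt_trans with (Cmod c * (eps / (Cmod c + 1))).
  - apply Rmult_le_compat_l; [apply Cmod_ge_0|lra].
  - pose proof (Cmod_ge_0 c).
    replace eps with ((Cmod c + 1) * (eps / (Cmod c + 1))) at 2 by (field; lra).
    apply Rmult_lt_compat_r; [apply Rdiv_lt_0_compat; lra|lra].
Qed.

Lemma is_zsum_shift (f : Z -> C) (d : Z) (l : C) :
  is_zsum f l -> is_zsum (fun m => f (m + d)%Z) l.
Proof.
  intros H eps Heps. destruct (H eps Heps) as [K HK].
  exists (K + Z.to_nat (Z.abs d))%nat. intros A B HA HB.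
  unfold Zsum. rewrite Csum_from_shift.
  specialize (HK (Z.to_nat (Z.of_nat A - d)) (Z.to_nat (Z.of_nat B + d))
    ltac:(lia) ltac:(lia)).
  unfold Zsum in HK.
  replace (- Z.of_nat (Z.to_nat (Z.of_nat A - d)))%Z with (- Z.of_nat A + d)%Z in HK by lia.
  replace (Z.to_nat (Z.of_nat A - d) + Z.to_nat (Z.of_nat B + d))%nat
    with (A + B)%nat in HK by lia.
  exact HK.
Qed.

Lemma major_plus (g h : Z -> R) : major g -> major h -> major (fun m => g m + h m).
Proof.
  intros [Hg [b Hb]] [Hh [c Hc]]. split.
  - intros m. pose proof (Hg m); pose proof (Hh m); lra.
  - exists (b + c). intros a n. rewrite Rsum_from_plus.
    pose proof (Hb a n); pose proof (Hc a n); lra.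
Qed.

Lemma major_scal (c : R) (g : Z -> R) : 0 <= c -> major g -> major (fun m => c * g m).
Proof.
  intros Hc [Hg [b Hb]]. split.
  - intros m. pose proof (Hg m); nra.
  - exists (c * b). intros a n. rewrite Rsum_from_scal.
    pose proof (Hb a n); nra.
Qed.

Lemma major_shift (g : Z -> R) (d : Z) : major g -> major (fun m => g (m + d)%Z).
Proof.
  intros [Hg [b Hb]]. split; [intros m; apply Hg|].
  exists b. intros a n. rewrite Rsum_from_shift. apply Hb.
Qed.

Lemma zsummable_plus (f g : Z -> C) :
  zsummable f -> zsummable g -> zsummable (fun m => f m + g m)%C.
Proof.
  intros Hf Hg. eapply dom_summable; [|exact (major_plus _ _ Hf Hg)].
  intros m. apply Cmod_triangle.
Qed.

Lemma zsummable_scal (c : C) (f : Z -> C) :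
  zsummable f -> zsummable (fun m => c * f m)%C.
Proof.
  intros Hf. eapply dom_summable; [|exact (major_scal _ _ (Cmod_ge_0 c) Hf)].
  intros m. rewrite Cmod_mult. lra.
Qed.

Lemma zsummable_shift (f : Z -> C) (d : Z) :
  zsummable f -> zsummable (fun m => f (m + d)%Z).
Proof. apply (major_shift (fun m => Cmod (f m))). Qed.

Lemma sumZ_plus (f g : Z -> C) : zsummable f -> zsummable g ->
  sumZ (fun m => f m + g m)%C = (sumZ f + sumZ g)%C.
Proof.
  intros Hf Hg. apply is_zsum_sumZ, is_zsum_plus; now apply sumZ_correct.
Qed.

Lemma sumZ_scal (c : C) (f : Z -> C) : zsummable f ->
  sumZ (fun m => c * f m)%C = (c * sumZ f)%C.
Proof. intros Hf. apply is_zsum_sumZ, is_zsum_scal; now apply sumZ_correct. Qed.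

Lemma sumZ_minus (f g : Z -> C) : zsummable f -> zsummable g ->
  sumZ (fun m => f m - g m)%C = (sumZ f - sumZ g)%C.
Proof.
  intros Hf Hg.
  rewrite (sumZ_ext _ (fun m => f m + (- (1)) * g m)%C) by (intros; ring).
  rewrite sumZ_plus; auto; [|now apply zsummable_scal].
  rewrite sumZ_scal by auto. ring.
Qed.

Lemma sumZ_shift (f : Z -> C) (d : Z) : zsummable f ->
  sumZ (fun m => f (m + d)%Z) = sumZ f.
Proof. intros Hf. apply is_zsum_sumZ, is_zsum_shift; now apply sumZ_correct. Qed.

Lemma Cmod_zsum_le (f : Z -> C) (l : C) (b : R) : is_zsum f l ->
  (forall A B, Cmod (Zsum f A B) <= b) -> Cmod l <= b.
Proof.
  intros H Hb. apply Rle_plus_epsilon. intros e He.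
  destruct (H e He) as [K HK]. specialize (HK K K ltac:(lia) ltac:(lia)).
  replace l with (Zsum f K K - (Zsum f K K - l))%C by ring.
  eapply Rle_trans; [apply Cmod_triangle|]. rewrite Cmod_opp.
  pose proof (Hb K K). lra.
Qed.

Lemma Cmod_sumZ_le (f : Z -> C) (b : R) : zsummable f ->
  (forall a n, Rsum_from (fun m => Cmod (f m)) a n <= b) -> Cmod (sumZ f) <= b.
Proof.
  intros Hf Hb. apply (Cmod_zsum_le f); [now apply sumZ_correct|].
  intros A B. eapply Rle_trans; [|apply Hb].
  apply Cmod_Csum_from_le. intros m. lra.
Qed.

(** Dominated convergence: a finite window converges termwise and the majorant controls all tails at
    once. The window may grow together with the parameter [K], as it does in box partial sums. *)
Lemma tannery (F : nat -> Z -> C) (f : Z -> C) (g : Z -> R) :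
  major g -> (forall K, dom (F K) g) ->
  (forall m eps, 0 < eps -> exists K0 : nat, forall K, (K0 <= K)%nat ->
     Cmod (F K m - f m) < eps) ->
  forall eps, 0 < eps -> exists K0 : nat, forall K A B : nat,
    (K0 <= K)%nat -> (K0 <= A)%nat -> (K0 <= B)%nat ->
    Cmod (Zsum (F K) A B - sumZ f) < eps.
Proof.
  intros Hg HF Hlim eps Heps.
  assert (Hf : dom f g).
  { intros m. apply Rle_plus_epsilon. intros e He.
    destruct (Hlim m e He) as [K0 HK0]. specialize (HK0 K0 (le_n _)).
    rewrite Cmod_minus_sym in HK0.
    pose proof (Cmod_triangle_rev (f m) (F K0 m)). pose proof (HF K0 m). lra. }
  destruct (zsum_uniform g Hg (eps / 5)) as [M HM]; [lra|].
  assert (Hfin : forall n a e, 0 < e -> exists K0 : nat, forall K, (K0 <= K)%nat ->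
    Cmod (Csum_from (F K) a n - Csum_from f a n) < e).
  { induction n as [|n IH]; intros a e He.
    - exists O. intros K _. simpl.
      replace (0 - 0)%C with (RtoC 0) by ring. rewrite Cmod_0; lra.
    - destruct (IH (a + 1)%Z (e / 2)) as [K1 H1]; [lra|].
      destruct (Hlim a (e / 2)) as [K2 H2]; [lra|].
      exists (Nat.max K1 K2). intros K HK. simpl.
      specialize (H1 K ltac:(lia)). specialize (H2 K ltac:(lia)).
      match goal with |- Cmod (?a + ?b - (?c + ?d)) < _ =>
        replace (a + b - (c + d))%C with ((a - c) + (b - d))%C by ring end.
      eapply Rle_lt_trans; [apply Cmod_triangle|]. lra. }
  destruct (Hfin (M + M)%nat (- Z.of_nat M)%Z (eps / 5)) as [K1 H1]; [lra|].
  exists (Nat.max M K1). intros K A B HK HA HB.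
  specialize (H1 K ltac:(lia)). fold (Zsum (F K) M M) in H1. fold (Zsum f M M) in H1.
  pose proof (HM (F K) (HF K) A B ltac:(lia) ltac:(lia)) as E1.
  pose proof (HM (F K) (HF K) M M ltac:(lia) ltac:(lia)) as E2.
  pose proof (HM f Hf M M ltac:(lia) ltac:(lia)) as E3.
  replace (Zsum (F K) A B - sumZ f)%C with
    ((Zsum (F K) A B - sumZ (F K)) + (- (Zsum (F K) M M - sumZ (F K)) +
     ((Zsum (F K) M M - Zsum f M M) + (Zsum f M M - sumZ f))))%C by ring.
  eapply Rle_lt_trans; [apply Cmod_triangle|].
  eapply Rle_lt_trans; [apply Rplus_le_compat_l, Cmod_triangle|].
  eapply Rle_lt_trans; [apply Rplus_le_compat_l, Rplus_le_compat_l, Cmod_triangle|].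
  rewrite Cmod_opp. lra.
Qed.

(* Finite partial sums in one variable commute with the other sum; Tannery does the rest. *)
Lemma sumZ_fubini (F : Z -> Z -> C) (g : Z -> R) :
  major g ->
  (forall k, zsummable (F k)) ->
  (forall k a n, Rsum_from (fun m => Cmod (F k m)) a n <= g k) ->
  (forall m, zsummable (fun k => F k m)) ->
  is_zsum (fun m => sumZ (fun k => F k m)) (sumZ (fun k => sumZ (F k))).
Proof.
  intros Hg Hk Hb Hm eps Heps.
  assert (Hd : forall n a, dom (fun k => Csum_from (F k) a n) g).
  { intros n a k. eapply Rle_trans; [|apply (Hb k a n)].
    apply Cmod_Csum_from_le. intros; lra. }
  assert (Hex : forall n a, Csum_from (fun m => sumZ (fun k => F k m)) a n
     = sumZ (fun k => Csum_from (F k) a n)).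
  { induction n as [|n IH]; intros a; simpl.
    - symmetry. apply is_zsum_sumZ. intros e He. exists O. intros A B _ _.
      replace (Zsum (fun _ => RtoC 0) A B) with (RtoC 0).
      + replace (0 - 0)%C with (RtoC 0) by ring. rewrite Cmod_0; lra.
      + unfold Zsum. generalize (- Z.of_nat A)%Z (A + B)%nat.
        intros z p; revert z; induction p as [|p IHp]; intros z; simpl; [reflexivity|].
        rewrite <- IHp; ring.
    - rewrite IH. symmetry. apply sumZ_plus; auto.
      eapply dom_summable; [apply Hd|exact Hg]. }
  assert (Hmain : forall e, 0 < e -> exists K : nat, forall A B : nat,
    (K <= A)%nat -> (K <= B)%nat ->
    Cmod (sumZ (fun k => Zsum (F k) A B) - sumZ (fun k => sumZ (F k))) < e).
  { intros e He.
    destruct (zsum_uniform g Hg (e / 5)) as [M HM]; [lra|].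
    assert (Hd2 : dom (fun k => sumZ (F k)) g).
    { intros k. apply Cmod_sumZ_le; auto. }
    assert (Hfin : forall n a e', 0 < e' -> exists K0 : nat, forall A B,
      (K0 <= A)%nat -> (K0 <= B)%nat ->
      Cmod (Csum_from (fun k => Zsum (F k) A B) a n
        - Csum_from (fun k => sumZ (F k)) a n) < e').
    { induction n as [|n IH]; intros a e' He'.
      - exists O. intros A B _ _. simpl.
        replace (0 - 0)%C with (RtoC 0) by ring. rewrite Cmod_0; lra.
      - destruct (IH (a + 1)%Z (e' / 2)) as [K1 H1]; [lra|].
        destruct (sumZ_correct _ (Hk a) (e' / 2)) as [K2 H2]; [lra|].
        exists (Nat.max K1 K2). intros A B HA HB. simpl.
        specialize (H1 A B ltac:(lia) ltac:(lia)).
        specialize (H2 A B ltac:(lia) ltac:(lia)).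
        match goal with |- Cmod (?a + ?b - (?c + ?d)) < _ =>
          replace (a + b - (c + d))%C with ((a - c) + (b - d))%C by ring end.
        eapply Rle_lt_trans; [apply Cmod_triangle|]. lra. }
    destruct (Hfin (M + M)%nat (- Z.of_nat M)%Z (e / 5)) as [K1 H1]; [lra|].
    exists K1. intros A B HA HB. specialize (H1 A B HA HB).
    pose proof (HM _ (Hd (A + B)%nat (- Z.of_nat A)%Z) M M (le_n _) (le_n _)) as E2.
    pose proof (HM _ Hd2 M M (le_n _) (le_n _)) as E3.
    fold (Zsum (fun k => Zsum (F k) A B) M M) in H1.
    fold (Zsum (fun k => sumZ (F k)) M M) in H1.
    change (fun k : Z => Csum_from (F k) (- Z.of_nat A) (A + B))
      with (fun k : Z => Zsum (F k) A B) in E2.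
    set (X := Zsum (fun k => Zsum (F k) A B) M M) in *.
    set (Y := Zsum (fun k => sumZ (F k)) M M) in *.
    match goal with |- Cmod (?a - ?b) < _ =>
      replace (a - b)%C with (- (X - a) + ((X - Y) + (Y - b)))%C by ring end.
    eapply Rle_lt_trans; [apply Cmod_triangle|].
    eapply Rle_lt_trans; [apply Rplus_le_compat_l, Cmod_triangle|].
    rewrite Cmod_opp. lra. }
  destruct (Hmain eps Heps) as [K HK]. exists K. intros A B HA HB.
  unfold Zsum at 1. rewrite Hex. now apply HK.
Qed.

(** * Exponential and Gaussian majorants *)

Lemma Rsum_from_telescope (g G : Z -> R) (b : R) (a : Z) (n : nat) :
  (forall m, g m <= G (m + 1)%Z - G m) -> (forall m, Rabs (G m) <= b) ->
  Rsum_from g a n <= 2 * b.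
Proof.
  intros H Hb.
  assert (E : Rsum_from g a n <= G (a + Z.of_nat n)%Z - G a).
  { revert a; induction n as [|n IH]; intros a; cbn [Rsum_from].
    - rewrite Z.add_0_r. lra.
    - pose proof (H a). pose proof (IH (a + 1)%Z).
      replace (a + Z.of_nat (S n))%Z with (a + 1 + Z.of_nat n)%Z by lia. lra. }
  pose proof (Hb (a + Z.of_nat n)%Z). pose proof (Hb a).
  apply Rabs_le_between in H0. apply Rabs_le_between in H1. lra.
Qed.

(** The majorant with which all Gaussian series are compared. Instead of summing geometric series on
    either side of 0, a bounded function with sufficiently large increments is exhibited and
    telescoped. *)
Lemma major_exp_abs : major (fun m => exp (- Rabs (IZR m))).
Proof.
  split; [intros m; left; apply exp_pos|].
  set (r := exp (- (1))).
  assert (Hr : 0 < r < 1).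
  { split; [apply exp_pos|]. unfold r. rewrite <- exp_0 at 2. apply exp_increasing. lra. }
  (* An odd function bounded by 1. Its increment at m is exactly (1 - r) e^(-m) for m >= 0 and at
     least (1 - r) e^m for m < 0. *)
  set (G := fun m : Z => if Z_le_dec 0 m then 1 - exp (- IZR m) else exp (IZR m) - 1).
  exists (2 * / (1 - r)). intros a n.
  apply Rsum_from_telescope with (G := fun m => G m / (1 - r)).
  - intros m.
    assert (Hm : (1 - r) * exp (- Rabs (IZR m)) <= G (m + 1)%Z - G m).
    { unfold G. destruct (Z_le_dec 0 m) as [H|H].
      - destruct (Z_le_dec 0 (m + 1)); [|lia].
        rewrite Rabs_pos_eq by (apply IZR_le; lia).
        rewrite plus_IZR.
        replace (- (IZR m + 1)) with (- IZR m + - (1)) by ring.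
        rewrite exp_plus. fold r. lra.
      - rewrite Rabs_left by (apply IZR_lt; lia). rewrite Ropp_involutive.
        pose proof (exp_pos (IZR m)).
        destruct (Z_le_dec 0 (m + 1)) as [H'|H'].
        + assert (m = (-1)%Z) by lia. subst m. simpl.
          replace (- (0)) with 0 by ring. rewrite exp_0.
          fold r. change (exp (-1)) with r. nra.
        + rewrite plus_IZR, exp_plus.
          assert (1 < exp 1) by (rewrite <- exp_0 at 1; apply exp_increasing; lra).
          assert (exp 1 * r = 1).
          { unfold r. rewrite <- exp_plus. replace (1 + - (1)) with 0 by ring. apply exp_0. }
          assert (2 - r <= exp 1) by nra. nra. }
    replace (G (m + 1)%Z / (1 - r) - G m / (1 - r)) with
      ((G (m + 1)%Z - G m) / (1 - r)) by (field; lra).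
    apply Rmult_le_reg_l with (1 - r); [lra|].
    replace ((1 - r) * ((G (m + 1)%Z - G m) / (1 - r))) with (G (m + 1)%Z - G m)
      by (field; lra). exact Hm.
  - intros m. unfold Rdiv. rewrite Rabs_mult, (Rabs_pos_eq (/ (1 - r))).
    2: { left; apply Rinv_0_lt_compat; lra. }
    rewrite <- (Rmult_1_l (/ (1 - r))) at 2.
    apply Rmult_le_compat_r; [left; apply Rinv_0_lt_compat; lra|].
    unfold G. destruct (Z_le_dec 0 m) as [H|H].
    + assert (exp (- IZR m) <= 1).
      { rewrite <- exp_0. 
        destruct (Z.eq_dec m 0) as [->|h].
        - simpl. right. f_equal. ring.
        - left. apply exp_increasing. assert (0 < IZR m) by (apply IZR_lt; lia). lra. }
      pose proof (exp_pos (- IZR m)). apply Rabs_le; lra.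
    + assert (exp (IZR m) < 1).
      { rewrite <- exp_0. apply exp_increasing. apply IZR_lt; lia. }
      pose proof (exp_pos (IZR m)). apply Rabs_le; lra.
Qed.

Lemma exp_le_mono (x y : R) : x <= y -> exp x <= exp y.
Proof.
  intros [H| ->]; [left; now apply exp_increasing|lra].
Qed.

(** The square is completed in |x| with [beta + 1] in place of [beta]; the unit set aside is the
    decay e^(-|x|) that both series and integrals use. *)
Lemma gauss_le (b beta x : R) : 0 < b ->
  - b * x ^ 2 + beta * Rabs x <= (beta + 1) ^ 2 / (4 * b) - Rabs x.
Proof.
  intros Hb.
  assert (E : x ^ 2 = Rabs x ^ 2) by (rewrite pow2_abs; reflexivity).
  rewrite E. set (y := Rabs x).
  apply Rmult_le_reg_l with (4 * b); [lra|].
  replace (4 * b * ((beta + 1) ^ 2 / (4 * b) - y)) with ((beta + 1) ^ 2 - 4 * b * y)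
    by (field; lra).
  pose proof (pow2_ge_0 (2 * b * y - (beta + 1))). nra.
Qed.

Lemma Im_mult_R (x : R) (z : C) : Im (RtoC x * z) = x * Im z.
Proof. unfold Im, Cmult, RtoC; simpl. ring. Qed.

Lemma Re_mult_R (x : R) (z : C) : Re (RtoC x * z) = x * Re z.
Proof. unfold Re, Cmult, RtoC; simpl. ring. Qed.

Lemma Im_plus (a b : C) : Im (a + b) = Im a + Im b.
Proof. reflexivity. Qed.

Lemma Re_plus (a b : C) : Re (a + b) = Re a + Re b.
Proof. reflexivity. Qed.

(** The constant of [gauss_le] for the rate pi Im tau and a linear term of size pi beta. It sees the
    elliptic variable only through a bound on one coordinate, hence is uniform on strips. *)
Definition gbound (tau : C) (beta : R) : R :=
  exp ((PI * beta + 1) ^ 2 / (4 * (PI * Im tau))).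

Lemma Cmod_epi_quad (tau w : C) (beta x : R) :
  0 < Im tau -> Rabs (Im w) <= beta ->
  Cmod (epi (RtoC (x ^ 2) * tau + RtoC x * w)) <= gbound tau beta * exp (- Rabs x).
Proof.
  intros Ht Hw. rewrite Cmod_epi, Im_plus, !Im_mult_R.
  unfold gbound. rewrite <- exp_plus. apply exp_le_mono.
  pose proof PI_RGT_0.
  pose proof (gauss_le (PI * Im tau) (PI * beta) x ltac:(nra)).
  assert (- (x * Im w) <= beta * Rabs x).
  { eapply Rle_trans; [apply Rle_abs|]. rewrite Rabs_Ropp, Rabs_mult.
    pose proof (Rabs_pos x). nra. }
  nra.
Qed.

(** * Entire functions *)

(* Quantitative complex differentiability: it passes to superpositions of exponentials
   without any interchange theorem, and it makes the derivative locally Lipschitz. *)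
Definition cderiv (f f' : C -> C) : Prop :=
  forall r, exists M, 0 <= M /\ forall z h, Cmod z <= r -> Cmod h <= r ->
    Cmod (f (z + h) - f z - h * f' z)%C <= M * Cmod h ^ 2.

Definition entire (f : C -> C) : Prop := exists f', cderiv f f'.

Lemma cderiv_bounded (f f' : C -> C) (r : R) : cderiv f f' ->
  exists B, 0 <= B /\ forall z, Cmod z <= r -> Cmod (f z) <= B.
Proof.
  intros H. destruct (H r) as [M [HM HB]].
  exists (Cmod (f 0) + (Rabs r * Cmod (f' 0) + M * r ^ 2)). split.
  - pose proof (Cmod_ge_0 (f 0)). pose proof (Cmod_ge_0 (f' 0)).
    pose proof (Rabs_pos r). pose proof (pow2_ge_0 r). nra.
  - intros z Hz. pose proof (Cmod_ge_0 z).
    specialize (HB 0 z ltac:(rewrite Cmod_0; lra) Hz). rewrite Cplus_0_l in HB.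
    replace (f z) with (f 0 + (z * f' 0 + (f z - f 0 - z * f' 0)))%C by ring.
    eapply Rle_trans; [apply Cmod_triangle|]. apply Rplus_le_compat_l.
    eapply Rle_trans; [apply Cmod_triangle|]. rewrite Cmod_mult.
    rewrite (Rabs_pos_eq r) by lra.
    pose proof (Cmod_ge_0 (f' 0)).
    assert (Cmod z ^ 2 <= r ^ 2) by nra.
    assert (M * Cmod z ^ 2 <= M * r ^ 2) by nra. nra.
Qed.

(** The expansions from z by h and from z + h by -h add up to h (f'(z + h) - f'(z)). The radius 2 r
    is used because z + h leaves the disc of radius r. *)
Lemma cderiv_lipschitz (f f' : C -> C) (r : R) : cderiv f f' ->
  exists M, 0 <= M /\ forall z h, Cmod z <= r -> Cmod h <= r ->
    Cmod (f' (z + h) - f' z)%C <= M * Cmod h.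
Proof.
  intros H. destruct (H (2 * r)) as [M [HM HB]].
  exists (2 * M). split; [lra|]. intros z h Hz Hh.
  pose proof (Cmod_ge_0 z). pose proof (Cmod_ge_0 h).
  destruct (Req_dec (Cmod h) 0) as [E|E].
  - apply Cmod_eq_0 in E. subst h. rewrite Cplus_0_r.
    replace (f' z - f' z)%C with (RtoC 0) by ring. rewrite Cmod_0. lra.
  - pose proof (HB z h ltac:(lra) ltac:(lra)) as E1.
    assert (Hzh : Cmod (z + h) <= 2 * r).
    { eapply Rle_trans; [apply Cmod_triangle|]. lra. }
    pose proof (HB (z + h)%C (- h)%C Hzh ltac:(rewrite Cmod_opp; lra)) as E2.
    replace (z + h + - h)%C with z in E2 by ring. rewrite Cmod_opp in E2.
    apply Rmult_le_reg_l with (Cmod h); [lra|].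
    rewrite <- Cmod_mult.
    replace (h * (f' (z + h) - f' z))%C with
      ((f (z + h) - f z - h * f' z) + (f z - f (z + h) - - h * f' (z + h)))%C by ring.
    eapply Rle_trans; [apply Cmod_triangle|]. nra.
Qed.

Lemma cderiv_bounded' (f f' : C -> C) (r : R) : cderiv f f' ->
  exists B, 0 <= B /\ forall z, Cmod z <= r -> Cmod (f' z) <= B.
Proof.
  intros H. destruct (cderiv_lipschitz f f' r H) as [M [HM HB]].
  exists (Cmod (f' 0) + M * Rabs r). split.
  - pose proof (Cmod_ge_0 (f' 0)). pose proof (Rabs_pos r). nra.
  - intros z Hz. pose proof (Cmod_ge_0 z).
    specialize (HB 0 z ltac:(rewrite Cmod_0; lra) Hz). rewrite Cplus_0_l in HB.
    replace (f' z) with (f' 0 + (f' z - f' 0))%C by ring.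
    eapply Rle_trans; [apply Cmod_triangle|]. apply Rplus_le_compat_l.
    rewrite (Rabs_pos_eq r) by lra. nra.
Qed.

Lemma cderiv_increment (f f' : C -> C) (r : R) : cderiv f f' ->
  exists B, 0 <= B /\ forall z h, Cmod z <= r -> Cmod h <= r ->
    Cmod (f (z + h) - f z)%C <= B * Cmod h.
Proof.
  intros H. destruct (cderiv_bounded' f f' r H) as [B [HB1 HB2]].
  destruct (H r) as [M [HM1 HM2]].
  exists (B + M * Rabs r). split; [pose proof (Rabs_pos r); nra|].
  intros z h Hz Hh. pose proof (Cmod_ge_0 h).
  replace (f (z + h) - f z)%C with (h * f' z + (f (z + h) - f z - h * f' z))%C by ring.
  eapply Rle_trans; [apply Cmod_triangle|]. rewrite Cmod_mult.
  specialize (HB2 z Hz). specialize (HM2 z h Hz Hh).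
  rewrite (Rabs_pos_eq r) by lra.
  assert (Cmod h ^ 2 <= r * Cmod h) by nra.
  assert (M * Cmod h ^ 2 <= M * (r * Cmod h)) by nra. nra.
Qed.

Lemma cderiv_const (c : C) : cderiv (fun _ => c) (fun _ => 0).
Proof.
  intros r. exists 0. split; [lra|]. intros z h _ _.
  replace (c - c - h * 0)%C with (RtoC 0) by ring. rewrite Cmod_0. lra.
Qed.

Lemma cderiv_id : cderiv (fun z => z) (fun _ => 1).
Proof.
  intros r. exists 0. split; [lra|]. intros z h _ _.
  replace (z + h - z - h * 1)%C with (RtoC 0) by ring. rewrite Cmod_0. lra.
Qed.

Lemma cderiv_plus (f f' g g' : C -> C) : cderiv f f' -> cderiv g g' ->
  cderiv (fun z => f z + g z)%C (fun z => f' z + g' z)%C.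
Proof.
  intros Hf Hg r. destruct (Hf r) as [M [HM1 HM2]]. destruct (Hg r) as [N [HN1 HN2]].
  exists (M + N). split; [lra|]. intros z h Hz Hh.
  specialize (HM2 z h Hz Hh). specialize (HN2 z h Hz Hh).
  replace (f (z + h) + g (z + h) - (f z + g z) - h * (f' z + g' z))%C with
    ((f (z + h) - f z - h * f' z) + (g (z + h) - g z - h * g' z))%C by ring.
  eapply Rle_trans; [apply Cmod_triangle|]. lra.
Qed.

Lemma cderiv_mult (f f' g g' : C -> C) : cderiv f f' -> cderiv g g' ->
  cderiv (fun z => f z * g z)%C (fun z => f' z * g z + f z * g' z)%C.
Proof.
  intros Hf Hg r. destruct (Hf r) as [M [HM1 HM2]]. destruct (Hg r) as [N [HN1 HN2]].
  destruct (cderiv_bounded f f' r Hf) as [Bf [Bf1 Bf2]].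
  destruct (cderiv_bounded g g' r Hg) as [Bg [Bg1 Bg2]].
  destruct (cderiv_increment f f' r Hf) as [If [If1 If2]].
  destruct (cderiv_increment g g' r Hg) as [Ig [Ig1 Ig2]].
  exists (M * Bg + Bf * N + If * Ig).
  split; [repeat apply Rplus_le_le_0_compat; now apply Rmult_le_pos|].
  intros z h Hz Hh.
  specialize (HM2 z h Hz Hh). specialize (HN2 z h Hz Hh).
  specialize (Bf2 z Hz). specialize (Bg2 z Hz).
  specialize (If2 z h Hz Hh). specialize (Ig2 z h Hz Hh).
  replace (f (z + h) * g (z + h) - f z * g z - h * (f' z * g z + f z * g' z))%C with
    ((f (z + h) - f z - h * f' z) * g z + (f z * (g (z + h) - g z - h * g' z)
     + (f (z + h) - f z) * (g (z + h) - g z)))%C by ring.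
  eapply Rle_trans; [apply Cmod_triangle|].
  eapply Rle_trans; [apply Rplus_le_compat_l, Cmod_triangle|].
  rewrite !Cmod_mult.
  assert (Cmod (f (z + h) - f z - h * f' z)%C * Cmod (g z) <= (M * Cmod h ^ 2) * Bg)
    by (apply Rmult_le_compat; auto using Cmod_ge_0).
  assert (Cmod (f z) * Cmod (g (z + h) - g z - h * g' z)%C <= Bf * (N * Cmod h ^ 2))
    by (apply Rmult_le_compat; auto using Cmod_ge_0).
  assert (Cmod (f (z + h) - f z)%C * Cmod (g (z + h) - g z)%C <= (If * Cmod h) * (Ig * Cmod h))
    by (apply Rmult_le_compat; auto using Cmod_ge_0).
  nra.
Qed.

Lemma cderiv_comp (f f' g g' : C -> C) : cderiv f f' -> cderiv g g' ->
  cderiv (fun z => f (g z)) (fun z => g' z * f' (g z))%C.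
Proof.
  intros Hf Hg r. destruct (Hg r) as [N [HN1 HN2]].
  destruct (cderiv_bounded g g' r Hg) as [Bg [Bg1 Bg2]].
  destruct (cderiv_increment g g' r Hg) as [Ig [Ig1 Ig2]].
  (* [s] bounds g z as well as the increment g (z + h) - g z, so that the expansion of [f] at radius
     [s] applies with this increment as its step. *)
  set (s := Bg + Ig * Rabs r).
  destruct (Hf s) as [M [HM1 HM2]].
  destruct (cderiv_bounded' f f' s Hf) as [B' [B1 B2]].
  exists (M * Ig ^ 2 + B' * N).
  assert (0 <= Ig ^ 2) by apply pow2_ge_0.
  split; [apply Rplus_le_le_0_compat; now apply Rmult_le_pos|].
  intros z h Hz Hh. pose proof (Cmod_ge_0 h).
  specialize (HN2 z h Hz Hh). specialize (Bg2 z Hz). specialize (Ig2 z h Hz Hh).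
  set (k := (g (z + h) - g z)%C) in *.
  assert (Hs : Cmod (g z) <= s).
  { unfold s. pose proof (Rabs_pos r). nra. }
  assert (Hk : Cmod k <= s).
  { unfold s. rewrite Rabs_pos_eq by lra. nra. }
  specialize (HM2 (g z) k Hs Hk). specialize (B2 (g z) Hs).
  replace (g z + k)%C with (g (z + h)%C) in HM2 by (unfold k; ring).
  replace (f (g (z + h)) - f (g z) - h * (g' z * f' (g z)))%C with
    ((f (g (z + h)) - f (g z) - k * f' (g z)) + f' (g z) * (k - h * g' z))%C by ring.
  eapply Rle_trans; [apply Cmod_triangle|]. rewrite Cmod_mult.
  assert (Cmod (f' (g z))%C * Cmod (k - h * g' z) <= B' * (N * Cmod h ^ 2))
    by (apply Rmult_le_compat; auto using Cmod_ge_0).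
  assert (M * Cmod k ^ 2 <= M * (Ig ^ 2 * Cmod h ^ 2)).
  { apply Rmult_le_compat_l; auto. rewrite <- Rpow_mult_distr.
    apply pow_incr. split; [apply Cmod_ge_0|exact Ig2]. }
  nra.
Qed.

Lemma exp_taylor1 (x : R) : Rabs (exp x - 1) <= Rabs x * exp (Rabs x).
Proof.
  destruct (MVT_gen exp 0 x exp) as [c [Hc E]].
  - intros y _. apply is_derive_Reals, derivable_pt_lim_exp.
  - intros y _. apply derivable_continuous_pt, derivable_pt_exp.
  - rewrite exp_0 in E. rewrite E, Rabs_mult, Rminus_0_r.
    rewrite Rmult_comm. apply Rmult_le_compat_l; [apply Rabs_pos|].
    rewrite Rabs_pos_eq by (left; apply exp_pos). apply exp_le_mono.
    unfold Rabs. destruct (Rcase_abs x).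
    + rewrite Rmin_right, Rmax_left in Hc; lra.
    + rewrite Rmin_left, Rmax_right in Hc; lra.
Qed.

Lemma exp_taylor2 (x : R) : Rabs (exp x - 1 - x) <= Rabs x ^ 2 * exp (Rabs x).
Proof.
  destruct (MVT_gen (fun y => exp y - y) 0 x (fun y => exp y - 1)) as [c [Hc E]].
  - intros y _. apply is_derive_Reals.
    apply (derivable_pt_lim_minus exp id);
      [apply derivable_pt_lim_exp|apply derivable_pt_lim_id].
  - intros y _. apply (continuity_pt_minus exp id).
    + apply derivable_continuous_pt, derivable_pt_exp.
    + apply derivable_continuous_pt, derivable_pt_id.
  - rewrite exp_0 in E. replace (exp x - 1 - x) with (exp x - x - (1 - 0)) by ring.
    rewrite E, Rabs_mult, Rminus_0_r.
    assert (Hcx : Rabs c <= Rabs x).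
    { unfold Rabs at 2. destruct (Rcase_abs x).
      + rewrite Rmin_right, Rmax_left in Hc by lra. apply Rabs_le; lra.
      + rewrite Rmin_left, Rmax_right in Hc by lra. apply Rabs_le; lra. }
    assert (Rabs (exp c - 1) <= Rabs x * exp (Rabs x)).
    { eapply Rle_trans; [apply exp_taylor1|].
      apply Rmult_le_compat; auto using Rabs_pos; [left; apply exp_pos|].
      now apply exp_le_mono. }
    pose proof (Rabs_pos x). nra.
Qed.

Lemma sin_taylor1 (y : R) : Rabs (sin y) <= Rabs y.
Proof.
  destruct (MVT_gen sin 0 y cos) as [c [Hc E]].
  - intros z _. apply is_derive_Reals, derivable_pt_lim_sin.
  - intros z _. apply continuity_sin.
  - rewrite sin_0, !Rminus_0_r in E. rewrite E, Rabs_mult.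
    assert (Rabs (cos c) <= 1) by (apply Rabs_le; apply COS_bound).
    pose proof (Rabs_pos y). nra.
Qed.

Lemma cos_taylor (y : R) : Rabs (cos y - 1) <= Rabs y ^ 2.
Proof.
  destruct (MVT_gen cos 0 y (fun z => - sin z)) as [c [Hc E]].
  - intros z _. apply is_derive_Reals, derivable_pt_lim_cos.
  - intros z _. apply continuity_cos.
  - rewrite cos_0, !Rminus_0_r in E. rewrite E, Rabs_mult, Rabs_Ropp.
    pose proof (sin_taylor1 c).
    assert (Rabs c <= Rabs y).
    { unfold Rabs at 2. destruct (Rcase_abs y).
      + rewrite Rmin_right, Rmax_left in Hc by lra. apply Rabs_le; lra.
      + rewrite Rmin_left, Rmax_right in Hc by lra. apply Rabs_le; lra. }
    pose proof (Rabs_pos y). nra.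
Qed.

(** For |y| <= 1 the mean value theorem gives the quadratic bound; for larger |y| the trivial bound
    2 |y| is already quadratic, which is how [cexp_taylor] uses the alternative. *)
Lemma sin_taylor2 (y : R) : Rabs (sin y - y) <= Rabs y ^ 2 \/ 1 < Rabs y.
Proof.
  destruct (Rle_lt_dec (Rabs y) 1) as [Hy|Hy]; [left|now right].
  destruct (MVT_gen (fun z => sin z - z) 0 y (fun z => cos z - 1)) as [c [Hc E]].
  - intros z _. apply is_derive_Reals.
    apply (derivable_pt_lim_minus sin id);
      [apply derivable_pt_lim_sin|apply derivable_pt_lim_id].
  - intros z _. apply (continuity_pt_minus sin id); [apply continuity_sin|].
    apply derivable_continuous_pt, derivable_pt_id.
  - rewrite sin_0, !Rminus_0_r in E. rewrite E, Rabs_mult.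
    pose proof (cos_taylor c).
    assert (Rabs c <= Rabs y).
    { unfold Rabs at 2. destruct (Rcase_abs y).
      + rewrite Rmin_right, Rmax_left in Hc by lra. apply Rabs_le; lra.
      + rewrite Rmin_left, Rmax_right in Hc by lra. apply Rabs_le; lra. }
    pose proof (Rabs_pos y). pose proof (Rabs_pos c). 
    assert (Rabs c ^ 2 <= Rabs y) by nra. nra.
Qed.

Lemma cexp_taylor (w : C) :
  Cmod (cexp w - 1 - w) <= 6 * Cmod w ^ 2 * exp (Cmod w).
Proof.
  destruct w as [x y]. set (m := Cmod (x, y)).
  assert (Hx : Rabs x <= m) by apply (re_le_Cmod (x, y)).
  assert (Hy : Rabs y <= m) by apply (im_le_Cmod (x, y)).
  assert (He : 1 <= exp m).
  { rewrite <- exp_0. apply exp_le_mono, Cmod_ge_0. }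
  assert (Hex : exp (Rabs x) <= exp m) by now apply exp_le_mono.
  assert (Hex' : exp x <= exp m).
  { apply exp_le_mono. eapply Rle_trans; [apply Rle_abs|exact Hx]. }
  assert (Hm : 0 <= m) by apply Cmod_ge_0.
  pose proof (Rabs_pos x) as Px. pose proof (Rabs_pos y) as Py.
  pose proof (exp_pos x) as Pe.
  eapply Rle_trans; [apply Cmod_le_abs|].
  unfold cexp, Re, Im, Cminus, Cplus, Copp, RtoC; simpl.
  replace (exp x * cos y + - (1) + - x) with
    ((exp x - 1 - x) + exp x * (cos y - 1)) by ring.
  replace (exp x * sin y + - 0 + - y) with
    ((exp x - 1) * sin y + (sin y - y)) by ring.
  assert (E1 : Rabs (exp x - 1 - x + exp x * (cos y - 1)) <= 2 * m ^ 2 * exp m).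
  { eapply Rle_trans; [apply Rabs_triang|]. rewrite Rabs_mult, (Rabs_pos_eq (exp x)) by lra.
    pose proof (exp_taylor2 x) as T1. pose proof (cos_taylor y) as T2.
    assert (Rabs x ^ 2 * exp (Rabs x) <= m ^ 2 * exp m).
    { apply Rmult_le_compat; try (left; apply exp_pos); try apply pow2_ge_0; auto.
      now apply pow_incr. }
    assert (exp x * Rabs (cos y - 1) <= exp m * m ^ 2).
    { apply Rmult_le_compat; auto using Rabs_pos; [lra|].
      eapply Rle_trans; [exact T2|]. now apply pow_incr. }
    lra. }
  assert (E2 : Rabs ((exp x - 1) * sin y + (sin y - y)) <= 4 * m ^ 2 * exp m).
  { eapply Rle_trans; [apply Rabs_triang|]. rewrite Rabs_mult.
    pose proof (exp_taylor1 x) as T1. pose proof (sin_taylor1 y) as T2.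
    assert (Rabs (exp x - 1) * Rabs (sin y) <= (m * exp m) * m).
    { apply Rmult_le_compat; auto using Rabs_pos; [|lra].
      eapply Rle_trans; [exact T1|].
      apply Rmult_le_compat; auto. left; apply exp_pos. }
    assert (Rabs (sin y - y) <= 2 * m ^ 2 * exp m).
    { destruct (sin_taylor2 y) as [T|T].
      - assert (Rabs y ^ 2 <= m ^ 2) by now apply pow_incr. nra.
      - assert (Rabs (sin y - y) <= 2 * Rabs y).
        { eapply Rle_trans; [apply Rabs_triang|]. rewrite Rabs_Ropp. lra. }
        assert (m <= m ^ 2) by nra. nra. }
    nra. }
  simpl in E1, E2 |- *. lra.
Qed.

Lemma cexp_taylor_at (a z h : C) :
  Cmod (cexp (a * (z + h)) - cexp (a * z) - h * (a * cexp (a * z))) <=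
  6 * Cmod h ^ 2 * (Cmod a ^ 2 * exp (Cmod a * (Cmod z + Cmod h))).
Proof.
  replace (cexp (a * (z + h)) - cexp (a * z) - h * (a * cexp (a * z)))%C with
    (cexp (a * z) * (cexp (a * h) - 1 - a * h))%C.
  - rewrite Cmod_mult, Cmod_cexp.
    pose proof (cexp_taylor (a * h)) as T. rewrite Cmod_mult in T.
    assert (E : exp (Re (a * z)) <= exp (Cmod a * Cmod z)).
    { apply exp_le_mono. rewrite <- Cmod_mult.
      eapply Rle_trans; [apply Rle_abs|apply re_le_Cmod]. }
    rewrite Rmult_plus_distr_l, exp_plus.
    apply Rle_trans with (exp (Cmod a * Cmod z) *
      (6 * (Cmod a * Cmod h) ^ 2 * exp (Cmod a * Cmod h))).
    + apply Rmult_le_compat; auto using Cmod_ge_0. left; apply exp_pos.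
    + right. ring.
  - rewrite Cmult_plus_distr_l, cexp_plus. ring.
Qed.

Lemma cderiv_cexp : cderiv cexp cexp.
Proof.
  intros r. exists (6 * exp (2 * r)). split; [pose proof (exp_pos (2 * r)); lra|].
  intros z h Hz Hh. pose proof (cexp_taylor_at 1 z h) as T.
  rewrite Cmod_1, !Cmult_1_l in T. eapply Rle_trans; [exact T|].
  assert (exp (1 * (Cmod z + Cmod h)) <= exp (2 * r)) by (apply exp_le_mono; lra).
  pose proof (pow2_ge_0 (Cmod h)). nra.
Qed.

Lemma entire_const (c : C) : entire (fun _ => c).
Proof. eexists; apply cderiv_const. Qed.

Lemma entire_id : entire (fun z => z).
Proof. eexists; apply cderiv_id. Qed.

Lemma entire_plus (f g : C -> C) : entire f -> entire g -> entire (fun z => f z + g z)%C.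
Proof. intros [f' Hf] [g' Hg]. eexists. apply (cderiv_plus f f' g g'); auto. Qed.

Lemma entire_mult (f g : C -> C) : entire f -> entire g -> entire (fun z => f z * g z)%C.
Proof. intros [f' Hf] [g' Hg]. eexists. apply (cderiv_mult f f' g g'); auto. Qed.

Lemma entire_comp (f g : C -> C) : entire f -> entire g -> entire (fun z => f (g z)).
Proof. intros [f' Hf] [g' Hg]. eexists. apply (cderiv_comp f f' g g'); auto. Qed.

Lemma entire_ext (f g : C -> C) : (forall z, f z = g z) -> entire f -> entire g.
Proof.
  intros H [f' Hf]. exists f'. intros r. destruct (Hf r) as [M HM]. exists M.
  split; [apply HM|]. intros z h. rewrite <- !H. apply HM.
Qed.

Lemma entire_opp (f : C -> C) : entire f -> entire (fun z => - f z)%C.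
Proof.
  intros Hf. apply (entire_ext (fun z => (- (1)) * f z)%C); [intros; ring|].
  apply entire_mult; [apply entire_const|exact Hf].
Qed.

Lemma entire_minus (f g : C -> C) : entire f -> entire g -> entire (fun z => f z - g z)%C.
Proof. intros Hf Hg. apply entire_plus; [exact Hf|now apply entire_opp]. Qed.

Lemma entire_epi (f : C -> C) : entire f -> entire (fun z => epi (f z)).
Proof.
  intros Hf. unfold epi. apply (entire_comp cexp); [eexists; apply cderiv_cexp|].
  apply entire_mult; [apply entire_const|exact Hf].
Qed.

Lemma entire_div (f : C -> C) (c : C) : entire f -> entire (fun z => f z / c)%C.
Proof. intros Hf. apply entire_mult; [exact Hf|apply entire_const]. Qed.

Create HintDb entire_db.
#[export] Hint Resolve entire_const entire_id entire_plus entire_mult entire_epi entire_opp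
  entire_minus entire_div : entire_db.

(** The hypothesis bounds the second derivative of each exponential on a disc by a summable
    sequence, so the quadratic Taylor remainders can simply be added. The extra 1 in the weight
    covers the series itself and, with the square, its derivative. *)
Lemma entire_series (A a : Z -> C) :
  (forall r, exists c, 0 <= c /\ forall n, Cmod (A n) * ((1 + Cmod (a n) ^ 2) * exp (Cmod (a n) * r))
     <= c * exp (- Rabs (IZR n))) ->
  entire (fun z => sumZ (fun n => A n * cexp (a n * z))%C).
Proof.
  intros HA.
  exists (fun z => sumZ (fun n => A n * (a n * cexp (a n * z)))%C).
  assert (Hexp : forall n z r, Cmod z <= r -> Cmod (cexp (a n * z)) <= exp (Cmod (a n) * r)).
  { intros n z r Hz. rewrite Cmod_cexp. apply exp_le_mono.
    eapply Rle_trans; [apply Rle_abs|]. eapply Rle_trans; [apply re_le_Cmod|].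
    rewrite Cmod_mult. apply Rmult_le_compat_l; auto using Cmod_ge_0. }
  assert (HS0 : forall z, zsummable (fun n => A n * cexp (a n * z))%C).
  { intros z. destruct (HA (Cmod z)) as [c [Hc HB]].
    eapply dom_summable; [|apply (major_scal c _ Hc major_exp_abs)].
    intros n. eapply Rle_trans; [|exact (HB n)]. rewrite Cmod_mult.
    apply Rmult_le_compat_l; [apply Cmod_ge_0|].
    pose proof (Hexp n z _ (Rle_refl _)). pose proof (pow2_ge_0 (Cmod (a n))).
    pose proof (exp_pos (Cmod (a n) * Cmod z)). nra. }
  assert (HS1 : forall z, zsummable (fun n => A n * (a n * cexp (a n * z)))%C).
  { intros z. destruct (HA (Cmod z)) as [c [Hc HB]].
    eapply dom_summable; [|apply (major_scal c _ Hc major_exp_abs)].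
    intros n. eapply Rle_trans; [|exact (HB n)]. rewrite Cmod_mult.
    apply Rmult_le_compat_l; [apply Cmod_ge_0|]. rewrite Cmod_mult.
    pose proof (Hexp n z _ (Rle_refl _)). pose proof (Cmod_ge_0 (a n)).
    apply Rmult_le_compat; auto using Cmod_ge_0. nra. }
  (* The remainder at z with step h involves exponentials of size up to |z| + |h| <= 2 r. *)
  intros r. destruct (HA (2 * r)) as [c [Hc HB]].
  destruct major_exp_abs as [Hpos [b Hb]].
  assert (Hb0 : 0 <= b) by (eapply Rle_trans; [|apply (Hb 0%Z O)]; simpl; lra).
  exists (6 * (c * b)). split; [pose proof (Rmult_le_pos c b Hc Hb0); lra|].
  intros z h Hz Hh.
  rewrite <- sumZ_scal by auto. rewrite <- sumZ_minus by auto.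
  rewrite <- sumZ_minus.
  2: { apply (zsummable_ext (fun n => A n * cexp (a n * (z + h)) +
        (- (1)) * (A n * cexp (a n * z)))%C); [intros; ring|].
       apply zsummable_plus; auto. now apply zsummable_scal. }
  2: now apply zsummable_scal.
  assert (Hd : forall n, Cmod (A n * cexp (a n * (z + h)) - A n * cexp (a n * z) -
     h * (A n * (a n * cexp (a n * z)))) <= (6 * c * Cmod h ^ 2) * exp (- Rabs (IZR n))).
  { intros n.
    replace (A n * cexp (a n * (z + h)) - A n * cexp (a n * z) -
      h * (A n * (a n * cexp (a n * z))))%C with
      (A n * (cexp (a n * (z + h)) - cexp (a n * z) - h * (a n * cexp (a n * z))))%C by ring.
    rewrite Cmod_mult.
    pose proof (cexp_taylor_at (a n) z h) as T.
    assert (E : exp (Cmod (a n) * (Cmod z + Cmod h)) <= exp (Cmod (a n) * (2 * r))).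
    { apply exp_le_mono, Rmult_le_compat_l; [apply Cmod_ge_0|lra]. }
    specialize (HB n).
    set (X := exp (Cmod (a n) * (2 * r))) in *.
    pose proof (pow2_ge_0 (Cmod h)) as P1. pose proof (pow2_ge_0 (Cmod (a n))) as P2.
    apply Rle_trans with (Cmod (A n) * (6 * Cmod h ^ 2 * ((1 + Cmod (a n) ^ 2) * X))).
    - apply Rmult_le_compat_l; [apply Cmod_ge_0|].
      eapply Rle_trans; [exact T|]. apply Rmult_le_compat_l; [nra|].
      pose proof (exp_pos (Cmod (a n) * (Cmod z + Cmod h))).
      apply Rmult_le_compat; nra.
    - replace (Cmod (A n) * (6 * Cmod h ^ 2 * ((1 + Cmod (a n) ^ 2) * X))) with
        (6 * Cmod h ^ 2 * (Cmod (A n) * ((1 + Cmod (a n) ^ 2) * X))) by ring.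
      replace (6 * c * Cmod h ^ 2 * exp (- Rabs (IZR n))) with
        (6 * Cmod h ^ 2 * (c * exp (- Rabs (IZR n)))) by ring.
      apply Rmult_le_compat_l; [nra|exact HB]. }
  assert (Hk : 0 <= 6 * c * Cmod h ^ 2) by (pose proof (pow2_ge_0 (Cmod h)); nra).
  apply Cmod_sumZ_le.
  - eapply dom_summable; [exact Hd|]. apply (major_scal _ _ Hk major_exp_abs).
  - intros m n. eapply Rle_trans; [apply (Rsum_from_le _ _ m n Hd)|].
    rewrite Rsum_from_scal. pose proof (Hb m n).
    replace (6 * (c * b) * Cmod h ^ 2) with ((6 * c * Cmod h ^ 2) * b) by ring.
    now apply Rmult_le_compat_l.
Qed.

(** * Integrals of complex-valued functions, contour deformation, Fourier uniqueness *)

(* Turns an equation stated over a structure on [R] back into one over [R] itself. *)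
Ltac change_eq_R := match goal with |- @eq _ ?a ?b => change (@eq R a b) end.

Definition CRInt (f : R -> C) (a b : R) : C :=
  (RInt (fun x => Re (f x)) a b, RInt (fun x => Im (f x)) a b).

Definition Ccont (f : R -> C) : Prop :=
  forall x eps, 0 < eps -> exists d, 0 < d /\
    forall y, Rabs (y - x) < d -> Cmod (f y - f x)%C < eps.

Lemma Ccont_Re (f : R -> C) : Ccont f -> forall x, continuous (fun x => Re (f x)) x.
Proof.
  intros H x. apply continuity_pt_filterlim. intros eps Heps.
  destruct (H x eps Heps) as [d [Hd Hy]]. exists d. split; [exact Hd|].
  intros y [_ Hxy]. eapply Rle_lt_trans; [|apply (Hy y Hxy)].
  eapply Rle_trans; [|apply re_le_Cmod]. right. reflexivity.
Qed.

Lemma Ccont_Im (f : R -> C) : Ccont f -> forall x, continuous (fun x => Im (f x)) x.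
Proof.
  intros H x. apply continuity_pt_filterlim. intros eps Heps.
  destruct (H x eps Heps) as [d [Hd Hy]]. exists d. split; [exact Hd|].
  intros y [_ Hxy]. eapply Rle_lt_trans; [|apply (Hy y Hxy)].
  eapply Rle_trans; [|apply im_le_Cmod]. right. reflexivity.
Qed.

Lemma Ccont_ex_Re (f : R -> C) (a b : R) : Ccont f -> ex_RInt (fun x => Re (f x)) a b.
Proof. intros H. apply (ex_RInt_continuous (V := R_CompleteNormedModule)). intros z _. now apply Ccont_Re. Qed.

Lemma Ccont_ex_Im (f : R -> C) (a b : R) : Ccont f -> ex_RInt (fun x => Im (f x)) a b.
Proof. intros H. apply (ex_RInt_continuous (V := R_CompleteNormedModule)). intros z _. now apply Ccont_Im. Qed.

Lemma Ccont_ext (f g : R -> C) : (forall x, f x = g x) -> Ccont f -> Ccont g.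
Proof.
  intros H Hf x eps Heps. destruct (Hf x eps Heps) as [d [Hd Hy]].
  exists d. split; [exact Hd|]. intros y. rewrite <- !H. apply Hy.
Qed.

Lemma Ccont_plus (f g : R -> C) : Ccont f -> Ccont g -> Ccont (fun x => f x + g x)%C.
Proof.
  intros Hf Hg x eps Heps.
  destruct (Hf x (eps / 2)) as [d1 [Hd1 H1]]; [lra|].
  destruct (Hg x (eps / 2)) as [d2 [Hd2 H2]]; [lra|].
  exists (Rmin d1 d2). split; [now apply Rmin_pos|].
  intros y Hy.
  specialize (H1 y (Rlt_le_trans _ _ _ Hy (Rmin_l _ _))).
  specialize (H2 y (Rlt_le_trans _ _ _ Hy (Rmin_r _ _))).
  replace (f y + g y - (f x + g x))%C with ((f y - f x) + (g y - g x))%C by ring.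
  eapply Rle_lt_trans; [apply Cmod_triangle|]. lra.
Qed.

Lemma Ccont_mult (f g : R -> C) : Ccont f -> Ccont g -> Ccont (fun x => f x * g x)%C.
Proof.
  intros Hf Hg x eps Heps.
  set (A := Cmod (f x)). set (B := Cmod (g x)).
  assert (HA : 0 <= A) by apply Cmod_ge_0. assert (HB : 0 <= B) by apply Cmod_ge_0.
  set (e := Rmin 1 (eps / (A + B + 2))).
  assert (He : 0 < e).
  { apply Rmin_pos; [lra|]. apply Rdiv_lt_0_compat; lra. }
  assert (He1 : e <= 1) by apply Rmin_l.
  assert (He2 : e * (A + B + 2) <= eps).
  { pose proof (Rmin_r 1 (eps / (A + B + 2))). fold e in H.
    replace eps with (eps / (A + B + 2) * (A + B + 2)) by (field; lra).
    apply Rmult_le_compat_r; lra. }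
  destruct (Hf x e He) as [d1 [Hd1 H1]].
  destruct (Hg x e He) as [d2 [Hd2 H2]].
  exists (Rmin d1 d2). split; [now apply Rmin_pos|].
  intros y Hy.
  specialize (H1 y (Rlt_le_trans _ _ _ Hy (Rmin_l _ _))).
  specialize (H2 y (Rlt_le_trans _ _ _ Hy (Rmin_r _ _))).
  replace (f y * g y - f x * g x)%C with
    ((f y - f x) * (g y - g x) + ((f y - f x) * g x + f x * (g y - g x)))%C by ring.
  eapply Rle_lt_trans; [apply Cmod_triangle|].
  eapply Rle_lt_trans; [apply Rplus_le_compat_l, Cmod_triangle|].
  rewrite !Cmod_mult. fold A B.
  pose proof (Cmod_ge_0 (f y - f x)). pose proof (Cmod_ge_0 (g y - g x)).
  nra.
Qed.

Lemma Ccont_const (c : C) : Ccont (fun _ => c).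
Proof.
  intros x eps Heps. exists 1. split; [lra|]. intros y _.
  replace (c - c)%C with (RtoC 0) by ring. rewrite Cmod_0. exact Heps.
Qed.

Lemma Ccont_RtoC (f : R -> R) : (forall x, continuous f x) -> Ccont (fun x => RtoC (f x)).
Proof.
  intros Hf x eps Heps.
  assert (H := Hf x). apply continuity_pt_filterlim in H.
  destruct (H eps Heps) as [d [Hd Hy]]. exists d. split; [exact Hd|].
  intros y Hxy. rewrite <- RtoC_minus, Cmod_R.
  destruct (Req_dec x y) as [->|Hne].
  - replace (f y - f y) with 0 by ring. rewrite Rabs_R0. exact Heps.
  - apply Hy. split; [split; [exact I|exact Hne]|exact Hxy].
Qed.

Lemma lipschitz_Ccont (f : C -> C) :
  (forall r, exists M, 0 <= M /\ forall z h, Cmod z <= r -> Cmod h <= r ->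
     Cmod (f (z + h)%C - f z)%C <= M * Cmod h) -> Ccont (fun x => f (RtoC x)).
Proof.
  intros H x eps Heps.
  destruct (H (Rabs x + 1)) as [M [HM HL]].
  exists (Rmin 1 (eps / (M + 1))). split.
  - apply Rmin_pos; [lra|]. apply Rdiv_lt_0_compat; lra.
  - intros y Hy.
    pose proof (Rlt_le_trans _ _ _ Hy (Rmin_l _ _)) as H1.
    pose proof (Rlt_le_trans _ _ _ Hy (Rmin_r _ _)) as H2.
    pose proof (Rabs_pos x). 
    specialize (HL (RtoC x) (RtoC (y - x))). rewrite !Cmod_R, <- RtoC_plus in HL.
    replace (x + (y - x)) with y in HL by ring.
    eapply Rle_lt_trans; [apply HL; lra|].
    apply Rle_lt_trans with (M * (eps / (M + 1))); [apply Rmult_le_compat_l; lra|].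
    replace eps with ((M + 1) * (eps / (M + 1))) at 2 by (field; lra).
    apply Rmult_lt_compat_r; [apply Rdiv_lt_0_compat; lra|lra].
Qed.

Lemma entire_Ccont (f : C -> C) : entire f -> Ccont (fun x => f (RtoC x)).
Proof.
  intros [f' Hf]. apply lipschitz_Ccont. intros r. now apply (cderiv_increment f f').
Qed.

Lemma cderiv_Ccont (f f' : C -> C) : cderiv f f' -> Ccont (fun x => f' (RtoC x)).
Proof.
  intros Hf. apply lipschitz_Ccont. intros r. now apply (cderiv_lipschitz f f').
Qed.

Lemma CRInt_ext (f g : R -> C) (a b : R) : (forall x, f x = g x) -> CRInt f a b = CRInt g a b.
Proof.
  intros H. unfold CRInt. f_equal; apply RInt_ext; intros x _; now rewrite H.
Qed.

Lemma CRInt_plus (f g : R -> C) (a b : R) : Ccont f -> Ccont g ->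
  CRInt (fun x => f x + g x)%C a b = (CRInt f a b + CRInt g a b)%C.
Proof.
  intros Hf Hg. unfold CRInt, Cplus; simpl. f_equal.
  - apply (RInt_plus (V := R_CompleteNormedModule)); now apply Ccont_ex_Re.
  - apply (RInt_plus (V := R_CompleteNormedModule)); now apply Ccont_ex_Im.
Qed.

Lemma RInt_lin2 (f g : R -> R) (p q a b : R) : ex_RInt f a b -> ex_RInt g a b ->
  RInt (fun x => p * f x + q * g x) a b = p * RInt f a b + q * RInt g a b.
Proof.
  intros Hf Hg. apply is_RInt_unique.
  apply (is_RInt_plus (V := R_NormedModule) (fun x => p * f x) (fun x => q * g x)).
  - apply (is_RInt_scal (V := R_NormedModule)).
    now apply (RInt_correct (V := R_CompleteNormedModule)).
  - apply (is_RInt_scal (V := R_NormedModule)).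
    now apply (RInt_correct (V := R_CompleteNormedModule)).
Qed.

Lemma CRInt_scal (c : C) (f : R -> C) (a b : R) : Ccont f ->
  CRInt (fun x => c * f x)%C a b = (c * CRInt f a b)%C.
Proof.
  intros Hf.
  pose proof (Ccont_ex_Re f a b Hf) as H1. pose proof (Ccont_ex_Im f a b Hf) as H2.
  destruct c as [p q]. unfold CRInt, Cmult; simpl. f_equal.
  - rewrite (RInt_ext _ (fun x => p * Re (f x) + (- q) * Im (f x))).
    + rewrite RInt_lin2 by auto. change_eq_R. ring.
    + intros x _. unfold Re, Im; simpl. change_eq_R. ring.
  - rewrite (RInt_ext _ (fun x => p * Im (f x) + q * Re (f x))).
    + rewrite RInt_lin2 by auto. change_eq_R. ring.
    + intros x _. unfold Re, Im; simpl. change_eq_R. ring.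
Qed.

Lemma CRInt_minus (f g : R -> C) (a b : R) : Ccont f -> Ccont g ->
  CRInt (fun x => f x - g x)%C a b = (CRInt f a b - CRInt g a b)%C.
Proof.
  intros Hf Hg.
  rewrite (CRInt_ext _ (fun x => f x + (- (1)) * g x)%C) by (intros; ring).
  rewrite CRInt_plus, CRInt_scal; auto; [ring|].
  apply Ccont_mult; [apply Ccont_const|exact Hg].
Qed.

Lemma CRInt_Chasles (f : R -> C) (a b c : R) : Ccont f ->
  (CRInt f a b + CRInt f b c = CRInt f a c)%C.
Proof.
  intros Hf. unfold CRInt, Cplus; simpl. f_equal.
  - apply (RInt_Chasles (V := R_CompleteNormedModule)); now apply Ccont_ex_Re.
  - apply (RInt_Chasles (V := R_CompleteNormedModule)); now apply Ccont_ex_Im.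
Qed.

(** The factor 2 comes from bounding the real and the imaginary part separately. *)
Lemma CRInt_bound (f : R -> C) (a b M : R) : Ccont f -> a <= b ->
  (forall x, a <= x <= b -> Cmod (f x) <= M) -> Cmod (CRInt f a b) <= 2 * (b - a) * M.
Proof.
  intros Hf Hab HM.
  eapply Rle_trans; [apply Cmod_le_abs|]. unfold CRInt, Re at 1, Im at 1; simpl.
  assert (H1 : Rabs (RInt (fun x => Re (f x)) a b) <= (b - a) * M).
  { apply abs_RInt_le_const; [exact Hab|now apply Ccont_ex_Re|].
    intros t Ht. eapply Rle_trans; [apply re_le_Cmod|now apply HM]. }
  assert (H2 : Rabs (RInt (fun x => Im (f x)) a b) <= (b - a) * M).
  { apply abs_RInt_le_const; [exact Hab|now apply Ccont_ex_Im|].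
    intros t Ht. eapply Rle_trans; [apply im_le_Cmod|now apply HM]. }
  lra.
Qed.

Lemma CRInt_shift (f : R -> C) (c a b : R) : Ccont f ->
  CRInt (fun x => f (x + c)) a b = CRInt f (a + c) (b + c).
Proof.
  intros Hf. unfold CRInt. f_equal.
    replace (a + c) with (1 * a + c) by ring. replace (b + c) with (1 * b + c) by ring.
    rewrite <- (RInt_comp_lin (V := R_CompleteNormedModule) (fun x => Re (f x)) 1 c a b)
      by now apply Ccont_ex_Re.
    apply RInt_ext. intros x _. unfold scal; simpl. unfold mult; simpl.
    now rewrite !Rmult_1_l.
  - replace (a + c) with (1 * a + c) by ring. replace (b + c) with (1 * b + c) by ring.
    rewrite <- (RInt_comp_lin (V := R_CompleteNormedModule) (fun x => Im (f x)) 1 c a b)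
      by now apply Ccont_ex_Im.
    apply RInt_ext. intros x _. unfold scal; simpl. unfold mult; simpl.
    now rewrite !Rmult_1_l.
Qed.

Lemma is_derive_quadratic (k : R -> R) (x l M : R) :
  (forall d, Rabs d <= 1 -> Rabs (k (x + d) - k x - d * l) <= M * Rabs d ^ 2) ->
  is_derive k x l.
Proof.
  intros H. apply is_derive_Reals. intros eps Heps.
  set (N := Rabs M + 1). assert (HN : 0 < N) by (pose proof (Rabs_pos M); unfold N; lra).
  assert (Hd : 0 < Rmin 1 (eps / N)) by (apply Rmin_pos; [lra|now apply Rdiv_lt_0_compat]).
  exists (mkposreal _ Hd). intros d Hd0 Hd1. simpl in Hd1.
  pose proof (Rlt_le_trans _ _ _ Hd1 (Rmin_l _ _)) as E1.
  pose proof (Rlt_le_trans _ _ _ Hd1 (Rmin_r _ _)) as E2.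
  specialize (H d ltac:(lra)).
  replace ((k (x + d) - k x) / d - l) with ((k (x + d) - k x - d * l) / d) by (field; auto).
  unfold Rdiv. rewrite Rabs_mult, Rabs_inv.
  assert (Hp : 0 < Rabs d) by now apply Rabs_pos_lt.
  apply Rmult_lt_reg_r with (Rabs d); [exact Hp|].
  rewrite Rmult_assoc, Rinv_l, Rmult_1_r by lra.
  assert (M <= Rabs M) by apply Rle_abs.
  assert (Rabs d * N < eps).
  { replace eps with (eps / N * N) by (field; lra). now apply Rmult_lt_compat_r. }
  apply Rle_lt_trans with (N * Rabs d * Rabs d); [|nra].
  eapply Rle_trans; [exact H|]. unfold N. pose proof (pow2_ge_0 (Rabs d)). nra.
Qed.

Lemma cderiv_CRInt (F F' : C -> C) (a b : R) : cderiv F F' ->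
  CRInt (fun x => F' (RtoC x)) a b = (F (RtoC b) - F (RtoC a))%C.
Proof.
  intros HF. pose proof (cderiv_Ccont F F' HF) as Hc.
  assert (Hq : forall x, exists M, forall d, Rabs d <= 1 ->
    Cmod (F (RtoC (x + d)) - F (RtoC x) - RtoC d * F' (RtoC x))%C <= M * Rabs d ^ 2).
  { intros x. destruct (HF (Rabs x + 1)) as [M [_ HM]]. exists M. intros d Hd.
    specialize (HM (RtoC x) (RtoC d)). rewrite !Cmod_R in HM.
    rewrite RtoC_plus. apply HM; [lra|]. pose proof (Rabs_pos x); lra. }
  unfold CRInt. apply injective_projections; simpl.
  - apply is_RInt_unique.
    apply (is_RInt_derive (V := R_CompleteNormedModule)
      (fun x => Re (F (RtoC x))) (fun x => Re (F' (RtoC x))));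
      [|intros x _; now apply (Ccont_Re (fun x => F' (RtoC x)))].
    intros x _. destruct (Hq x) as [M HM]. apply is_derive_quadratic with M.
    intros d Hd. eapply Rle_trans; [|apply (HM d Hd)].
    eapply Rle_trans; [|apply re_le_Cmod]. right. f_equal.
    unfold Re, Cminus, Cplus, Cmult, Copp, RtoC; simpl. ring.
  - apply is_RInt_unique.
    apply (is_RInt_derive (V := R_CompleteNormedModule)
      (fun x => Im (F (RtoC x))) (fun x => Im (F' (RtoC x))));
      [|intros x _; now apply (Ccont_Im (fun x => F' (RtoC x)))].
    intros x _. destruct (Hq x) as [M HM]. apply is_derive_quadratic with M.
    intros d Hd. eapply Rle_trans; [|apply (HM d Hd)].
    eapply Rle_trans; [|apply im_le_Cmod]. right. f_equal.
    unfold Im, Cminus, Cplus, Cmult, Copp, RtoC; simpl. ring.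
Qed.

(** A mean value inequality by subdivision: with n steps of length 1/n the linear errors add up to
    [eps] and the quadratic ones to K/n. *)
Lemma path_bound (F : R -> C) (eps K : R) :
  (forall t d, 0 <= t <= 1 -> 0 <= d <= 1 -> Cmod (F (t + d)%R - F t)%C <= eps * d + K * d ^ 2) ->
  Cmod (F 1 - F 0)%C <= eps.
Proof.
  intros H. apply Rle_plus_epsilon. intros e He.
  destruct (nfloor_ex (Rabs K / e)) as [m [_ Hm]].
  { apply Rmult_le_pos; [apply Rabs_pos|left; now apply Rinv_0_lt_compat]. }
  set (n := S m). rewrite <- S_INR in Hm. fold n in Hm.
  assert (Hn : 0 < INR n) by (apply lt_0_INR; unfold n; lia).
  assert (Hn1 : 1 <= INR n) by (change 1 with (INR 1); apply le_INR; unfold n; lia).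
  assert (Hd : 0 <= / INR n <= 1).
  { split; [left; now apply Rinv_0_lt_compat|].
    rewrite <- Rinv_1. apply Rinv_le_contravar; lra. }
  assert (Hk : forall k, (k <= n)%nat -> Cmod (F (INR k * / INR n)%R - F 0)%C <=
    INR k * (eps * / INR n + K * (/ INR n) ^ 2)).
  { induction k as [|k IH]; intros Hk.
    - simpl. rewrite !Rmult_0_l. replace (F 0 - F 0)%C with (RtoC 0) by ring.
      rewrite Cmod_0; lra.
    - specialize (IH ltac:(lia)).
      assert (Ht : 0 <= INR k * / INR n <= 1).
      { split; [apply Rmult_le_pos; [apply pos_INR|lra]|].
        assert (INR k <= INR n) by (apply le_INR; lia).
        apply Rmult_le_reg_r with (INR n); [lra|].
        rewrite Rmult_assoc, Rinv_l, Rmult_1_r by lra. lra. }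
      specialize (H _ _ Ht Hd).
      rewrite S_INR. replace ((INR k + 1) * / INR n) with (INR k * / INR n + / INR n) by ring.
      match goal with |- Cmod (?a - ?b)%C <= _ =>
        replace (a - b)%C with ((a - F (INR k * / INR n)%R) + (F (INR k * / INR n)%R - b))%C
          by ring end.
      eapply Rle_trans; [apply Cmod_triangle|]. lra. }
  specialize (Hk n (le_n n)). rewrite Rinv_r in Hk by lra.
  eapply Rle_trans; [exact Hk|].
  replace (INR n * (eps * / INR n + K * (/ INR n) ^ 2)) with (eps + K * / INR n)
    by (field; lra).
  apply Rplus_le_compat_l.
  assert (K <= Rabs K) by apply Rle_abs.
  assert (Rabs K * / INR n <= e).
  { apply Rmult_le_reg_r with (INR n); [lra|].
    rewrite Rmult_assoc, Rinv_l, Rmult_1_r by lra.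
    replace (Rabs K) with (Rabs K / e * e) by (field; lra). nra. }
  nra.
Qed.

(* Along the affine homotopy [z_t(x) = (a0 + t a1) x + (b0 + t b1)] one has
   [d/dt (f(z_t) dz_t/dx) = d/dx (f(z_t) dz_t/dt)], so the integral of [f] along the
   segments changes only through the end points. *)
Lemma contour_deformation (f : C -> C) (a0 a1 b0 b1 : C) (a b eps : R) :
  entire f -> a <= b ->
  (forall t, 0 <= t <= 1 ->
    Cmod (f ((a0 + RtoC t * a1) * RtoC b + (b0 + RtoC t * b1))%C * (a1 * RtoC b + b1)
      - f ((a0 + RtoC t * a1) * RtoC a + (b0 + RtoC t * b1))%C * (a1 * RtoC a + b1))%C <= eps) ->
  Cmod (CRInt (fun x => f ((a0 + a1) * RtoC x + (b0 + b1))%C * (a0 + a1))%C a b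
    - CRInt (fun x => f (a0 * RtoC x + b0)%C * a0)%C a b)%C <= eps.
Proof.
  intros [f' Hf] Hab Heps.
  assert (Ef : entire f) by now exists f'.
  set (al := fun t : R => (a0 + RtoC t * a1)%C).
  set (phi := fun (t : R) (z : C) => (al t * z + (b0 + RtoC t * b1))%C).
  set (psi := fun z : C => (a1 * z + b1)%C).
  set (G := fun (t : R) (x : R) => (f (phi t (RtoC x)) * al t)%C).
  set (dG := fun (t : R) (x : R) =>
    (al t * f' (phi t (RtoC x)) * psi (RtoC x) + f (phi t (RtoC x)) * a1)%C).
  assert (Hphi : forall t, cderiv (phi t) (fun z => (0 * z + al t * 1) + 0)%C).
  { intros t. unfold phi.
    apply (cderiv_plus (fun z => al t * z)%C _ (fun _ => b0 + RtoC t * b1)%C).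
    - apply (cderiv_mult (fun _ => al t) _ (fun z => z)); [apply cderiv_const|apply cderiv_id].
    - apply cderiv_const. }
  assert (Hpsi : cderiv psi (fun z => (0 * z + a1 * 1) + 0)%C).
  { unfold psi. apply (cderiv_plus (fun z => a1 * z)%C _ (fun _ => b1)).
    - apply (cderiv_mult (fun _ => a1) _ (fun z => z)); [apply cderiv_const|apply cderiv_id].
    - apply cderiv_const. }
  assert (HGc : forall t, Ccont (G t)).
  { intros t. unfold G. apply Ccont_mult; [|apply Ccont_const].
    apply (entire_Ccont (fun z => f (phi t z))). apply entire_comp; [exact Ef|].
    eexists; apply Hphi. }
  pose (H' := fun t => cderiv_mult _ _ _ _ (cderiv_comp _ _ _ _ Hf (Hphi t)) Hpsi).
  assert (HdG : forall t x, dG t x = ((fun z =>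
    (((0 * z + al t * 1) + 0) * f' (phi t z)) * psi z +
      f (phi t z) * ((0 * z + a1 * 1) + 0))%C (RtoC x))).
  { intros t x. unfold dG. cbv beta. ring. }
  assert (HdGc : forall t, Ccont (dG t)).
  { intros t. eapply Ccont_ext; [intros x; symmetry; apply HdG|].
    exact (cderiv_Ccont _ _ (H' t)). }
  assert (HdGi : forall t, CRInt (dG t) a b =
    (f (phi t (RtoC b)) * psi (RtoC b) - f (phi t (RtoC a)) * psi (RtoC a))%C).
  { intros t. rewrite (CRInt_ext _ _ a b (HdG t)).
    apply (cderiv_CRInt (fun z => f (phi t z) * psi z)%C _ a b (H' t)). }
  set (X := Rabs a + Rabs b).
  set (A := Cmod a0 + Cmod a1).
  (* [r] bounds the points [phi] of every intermediate path and also the velocity [psi], so a single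
     Taylor constant at this radius serves all t and x. *)
  set (r := (A * X + (Cmod b0 + Cmod b1))).
  pose proof (Cmod_ge_0 a0) as Pa0. pose proof (Cmod_ge_0 a1) as Pa1.
  pose proof (Cmod_ge_0 b0) as Pb0. pose proof (Cmod_ge_0 b1) as Pb1.
  assert (HX : 0 <= X) by (unfold X; pose proof (Rabs_pos a); pose proof (Rabs_pos b); lra).
  assert (HA : 0 <= A) by (unfold A; lra).
  assert (HAX : 0 <= A * X) by now apply Rmult_le_pos.
  assert (Hr : 0 <= r) by (unfold r; lra).
  destruct (Hf r) as [M [HM1 HM2]].
  destruct (cderiv_bounded' f f' r Hf) as [B [HB1 HB2]].
  set (K := 2 * (b - a) * (M * r ^ 2 * (2 * A) + r * B * A)).
  assert (Hal : forall t, 0 <= t <= 1 -> Cmod (al t) <= A).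
  { intros t Ht. unfold al, A. eapply Rle_trans; [apply Cmod_triangle|].
    rewrite Cmod_mult, Cmod_R, Rabs_pos_eq by lra. nra. }
  assert (HxX : forall x, a <= x <= b -> Rabs x <= X).
  { intros x Hx. unfold X. pose proof (Rle_abs b). pose proof (Rle_abs (- a)) as Q.
    rewrite Rabs_Ropp in Q. pose proof (Rabs_pos a). pose proof (Rabs_pos b).
    apply Rabs_le. lra. }
  assert (Hphib : forall t x, 0 <= t <= 1 -> a <= x <= b -> Cmod (phi t (RtoC x)) <= r).
  { intros t x Ht Hx. unfold phi, r. eapply Rle_trans; [apply Cmod_triangle|].
    apply Rplus_le_compat.
    - rewrite Cmod_mult, Cmod_R. apply Rmult_le_compat; auto using Cmod_ge_0, Rabs_pos.
    - eapply Rle_trans; [apply Cmod_triangle|].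
      rewrite Cmod_mult, Cmod_R, Rabs_pos_eq by lra. nra. }
  assert (Hpsib : forall x, a <= x <= b -> Cmod (psi (RtoC x)) <= r).
  { intros x Hx. unfold psi, r. eapply Rle_trans; [apply Cmod_triangle|].
    rewrite Cmod_mult, Cmod_R. specialize (HxX x Hx).
    assert (Cmod a1 * Rabs x <= A * X); [|lra].
    apply Rmult_le_compat; auto using Rabs_pos. unfold A; lra. }
  (* The integral is expanded to first order in the homotopy parameter with an explicit quadratic
     remainder, which is the input of [path_bound]. *)
  assert (Hstep : forall t d, 0 <= t <= 1 -> 0 <= d <= 1 ->
    Cmod (CRInt (G (t + d)%R) a b - CRInt (G t) a b - RtoC d * CRInt (dG t) a b)%C <= K * d ^ 2).
  { intros t d Ht Hd.
    rewrite <- CRInt_scal, <- !CRInt_minus; auto.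
    2: { apply (Ccont_ext (fun x => G (t + d)%R x + (- (1)) * G t x)%C); [intros; ring|].
         apply Ccont_plus; auto. apply Ccont_mult; auto using Ccont_const. }
    2: { apply Ccont_mult; auto using Ccont_const. }
    replace (K * d ^ 2) with
      (2 * (b - a) * ((M * r ^ 2 * (2 * A) + r * B * A) * d ^ 2)) by (unfold K; ring).
    apply CRInt_bound; [|exact Hab|].
    { apply (Ccont_ext (fun x => (G (t + d)%R x + (- (1)) * G t x)
        + (- RtoC d) * dG t x)%C); [intros; ring|].
      apply Ccont_plus; [apply Ccont_plus; auto|]; apply Ccont_mult; auto using Ccont_const. }
    intros x Hx. specialize (Hphib t x Ht Hx). specialize (Hpsib x Hx).
    unfold G, dG. set (p := phi t (RtoC x)) in *. set (s := psi (RtoC x)) in *.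
    assert (Ep : phi (t + d)%R (RtoC x) = (p + RtoC d * s)%C).
    { unfold p, s, phi, psi, al. rewrite RtoC_plus. ring. }
    assert (Ea : al (t + d)%R = (al t + RtoC d * a1)%C).
    { unfold al. rewrite RtoC_plus. ring. }
    rewrite Ep, Ea.
    assert (Hds : Cmod (RtoC d * s) <= r * d).
    { rewrite Cmod_mult, Cmod_R, Rabs_pos_eq by lra. nra. }
    specialize (HM2 p (RtoC d * s)%C Hphib ltac:(nra)). specialize (HB2 p Hphib).
    replace (f (p + RtoC d * s)%C * (al t + RtoC d * a1) - f p * al t
      - RtoC d * (al t * f' p * s + f p * a1))%C with
      ((f (p + RtoC d * s)%C - f p - (RtoC d * s) * f' p) * (al t + RtoC d * a1)
       + (RtoC d * s) * f' p * (RtoC d * a1))%C by ring.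
    eapply Rle_trans; [apply Cmod_triangle|]. rewrite !(Cmod_mult _ (_ + _)), !(Cmod_mult _ (RtoC d * a1)).
    rewrite (Cmod_mult (RtoC d * s)).
    assert (Hda : Cmod (RtoC d * a1) <= d * A).
    { rewrite Cmod_mult, Cmod_R, Rabs_pos_eq by lra. unfold A. nra. }
    assert (HaA : Cmod (al t + RtoC d * a1) <= 2 * A).
    { eapply Rle_trans; [apply Cmod_triangle|]. specialize (Hal t Ht). nra. }
    rewrite Rmult_plus_distr_r. apply Rplus_le_compat.
    - apply Rle_trans with ((M * (r * d) ^ 2) * (2 * A)); [|right; ring].
      apply Rmult_le_compat; auto using Cmod_ge_0.
      eapply Rle_trans; [exact HM2|]. apply Rmult_le_compat_l; auto.
      apply pow_incr. split; [apply Cmod_ge_0|exact Hds].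
    - apply Rle_trans with ((r * d) * B * (d * A)); [|right; ring].
      apply Rmult_le_compat; auto using Cmod_ge_0.
      + apply Rmult_le_pos; apply Cmod_ge_0.
      + apply Rmult_le_compat; auto using Cmod_ge_0. }
  pose proof (path_bound (fun t => CRInt (G t) a b) eps K) as Hp.
  cbv beta in Hp.
  assert (E1 : CRInt (G 1) a b =
    CRInt (fun x => f ((a0 + a1) * RtoC x + (b0 + b1))%C * (a0 + a1))%C a b).
  { apply CRInt_ext. intros x. unfold G, phi, al. now rewrite !Cmult_1_l. }
  assert (E0 : CRInt (G 0) a b = CRInt (fun x => f (a0 * RtoC x + b0)%C * a0)%C a b).
  { apply CRInt_ext. intros x. unfold G, phi, al. now rewrite !Cmult_0_l, !Cplus_0_r. }
  rewrite E1, E0 in Hp. apply Hp. clear Hp E1 E0.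
  intros t d Ht Hd. specialize (Hstep t d Ht Hd). specialize (Heps t Ht).
  rewrite HdGi in Hstep.
  fold (al t) in Heps. fold (psi (RtoC b)) in Heps. fold (psi (RtoC a)) in Heps.
  fold (phi t (RtoC b)) in Heps. fold (phi t (RtoC a)) in Heps.
  set (D := (f (phi t (RtoC b)) * psi (RtoC b) - f (phi t (RtoC a)) * psi (RtoC a))%C) in *.
  set (I1 := CRInt (G (t + d)%R) a b) in *. set (I0 := CRInt (G t) a b) in *.
  replace (I1 - I0)%C with (RtoC d * D + (I1 - I0 - RtoC d * D))%C by ring.
  eapply Rle_trans; [apply Cmod_triangle|].
  rewrite Cmod_mult, Cmod_R, Rabs_pos_eq by lra. nra.
Qed.

(** The segment is translated along t w; by periodicity the contributions of its two ends cancel, so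
    the deformation bound holds for every positive [eps]. *)
Lemma periodic_contour (f : C -> C) (w : C) : entire f ->
  (forall z, f (z + 1)%C = f z) ->
  CRInt (fun x => f (RtoC x + w)%C) 0 1 = CRInt (fun x => f (RtoC x)) 0 1.
Proof.
  intros Hf Hper. apply Ceq_minus, Cmod_small_0. intros eps Heps.
  pose proof (contour_deformation f 1 0 0 w 0 1 eps Hf ltac:(lra)) as H.
  rewrite (CRInt_ext _ (fun x => f ((1 + 0) * RtoC x + (0 + w))%C * (1 + 0))%C).
  2: { intros x. rewrite Cplus_0_r, Cplus_0_l, Cmult_1_l, Cmult_1_r. reflexivity. }
  rewrite (CRInt_ext (fun x => f (RtoC x)) (fun x => f (1 * RtoC x + 0)%C * 1)%C).
  2: { intros x. rewrite Cplus_0_r, Cmult_1_l, Cmult_1_r. reflexivity. }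
  apply H. intros t Ht.
  replace ((1 + RtoC t * 0) * 1 + (0 + RtoC t * w))%C with (RtoC t * w + 1)%C by ring.
  replace ((1 + RtoC t * 0) * 0 + (0 + RtoC t * w))%C with (RtoC t * w)%C by ring.
  rewrite Hper.
  replace (f (RtoC t * w)%C * (0 * 1 + w) - f (RtoC t * w)%C * (0 * 0 + w))%C
    with (RtoC 0) by ring.
  rewrite Cmod_0. lra.
Qed.

Lemma RInt_ge_const (f : R -> R) (a b c : R) : a <= b -> (forall x, continuous f x) ->
  (forall x, a <= x <= b -> c <= f x) -> c * (b - a) <= RInt f a b.
Proof.
  intros Hab Hf Hc.
  assert (E : RInt (fun _ => c) a b = c * (b - a)).
  { rewrite RInt_const. unfold scal; simpl. unfold mult; simpl. ring. }
  rewrite <- E. apply RInt_le; auto.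
  - apply ex_RInt_const.
  - apply (ex_RInt_continuous (V := R_CompleteNormedModule)). intros z _; apply Hf.
  - intros x Hx. apply Hc. lra.
Qed.

(* [sin (pi x) ^ (2 m)] is a trigonometric polynomial that concentrates at [x = 1/2]. *)
Lemma fourier_zero_mid (g : R -> C) : Ccont g ->
  (forall n : Z, CRInt (fun x => g x * epi (- (2 * zc n * RtoC x)))%C 0 1 = 0) ->
  g (/ 2) = 0.
Proof.
  intros Hg H0.
  set (s := fun x => sin (PI * x) ^ 2).
  assert (Hs : forall x, RtoC (s x) =
    ((2 - epi (2 * RtoC x) - epi (- (2 * RtoC x))) / 4)%C).
  { intros x. replace (2 * RtoC x)%C with (RtoC (2 * x)) by (rewrite RtoC_mult; reflexivity).
    rewrite <- RtoC_opp, !epi_real.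
    replace (PI * - (2 * x)) with (- (PI * (2 * x))) by ring.
    rewrite cos_neg, sin_neg.
    replace (PI * (2 * x)) with (2 * (PI * x)) by ring. rewrite cos_2a_sin.
    unfold s, Cdiv, Cinv, Cminus, Cplus, Copp, Cmult, RtoC; simpl. f_equal; field. }
  assert (Hepi : forall n : Z, Ccont (fun x => epi (- (2 * zc n * RtoC x)))%C).
  { intros n. apply (entire_Ccont (fun z => epi (- (2 * zc n * z)))%C). auto with entire_db. }
  assert (Hsc : forall x, continuous s x).
  { intros x. apply (ex_derive_continuous s). unfold s. auto_derive. auto. }
  assert (Hsm : forall m x, continuous (fun x => s x ^ m) x).
  { intros m x. apply (ex_derive_continuous (fun x => s x ^ m)). unfold s. auto_derive. auto. }
  assert (Hgm : forall m, Ccont (fun x => g x * RtoC (s x ^ m))%C).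
  { intros m. apply Ccont_mult; [exact Hg|]. apply Ccont_RtoC. apply Hsm. }
  (* Multiplication by [s] replaces a Fourier coefficient by a combination of those with index n -
     1, n and n + 1; hence all coefficients of g s^m vanish too. *)
  assert (Hm : forall m n, CRInt (fun x => (g x * RtoC (s x ^ m)) *
    epi (- (2 * zc n * RtoC x)))%C 0 1 = 0).
  { induction m as [|m IH]; intros n.
    - rewrite <- (H0 n). apply CRInt_ext. intros x. simpl. ring.
    - rewrite (CRInt_ext _ (fun x => (/ 2) * ((g x * RtoC (s x ^ m)) *
          epi (- (2 * zc n * RtoC x))) +
        ((- / 4) * ((g x * RtoC (s x ^ m)) * epi (- (2 * zc (n - 1) * RtoC x)))
        + (- / 4) * ((g x * RtoC (s x ^ m)) * epi (- (2 * zc (n + 1) * RtoC x)))))%C).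
      + pose proof (fun k => Ccont_mult _ _ (Hgm m) (Hepi k)) as Q.
        assert (Q' : forall c k, Ccont (fun x => c * (g x * RtoC (s x ^ m) *
           epi (- (2 * zc k * RtoC x))))%C).
        { intros c k. apply Ccont_mult; [apply Ccont_const|apply Q]. }
        rewrite !CRInt_plus; auto using Ccont_plus.
        rewrite !CRInt_scal by auto. rewrite !IH. ring.
      + intros x. simpl pow. rewrite RtoC_mult, Hs, zc_minus, zc_plus.
        replace (- (2 * (zc n - 1) * RtoC x))%C with (- (2 * zc n * RtoC x) + 2 * RtoC x)%C
          by ring.
        replace (- (2 * (zc n + 1) * RtoC x))%C with (- (2 * zc n * RtoC x) + - (2 * RtoC x))%C
          by ring.
        rewrite !epi_plus. field. }
  destruct (Req_dec (Cmod (g (/ 2))) 0) as [E|E]; [now apply Cmod_eq_0|exfalso].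
  set (c := Cconj (g (/ 2))).
  set (G := fun x => Re (c * g x)%C).
  assert (HGc : forall x, continuous G x).
  { apply (Ccont_Re (fun x => c * g x)%C). apply Ccont_mult; [apply Ccont_const|exact Hg]. }
  set (A := G (/ 2)).
  assert (HA : 0 < A).
  { assert (EA : A = Cmod (g (/ 2)) ^ 2).
    { unfold A, G, c. rewrite Cmod2_alt. unfold Cconj, Re, Im, Cmult; simpl. ring. }
    rewrite EA. pose proof (Cmod_ge_0 (g (/ 2))). apply pow_lt. lra. }
  assert (HGint : forall m, RInt (fun x => G x * s x ^ m) 0 1 = 0).
  { intros m. pose proof (Hm m 0%Z) as E0.
    assert (E1 : CRInt (fun x => c * ((g x * RtoC (s x ^ m)) *
      epi (- (2 * zc 0 * RtoC x))))%C 0 1 = 0).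
    { rewrite CRInt_scal, E0; [ring|]. apply Ccont_mult; auto. }
    transitivity (Re (CRInt (fun x => c * ((g x * RtoC (s x ^ m)) *
      epi (- (2 * zc 0 * RtoC x))))%C 0 1)); [|now rewrite E1].
    change (RInt (fun x => G x * s x ^ m) 0 1 = RInt (fun x => Re (c * ((g x *
      RtoC (s x ^ m)) * epi (- (2 * zc 0 * RtoC x))))%C) 0 1).
    apply RInt_ext. intros x _.
    replace (- (2 * 0 * RtoC x))%C with (RtoC 0) by ring. rewrite epi_0.
    unfold G, Re, Cmult, RtoC; simpl. change_eq_R. ring. }
  assert (HGd := HGc (/ 2)). apply continuity_pt_filterlim in HGd.
  destruct (HGd (A / 2) ltac:(lra)) as [d0 [Hd0 HGd']].
  (* On the interval of radius [d] around 1/2 the function [G] is at least A/2. The cap 1/4 keeps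
     1/2 - d away from 0, so that [r] below is positive. *)
  set (d := Rmin (d0 / 2) (/ 4)).
  assert (Hd : 0 < d) by (apply Rmin_pos; lra).
  assert (Hd4 : d <= / 4) by apply Rmin_r.
  assert (HGA : forall x, / 2 - d <= x <= / 2 + d -> A / 2 <= G x).
  { intros x Hx. destruct (Req_dec x (/ 2)) as [->|Hne]; [fold A; lra|].
    assert (Hxd : Rabs (x - / 2) < d0).
    { apply Rle_lt_trans with d; [apply Rabs_le; lra|].
      pose proof (Rmin_l (d0 / 2) (/ 4)) as Q. fold d in Q. lra. }
    specialize (HGd' x (conj (conj I (not_eq_sym Hne)) Hxd)).
    simpl in HGd'. unfold Rdist in HGd'. fold A in HGd'.
    apply Rabs_def2 in HGd'. lra. }
  destruct (continuity_ab_min G 0 1 ltac:(lra)) as [xm [Hxm _]].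
  { intros x _. apply continuity_pt_filterlim, HGc. }
  set (B := Rabs (G xm)).
  assert (HB : forall x, 0 <= x <= 1 -> - B <= G x).
  { intros x Hx. specialize (Hxm x Hx). unfold B.
    pose proof (Rle_abs (- G xm)) as Q. rewrite Rabs_Ropp in Q. lra. }
  assert (HB0 : 0 <= B) by apply Rabs_pos.
  set (r := s (/ 2 - d)). set (r' := s (/ 2 - d / 2)).
  pose proof PI_RGT_0 as HPI.
  assert (Hsin_pos : forall x, 0 <= x <= 1 -> 0 <= sin (PI * x)).
  { intros x Hx. apply sin_ge_0; nra. }
  assert (Hs0 : forall x, 0 <= s x) by (intros x; apply pow2_ge_0).
  assert (Hmono : forall x y, 0 <= x -> x <= y -> y <= / 2 -> s x <= s y).
  { intros x y Hx Hxy Hy. unfold s. apply pow_incr. split; [apply Hsin_pos; lra|].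
    apply sin_incr_1; nra. }
  assert (Hsym : forall x, s (1 - x) = s x).
  { intros x. unfold s. replace (PI * (1 - x)) with (PI - PI * x) by ring.
    rewrite sin_PI_x. reflexivity. }
  assert (Hr0 : 0 < r).
  { unfold r, s. apply pow_lt. apply sin_gt_0; nra. }
  assert (Hrr : r < r').
  { unfold r, r', s.
    assert (sin (PI * (/ 2 - d)) < sin (PI * (/ 2 - d / 2))).
    { apply sin_increasing_1; nra. }
    assert (0 < sin (PI * (/ 2 - d))) by (apply sin_gt_0; nra). nra. }
  (* The core of radius d/2, where s >= r', contributes at least the left side; the rings up to
     radius d contribute nonnegatively; outside s <= r and the total length is below 1. The sum of
     all is 0. *)
  assert (Hlow : forall m, d * (A / 2 * r' ^ m) <= B * r ^ m).
  { intros m.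
    assert (Hcm : forall x, continuous (fun x => G x * s x ^ m) x).
    { intros x. apply (continuous_mult G (fun x => s x ^ m)); auto. }
    assert (Hex : forall u v, ex_RInt (fun x => G x * s x ^ m) u v).
    { intros u v. apply (ex_RInt_continuous (V := R_CompleteNormedModule)). intros; apply Hcm. }
    pose proof (HGint m) as E0.
    rewrite <- (RInt_Chasles (V := R_CompleteNormedModule) _ 0 (/ 2 - d) 1) in E0 by auto.
    rewrite <- (RInt_Chasles (V := R_CompleteNormedModule) _ (/ 2 - d) (/ 2 - d / 2) 1)
      in E0 by auto.
    rewrite <- (RInt_Chasles (V := R_CompleteNormedModule) _ (/ 2 - d / 2) (/ 2 + d / 2) 1)
      in E0 by auto.
    rewrite <- (RInt_Chasles (V := R_CompleteNormedModule) _ (/ 2 + d / 2) (/ 2 + d) 1)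
      in E0 by auto.
    unfold plus in E0; simpl in E0.
    assert (Hout : forall x, 0 <= x <= 1 -> s x <= r -> - (B * r ^ m) <= G x * s x ^ m).
    { intros x Hx Hsr. specialize (HB x Hx).
      assert (Q : 0 <= s x ^ m <= r ^ m).
      { split; [apply pow_le, Hs0|]. apply pow_incr. split; [apply Hs0|exact Hsr]. }
      nra. }
    assert (Q1 := RInt_ge_const (fun x => G x * s x ^ m) 0 (/ 2 - d) (- (B * r ^ m))
      ltac:(lra) Hcm).
    assert (Q2 := RInt_ge_const (fun x => G x * s x ^ m) (/ 2 - d) (/ 2 - d / 2) 0
      ltac:(lra) Hcm).
    assert (Q3 := RInt_ge_const (fun x => G x * s x ^ m) (/ 2 - d / 2) (/ 2 + d / 2)
      (A / 2 * r' ^ m) ltac:(lra) Hcm).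
    assert (Q4 := RInt_ge_const (fun x => G x * s x ^ m) (/ 2 + d / 2) (/ 2 + d) 0
      ltac:(lra) Hcm).
    assert (Q5 := RInt_ge_const (fun x => G x * s x ^ m) (/ 2 + d) 1 (- (B * r ^ m))
      ltac:(lra) Hcm).
    assert (Hin : forall x, / 2 - d <= x <= / 2 + d -> 0 <= G x * s x ^ m).
    { intros x Hx. specialize (HGA x Hx). apply Rmult_le_pos; [lra|apply pow_le, Hs0]. }
    assert (P1 := Q1 ltac:(intros x Hx; apply Hout; [lra|apply Hmono; lra])).
    assert (P2 := Q2 ltac:(intros x Hx; apply Hin; lra)).
    assert (P4 := Q4 ltac:(intros x Hx; apply Hin; lra)).
    assert (P5 := Q5 ltac:(intros x Hx; apply Hout; [lra|rewrite <- Hsym; apply Hmono; lra])).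
    assert (P3 : A / 2 * r' ^ m * (/ 2 + d / 2 - (/ 2 - d / 2)) <=
       RInt (fun x => G x * s x ^ m) (/ 2 - d / 2) (/ 2 + d / 2)).
    { apply Q3. intros x Hx. specialize (HGA x ltac:(lra)).
      assert (Hsx : r' <= s x).
      { destruct (Rle_lt_dec x (/ 2)).
        - apply Hmono; lra.
        - rewrite <- (Hsym x). apply Hmono; lra. }
      assert (r' ^ m <= s x ^ m) by (apply pow_incr; lra).
      assert (0 <= r' ^ m) by (apply pow_le; lra).
      apply Rmult_le_compat; lra. }
    assert (0 <= B * r ^ m) by (apply Rmult_le_pos; [exact HB0|apply pow_le; lra]).
    nra. }
  (* As r' > r, the powers of r'/r are unbounded, which contradicts [Hlow]. *)
  destruct (Pow_x_infinity (r' / r)) with (b := 2 * B / (d * A) + 1) as [N HN].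
  { rewrite Rabs_pos_eq.
    - apply Rmult_lt_reg_r with r; [exact Hr0|].
      replace (r' / r * r) with r' by (field; lra). lra.
    - apply Rlt_le, Rdiv_lt_0_compat; lra. }
  specialize (HN N (le_n N)). specialize (Hlow N).
  rewrite Rabs_pos_eq in HN by (apply pow_le, Rlt_le, Rdiv_lt_0_compat; lra).
  replace ((r' / r) ^ N) with (r' ^ N * / r ^ N) in HN
    by (unfold Rdiv; now rewrite Rpow_mult_distr, pow_inv).
  assert (Hrn : 0 < r ^ N) by now apply pow_lt.
  assert (HdA : 0 < d * A) by now apply Rmult_lt_0_compat.
  assert (E2 : (2 * B / (d * A) + 1) * (d * A) * r ^ N <= r' ^ N * (d * A)).
  { replace (r' ^ N * (d * A)) with (r' ^ N * / r ^ N * (d * A) * r ^ N) by (field; lra).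
    apply Rmult_le_compat_r; [lra|]. apply Rmult_le_compat_r; lra. }
  replace ((2 * B / (d * A) + 1) * (d * A)) with (2 * B + d * A) in E2 by (field; lra).
  nra.
Qed.

(* The hypothesis quantifies over translates so that periodicity need not be used. *)
Lemma fourier_unique (F : C -> C) : entire F ->
  (forall (w : C) (n : Z),
     CRInt (fun x => F (RtoC x + w)%C * epi (- (2 * zc n * RtoC x)))%C 0 1 = 0) ->
  forall z, F z = 0.
Proof.
  intros HF H z.
  pose proof (fourier_zero_mid (fun x => F (RtoC x + (z - RtoC (/ 2)))%C)) as Hm.
  cbv beta in Hm.
  replace (RtoC (/ 2) + (z - RtoC (/ 2)))%C with z in Hm by ring.
  apply Hm.
  - apply (entire_Ccont (fun x => F (x + (z - RtoC (/ 2)))%C)).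
    apply (entire_comp F); auto with entire_db.
  - intros n. apply H.
Qed.

(** * Improper integrals *)

(** The two ends are independent, in accordance with the product filter behind [RInt_gen]. *)
Definition is_CInt (f : R -> C) (l : C) : Prop :=
  forall eps, 0 < eps -> exists K, 0 <= K /\ forall a b, a <= - K -> K <= b ->
    Cmod (CRInt f a b - l) < eps.

Lemma is_CInt_unique (f : R -> C) (l l' : C) : is_CInt f l -> is_CInt f l' -> l = l'.
Proof.
  intros H H'. apply Ceq_minus, Cmod_small_0. intros eps Heps.
  destruct (H (eps / 2)) as [K [_ HK]]; [lra|].
  destruct (H' (eps / 2)) as [K' [_ HK']]; [lra|].
  pose proof (Rmax_l K K'). pose proof (Rmax_r K K').
  specialize (HK (- Rmax K K') (Rmax K K') ltac:(lra) ltac:(lra)).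
  specialize (HK' (- Rmax K K') (Rmax K K') ltac:(lra) ltac:(lra)).
  set (z := CRInt f (- Rmax K K') (Rmax K K')) in *.
  replace (l - l')%C with ((z - l') - (z - l))%C by ring.
  eapply Rle_trans; [apply Cmod_triangle|]. rewrite Cmod_opp. lra.
Qed.

Lemma is_CInt_plus (f g : R -> C) (l l' : C) : Ccont f -> Ccont g ->
  is_CInt f l -> is_CInt g l' -> is_CInt (fun x => f x + g x)%C (l + l').
Proof.
  intros Cf Cg H H' eps Heps.
  destruct (H (eps / 2)) as [K [HK0 HK]]; [lra|].
  destruct (H' (eps / 2)) as [K' [HK0' HK']]; [lra|].
  pose proof (Rmax_l K K'). pose proof (Rmax_r K K').
  exists (Rmax K K'). split; [lra|]. intros a b Ha Hb.
  specialize (HK a b ltac:(lra) ltac:(lra)). specialize (HK' a b ltac:(lra) ltac:(lra)).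
  rewrite CRInt_plus by auto.
  replace (CRInt f a b + CRInt g a b - (l + l'))%C with
    ((CRInt f a b - l) + (CRInt g a b - l'))%C by ring.
  eapply Rle_lt_trans; [apply Cmod_triangle|]. lra.
Qed.

Lemma is_CInt_scal (c : C) (f : R -> C) (l : C) : Ccont f ->
  is_CInt f l -> is_CInt (fun x => c * f x)%C (c * l).
Proof.
  intros Cf H eps Heps.
  assert (Hc : 0 < Cmod c + 1) by (pose proof (Cmod_ge_0 c); lra).
  destruct (H (eps / (Cmod c + 1))) as [K [HK0 HK]].
  { apply Rdiv_lt_0_compat; lra. }
  exists K. split; [exact HK0|]. intros a b Ha Hb. specialize (HK a b Ha Hb).
  rewrite CRInt_scal by auto.
  replace (c * CRInt f a b - c * l)%C with (c * (CRInt f a b - l))%C by ring.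
  rewrite Cmod_mult. pose proof (Cmod_ge_0 c).
  apply Rle_lt_trans with (Cmod c * (eps / (Cmod c + 1))).
  - apply Rmult_le_compat_l; lra.
  - replace eps with ((Cmod c + 1) * (eps / (Cmod c + 1))) at 2 by (field; lra).
    apply Rmult_lt_compat_r; [apply Rdiv_lt_0_compat; lra|lra].
Qed.

Lemma RInt_exp_bound (g : R -> R) (B a b : R) : a <= b -> (forall x, continuous g x) ->
  (forall x, Rabs (g x) <= B * exp (- Rabs x)) ->
  (0 <= a -> Rabs (RInt g a b) <= B * exp (- a)) /\
  (b <= 0 -> Rabs (RInt g a b) <= B * exp b).
Proof.
  intros Hab Hc HB.
  assert (HB0 : 0 <= B).
  { specialize (HB 0). rewrite Rabs_R0, Ropp_0, exp_0 in HB. pose proof (Rabs_pos (g 0)). lra. }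
  assert (Hg : is_RInt g a b (RInt g a b)).
  { apply (RInt_correct (V := R_CompleteNormedModule)).
    apply (ex_RInt_continuous (V := R_CompleteNormedModule)). auto. }
  split; intros H.
  - assert (HI : is_RInt (fun x => B * exp (- x)) a b
      (minus (- (B * exp (- b))) (- (B * exp (- a))))).
    { apply (is_RInt_derive (V := R_CompleteNormedModule) (fun x => - (B * exp (- x)))).
      - intros x _. auto_derive; auto. ring.
      - intros x _. apply (ex_derive_continuous (fun x => B * exp (- x))). auto_derive; auto. }
    eapply Rle_trans; [exact (norm_RInt_le (V := R_NormedModule) g _ a b _ _ Hab
      (fun x Hx => ltac:(eapply Rle_trans; [apply (HB x)|];
        rewrite Rabs_pos_eq by lra; apply Rle_refl)) Hg HI)|].
    unfold minus, plus, opp; simpl. pose proof (exp_pos (- b)). nra.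
  - assert (HI : is_RInt (fun x => B * exp x) a b
      (minus (B * exp b) (B * exp a))).
    { apply (is_RInt_derive (V := R_CompleteNormedModule) (fun x => (B * exp x))).
      - intros x _. auto_derive; auto. ring.
      - intros x _. apply (ex_derive_continuous (fun x => B * exp x)). auto_derive; auto. }
    eapply Rle_trans; [exact (norm_RInt_le (V := R_NormedModule) g _ a b _ _ Hab
      (fun x Hx => ltac:(eapply Rle_trans; [apply (HB x)|];
        rewrite Rabs_left1, Ropp_involutive by lra; apply Rle_refl)) Hg HI)|].
    unfold minus, plus, opp; simpl. pose proof (exp_pos a). nra.
Qed.

Definition exp_dom (f : R -> C) (B : R) : Prop :=
  forall x, Cmod (f x) <= B * exp (- Rabs x).

Lemma CRInt_exp_bound (f : R -> C) (B a b : R) : a <= b -> Ccont f -> exp_dom f B ->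
  (0 <= a -> Cmod (CRInt f a b) <= 2 * B * exp (- a)) /\
  (b <= 0 -> Cmod (CRInt f a b) <= 2 * B * exp b).
Proof.
  intros Hab Hf HB.
  destruct (RInt_exp_bound (fun x => Re (f x)) B a b Hab (Ccont_Re f Hf)) as [H1 H2].
  { intros x. eapply Rle_trans; [apply re_le_Cmod|apply HB]. }
  destruct (RInt_exp_bound (fun x => Im (f x)) B a b Hab (Ccont_Im f Hf)) as [H3 H4].
  { intros x. eapply Rle_trans; [apply im_le_Cmod|apply HB]. }
  split; intros H; (eapply Rle_trans; [apply Cmod_le_abs|]);
    unfold CRInt, Re at 1, Im at 1; simpl.
  - specialize (H1 H). specialize (H3 H). lra.
  - specialize (H2 H). specialize (H4 H). lra.
Qed.

Lemma exp_small (eps : R) : 0 < eps -> exists K, 0 <= K /\ exp (- K) < eps.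
Proof.
  intros H. exists (Rabs (ln eps) + 1). pose proof (Rabs_pos (ln eps)). split; [lra|].
  rewrite <- (exp_ln eps H) at 2. apply exp_increasing.
  pose proof (Rle_abs (- ln eps)) as Q. rewrite Rabs_Ropp in Q. lra.
Qed.

(** [RInt_gen] is total, so convergence has to be produced: exponential tails make the integrals
    over [-n, n] a Cauchy sequence, and its limit is carried over to the filter for each
    coordinate. *)
Lemma is_CInt_exists (f : R -> C) (B : R) : Ccont f -> exp_dom f B ->
  is_CInt f (Cintegral_R f).
Proof.
  intros Hf HB.
  assert (HB0 : 0 <= B).
  { specialize (HB 0). rewrite Rabs_R0, Ropp_0, exp_0 in HB.
    pose proof (Cmod_ge_0 (f 0)). lra. }
  assert (Hd : forall K a b, 0 <= K -> a <= - K -> K <= b ->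
    Cmod (CRInt f a b - CRInt f (- K) K) <= 4 * B * exp (- K)).
  { intros K a b HK Ha Hb.
    rewrite <- (CRInt_Chasles f a (- K) b Hf), <- (CRInt_Chasles f (- K) K b Hf).
    replace (CRInt f a (- K) + (CRInt f (- K) K + CRInt f K b) - CRInt f (- K) K)%C
      with (CRInt f a (- K) + CRInt f K b)%C by ring.
    eapply Rle_trans; [apply Cmod_triangle|].
    pose proof (proj2 (CRInt_exp_bound f B a (- K) ltac:(lra) Hf HB) ltac:(lra)).
    pose proof (proj1 (CRInt_exp_bound f B K b ltac:(lra) Hf HB) ltac:(lra)). lra. }
  assert (Hs : forall eps, 0 < eps -> exists K, 0 <= K /\ 4 * B * exp (- K) < eps).
  { intros eps Heps. destruct (exp_small (eps / (4 * B + 1))) as [K [HK1 HK2]].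
    { apply Rdiv_lt_0_compat; lra. }
    exists K. split; [exact HK1|]. pose proof (exp_pos (- K)).
    apply Rle_lt_trans with ((4 * B + 1) * exp (- K)); [nra|].
    replace eps with ((4 * B + 1) * (eps / (4 * B + 1))) by (field; lra).
    apply Rmult_lt_compat_l; lra. }
  destruct (C_complete (fun n => CRInt f (- INR n) (INR n))) as [l Hl].
  { intros eps Heps. destruct (Hs eps Heps) as [K [HK1 HK2]].
    destruct (nfloor_ex K HK1) as [m [_ Hm]]. exists (S m). intros n Hn.
    rewrite <- S_INR in Hm. apply le_INR in Hn.
    eapply Rle_lt_trans; [apply Hd; lra|].
    eapply Rle_lt_trans; [|exact HK2]. apply Rmult_le_compat_l; [lra|].
    apply exp_le_mono. lra. }
  assert (HI : is_CInt f l).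
  { intros eps Heps. destruct (Hs (eps / 4)) as [K [HK1 HK2]]; [lra|].
    exists K. split; [exact HK1|]. intros a b Ha Hb.
    destruct (Hl (eps / 4)) as [N HN]; [lra|].
    destruct (nfloor_ex K HK1) as [m [_ Hm]].
    set (n := Nat.max N (S m)). specialize (HN n ltac:(unfold n; lia)).
    assert (HnK : K <= INR n).
    { rewrite <- S_INR in Hm. assert (INR (S m) <= INR n) by (apply le_INR; unfold n; lia).
      lra. }
    pose proof (Hd K a b HK1 Ha Hb). pose proof (Hd K (- INR n) (INR n) HK1 ltac:(lra) HnK).
    replace (CRInt f a b - l)%C with ((CRInt f a b - CRInt f (- K) K) +
      (- (CRInt f (- INR n) (INR n) - CRInt f (- K) K) +
        (CRInt f (- INR n) (INR n) - l)))%C by ring.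
    eapply Rle_lt_trans; [apply Cmod_triangle|].
    eapply Rle_lt_trans; [apply Rplus_le_compat_l, Cmod_triangle|].
    rewrite Cmod_opp. lra. }
  assert (Hgen : forall p : C -> R, (forall x, continuous (fun x => p (f x)) x) ->
    (forall a b, RInt (fun x => p (f x)) a b = p (CRInt f a b)) ->
    (forall z w, Rabs (p z - p w) <= Cmod (z - w)) ->
    RInt_gen (fun x => p (f x)) (Rbar_locally m_infty) (Rbar_locally p_infty) = p l).
  { intros p Hpc Hpi Hpl. apply (is_RInt_gen_unique (V := R_CompleteNormedModule)).
    intros P [eps HP]. destruct (HI eps (cond_pos eps)) as [K [_ HK]].
    apply (Filter_prod _ _ _ (fun a => a < - K) (fun b => K < b)).
    - exists (- K). auto.
    - exists K. auto.
    - intros a b Ha Hb. exists (RInt (fun x => p (f x)) a b). split.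
      + apply (RInt_correct (V := R_CompleteNormedModule)).
        apply (ex_RInt_continuous (V := R_CompleteNormedModule)). auto.
      + apply HP. simpl. rewrite Hpi.
        eapply Rle_lt_trans; [apply Hpl|]. apply HK; lra. }
  assert (E : Cintegral_R f = l).
  { unfold Cintegral_R. rewrite (Hgen Re), (Hgen Im).
    - now destruct l.
    - now apply Ccont_Im.
    - reflexivity.
    - intros z w. eapply Rle_trans; [|apply im_le_Cmod]. right; f_equal.
    - now apply Ccont_Re.
    - reflexivity.
    - intros z w. eapply Rle_trans; [|apply re_le_Cmod]. right; f_equal. }
  now rewrite E.
Qed.

Lemma Cintegral_bound (f : R -> C) (B : R) : Ccont f -> exp_dom f B ->
  Cmod (Cintegral_R f) <= 4 * B.
Proof.
  intros Hf HB. apply Rle_plus_epsilon. intros eps Heps.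
  destruct (is_CInt_exists f B Hf HB eps Heps) as [K [HK0 HK]].
  specialize (HK (- K) K ltac:(lra) ltac:(lra)).
  rewrite <- (CRInt_Chasles f (- K) 0 K Hf) in HK.
  pose proof (proj2 (CRInt_exp_bound f B (- K) 0 ltac:(lra) Hf HB) ltac:(lra)) as E1.
  pose proof (proj1 (CRInt_exp_bound f B 0 K ltac:(lra) Hf HB) ltac:(lra)) as E2.
  rewrite Ropp_0 in E2. rewrite exp_0 in E1, E2.
  set (z1 := CRInt f (- K) 0) in *. set (z2 := CRInt f 0 K) in *.
  replace (Cintegral_R f) with (z1 + (z2 - (z1 + z2 - Cintegral_R f)))%C by ring.
  eapply Rle_trans; [apply Cmod_triangle|].
  eapply Rle_trans; [apply Rplus_le_compat_l, Cmod_triangle|]. rewrite Cmod_opp. lra.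
Qed.

Lemma Cintegral_lin (f g : R -> C) (c : C) (B B' : R) : Ccont f -> Ccont g ->
  exp_dom f B -> exp_dom g B' ->
  Cintegral_R (fun x => f x + c * g x)%C = (Cintegral_R f + c * Cintegral_R g)%C.
Proof.
  intros Cf Cg Df Dg.
  apply (is_CInt_unique (fun x => f x + c * g x)%C).
  - apply (is_CInt_exists _ (B + Cmod c * B')).
    + apply Ccont_plus, Ccont_mult; auto using Ccont_const.
    + intros x. eapply Rle_trans; [apply Cmod_triangle|]. rewrite Cmod_mult.
      specialize (Df x). specialize (Dg x).
      assert (Cmod c * Cmod (g x) <= Cmod c * (B' * exp (- Rabs x)))
        by (apply Rmult_le_compat_l; auto using Cmod_ge_0). lra.
  - apply is_CInt_plus; auto.
    + apply Ccont_mult; auto using Ccont_const.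
    + now apply (is_CInt_exists f B).
    + apply is_CInt_scal; auto. now apply (is_CInt_exists g B').
Qed.

Lemma Cintegral_ext (f g : R -> C) : (forall x, f x = g x) -> Cintegral_R f = Cintegral_R g.
Proof.
  intros H. unfold Cintegral_R. f_equal.
  - f_equal. apply FunctionalExtensionality.functional_extensionality.
    intros x. now rewrite H.
  - f_equal. apply FunctionalExtensionality.functional_extensionality.
    intros x. now rewrite H.
Qed.

(** * The Gaussian integral *)

Lemma Ccont_gauss (tau w : C) : Ccont (fun x => epi (RtoC (x ^ 2) * tau + RtoC x * w)%C).
Proof.
  apply (Ccont_ext (fun x => epi (RtoC x * RtoC x * tau + RtoC x * w)%C)).
  - intros x. now rewrite <- RtoC_mult, <- Rsqr_pow2.
  - apply (entire_Ccont (fun z => epi (z * z * tau + z * w)%C)). auto 7 with entire_db.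
Qed.

Lemma exp_dom_gauss (tau w : C) : 0 < Im tau ->
  exp_dom (fun x => epi (RtoC (x ^ 2) * tau + RtoC x * w)%C) (gbound tau (Rabs (Im w))).
Proof. intros Ht x. apply Cmod_epi_quad; [exact Ht|apply Rle_refl]. Qed.

(** The integral of e^(-pi x^2), carried along as an unknown until [gauss_const_eq1]. The zero
    linear term gives it the shape of the other Gaussian integrals. *)
Definition gauss_const : C := Cintegral_R (fun x => epi (RtoC (x ^ 2) * Ci + RtoC x * 0)%C).

(** The factor k |x| + k is the speed at which the end points move in the homotopy. Completing the
    square with [beta + 1] leaves two factors e^(-|x|), and one of them absorbs it. *)
Lemma quad_contour_decay (m beta k : R) : 0 < m -> 0 <= beta -> 0 <= k ->
  exists D, 0 <= D /\ forall x,
    exp (PI * (- m * x ^ 2 + beta * Rabs x + beta)) * (k * Rabs x + k) <= D * exp (- Rabs x).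
Proof.
  intros Hm Hb Hk. pose proof PI_RGT_0 as HPI.
  set (D0 := exp ((PI * beta + 1 + 1) ^ 2 / (4 * (PI * m)) + PI * beta)).
  exists (D0 * k). pose proof (exp_pos ((PI * beta + 1 + 1) ^ 2 / (4 * (PI * m)) + PI * beta)).
  split; [apply Rmult_le_pos; [unfold D0; lra|exact Hk]|]. intros x.
  pose proof (gauss_le (PI * m) (PI * beta + 1) x ltac:(nra)) as G.
  pose proof (Rabs_pos x) as Px.
  assert (E1 : exp (PI * (- m * x ^ 2 + beta * Rabs x + beta)) <=
    D0 * exp (- Rabs x) * exp (- Rabs x)).
  { unfold D0. rewrite <- !exp_plus. apply exp_le_mono.
    replace (PI * (- m * x ^ 2 + beta * Rabs x + beta)) with
      (- (PI * m) * x ^ 2 + (PI * beta + 1) * Rabs x - Rabs x + PI * beta) by ring.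
    lra. }
  assert (E2 : Rabs x + 1 <= exp (Rabs x)).
  { pose proof (exp_ineq1_le (Rabs x)). lra. }
  assert (E3 : exp (- Rabs x) * exp (Rabs x) = 1).
  { rewrite <- exp_plus. replace (- Rabs x + Rabs x) with 0 by ring. apply exp_0. }
  pose proof (exp_pos (- Rabs x)) as P1.
  assert (E4 : exp (- Rabs x) * (k * Rabs x + k) <= k).
  { assert (exp (- Rabs x) * (Rabs x + 1) <= 1) by nra. nra. }
  apply Rle_trans with (D0 * exp (- Rabs x) * exp (- Rabs x) * (k * Rabs x + k)).
  - apply Rmult_le_compat_r; [|exact E1]. pose proof (Rmult_le_pos _ _ Hk Px). lra.
  - replace (D0 * exp (- Rabs x) * exp (- Rabs x) * (k * Rabs x + k)) with
      (D0 * exp (- Rabs x) * (exp (- Rabs x) * (k * Rabs x + k))) by ring.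
    replace (D0 * k * exp (- Rabs x)) with (D0 * exp (- Rabs x) * k) by ring.
    apply Rmult_le_compat_l; [|exact E4]. apply Rmult_le_pos; unfold D0; lra.
Qed.

(* Rotating the line of integration [x |-> x] to [x |-> c x + w / c] keeps
   [Re (z^2)] positive because both [1] and [c] lie in the sector [|arg| < pi/4]. *)
Lemma gauss_integral (tau c w : C) : 0 < Im tau -> 0 < Re c -> (c * c = - Ci * tau)%C ->
  Cintegral_R (fun x => epi (RtoC (x ^ 2) * tau + RtoC x * (2 * Ci * w))%C)
    = (gauss_const * epi (w * w / tau) / c)%C.
Proof.
  intros Ht Hc Hc2.
  assert (Hc0 : c <> RtoC 0) by (intros ->; simpl in Hc; lra).
  assert (Ht0 : tau <> RtoC 0) by (intros ->; simpl in Ht; lra).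
  set (F := fun z : C => epi (Ci * (z * z))%C).
  assert (HF : entire F) by (unfold F; auto 7 with entire_db).
  destruct c as [p q] eqn:Ec.
  (* The real part of c^2 = -i tau is p^2 - q^2 = Im tau > 0. *)
  assert (Hpq : Rabs q < p).
  { injection Hc2 as E1 E2. unfold Im in Ht. simpl in Hc.
    assert (q * q < p * p) by lra. apply Rabs_def1; nra. }
  rewrite <- Ec in *.
  (* Completing the square: i (c x + w/c)^2 = tau x^2 + 2 i w x - w^2/tau, since i c^2 = tau. *)
  set (b1 := (w / c)%C).
  (* Along the segment from 1 to c the difference Re - |Im| is at least [m0], so the real part of
     the squared slope is at least m0^2. *)
  set (m0 := Rmin 1 (p - Rabs q)).
  assert (Hm0 : 0 < m0) by (apply Rmin_pos; lra).
  assert (Hm01 : m0 <= 1) by apply Rmin_l.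
  assert (Hm02 : m0 <= p - Rabs q) by apply Rmin_r.
  set (k := Cmod (c - 1) + Cmod b1).
  (* [beta] dominates both the linear and the constant term of the squared path, uniformly in t. *)
  set (beta := 2 * (1 + Cmod (c - 1)) * Cmod b1 + Cmod b1 ^ 2).
  pose proof (Cmod_ge_0 (c - 1)) as Pc. pose proof (Cmod_ge_0 b1) as Pb.
  destruct (quad_contour_decay (m0 ^ 2) beta k) as [D [HD0 HD]].
  { apply pow_lt; exact Hm0. } { unfold beta. nra. } { unfold k. lra. }
  assert (Hbd : forall t x, 0 <= t <= 1 ->
    Cmod (F ((1 + RtoC t * (c - 1)) * RtoC x + (0 + RtoC t * b1))%C
       * ((c - 1) * RtoC x + b1))%C <= D * exp (- Rabs x)).
  { intros t x Ht'. eapply Rle_trans; [|apply HD]. rewrite Cmod_mult.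
    apply Rmult_le_compat; auto using Cmod_ge_0.
    - unfold F. rewrite Cmod_epi. apply exp_le_mono.
      set (ct := (1 + RtoC t * (c - 1))%C).
      replace (Im (Ci * ((ct * RtoC x + (0 + RtoC t * b1)) * (ct * RtoC x + (0 + RtoC t * b1)))))
        with (x ^ 2 * Re (ct * ct) + 2 * x * t * Re (ct * b1) + t ^ 2 * Re (b1 * b1)).
      2: { unfold Re, Im, Ci, Cmult, Cplus, RtoC; simpl. ring. }
      assert (H1 : m0 ^ 2 <= Re (ct * ct)).
      { unfold ct. rewrite Ec. unfold Re, Cmult, Cplus, Cminus, Copp, RtoC; simpl.
        set (s := 1 - t + t * p).
        match goal with |- _ <= ?e => replace e with ((s - t * Rabs q) * (s + t * Rabs q)) end.
        - pose proof (Rabs_pos q). assert (m0 <= s - t * Rabs q) by (unfold s; nra).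
          assert (0 <= t * Rabs q) by nra. nra.
        - assert (Hqq : Rabs q * Rabs q = q * q) by (rewrite <- Rabs_mult; apply Rabs_pos_eq; nra).
          replace ((s - t * Rabs q) * (s + t * Rabs q)) with (s * s - t * t * (Rabs q * Rabs q))
            by ring. rewrite Hqq. unfold s. ring. }
      assert (Hct : Cmod ct <= 1 + Cmod (c - 1)).
      { unfold ct. eapply Rle_trans; [apply Cmod_triangle|].
        rewrite Cmod_1, Cmod_mult, Cmod_R, Rabs_pos_eq by lra. nra. }
      assert (H2 : Rabs (Re (ct * b1)) <= (1 + Cmod (c - 1)) * Cmod b1).
      { eapply Rle_trans; [apply re_le_Cmod|]. rewrite Cmod_mult.
        apply Rmult_le_compat_r; auto. }
      assert (H3 : Rabs (Re (b1 * b1)) <= Cmod b1 ^ 2).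
      { eapply Rle_trans; [apply re_le_Cmod|]. rewrite Cmod_mult. right; ring. }
      pose proof (Rabs_pos x) as Px.
      assert (H4 : - (2 * x * t * Re (ct * b1)) <= 2 * Rabs x * ((1 + Cmod (c - 1)) * Cmod b1)).
      { eapply Rle_trans; [apply Rle_abs|].
        rewrite Rabs_Ropp, !Rabs_mult, (Rabs_pos_eq 2), (Rabs_pos_eq t) by lra.
        set (u := Rabs (Re (ct * b1))) in *.
        assert (0 <= u) by apply Rabs_pos.
        assert (t * u <= (1 + Cmod (c - 1)) * Cmod b1) by nra. nra. }
      assert (H5 : - (t ^ 2 * Re (b1 * b1)) <= Cmod b1 ^ 2).
      { eapply Rle_trans; [apply Rle_abs|].
        rewrite Rabs_Ropp, Rabs_mult, (Rabs_pos_eq (t ^ 2)) by apply pow2_ge_0.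
        assert (0 <= t ^ 2 <= 1) by (split; [apply pow2_ge_0|nra]).
        pose proof (Rabs_pos (Re (b1 * b1))). nra. }
      assert (H6 : m0 ^ 2 * x ^ 2 <= x ^ 2 * Re (ct * ct)).
      { rewrite Rmult_comm. apply Rmult_le_compat_l; [apply pow2_ge_0|exact H1]. }
      pose proof PI_RGT_0. unfold beta.
      match goal with |- - PI * ?X <= PI * ?Y => assert (- X <= Y); [|nra] end.
      assert (0 <= Cmod b1 ^ 2 * Rabs x) by (apply Rmult_le_pos; [apply pow2_ge_0|exact Px]).
      assert (0 <= 2 * (1 + Cmod (c - 1)) * Cmod b1) by nra. nra.
    - eapply Rle_trans; [apply Cmod_triangle|]. rewrite Cmod_mult, Cmod_R.
      unfold k. pose proof (Rabs_pos x). nra. }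
  set (If := Cintegral_R (fun x => epi (RtoC (x ^ 2) * tau + RtoC x * (2 * Ci * w))%C)).
  assert (HIf : is_CInt (fun x => epi (RtoC (x ^ 2) * tau + RtoC x * (2 * Ci * w))%C) If).
  { eapply is_CInt_exists; [apply Ccont_gauss|now apply exp_dom_gauss]. }
  assert (HI0 : is_CInt (fun x => epi (RtoC (x ^ 2) * Ci + RtoC x * 0)%C) gauss_const).
  { eapply is_CInt_exists; [apply Ccont_gauss|apply exp_dom_gauss].
    unfold Ci, Im; simpl; lra. }
  set (c1 := (epi (- (w * w / tau)) * c)%C).
  assert (E : (c1 * If)%C = gauss_const).
  { apply (is_CInt_unique (fun x => c1 *
      epi (RtoC (x ^ 2) * tau + RtoC x * (2 * Ci * w)))%C).
    - apply is_CInt_scal; [apply Ccont_gauss|exact HIf].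
    - intros eps Heps.
      destruct (HI0 (eps / 2)) as [K1 [HK1 HK1']]; [lra|].
      destruct (exp_small (eps / 4 / (D + 1))) as [K2 [HK2 HK2']].
      { apply Rdiv_lt_0_compat; lra. }
      assert (HDe : D * exp (- K2) < eps / 4).
      { pose proof (exp_pos (- K2)). apply Rle_lt_trans with ((D + 1) * exp (- K2)); [nra|].
        replace (eps / 4) with ((D + 1) * (eps / 4 / (D + 1))) by (field; lra).
        apply Rmult_lt_compat_l; lra. }
      pose proof (Rmax_l K1 K2). pose proof (Rmax_r K1 K2).
      exists (Rmax K1 K2). split; [lra|]. intros a b Ha Hb.
      specialize (HK1' a b ltac:(lra) ltac:(lra)).
      pose proof (contour_deformation F 1 (c - 1) 0 b1 a b (eps / 2) HF ltac:(lra)) as Hcd.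
      assert (Hcd' := Hcd ltac:(intros t Ht';
        replace (eps / 2) with (eps / 4 + eps / 4) by field;
        eapply Rle_trans; [apply Cmod_triangle|]; rewrite Cmod_opp;
        apply Rplus_le_compat;
        (eapply Rle_trans; [apply Hbd; exact Ht'|]);
        (eapply Rle_trans; [|left; exact HDe]);
        (apply Rmult_le_compat_l; [exact HD0|]); apply exp_le_mono;
        [rewrite Rabs_pos_eq by lra|rewrite Rabs_left1 by lra]; lra)).
      clear Hcd.
      rewrite (CRInt_ext _ (fun x => c1 *
        epi (RtoC (x ^ 2) * tau + RtoC x * (2 * Ci * w)))%C) in Hcd'.
      2: { intros x. unfold F, c1.
           replace (1 + (c - 1))%C with c by ring. rewrite Cplus_0_l.
           replace (Ci * ((c * RtoC x + b1) * (c * RtoC x + b1)))%C with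
             (Ci * (c * c) * (RtoC x * RtoC x) + 2 * Ci * (c * b1) * RtoC x
               + Ci * (b1 * b1))%C by ring.
           replace (c * b1)%C with w by (unfold b1; field; exact Hc0).
           replace (b1 * b1)%C with (w * w / (c * c))%C by (unfold b1; field; exact Hc0).
           rewrite Hc2. rewrite <- RtoC_mult, <- Rsqr_pow2.
           replace (Ci * (- Ci * tau))%C with (- (Ci * Ci) * tau)%C by ring. rewrite Ci2.
           replace (Ci * (w * w / (- Ci * tau)))%C with (- (w * w / tau))%C
             by (field; split; [exact Ht0|exact Ci_neq0]).
           unfold Rsqr. 
           replace (- - (1) * tau * RtoC (x * x) + 2 * Ci * w * RtoC x + - (w * w / tau))%C with
             (- (w * w / tau) + (RtoC (x * x) * tau + RtoC x * (2 * Ci * w)))%C by ring.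
           rewrite (epi_plus (- (w * w / tau))). ring. }
      rewrite (CRInt_ext (fun x => F (1 * RtoC x + 0)%C * 1)%C
        (fun x => epi (RtoC (x ^ 2) * Ci + RtoC x * 0)%C)) in Hcd'.
      2: { intros x. unfold F. rewrite Cmult_1_r. f_equal.
           rewrite <- Rsqr_pow2. unfold Rsqr. rewrite RtoC_mult. ring. }
      match goal with |- Cmod (?A - ?B) < _ => match type of Hcd' with Cmod (_ - ?Z) <= _ =>
        replace (A - B)%C with ((A - Z) + (Z - B))%C by ring end end.
      eapply Rle_lt_trans; [apply Cmod_triangle|].
      fold c1. lra. }
  rewrite <- E. unfold c1. rewrite epi_opp. field. split; [apply epi_neq0|exact Hc0].
Qed.

(** * Gaussian series and Poisson summation *)

(** One family for two purposes: weights 1 give the theta function [th3], and the bounded weights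
    (-1)^n phi (u + n tau) give the Appell-Lerch sum [Lser]. *)
Definition gser (B : Z -> C) (tau v : C) : C :=
  sumZ (fun n => B n * epi (zc n * zc n * tau + 2 * zc n * v))%C.

Lemma zc_sq (n : Z) : (zc n * zc n)%C = RtoC (IZR n ^ 2).
Proof. rewrite <- RtoC_mult. f_equal. ring. Qed.

Lemma gser_dom (B : Z -> C) (b : R) (tau v : C) (beta : R) :
  0 < Im tau -> (forall n, Cmod (B n) <= b) -> Rabs (Im v) <= beta ->
  forall n, Cmod (B n * epi (zc n * zc n * tau + 2 * zc n * v)) <=
    b * gbound tau (2 * beta) * exp (- Rabs (IZR n)).
Proof.
  intros Ht HB Hv n. rewrite Cmod_mult, zc_sq.
  replace (2 * zc n * v)%C with (zc n * (2 * v))%C by ring.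
  rewrite Rmult_assoc. apply Rmult_le_compat; auto using Cmod_ge_0.
  apply Cmod_epi_quad; [exact Ht|].
  rewrite Im_mult_R, Rabs_mult, (Rabs_pos_eq 2) by lra. lra.
Qed.

Lemma gbound_pos (tau : C) (beta : R) : 0 < gbound tau beta.
Proof. apply exp_pos. Qed.

Lemma gser_summable (B : Z -> C) (b : R) (tau v : C) :
  0 < Im tau -> (forall n, Cmod (B n) <= b) ->
  zsummable (fun n => B n * epi (zc n * zc n * tau + 2 * zc n * v))%C.
Proof.
  intros Ht HB.
  assert (Hb : 0 <= b) by (eapply Rle_trans; [apply Cmod_ge_0|apply (HB 0%Z)]).
  eapply dom_summable.
  - intros n. apply (gser_dom B b tau v _ Ht HB (Rle_refl _)).
  - apply major_scal; [|apply major_exp_abs].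
    pose proof (gbound_pos tau (2 * Rabs (Im v))). nra.
Qed.

Lemma one_plus_sqr_le_exp (x : R) : 0 <= x -> 1 + x ^ 2 <= 2 * exp (2 * x).
Proof.
  intros Hx. pose proof (exp_ineq1_le x) as H.
  replace (2 * x) with (x + x) by ring. rewrite exp_plus. nra.
Qed.

(** Serves the series at x = n and the Mordell integral at real x. The polynomial weight 1 + y^2 is
    absorbed by 2 e^(2y) with y = 2 pi |x|, which is why r is raised by 2. *)
Lemma gauss_growth (b r x : R) : 0 < b ->
  exp (- PI * (x ^ 2 * b)) * ((1 + (2 * PI * Rabs x) ^ 2) * exp (2 * PI * Rabs x * r)) <=
  2 * exp ((2 * PI * (Rabs r + 2) + 1) ^ 2 / (4 * (PI * b))) * exp (- Rabs x).
Proof.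
  intros Hb. pose proof PI_RGT_0 as HPI. pose proof (Rabs_pos x) as Hy.
  pose proof (one_plus_sqr_le_exp (2 * PI * Rabs x) ltac:(nra)) as H1.
  pose proof (gauss_le (PI * b) (2 * PI * (Rabs r + 2)) x ltac:(nra)) as H2.
  pose proof (Rle_abs r) as Hr. set (y := Rabs x) in *.
  apply Rle_trans with (exp (- PI * (x ^ 2 * b)) *
    (2 * exp (2 * (2 * PI * y)) * exp (2 * PI * y * r))).
  - apply Rmult_le_compat_l; [left; apply exp_pos|].
    apply Rmult_le_compat_r; [left; apply exp_pos|exact H1].
  - replace (exp (- PI * (x ^ 2 * b)) *
      (2 * exp (2 * (2 * PI * y)) * exp (2 * PI * y * r))) with
      (2 * (exp (- PI * (x ^ 2 * b)) *
      (exp (2 * (2 * PI * y)) * exp (2 * PI * y * r)))) by ring.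
    rewrite (Rmult_assoc 2 (exp _) (exp (- y))).
    apply Rmult_le_compat_l; [lra|]. rewrite <- !exp_plus. apply exp_le_mono.
    assert (y * r <= y * Rabs r) by (apply Rmult_le_compat_l; lra). nra.
Qed.

Lemma gser_entire (B : Z -> C) (b : R) (tau : C) :
  0 < Im tau -> (forall n, Cmod (B n) <= b) -> entire (gser B tau).
Proof.
  intros Ht HB.
  assert (Hb : 0 <= b) by (eapply Rle_trans; [apply Cmod_ge_0|apply (HB 0%Z)]).
  pose proof PI_RGT_0 as HPI.
  apply (entire_ext (fun v => sumZ (fun n =>
    (B n * epi (zc n * zc n * tau)) * cexp ((2 * PI * Ci * zc n) * v))%C)).
  { intros v. apply sumZ_ext. intros n. rewrite epi_plus. unfold epi.
    rewrite <- Cmult_assoc. do 3 f_equal. ring. }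
  apply entire_series. intros r.
  set (E := (2 * PI * (Rabs r + 2) + 1) ^ 2 / (4 * (PI * Im tau))).
  exists (b * (2 * exp E)). split; [pose proof (exp_pos E); nra|].
  intros n.
  assert (Ha : Cmod (2 * PI * Ci * zc n) = 2 * PI * Rabs (IZR n)).
  { rewrite !Cmod_mult, Cmod_Ci, !Cmod_R, (Rabs_pos_eq 2), (Rabs_pos_eq PI) by lra. ring. }
  rewrite Ha.
  rewrite Cmod_mult, Cmod_epi, zc_sq, Im_mult_R.
  rewrite (Rmult_assoc (Cmod (B n))), (Rmult_assoc b).
  apply Rmult_le_compat; auto using Cmod_ge_0.
  { apply Rmult_le_pos; [left; apply exp_pos|].
    apply Rmult_le_pos; [pose proof (pow2_ge_0 (2 * PI * Rabs (IZR n))); lra|left; apply exp_pos]. }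
  now apply gauss_growth.
Qed.

Lemma Csum_from_CRInt (f : Z -> R -> C) (a : Z) (n : nat) (x y : R) :
  (forall m, Ccont (f m)) ->
  Ccont (fun t => Csum_from (fun m => f m t) a n) /\
  CRInt (fun t => Csum_from (fun m => f m t) a n) x y =
    Csum_from (fun m => CRInt (f m) x y) a n.
Proof.
  intros Hf. revert a; induction n as [|n IH]; intros a; cbn [Csum_from].
  - split; [apply Ccont_const|].
    rewrite (CRInt_ext _ (fun t => 0 * 0)%C) by (intros; ring).
    rewrite CRInt_scal by apply Ccont_const. ring.
  - destruct (IH (a + 1)%Z) as [H1 H2]. split; [now apply Ccont_plus|].
    rewrite CRInt_plus, H2; auto.
Qed.

Lemma sumZ_CRInt (f : Z -> R -> C) (g : Z -> R) :
  major g -> (forall m, Ccont (f m)) ->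
  (forall m x, 0 <= x <= 1 -> Cmod (f m x) <= g m) ->
  Ccont (fun x => sumZ (fun m => f m x)) ->
  is_zsum (fun m => CRInt (f m) 0 1) (CRInt (fun x => sumZ (fun m => f m x)) 0 1).
Proof.
  intros Hg Hf Hb Hc eps Heps.
  destruct (zsum_uniform g Hg (eps / 4)) as [K HK]; [lra|].
  exists K. intros A B HA HB.
  destruct (Csum_from_CRInt f (- Z.of_nat A) (A + B) 0 1 Hf) as [H1 H2].
  unfold Zsum at 1. rewrite <- H2, <- CRInt_minus by auto.
  eapply Rle_lt_trans; [apply CRInt_bound with (M := eps / 4)|lra].
  - apply (Ccont_ext (fun x => Csum_from (fun m => f m x) (- Z.of_nat A) (A + B)
      + (- (1)) * sumZ (fun m => f m x))%C); [intros; ring|].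
    apply Ccont_plus; auto. apply Ccont_mult; auto using Ccont_const.
  - lra.
  - intros x Hx. apply (HK (fun m => f m x)); auto. intros m. now apply Hb.
Qed.

Lemma Ccont_epi_lin (w : C) : Ccont (fun x => epi (w * RtoC x)%C).
Proof. apply (entire_Ccont (fun z => epi (w * z)%C)). auto with entire_db. Qed.

Lemma Ccont_translate (F : C -> C) (w : C) : entire F -> Ccont (fun x => F (RtoC x + w)%C).
Proof.
  intros HF. apply (entire_Ccont (fun z => F (z + w)%C)).
  apply (entire_comp F); auto with entire_db.
Qed.

Lemma CRInt_epi (k : Z) : CRInt (fun x => epi (2 * zc k * RtoC x)%C) 0 1 =
  if Z.eq_dec k 0 then RtoC 1 else RtoC 0.
Proof.
  destruct (Z.eq_dec k 0) as [->|Hk].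
  - rewrite (CRInt_ext _ (fun x => RtoC 1)).
    + unfold CRInt, Re, Im, RtoC; simpl. rewrite !RInt_const.
      unfold scal; simpl. unfold mult; simpl. f_equal; ring.
    + intros x. replace (2 * 0 * RtoC x)%C with (RtoC 0) by ring. apply epi_0.
  - set (a := (PI * Ci * (2 * zc k))%C).
    assert (Ha : a <> RtoC 0).
    { unfold a. repeat apply Cneq_mult; try apply Ci_neq0; apply RtoC_neq;
        [apply PI_neq0|lra|now apply not_0_IZR]. }
    pose (H := cderiv_mult (fun _ => (/ a)%C) _ _ _ (cderiv_const (/ a)%C)
      (cderiv_comp _ _ _ _ cderiv_cexp
        (cderiv_mult (fun _ => a) _ (fun z => z) _ (cderiv_const a) cderiv_id))).
    pose proof (cderiv_CRInt _ _ 0 1 H) as E. cbv beta in E.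
    rewrite (CRInt_ext _ (fun x => (0 * cexp (a * RtoC x) +
      / a * ((0 * RtoC x + a * 1) * cexp (a * RtoC x)))%C)).
    + rewrite E. replace (a * 1)%C with (PI * Ci * (2 * zc k))%C by (unfold a; ring).
      fold (epi (2 * zc k)). rewrite epi_even.
      replace (a * 0)%C with (RtoC 0) by ring. rewrite cexp_0. ring.
    + intros x. unfold epi.
      replace (PI * Ci * (2 * zc k * RtoC x))%C with (a * RtoC x)%C by (unfold a; ring).
      field. exact Ha.
Qed.

Lemma is_zsum_single (f : Z -> C) (n : Z) : (forall m, m <> n -> f m = 0) -> is_zsum f (f n).
Proof.
  intros Hf eps Heps. exists (Z.to_nat (Z.abs n) + 1)%nat. intros A B HA HB.
  replace (Zsum f A B) with (f n).
  { replace (f n - f n)%C with (RtoC 0) by ring. now rewrite Cmod_0. }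
  assert (G : forall p a, Csum_from f a p =
    if Z_le_dec a n then (if Z_lt_dec n (a + Z.of_nat p) then f n else RtoC 0) else RtoC 0).
  { induction p as [|p IH]; intros a; cbn [Csum_from].
    - destruct (Z_le_dec a n); auto. destruct (Z_lt_dec n (a + Z.of_nat 0)); auto; lia.
    - rewrite IH. destruct (Z.eq_dec a n) as [->|Ha]; [|rewrite (Hf a Ha)];
        repeat destruct (Z_le_dec _ _); repeat destruct (Z_lt_dec _ _); try lia; ring. }
  unfold Zsum. rewrite G. destruct (Z_le_dec (- Z.of_nat A) n); [|lia].
  destruct (Z_lt_dec n (- Z.of_nat A + Z.of_nat (A + B))); [reflexivity|lia].
Qed.

Lemma fourier_coeff (c : Z -> C) (n : Z) : zsummable c ->
  Ccont (fun x => sumZ (fun m => c m * epi (2 * zc m * RtoC x))%C) ->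
  CRInt (fun x => sumZ (fun m => c m * epi (2 * zc m * RtoC x))%C *
    epi (- (2 * zc n * RtoC x)))%C 0 1 = c n.
Proof.
  intros Hc Hcont.
  assert (Hb : forall m x, Cmod (c m * epi (2 * zc m * RtoC x)) <= Cmod (c m)).
  { intros m x. rewrite Cmod_mult, Cmod_epi.
    replace (2 * zc m * RtoC x)%C with (RtoC (2 * IZR m * x)) by (rewrite !RtoC_mult; reflexivity).
    simpl. rewrite Rmult_0_r, exp_0. lra. }
  assert (Hs : forall x, zsummable (fun m => c m * epi (2 * zc m * RtoC x))%C).
  { intros x. eapply dom_summable; [intros m; apply Hb|exact Hc]. }
  assert (He : Ccont (fun x => epi (- (2 * zc n * RtoC x)))%C).
  { apply (Ccont_ext (fun x => epi ((- (2 * zc n)) * RtoC x)%C)).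
    - intros; f_equal; ring.
    - apply Ccont_epi_lin. }
  set (f := fun m x => (epi (- (2 * zc n * RtoC x)) * (c m * epi (2 * zc m * RtoC x)))%C).
  assert (E : forall x, (sumZ (fun m => c m * epi (2 * zc m * RtoC x)) *
    epi (- (2 * zc n * RtoC x)))%C = sumZ (fun m => f m x)).
  { intros x. unfold f. rewrite sumZ_scal by auto. ring. }
  rewrite (CRInt_ext _ _ 0 1 E).
  assert (Hz : is_zsum (fun m => CRInt (f m) 0 1) (CRInt (fun x => sumZ (fun m => f m x)) 0 1)).
  { apply (sumZ_CRInt f (fun m => Cmod (c m))); [exact Hc| | |].
    - intros m. unfold f. apply Ccont_mult; [exact He|].
      apply Ccont_mult; [apply Ccont_const|apply Ccont_epi_lin].
    - intros m x _. unfold f. rewrite Cmod_mult, Cmod_epi.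
      replace (- (2 * zc n * RtoC x))%C with (RtoC (- (2 * IZR n * x)))
        by (rewrite RtoC_opp, !RtoC_mult; reflexivity).
      simpl. rewrite Rmult_0_r, exp_0, Rmult_1_l. apply Hb.
    - apply (Ccont_ext _ _ E). now apply Ccont_mult. }
  eapply is_zsum_unique; [exact Hz|].
  assert (Ef : forall m, CRInt (f m) 0 1 = if Z.eq_dec m n then c n else RtoC 0).
  { intros m. unfold f.
    rewrite (CRInt_ext _ (fun x => c m * epi (2 * zc (m - n) * RtoC x))%C).
    - rewrite CRInt_scal by apply Ccont_epi_lin. rewrite CRInt_epi.
      destruct (Z.eq_dec m n) as [->|H].
      + destruct (Z.eq_dec (n - n) 0); [ring|lia].
      + destruct (Z.eq_dec (m - n) 0); [lia|ring].
    - intros x. rewrite zc_minus.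
      replace (2 * (zc m - zc n) * RtoC x)%C with
        (- (2 * zc n * RtoC x) + 2 * zc m * RtoC x)%C by ring.
      rewrite epi_plus. ring. }
  replace (c n) with (CRInt (f n) 0 1) by (rewrite Ef; destruct (Z.eq_dec n n); easy).
  apply (is_zsum_single (fun m => CRInt (f m) 0 1) n). intros m Hm. rewrite Ef. now destruct (Z.eq_dec m n).
Qed.

(** The unfolding step of Poisson summation: the line is cut into unit segments. *)
Lemma is_zsum_CRInt (F : R -> C) (l : C) : Ccont F -> is_CInt F l ->
  is_zsum (fun m => CRInt F (IZR m) (IZR m + 1)) l.
Proof.
  intros HF Hl eps Heps. destruct (Hl eps Heps) as [K [HK0 HK]].
  destruct (nfloor_ex K HK0) as [m [_ Hm]]. rewrite <- S_INR in Hm.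
  exists (S m). intros A B HA HB. apply le_INR in HA, HB.
  assert (E : forall p a, Csum_from (fun m => CRInt F (IZR m) (IZR m + 1)) a p =
    CRInt F (IZR a) (IZR a + INR p)).
  { induction p as [|p IH]; intros a; cbn [Csum_from].
    - simpl. rewrite Rplus_0_r. unfold CRInt. rewrite !RInt_point. reflexivity.
    - rewrite IH, plus_IZR, S_INR.
      replace (IZR a + (INR p + 1)) with (IZR a + 1 + INR p) by ring.
      now apply CRInt_Chasles. }
  unfold Zsum. rewrite E, opp_IZR, <- INR_IZR_INZ, plus_INR.
  replace (- INR A + (INR A + INR B)) with (INR B) by ring. apply HK; lra.
Qed.

(** Both sides are entire in v, and their n-th Fourier coefficients on the line through w are
    compared. On the right a single term survives; on the left the unit integrals of the translates
    unfold to one Gaussian integral over the whole line. *)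
Lemma poisson_aux (tau c : C) : 0 < Im tau -> 0 < Re c -> (c * c = - Ci * tau)%C ->
  forall v, (epi (- (v * v / tau)) * gser (fun _ => 1) (- / tau) (- (v / tau)) =
    gauss_const * c * gser (fun _ => 1) tau v)%C.
Proof.
  intros Ht Hc Hc2 v.
  assert (Ht0 : tau <> RtoC 0) by (intros ->; simpl in Ht; lra).
  assert (Hc0 : c <> RtoC 0) by (intros ->; simpl in Hc; lra).
  set (sg := (- / tau)%C).
  assert (Hnorm : 0 < fst tau ^ 2 + snd tau ^ 2).
  { unfold Im in Ht. pose proof (pow2_ge_0 (fst tau)). nra. }
  assert (Hsg : 0 < Im sg).
  { unfold sg, Im, Copp, Cinv; simpl.
    replace (- (- snd tau / (fst tau * (fst tau * 1) + snd tau * (snd tau * 1)))) with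
      (snd tau / (fst tau ^ 2 + snd tau ^ 2)) by (field; lra).
    apply Rdiv_lt_0_compat; [exact Ht|exact Hnorm]. }
  assert (Hone : forall n : Z, Cmod ((fun _ : Z => RtoC 1) n) <= 1) by (intros; rewrite Cmod_1; lra).
  set (P := fun v => (epi (- (v * v / tau)) * gser (fun _ => 1) sg (- (v / tau)))%C).
  set (Q := fun v => gser (fun _ => 1) tau v).
  assert (HP : entire P).
  { unfold P. apply entire_mult; [auto 7 with entire_db|].
    apply (entire_comp (gser (fun _ => 1) sg)); [now apply (gser_entire _ 1)|].
    auto with entire_db. }
  assert (HQ : entire Q) by now apply (gser_entire _ 1).
  apply Ceq_minus.
  apply (fourier_unique (fun v => P v - gauss_const * c * Q v)%C); [auto with entire_db|].
  clear v. intros w n.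
  set (en := fun x : R => epi (- (2 * zc n * RtoC x))%C).
  assert (Hen : Ccont en).
  { apply (Ccont_ext (fun x => epi ((- (2 * zc n)) * RtoC x)%C)).
    - intros; unfold en; f_equal; ring.
    - apply Ccont_epi_lin. }
  rewrite (CRInt_ext _ (fun x => P (RtoC x + w)%C * en x -
    gauss_const * c * (Q (RtoC x + w)%C * en x))%C) by (intros; unfold en; ring).
  pose proof (Ccont_mult _ _ (Ccont_translate P w HP) Hen) as CP.
  pose proof (Ccont_mult _ _ (Ccont_translate Q w HQ) Hen) as CQ.
  rewrite CRInt_minus, CRInt_scal; auto.
  2: { apply Ccont_mult; auto using Ccont_const. }
  assert (EQ : CRInt (fun x => Q (RtoC x + w)%C * en x)%C 0 1 =
    epi (zc n * zc n * tau + 2 * zc n * w)%C).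
  { set (cf := fun m => epi (zc m * zc m * tau + 2 * zc m * w)%C).
    assert (E : forall x, Q (RtoC x + w)%C = sumZ (fun m => cf m * epi (2 * zc m * RtoC x))%C).
    { intros x. apply sumZ_ext. intros m. unfold cf.
      replace (zc m * zc m * tau + 2 * zc m * (RtoC x + w))%C with
        (zc m * zc m * tau + 2 * zc m * w + 2 * zc m * RtoC x)%C by ring.
      rewrite (epi_plus (_ + _)). ring. }
    rewrite (CRInt_ext _ (fun x => sumZ (fun m => cf m * epi (2 * zc m * RtoC x)) * en x)%C)
      by (intros; now rewrite E).
    apply (fourier_coeff cf n).
    - eapply zsummable_ext; [|apply (gser_summable (fun _ => 1) 1 tau w Ht Hone)].
      intros m. unfold cf. ring.
    - apply (Ccont_ext _ _ E). now apply Ccont_translate. }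
  (* The m-th term of the left side times e^(-2 pi i n x) equals, up to a constant, F (x + m): the
     defect is e^(2 pi i m n) = 1. *)
  set (F := fun x : R => epi (RtoC (x ^ 2) * sg + RtoC x * (2 * Ci * (- Ci * (sg * w - zc n))))%C).
  assert (EP : forall x, (P (RtoC x + w)%C * en x)%C =
    sumZ (fun m => epi (sg * (w * w)) * F (x + IZR m)%R)%C).
  { intros x. unfold P, gser. rewrite Cmult_comm, Cmult_assoc, <- sumZ_scal.
    - apply sumZ_ext. intros m. unfold en, F.
      rewrite Cmult_1_l, <- !epi_plus. apply epi_congr with (- - (m * n))%Z.
      unfold sg. rewrite !zc_opp, zc_mult, <- Rsqr_pow2. unfold Rsqr.
      rewrite RtoC_mult, RtoC_plus.
      replace (2 * Ci * (- Ci * (- / tau * w - zc n)))%C with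
        (2 * - (Ci * Ci) * (- / tau * w - zc n))%C by ring.
      rewrite Ci2. field. exact Ht0.
    - apply (gser_summable (fun _ => 1) 1 sg _ Hsg Hone). }
  assert (HF : Ccont F) by apply Ccont_gauss.
  assert (HFd : exp_dom F (gbound sg (Rabs (Im (2 * Ci * (- Ci * (sg * w - zc n)))))))
    by now apply exp_dom_gauss.
  (* 1/c is the admissible root for the modulus -1/tau. *)
  assert (Hci : ((/ c) * (/ c) = - Ci * sg)%C).
  { replace (/ c * / c)%C with (/ (c * c))%C by (field; exact Hc0). rewrite Hc2. unfold sg.
    transitivity (- (Ci * Ci) / (- Ci * tau))%C.
    - rewrite Ci2. field. split; [exact Ht0|exact Ci_neq0].
    - field. split; [exact Ht0|exact Ci_neq0]. }
  assert (Hrc : 0 < Re (/ c)).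
  { destruct c as [p q]. unfold Re, Cinv in *; simpl in *.
    apply Rdiv_lt_0_compat; [exact Hc|]. nra. }
  assert (EF : Cintegral_R F = (gauss_const * c * epi (- sg * (w * w)
     + (zc n * zc n * tau + 2 * zc n * w)))%C).
  { unfold F. rewrite (gauss_integral sg (/ c) _ Hsg Hrc Hci).
    replace (- Ci * (sg * w - zc n) * (- Ci * (sg * w - zc n)) / sg)%C with
      ((Ci * Ci) * ((sg * w - zc n) * (sg * w - zc n) / sg))%C.
    - rewrite Ci2. unfold sg.
      replace (- (1) * ((- / tau * w - zc n) * (- / tau * w - zc n) / - / tau))%C with
        (- - / tau * (w * w) + (zc n * zc n * tau + 2 * zc n * w))%C
        by (field; exact Ht0).
      field. exact Hc0.
    - unfold sg. field. exact Ht0. }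
  assert (EI : CRInt (fun x => P (RtoC x + w)%C * en x)%C 0 1 =
    (gauss_const * c * epi (zc n * zc n * tau + 2 * zc n * w))%C).
  { rewrite (CRInt_ext _ _ 0 1 EP).
    assert (HCF : forall m, Ccont (fun x => F (x + IZR m)%R)).
    { intros m x eps Heps. destruct (HF (x + IZR m) eps Heps) as [d [Hd Hy]].
      exists d. split; [exact Hd|]. intros y Hxy. apply Hy.
      replace (y + IZR m - (x + IZR m)) with (y - x) by ring. exact Hxy. }
    pose proof (sumZ_CRInt (fun m x => epi (sg * (w * w)) * F (x + IZR m)%R)%C
      (fun m => Cmod (epi (sg * (w * w))) *
        ((gbound sg (Rabs (Im (2 * Ci * (- Ci * (sg * w - zc n))))) * exp 1) *
         exp (- Rabs (IZR m))))) as Hz.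
    eapply is_zsum_unique; [apply Hz; clear Hz|].
    - apply major_scal; [apply Cmod_ge_0|]. apply major_scal; [|apply major_exp_abs].
      apply Rmult_le_pos; left; apply exp_pos.
    - intros m. apply Ccont_mult; auto using Ccont_const.
    - intros m x Hx. rewrite Cmod_mult. apply Rmult_le_compat_l; [apply Cmod_ge_0|].
      eapply Rle_trans; [apply HFd|]. rewrite Rmult_assoc.
      apply Rmult_le_compat_l; [left; apply exp_pos|].
      rewrite <- exp_plus. apply exp_le_mono.
      pose proof (Rabs_triang_inv (IZR m) (- x)) as T. rewrite Rabs_Ropp in T.
      replace (IZR m - - x) with (x + IZR m) in T by ring.
      rewrite (Rabs_pos_eq x) in T by lra. lra.
    - apply (Ccont_ext _ _ EP). exact CP.
    - replace (gauss_const * c * epi (zc n * zc n * tau + 2 * zc n * w))%C with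
        (epi (sg * (w * w)) * Cintegral_R F)%C.
      + assert (Hzs : is_zsum (fun m => epi (sg * (w * w)) * CRInt F (IZR m) (IZR m + 1))%C
          (epi (sg * (w * w)) * Cintegral_R F)).
        { apply is_zsum_scal. apply is_zsum_CRInt; [exact HF|]. now apply (is_CInt_exists _ _ HF HFd). }
        intros eps Heps. destruct (Hzs eps Heps) as [K HK]. exists K. intros A B HA HB.
        specialize (HK A B HA HB).
        unfold Zsum in *. rewrite (Csum_from_ext _ (fun m => epi (sg * (w * w)) *
          CRInt F (IZR m) (IZR m + 1))%C); [exact HK|].
        intros m _. rewrite CRInt_scal by auto. f_equal.
        rewrite (CRInt_shift F (IZR m) 0 1 HF). f_equal; ring.
      + rewrite EF. rewrite (epi_plus (- sg * (w * w))).
        replace (- sg * (w * w))%C with (- (sg * (w * w)))%C by ring.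
        rewrite epi_opp. field. apply epi_neq0. }
  rewrite EI, EQ. ring.
Qed.

(* At [tau = i], [v = 0] both sides of Poisson's formula contain the same positive series. *)
Lemma gauss_const_eq1 : gauss_const = 1.
Proof.
  assert (Hi : 0 < Im Ci) by (simpl; lra).
  assert (H := poisson_aux Ci 1 Hi ltac:(simpl; lra)
    ltac:(rewrite Cmult_1_l; replace (- Ci * Ci)%C with (- (Ci * Ci))%C by ring;
          rewrite Ci2; ring) 0).
  replace (- (0 * 0 / Ci))%C with (RtoC 0) in H by (field; apply Ci_neq0).
  replace (- (0 / Ci))%C with (RtoC 0) in H by (field; apply Ci_neq0).
  replace (- / Ci)%C with Ci in H.
  2: { transitivity (Ci * Ci / Ci)%C; [field; apply Ci_neq0|].
       rewrite Ci2. field; apply Ci_neq0. }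
  rewrite epi_0, Cmult_1_l, Cmult_1_r in H.
  set (S := gser (fun _ => RtoC 1) Ci 0) in *.
  (* At tau = i all terms are positive and the term n = 0 equals 1, so every window around 0 has
     real part at least 1. *)
  assert (HS : S <> RtoC 0).
  { assert (Hs : zsummable (fun n => 1 * epi (zc n * zc n * Ci + 2 * zc n * 0))%C).
    { apply (gser_summable (fun _ => RtoC 1) 1 Ci 0 Hi). intros; rewrite Cmod_1; lra. }
    assert (Hpos : forall a n, 0 <= Re (Csum_from (fun n => 1 * epi (zc n * zc n * Ci
      + 2 * zc n * 0))%C a n) /\ ((a <= 0 < a + Z.of_nat n)%Z ->
      1 <= Re (Csum_from (fun n => 1 * epi (zc n * zc n * Ci + 2 * zc n * 0))%C a n))).
    { intros a n; revert a; induction n as [|n IH]; intros a; cbn [Csum_from].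
      - split; [simpl; lra|intros; lia].
      - destruct (IH (a + 1)%Z) as [I1 I2]. rewrite Re_plus.
        assert (E : Re (1 * epi (zc a * zc a * Ci + 2 * zc a * 0)) = exp (- PI * (IZR a * IZR a))).
        { rewrite Cmult_1_l. unfold epi, cexp.
          replace (PI * Ci * (zc a * zc a * Ci + 2 * zc a * 0))%C with
            (RtoC (- PI * (IZR a * IZR a))).
          - unfold Re, Im, RtoC; simpl. rewrite cos_0. ring.
          - rewrite !RtoC_mult, RtoC_opp. transitivity (PI * (Ci * Ci) * (zc a * zc a))%C.
            + rewrite Ci2. ring. + ring. }
        rewrite E. pose proof (exp_pos (- PI * (IZR a * IZR a))) as Pe. split; [lra|].
        intros Ha. destruct (Z.eq_dec a 0) as [->|Hne].
        + rewrite Rmult_0_r, Rmult_0_r, exp_0. lra.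
        + specialize (I2 ltac:(lia)). lra. }
    intros E0. pose proof (sumZ_correct _ Hs (1 / 2) ltac:(lra)) as [K HK].
    change (sumZ (fun n => 1 * epi (zc n * zc n * Ci + 2 * zc n * 0))%C) with S in HK.
    specialize (HK (K + 1)%nat (K + 1)%nat ltac:(lia) ltac:(lia)).
    rewrite E0 in HK. unfold Zsum in HK.
    match type of HK with Cmod (?z - RtoC 0)%C < _ => replace (z - RtoC 0)%C with z in HK by ring;
      pose proof (re_le_Cmod z) as HR end.
    pose proof (proj2 (Hpos (- Z.of_nat (K + 1))%Z (K + 1 + (K + 1))%nat) ltac:(lia)) as HP.
    pose proof (Rle_trans _ _ _ (Rle_abs _) HR). lra. }
  apply Cmult_neq_inv_l with S; [exact HS|]. rewrite Cmult_comm, <- H. ring.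
Qed.

Lemma poisson (tau c : C) : 0 < Im tau -> 0 < Re c -> (c * c = - Ci * tau)%C ->
  forall v, (epi (- (v * v / tau)) * gser (fun _ => 1) (- / tau) (- (v / tau)) =
    c * gser (fun _ => 1) tau v)%C.
Proof.
  intros Ht Hc Hc2 v. rewrite (poisson_aux tau c Ht Hc Hc2), gauss_const_eq1. ring.
Qed.

(** * The Mordell integral *)

(** The exponent -2 pi x w of the Mordell integral is pi i x (2 i w); in this form the integrand is
    1/cosh times the Gaussian of [gauss_integral]. *)
Definition hker (tau w : C) (x : R) : C :=
  (RtoC (/ cosh (PI * x)) * epi (RtoC (x ^ 2) * tau + RtoC x * (2 * Ci * w)))%C.

Lemma cosh_ge1 (x : R) : 1 <= cosh x.
Proof.
  unfold cosh. pose proof (exp_ineq1_le x). pose proof (exp_ineq1_le (- x)). lra.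
Qed.

Lemma RtoC_half : RtoC (/ 2) = (/ 2)%C.
Proof. apply RtoC_inv. lra. Qed.

Lemma mordell_hker (w tau : C) : mordell_h w tau = Cintegral_R (hker tau w).
Proof.
  apply Cintegral_ext. intros x. unfold hker, epi.
  replace (PI * Ci * (RtoC (x ^ 2) * tau + RtoC x * (2 * Ci * w)))%C with
    (PI * Ci * RtoC (x ^ 2) * tau + 2 * PI * RtoC x * w * (Ci * Ci))%C by ring.
  rewrite Ci2. unfold Cdiv. rewrite <- RtoC_inv, Cmult_comm.
  - do 2 f_equal. ring.
  - pose proof (cosh_ge1 (PI * x)). lra.
Qed.

Lemma Ccont_inv_cosh : Ccont (fun x => RtoC (/ cosh (PI * x))).
Proof.
  apply Ccont_RtoC. intros x. apply (ex_derive_continuous (fun x => / cosh (PI * x))).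
  unfold cosh. auto_derive.
  pose proof (exp_pos (PI * x)). pose proof (exp_pos (- (PI * x))). lra.
Qed.

Lemma Ccont_hker (tau w : C) : Ccont (hker tau w).
Proof. apply Ccont_mult; [apply Ccont_inv_cosh|apply Ccont_gauss]. Qed.

Lemma Cmod_inv_cosh (x : R) : Cmod (RtoC (/ cosh (PI * x))) <= 1.
Proof.
  pose proof (cosh_ge1 (PI * x)). rewrite Cmod_R, Rabs_pos_eq.
  - rewrite <- Rinv_1. apply Rinv_le_contravar; lra.
  - left. apply Rinv_0_lt_compat. lra.
Qed.

Lemma exp_dom_hker (tau w : C) (beta : R) : 0 < Im tau -> Rabs (Re w) <= beta ->
  exp_dom (hker tau w) (gbound tau (2 * beta)).
Proof.
  intros Ht Hw x. unfold hker. rewrite Cmod_mult.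
  rewrite <- (Rmult_1_l (gbound tau (2 * beta) * exp (- Rabs x))).
  apply Rmult_le_compat; auto using Cmod_ge_0, Cmod_inv_cosh.
  apply Cmod_epi_quad; [exact Ht|].
  replace (Im (2 * Ci * w)) with (2 * Re w)
    by (unfold Im, Re, Ci, Cmult, RtoC; simpl; ring).
  rewrite Rabs_mult, (Rabs_pos_eq 2) by lra. lra.
Qed.

Lemma mordell_h_bound (tau w : C) (beta : R) : 0 < Im tau -> Rabs (Re w) <= beta ->
  Cmod (mordell_h w tau) <= 4 * gbound tau (2 * beta).
Proof.
  intros Ht Hw. rewrite mordell_hker.
  apply Cintegral_bound; [apply Ccont_hker|now apply exp_dom_hker].
Qed.

Lemma mordell_h_entire (tau : C) : 0 < Im tau -> entire (fun w => mordell_h w tau).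
Proof.
  intros Ht. pose proof PI_RGT_0 as HPI.
  exists (fun w => Cintegral_R (fun x => RtoC (- (2 * PI * x)) * hker tau w x)%C).
  set (B := fun r : R => 2 * exp ((2 * PI * (Rabs r + 2) + 1) ^ 2 / (4 * (PI * Im tau)))).
  assert (HE : forall w x, hker tau w x = (RtoC (/ cosh (PI * x)) *
    epi (RtoC (x ^ 2) * tau) * cexp (RtoC (- (2 * PI * x)) * w))%C).
  { intros w x. unfold hker. rewrite epi_plus, Cmult_assoc. f_equal. unfold epi. f_equal.
    replace (PI * Ci * (RtoC x * (2 * Ci * w)))%C with
      (2 * PI * RtoC x * w * (Ci * Ci))%C by ring.
    rewrite Ci2, RtoC_opp, !RtoC_mult. ring. }
  assert (Hgrow : forall x r, exp (- PI * (x ^ 2 * Im tau)) *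
    ((1 + (2 * PI * Rabs x) ^ 2) * exp (2 * PI * Rabs x * r)) <= B r * exp (- Rabs x)).
  { intros x r. now apply gauss_growth. }
  assert (Ha : forall x, Cmod (RtoC (- (2 * PI * x))) = 2 * PI * Rabs x).
  { intros x. rewrite Cmod_R, Rabs_Ropp, !Rabs_mult, (Rabs_pos_eq 2), (Rabs_pos_eq PI); lra. }
  assert (Hc' : forall w, Ccont (fun x => RtoC (- (2 * PI * x)) * hker tau w x)%C).
  { intros w. apply Ccont_mult; [|apply Ccont_hker]. apply Ccont_RtoC. intros x.
    apply (ex_derive_continuous (fun x => - (2 * PI * x))). auto_derive; auto. }
  assert (Hd' : forall w, exp_dom (fun x => RtoC (- (2 * PI * x)) * hker tau w x)%C (B (Cmod w))).
  { intros w x. rewrite HE, !Cmod_mult, Ha.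
    pose proof (Cmod_inv_cosh x) as H1. pose proof (Cmod_ge_0 (RtoC (/ cosh (PI * x)))) as H0.
    rewrite Cmod_epi, Im_mult_R, Cmod_cexp.
    assert (H2 : exp (Re (RtoC (- (2 * PI * x)) * w)) <= exp (2 * PI * Rabs x * Cmod w)).
    { apply exp_le_mono. eapply Rle_trans; [apply Rle_abs|].
      eapply Rle_trans; [apply re_le_Cmod|]. rewrite Cmod_mult, Ha. lra. }
    eapply Rle_trans; [|apply (Hgrow x (Cmod w))].
    set (k := Cmod (RtoC (/ cosh (PI * x)))) in *.
    set (e1 := exp (- PI * (x ^ 2 * Im tau))).
    assert (He1 : 0 < e1) by apply exp_pos.
    set (y := 2 * PI * Rabs x) in *.
    assert (Hy : 0 <= y) by (unfold y; pose proof (Rabs_pos x); nra).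
    set (e2 := exp (Re (RtoC (- (2 * PI * x)) * w))) in *.
    assert (He2 : 0 < e2) by apply exp_pos.
    assert (k * e1 <= e1) by nra.
    assert (0 <= k * e1) by nra.
    assert (y * e2 <= (1 + y ^ 2) * exp (y * Cmod w)).
    { apply Rmult_le_compat; try lra. nra. }
    assert (0 <= y * e2) by nra.
    replace (y * (k * e1 * e2)) with ((k * e1) * (y * e2)) by ring.
    apply Rmult_le_compat; assumption. }
  intros r. exists (24 * B (2 * r)).
  assert (HB0 : 0 < B (2 * r)).
  { unfold B. match goal with |- 0 < 2 * exp ?e => pose proof (exp_pos e) end. lra. }
  split; [lra|]. intros z h Hz Hh. rewrite !mordell_hker.
  assert (Hdz : exp_dom (hker tau z) (gbound tau (2 * Rabs (Re z))))
    by (apply exp_dom_hker; auto; apply Rle_refl).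
  assert (Hdzh : exp_dom (hker tau (z + h)) (gbound tau (2 * Rabs (Re (z + h)))))
    by (apply exp_dom_hker; auto; apply Rle_refl).
  replace (Cintegral_R (hker tau (z + h)) - Cintegral_R (hker tau z) -
    h * Cintegral_R (fun x => RtoC (- (2 * PI * x)) * hker tau z x))%C with
    (Cintegral_R (fun x => (hker tau (z + h) x + (- (1)) * hker tau z x) +
       (- h) * (RtoC (- (2 * PI * x)) * hker tau z x))%C).
  2: { rewrite (Cintegral_lin (fun x => hker tau (z + h) x + (- (1)) * hker tau z x)%C _ (- h)
        (gbound tau (2 * Rabs (Re (z + h))) + gbound tau (2 * Rabs (Re z))) (B (Cmod z))); auto.
       - rewrite (Cintegral_lin _ _ (- (1)) _ _ (Ccont_hker _ _) (Ccont_hker _ _) Hdzh Hdz).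
         ring.
       - apply Ccont_plus, Ccont_mult; auto using Ccont_const, Ccont_hker.
       - intros x. eapply Rle_trans; [apply Cmod_triangle|].
         rewrite Cmod_mult, Cmod_opp, Cmod_1. specialize (Hdz x). specialize (Hdzh x). lra. }
  eapply Rle_trans; [apply Cintegral_bound with (B := 6 * Cmod h ^ 2 * B (2 * r))|right; ring].
  - apply Ccont_plus; [apply Ccont_plus; [apply Ccont_hker|]|];
      (apply Ccont_mult; [apply Ccont_const|auto using Ccont_hker]).
  - intros x. rewrite !HE.
    set (a := RtoC (- (2 * PI * x))).
    set (k := (RtoC (/ cosh (PI * x)) * epi (RtoC (x ^ 2) * tau))%C).
    replace (k * cexp (a * (z + h)) + - (1) * (k * cexp (a * z)) +
      - h * (a * (k * cexp (a * z))))%C with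
      (k * (cexp (a * (z + h)) - cexp (a * z) - h * (a * cexp (a * z))))%C by ring.
    rewrite Cmod_mult. pose proof (cexp_taylor_at a z h) as T.
    unfold k. rewrite Cmod_mult, Cmod_epi, Im_mult_R.
    unfold a in T. rewrite Ha in T.
    specialize (Hgrow x (2 * r)).
    set (e1 := exp (- PI * (x ^ 2 * Im tau))) in *.
    assert (He1 : 0 < e1) by apply exp_pos.
    pose proof (Cmod_inv_cosh x) as H1. pose proof (Cmod_ge_0 (RtoC (/ cosh (PI * x)))) as H0.
    set (kk := Cmod (RtoC (/ cosh (PI * x)))) in *.
    set (y := 2 * PI * Rabs x) in *.
    assert (Hy : 0 <= y) by (unfold y; pose proof (Rabs_pos x); nra).
    assert (He : exp (y * (Cmod z + Cmod h)) <= exp (y * (2 * r)))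
      by (apply exp_le_mono, Rmult_le_compat_l; lra).
    pose proof (pow2_ge_0 (Cmod h)) as Ph. pose proof (pow2_ge_0 y) as Py.
    pose proof (exp_pos (y * (Cmod z + Cmod h))) as Pe.
    assert (T' : y ^ 2 * exp (y * (Cmod z + Cmod h)) <= (1 + y ^ 2) * exp (y * (2 * r)))
      by (apply Rmult_le_compat; lra).
    assert (Hk1 : kk * e1 <= e1) by nra. assert (Hk0 : 0 <= kk * e1) by nra.
    eapply Rle_trans.
    { apply Rmult_le_compat; [exact Hk0|apply Cmod_ge_0|exact Hk1|exact T]. }
    replace (e1 * (6 * Cmod h ^ 2 * (y ^ 2 * exp (y * (Cmod z + Cmod h))))) with
      (6 * Cmod h ^ 2 * (e1 * (y ^ 2 * exp (y * (Cmod z + Cmod h))))) by ring.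
    rewrite (Rmult_assoc (6 * Cmod h ^ 2)). apply Rmult_le_compat_l; [lra|].
    eapply Rle_trans; [|exact Hgrow]. apply Rmult_le_compat_l; lra.
Qed.

(** In h(w) + h(w + 1) the factor 1 + e^(-2 pi x) = 2 e^(-pi x) cosh(pi x) cancels the denominator,
    and a pure Gaussian centred at w + 1/2 is left. *)
Lemma mordell_h_add1 (tau c w : C) : 0 < Im tau -> 0 < Re c -> (c * c = - Ci * tau)%C ->
  mordell_h (w + 1) tau =
    (2 / c * epi ((w + RtoC (/ 2)) * (w + RtoC (/ 2)) / tau) - mordell_h w tau)%C.
Proof.
  intros Ht Hc Hc2. rewrite !mordell_hker.
  assert (E : (Cintegral_R (hker tau w) + 1 * Cintegral_R (hker tau (w + 1)))%C =
    (2 * Cintegral_R (fun x => epi (RtoC (x ^ 2) * tau +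
       RtoC x * (2 * Ci * (w + RtoC (/ 2))))))%C).
  { rewrite <- (Cintegral_lin _ _ 1 _ _ (Ccont_hker tau w) (Ccont_hker tau (w + 1))
      (exp_dom_hker tau w _ Ht (Rle_refl _)) (exp_dom_hker tau (w + 1) _ Ht (Rle_refl _))).
    replace (2 * Cintegral_R (fun x => epi (RtoC (x ^ 2) * tau +
       RtoC x * (2 * Ci * (w + RtoC (/ 2))))))%C with
      (0 + 2 * Cintegral_R (fun x => epi (RtoC (x ^ 2) * tau +
       RtoC x * (2 * Ci * (w + RtoC (/ 2))))))%C by ring.
    assert (Hz : Cintegral_R (fun _ => RtoC 0) = 0).
    { apply (is_CInt_unique (fun _ => RtoC 0)).
      - apply (is_CInt_exists _ 0); [apply Ccont_const|].
        intros x. rewrite Cmod_0. lra.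
      - intros eps Heps. exists 0. split; [lra|]. intros a b _ _.
        rewrite (CRInt_ext _ (fun _ => 0 * 0)%C) by (intros; ring).
        rewrite CRInt_scal by apply Ccont_const.
        replace (0 * CRInt (fun _ => 0) a b - 0)%C with (RtoC 0) by ring.
        rewrite Cmod_0. exact Heps. }
    rewrite <- Hz.
    rewrite <- (Cintegral_lin (fun _ => RtoC 0) _ 2 0 _ (Ccont_const 0)
      (Ccont_gauss tau (2 * Ci * (w + RtoC (/ 2)))) ltac:(intros x; rewrite Cmod_0; lra)
      (exp_dom_gauss tau _ Ht)).
    apply Cintegral_ext. intros x. unfold hker.
    assert (Hch : RtoC (cosh (PI * x)) = ((epi (RtoC x * Ci) + epi (- (RtoC x * Ci))) / 2)%C).
    { unfold epi, cexp.
      replace (PI * Ci * (RtoC x * Ci))%C with (RtoC (- (PI * x))).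
      2: { rewrite RtoC_opp, RtoC_mult. transitivity (PI * RtoC x * (Ci * Ci))%C; [rewrite Ci2|]; ring. }
      replace (PI * Ci * - (RtoC x * Ci))%C with (RtoC (PI * x)).
      2: { rewrite RtoC_mult. transitivity (- (PI * RtoC x * (Ci * Ci)))%C; [rewrite Ci2|]; ring. }
      unfold cosh, Re, Im, Cdiv, Cinv, Cmult, Cplus, RtoC; simpl.
      rewrite cos_0, sin_0. f_equal; field. }
    assert (Hch0 : RtoC (cosh (PI * x)) <> RtoC 0).
    { apply RtoC_neq. pose proof (cosh_ge1 (PI * x)). lra. }
    rewrite (RtoC_inv (cosh _)) by (pose proof (cosh_ge1 (PI * x)); lra).
    replace (RtoC x * (2 * Ci * (w + 1)))%C with
      (RtoC x * (2 * Ci * (w + RtoC (/ 2))) + RtoC x * Ci)%C.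
    2: { rewrite RtoC_half. field. }
    replace (RtoC x * (2 * Ci * w))%C with
      (RtoC x * (2 * Ci * (w + RtoC (/ 2))) + - (RtoC x * Ci))%C.
    2: { rewrite RtoC_half. field. }
    rewrite !Cplus_assoc, !(epi_plus (_ + _) _).
    set (e := epi (RtoC (x ^ 2) * tau + RtoC x * (2 * Ci * (w + RtoC (/ 2))))).
    set (ch := RtoC (cosh (PI * x))) in *.
    set (e1 := epi (RtoC x * Ci)) in *. set (e2 := epi (- (RtoC x * Ci))) in *.
    transitivity (e * (e1 + e2) / ch)%C; [field; exact Hch0|].
    replace (e1 + e2)%C with (2 * ch)%C by (rewrite Hch; field). field. exact Hch0. }
  rewrite (gauss_integral tau c _ Ht Hc Hc2), gauss_const_eq1 in E.
  assert (Hc0 : c <> RtoC 0) by (intros ->; simpl in Hc; lra).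
  set (X := Cintegral_R (hker tau w)) in *.
  replace (Cintegral_R (hker tau (w + 1))) with
    ((X + 1 * Cintegral_R (hker tau (w + 1))) - X)%C by ring.
  rewrite E. f_equal. field. exact Hc0.
Qed.

(** F(z) e^(-2 pi i n z) is again 1-periodic, so [periodic_contour] moves its segment of integration
    by w. *)
Lemma fourier_translate (F : C -> C) (w : C) (n : Z) : entire F ->
  (forall z, F (z + 1)%C = F z) ->
  CRInt (fun x => F (RtoC x + w)%C * epi (- (2 * zc n * RtoC x)))%C 0 1 =
  (epi (2 * zc n * w) * CRInt (fun x => F (RtoC x) * epi (- (2 * zc n * RtoC x)))%C 0 1)%C.
Proof.
  intros HF Hper.
  set (G := fun z => (F z * epi (- (2 * zc n * z)))%C).
  assert (HG : entire G) by (unfold G; auto 6 with entire_db).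
  change (CRInt (fun x => F (RtoC x) * epi (- (2 * zc n * RtoC x)))%C 0 1) with
    (CRInt (fun x => G (RtoC x)) 0 1).
  rewrite <- (periodic_contour G w HG).
  - rewrite <- CRInt_scal by now apply Ccont_translate.
    apply CRInt_ext. intros x. unfold G.
    replace (- (2 * zc n * (RtoC x + w)))%C with (- (2 * zc n * RtoC x) - 2 * zc n * w)%C by ring.
    rewrite epi_minus. field. apply epi_neq0.
  - intros z. unfold G. rewrite Hper. f_equal. apply epi_congr with (- n)%Z.
    rewrite zc_opp. ring.
Qed.

(* By periodicity and the growth [O(e^{pi |Im w|})] only the constant Fourier coefficient of
   this function survives; the value of the constant is found in [mordell_constant]. *)
Lemma mordell_h_addtau_const (tau c : C) : 0 < Im tau -> 0 < Re c -> (c * c = - Ci * tau)%C ->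
  exists k, forall w,
    (epi w * mordell_h w tau + epi (- w - tau) * mordell_h (w + tau) tau)%C = k.
Proof.
  intros Ht Hc Hc2.
  assert (Ht0 : tau <> RtoC 0) by (intros ->; simpl in Ht; lra).
  assert (Hc0 : c <> RtoC 0) by (intros ->; simpl in Hc; lra).
  set (rho := fun w => (epi w * mordell_h w tau + epi (- w - tau) * mordell_h (w + tau) tau)%C).
  assert (Hrho : entire rho).
  { pose proof (mordell_h_entire tau Ht) as Hh.
    apply entire_plus; apply entire_mult; auto with entire_db.
    apply (entire_comp (fun w => mordell_h w tau)); auto with entire_db. }
  (* Each of the two terms produces a Gaussian under w -> w + 1; their quotient is -e^(pi i (2 z +
     tau)), so with the prefactors of [rho] they cancel. *)
  assert (Hper : forall z, rho (z + 1)%C = rho z).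
  { intros z. unfold rho.
    replace (z + 1 + tau)%C with (z + tau + 1)%C by ring.
    rewrite !(mordell_h_add1 tau c _ Ht Hc Hc2).
    replace ((z + tau + RtoC (/ 2)) * (z + tau + RtoC (/ 2)) / tau)%C with
      ((z + RtoC (/ 2)) * (z + RtoC (/ 2)) / tau + (2 * z + tau + 1))%C
      by (rewrite RtoC_half; field; exact Ht0).
    replace (- (z + 1) - tau)%C with (- (z + tau) + - (1))%C by ring.
    replace (- z - tau)%C with (- (z + tau))%C by ring.
    replace (2 * z + tau + 1)%C with (z + (z + tau) + 1)%C by ring.
    rewrite !(epi_plus _ (- (1))), !(epi_plus _ 1), (epi_plus _ (z + (z + tau) + 1)),
      !(epi_plus _ 1), (epi_plus z (z + tau)), !epi_opp, epi_1.
    field. repeat split; try apply epi_neq0; try exact Hc0. }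
  set (D := 4 * gbound tau (2 * (1 + Rabs (Re tau)))).
  assert (HD : 0 < D) by (unfold D; pose proof (gbound_pos tau (2 * (1 + Rabs (Re tau)))); lra).
  set (E := exp (PI * Im tau)).
  assert (HE : 0 < E) by apply exp_pos.
  assert (Hgr : forall x y, 0 <= x <= 1 -> Cmod (rho (RtoC x + RtoC y * Ci)%C) <=
     D * (1 + E) * exp (PI * Rabs y)).
  { intros x y Hx. unfold rho. eapply Rle_trans; [apply Cmod_triangle|].
    rewrite !Cmod_mult, !Cmod_epi.
    assert (H1 : Cmod (mordell_h (RtoC x + RtoC y * Ci) tau) <= D).
    { apply mordell_h_bound; [exact Ht|]. unfold Re, Cmult, Cplus, RtoC, Ci; simpl.
      replace (x + (y * 0 - 0 * 1)) with x by ring. rewrite Rabs_pos_eq by lra.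
      pose proof (Rabs_pos (fst tau)). lra. }
    assert (H2 : Cmod (mordell_h (RtoC x + RtoC y * Ci + tau) tau) <= D).
    { apply mordell_h_bound; [exact Ht|]. unfold Re, Cmult, Cplus, RtoC, Ci; simpl.
      replace (x + (y * 0 - 0 * 1) + fst tau) with (x + fst tau) by ring.
      eapply Rle_trans; [apply Rabs_triang|]. rewrite (Rabs_pos_eq x) by lra. lra. }
    replace (Im (RtoC x + RtoC y * Ci)) with y
      by (unfold Im, Cmult, Cplus, RtoC, Ci; simpl; ring).
    replace (Im (- (RtoC x + RtoC y * Ci) - tau)) with (- y - Im tau)
      by (unfold Im, Cmult, Cplus, Cminus, Copp, RtoC, Ci; simpl; ring).
    pose proof PI_RGT_0 as HPI.
    assert (E1 : exp (- PI * y) <= exp (PI * Rabs y)).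
    { apply exp_le_mono. pose proof (Rle_abs (- y)) as Q. rewrite Rabs_Ropp in Q. nra. }
    assert (E2 : exp (- PI * (- y - Im tau)) <= E * exp (PI * Rabs y)).
    { unfold E. rewrite <- exp_plus. apply exp_le_mono. pose proof (Rle_abs y). nra. }
    apply Rle_trans with (exp (PI * Rabs y) * D + E * exp (PI * Rabs y) * D); [|right; ring].
    apply Rplus_le_compat; apply Rmult_le_compat; auto using Cmod_ge_0; left; apply exp_pos. }
  set (a := fun n : Z => CRInt (fun x => rho (RtoC x) * epi (- (2 * zc n * RtoC x)))%C 0 1).
  assert (Ha : forall n, n <> 0%Z -> a n = 0).
  { intros n Hn. apply Cmod_small_0. intros eps Heps.
    destruct (exp_small (eps / (2 * (D * (1 + E))))) as [K [HK1 HK2]].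
    { apply Rdiv_lt_0_compat; nra. }
    (* The segment is moved to the height where e^(2 pi n y) decays at rate at least 2 pi, against
       growth at rate pi. *)
    set (y := if Z_lt_dec 0 n then - K else K).
    assert (Hy : Rabs y = K).
    { unfold y. destruct (Z_lt_dec 0 n); [rewrite Rabs_Ropp|]; apply Rabs_pos_eq; lra. }
    assert (Hny : 2 * PI * IZR n * y <= - (2 * PI * K)).
    { pose proof PI_RGT_0. unfold y. destruct (Z_lt_dec 0 n).
      - assert (1 <= IZR n) by (apply IZR_le; lia).
        assert (K <= IZR n * K) by nra. nra.
      - assert (IZR n <= -1) by (apply IZR_le; lia).
        assert (IZR n * K <= - K) by nra. nra. }
    pose proof (fourier_translate rho (RtoC y * Ci) n Hrho Hper) as HT.
    fold (a n) in HT.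
    assert (Ea : a n = (epi (- (2 * zc n * (RtoC y * Ci))) *
      CRInt (fun x => rho (RtoC x + RtoC y * Ci)%C * epi (- (2 * zc n * RtoC x)))%C 0 1)%C).
    { rewrite HT, epi_opp. field. apply epi_neq0. }
    rewrite Ea, Cmod_mult, Cmod_epi.
    replace (- PI * Im (- (2 * zc n * (RtoC y * Ci)))) with (2 * PI * IZR n * y)
      by (unfold Im, Cmult, Copp, RtoC, Ci; simpl; ring).
    assert (HC : Cmod (CRInt (fun x => rho (RtoC x + RtoC y * Ci) *
       epi (- (2 * zc n * RtoC x)))%C 0 1) <= 2 * (1 - 0) * (D * (1 + E) * exp (PI * K))).
    { apply CRInt_bound; [|lra|].
      - apply Ccont_mult; [now apply Ccont_translate|].
        apply (Ccont_ext (fun x => epi ((- (2 * zc n)) * RtoC x)%C)).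
        + intros; f_equal; ring.
        + apply Ccont_epi_lin.
      - intros x Hx. rewrite Cmod_mult, Cmod_epi.
        replace (- (2 * zc n * RtoC x))%C with (RtoC (- (2 * IZR n * x)))
          by (rewrite RtoC_opp, !RtoC_mult; reflexivity).
        simpl Im. rewrite Rmult_0_r, exp_0, Rmult_1_r, <- Hy. now apply Hgr. }
    eapply Rle_trans.
    { apply Rmult_le_compat; [left; apply exp_pos|apply Cmod_ge_0| |exact HC].
      apply exp_le_mono, Hny. }
    assert (Q : exp (- (2 * PI * K)) * exp (PI * K) <= exp (- K)).
    { rewrite <- exp_plus. apply exp_le_mono. pose proof PI2_1. nra. }
    apply Rle_trans with ((2 * (D * (1 + E))) * exp (- K)).
    - replace (exp (- (2 * PI * K)) * (2 * (1 - 0) * (D * (1 + E) * exp (PI * K)))) with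
        ((2 * (D * (1 + E))) * (exp (- (2 * PI * K)) * exp (PI * K))) by ring.
      apply Rmult_le_compat_l; [nra|exact Q].
    - assert (0 < 2 * (D * (1 + E))) by nra.
      replace eps with ((2 * (D * (1 + E))) * (eps / (2 * (D * (1 + E))))) by (field; lra).
      apply Rmult_le_compat_l; lra. }
  exists (a 0%Z). intros w. apply Ceq_minus.
  change (rho w - a 0%Z = 0)%C.
  apply (fourier_unique (fun w => rho w - a 0%Z)%C); [auto with entire_db|].
  clear w. intros w n.
  rewrite (CRInt_ext _ (fun x => rho (RtoC x + w)%C * epi (- (2 * zc n * RtoC x))
    - a 0%Z * epi (2 * zc (- n) * RtoC x))%C).
  - rewrite CRInt_minus, CRInt_scal, fourier_translate, CRInt_epi;
      auto using Ccont_epi_lin.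
    + fold (a n). destruct (Z.eq_dec (- n) 0) as [h|h].
      * replace n with 0%Z by lia.
        replace (2 * 0 * w)%C with (RtoC 0) by ring. rewrite epi_0. ring.
      * rewrite (Ha n) by lia. ring.
    + apply Ccont_mult; [now apply Ccont_translate|].
      apply (Ccont_ext (fun x => epi ((- (2 * zc n)) * RtoC x)%C)).
      * intros; f_equal; ring.
      * apply Ccont_epi_lin.
    + apply Ccont_mult; auto using Ccont_const, Ccont_epi_lin.
  - intros x. replace (2 * zc (- n) * RtoC x)%C with (- (2 * zc n * RtoC x))%C
      by (rewrite zc_opp; ring). ring.
Qed.

(** * Theta functions *)

Lemma Csum_from_last (f : Z -> C) (a : Z) (n : nat) :
  Csum_from f a (S n) = (Csum_from f a n + f (a + Z.of_nat n)%Z)%C.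
Proof.
  replace (S n) with (n + 1)%nat by lia. rewrite Csum_from_app. simpl. ring.
Qed.

Lemma Csum_from_opp (f : Z -> C) (a : Z) (n : nat) :
  Csum_from (fun m => f (- m)%Z) a n = Csum_from f (1 - a - Z.of_nat n) n.
Proof.
  revert a; induction n as [|n IH]; intros a; [reflexivity|].
  rewrite Csum_from_last, IH. cbn [Csum_from].
  replace (- (a + Z.of_nat n))%Z with (1 - a - Z.of_nat (S n))%Z by lia.
  replace (1 - a - Z.of_nat (S n) + 1)%Z with (1 - a - Z.of_nat n)%Z by lia. ring.
Qed.

Lemma sumZ_opp (f : Z -> C) : zsummable f -> sumZ (fun m => f (- m)%Z) = sumZ f.
Proof.
  intros Hf. apply is_zsum_sumZ. intros eps Heps.
  destruct (sumZ_correct f Hf eps Heps) as [K HK]. exists (K + 1)%nat. intros A B HA HB.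
  unfold Zsum. rewrite Csum_from_opp.
  specialize (HK (B - 1)%nat (A + 1)%nat ltac:(lia) ltac:(lia)). unfold Zsum in HK.
  replace (1 - - Z.of_nat A - Z.of_nat (A + B))%Z with (- Z.of_nat (B - 1))%Z by lia.
  replace (A + B)%nat with (B - 1 + (A + 1))%nat by lia. exact HK.
Qed.

Definition th3 (tau v : C) : C := gser (fun _ => 1) tau v.

Lemma th3_summable (tau v : C) : 0 < Im tau ->
  zsummable (fun n => 1 * epi (zc n * zc n * tau + 2 * zc n * v))%C.
Proof. intros Ht. apply (gser_summable (fun _ => RtoC 1) 1); auto. intros; rewrite Cmod_1; lra. Qed.

Lemma th3_entire (tau : C) : 0 < Im tau -> entire (th3 tau).
Proof. intros Ht. apply (gser_entire _ 1); auto. intros; rewrite Cmod_1; lra. Qed.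

Lemma th3_even (tau v : C) : 0 < Im tau -> th3 tau (- v) = th3 tau v.
Proof.
  intros Ht. unfold th3, gser. rewrite <- (sumZ_opp _ (th3_summable tau v Ht)).
  apply sumZ_ext. intros n. rewrite zc_opp. do 2 f_equal. ring.
Qed.

Lemma th3_addZ (tau v : C) (k : Z) : th3 tau (v + zc k) = th3 tau v.
Proof.
  apply sumZ_ext. intros n. f_equal. apply epi_congr with (n * k)%Z. rewrite zc_mult. ring.
Qed.

Lemma th3_add1 (tau v : C) : th3 tau (v + 1) = th3 tau v.
Proof. apply (th3_addZ tau v 1). Qed.

Lemma th3_addtau (tau v : C) : 0 < Im tau ->
  th3 tau (v + tau) = (epi (- tau - 2 * v) * th3 tau v)%C.
Proof.
  intros Ht. unfold th3, gser.
  rewrite <- (sumZ_shift _ 1 (th3_summable tau v Ht)), <- sumZ_scal.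
  - apply sumZ_ext. intros n. rewrite zc_plus, !Cmult_1_l, <- epi_plus. f_equal. ring.
  - exact (zsummable_shift _ 1 (th3_summable tau v Ht)).
Qed.

Lemma vartheta_th3 (v tau : C) : 0 < Im tau ->
  vartheta v tau = (Ci * epi (v + tau / 4) * th3 tau (v + tau / 2 + / 2))%C.
Proof.
  intros Ht. unfold vartheta, th3, gser. rewrite <- sumZ_scal by (apply th3_summable; exact Ht).
  apply sumZ_ext. intros m. unfold qpow. rewrite !ee_epi, <- epi_plus, Cmult_1_l, <- epi_half.
  rewrite <- !epi_plus. f_equal.
  unfold Rdiv. rewrite !RtoC_mult, RtoC_pow, !RtoC_plus, RtoC_half. simpl. field.
Qed.

Lemma th3_vartheta (v tau : C) : 0 < Im tau ->
  th3 tau (- v + tau / 2 + / 2) = (Ci * epi (v - tau / 4) * vartheta v tau)%C.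
Proof.
  intros Ht. rewrite vartheta_th3 by exact Ht.
  replace (- v + tau / 2 + / 2)%C with (- (v - tau / 2 - / 2))%C by ring.
  rewrite (th3_even tau _ Ht).
  replace (v + tau / 2 + / 2)%C with (v - tau / 2 - / 2 + tau + 1)%C by field.
  rewrite th3_add1, th3_addtau by exact Ht.
  set (X := th3 tau (v - tau / 2 - / 2)).
  transitivity ((Ci * Ci) * (epi (v - tau / 4) * epi (v + tau / 4) *
    epi (- tau - 2 * (v - tau / 2 - / 2))) * X)%C; [|ring].
  rewrite <- !epi_plus, Ci2.
  replace (v - tau / 4 + (v + tau / 4) + (- tau - 2 * (v - tau / 2 - / 2)))%C
    with (RtoC 1) by field. rewrite epi_1. ring.
Qed.

Lemma vartheta_entire (tau : C) : 0 < Im tau -> entire (fun v => vartheta v tau).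
Proof.
  intros Ht.
  apply (entire_ext (fun v => Ci * epi (v + tau / 4) * th3 tau (v + tau / 2 + / 2))%C).
  - intros v. symmetry. now apply vartheta_th3.
  - apply entire_mult; [auto with entire_db|].
    apply (entire_comp (th3 tau)); [now apply th3_entire|auto with entire_db].
Qed.

Lemma vartheta_add1 (v tau : C) : 0 < Im tau -> vartheta (v + 1) tau = (- vartheta v tau)%C.
Proof.
  intros Ht. rewrite !vartheta_th3 by exact Ht.
  replace (v + 1 + tau / 2 + / 2)%C with (v + tau / 2 + / 2 + 1)%C by ring.
  replace (v + 1 + tau / 4)%C with (v + tau / 4 + 1)%C by ring.
  rewrite th3_add1, (epi_plus _ 1), epi_1. ring.
Qed.

Lemma vartheta_subtau (v tau : C) : 0 < Im tau ->
  vartheta (v - tau) tau = (- epi (2 * v - tau) * vartheta v tau)%C.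
Proof.
  intros Ht. rewrite !vartheta_th3 by exact Ht.
  replace (v + tau / 2 + / 2)%C with (v - tau + tau / 2 + / 2 + tau)%C by ring.
  rewrite th3_addtau by exact Ht.
  replace (- tau - 2 * (v - tau + tau / 2 + / 2))%C with (- (2 * v) + - (1))%C by field.
  replace (v - tau + tau / 4)%C with (v + tau / 4 + - tau)%C by ring.
  unfold Cminus.
  rewrite (epi_plus (v + tau / 4)), (epi_plus (- (2 * v))), (epi_plus (2 * v)), !epi_opp, epi_1.
  field. split; apply epi_neq0.
Qed.

(** The point (tau + 1)/2 is congruent to its negative modulo the lattice; evenness and
    quasi-periodicity give th3 = -th3 there. *)
Lemma vartheta_0 (tau : C) : 0 < Im tau -> vartheta 0 tau = 0.
Proof.
  intros Ht. rewrite vartheta_th3 by exact Ht.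
  assert (E : th3 tau (0 + tau / 2 + / 2) = (- th3 tau (0 + tau / 2 + / 2))%C).
  { rewrite <- (th3_even tau (0 + tau / 2 + / 2) Ht) at 2.
    rewrite <- (th3_add1 tau (- (0 + tau / 2 + / 2))).
    replace (0 + tau / 2 + / 2)%C with (- (0 + tau / 2 + / 2) + 1 + tau)%C at 1 by field.
    rewrite th3_addtau by exact Ht.
    replace (- tau - 2 * (- (0 + tau / 2 + / 2) + 1))%C with (- (1))%C by field.
    rewrite epi_opp, epi_1. field. }
  set (X := th3 tau (0 + tau / 2 + / 2)) in *.
  replace X with (RtoC 0); [ring|].
  transitivity ((X + - X) / 2)%C; [field|]. rewrite <- E. field.
Qed.

(** The principal root of -i tau is characterised as the root in the right half-plane, so that the
    roots for -1/tau and for N tau are recognised by these two properties. *)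
Definition is_sqrt_tau (c tau : C) : Prop := 0 < Re c /\ (c * c = - Ci * tau)%C.

Lemma th3_inversion (tau c v : C) : 0 < Im tau -> is_sqrt_tau c tau ->
  th3 (- / tau) (v / tau) = (c * epi (v * v / tau) * th3 tau v)%C.
Proof.
  intros Ht [Hc Hc2].
  assert (Ht0 : tau <> RtoC 0) by (intros ->; simpl in Ht; lra).
  pose proof (poisson tau c Ht Hc Hc2 (- v)) as H.
  fold (th3 (- / tau) (- (- v / tau))) in H. fold (th3 tau (- v)) in H.
  rewrite (th3_even tau v Ht) in H.
  replace (- (- v / tau))%C with (v / tau)%C in H by (field; exact Ht0).
  replace (- (- v * - v / tau))%C with (- (v * v / tau))%C in H by (field; exact Ht0).
  rewrite epi_opp in H.
  apply Cmult_neq_inv_l with (/ epi (v * v / tau))%C.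
  - rewrite <- epi_opp. apply epi_neq0.
  - rewrite H. field. apply epi_neq0.
Qed.

Lemma neg_inv_upper (tau : C) : 0 < Im tau -> 0 < Im (- / tau).
Proof.
  intros Ht. destruct tau as [p q]. unfold Im, Copp, Cinv in *; simpl in *.
  replace (- (- q / (p * (p * 1) + q * (q * 1)))) with (q / (p ^ 2 + q ^ 2)) by (field; nra).
  apply Rdiv_lt_0_compat; nra.
Qed.

Lemma upper_neq0 (tau : C) : 0 < Im tau -> tau <> RtoC 0.
Proof. intros Ht ->; simpl in Ht; lra. Qed.

Lemma sqrt_tau_neq0 (c tau : C) : is_sqrt_tau c tau -> c <> RtoC 0.
Proof. intros [Hc _] ->; simpl in Hc; lra. Qed.

(** [th3_inversion] transported by half periods; the factor -i is e^(-pi i/2), left over from the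
    half period. *)
Lemma vartheta_inversion (tau c v : C) : 0 < Im tau -> is_sqrt_tau c tau ->
  vartheta (v / tau) (- / tau) = (- Ci * c * epi (v * v / tau) * vartheta v tau)%C.
Proof.
  intros Ht Hc. pose proof (upper_neq0 tau Ht) as Ht0.
  rewrite !vartheta_th3 by auto using neg_inv_upper.
  replace (v / tau + - / tau / 2 + / 2)%C with ((v - / 2 + tau / 2) / tau)%C by (field; exact Ht0).
  rewrite (th3_inversion tau c _ Ht Hc).
  replace (v + tau / 2 + / 2)%C with (v - / 2 + tau / 2 + 1)%C by field.
  rewrite th3_add1.
  replace ((v - / 2 + tau / 2) * (v - / 2 + tau / 2) / tau)%C with
    (v * v / tau - v / tau + v - / 2 + tau / 4 + / 4 / tau)%C by (field; exact Ht0).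
  replace (v / tau + - / tau / 4)%C with (- (- (v / tau) + / 4 / tau))%C by (field; exact Ht0).
  replace (v * v / tau - v / tau + v - / 2 + tau / 4 + / 4 / tau)%C with
    (v * v / tau + (v + tau / 4) + (- (v / tau) + / 4 / tau) + - / 2)%C by ring.
  assert (E : epi (- / 2) = (- Ci)%C).
  { rewrite epi_opp, <- RtoC_half, epi_half.
    apply Cmult_neq_inv_l with Ci; [apply Ci_neq0|].
    transitivity (RtoC 1); [field; apply Ci_neq0|].
    replace (Ci * - Ci)%C with (- (Ci * Ci))%C by ring. rewrite Ci2. ring. }
  rewrite (epi_plus _ (- / 2)), (epi_plus _ (- (v / tau) + / 4 / tau)),
    (epi_plus (v * v / tau)), (epi_opp (- (v / tau) + / 4 / tau)), E.
  field. apply epi_neq0.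
Qed.

(** * The level-one Appell-Lerch sum and its inversion formula *)

(** Away from the integers this is i/(2 sin(pi w)): odd, and changing sign under w -> w + 1. *)
Definition phi (w : C) : C := (epi w / (1 - epi (2 * w)))%C.

(** The numerator vartheta(v) mu_1(u, v) of the level-one function. The factor q^(n/2) of its n-th
    term sits in the numerator of [phi], so that q^(n^2/2) alone remains in the Gaussian. *)
Definition Lser (u v tau : C) : C :=
  gser (fun n => epi (zc n) * phi (u + zc n * tau))%C tau (- v).

(** In the upper half-plane e^(pi i w) is small; oddness of [phi] reduces the lower half-plane to
    it. *)
Lemma phi_bound (w : C) (d : R) : 0 < d -> d <= Rabs (Im w) ->
  Cmod (phi w) <= / (1 - exp (- PI * d)).
Proof.
  intros Hd Hw. pose proof PI_RGT_0 as HPI.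
  set (r := exp (- PI * d)).
  assert (Hr : 0 < r < 1).
  { split; [apply exp_pos|]. unfold r. rewrite <- exp_0. apply exp_increasing. nra. }
  assert (Hpos : forall z, d <= Im z -> Cmod (phi z) <= / (1 - r)).
  { intros z Hz. unfold phi.
    assert (Hm : Cmod (epi z) <= r) by (rewrite Cmod_epi; apply exp_le_mono; nra).
    assert (Hz2 : Cmod (epi (2 * z)) <= r).
    { rewrite epi_sqr, Cmod_mult. pose proof (Cmod_ge_0 (epi z)). nra. }
    assert (Hden : 1 - r <= Cmod (1 - epi (2 * z))).
    { pose proof (Cmod_triangle_rev 1 (epi (2 * z))) as T. rewrite Cmod_1 in T. lra. }
    rewrite Cmod_div.
    - unfold Rdiv. rewrite <- (Rmult_1_l (/ (1 - r))).
      apply Rmult_le_compat; [apply Cmod_ge_0| |lra|].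
      + left. apply Rinv_0_lt_compat. lra.
      + apply Rinv_le_contravar; lra.
    - apply Cmod_gt_0. lra. }
  unfold Rabs in Hw. destruct (Rcase_abs (Im w)) as [h|h]; [|now apply Hpos].
  replace (Cmod (phi w)) with (Cmod (phi (- w))).
  - apply Hpos. exact Hw.
  - rewrite <- Cmod_opp. f_equal. unfold phi.
    replace (2 * - w)%C with (- (2 * w))%C by ring. rewrite !epi_opp, epi_sqr.
    assert (H1 : (1 - epi w * epi w)%C <> RtoC 0).
    { apply Cmod_gt_0.
      assert (Hm : / r <= Cmod (epi w)).
      { rewrite Cmod_epi. unfold r. rewrite <- exp_Ropp. apply exp_le_mono. nra. }
      assert (1 < / r) by (rewrite <- Rinv_1; apply Rinv_lt_contravar; lra).
      pose proof (Cmod_triangle_rev (epi w * epi w) 1) as T.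
      rewrite Cmod_minus_sym, Cmod_mult, Cmod_1 in T. nra. }
    field. repeat split; auto using epi_neq0.
    intros E. apply H1. replace (1 - epi w * epi w)%C with (- (epi w * epi w - 1))%C by ring.
    rewrite E. ring.
Qed.

(** Consecutive points differ by Im tau in height. All but the one nearest to the real axis
    therefore keep distance Im tau / 2 from it, and with it from the poles. *)
Lemma phi_lattice_bound (u tau : C) (n0 : Z) : 0 < Im tau ->
  Rabs (Im u + IZR n0 * Im tau) <= Im tau / 2 ->
  forall n, n <> n0 -> Cmod (phi (u + zc n * tau)) <= / (1 - exp (- PI * (Im tau / 2))).
Proof.
  intros Ht H0 n Hn. apply phi_bound; [lra|].
  rewrite Im_plus, Im_mult_R.
  assert (Hd : 1 <= Rabs (IZR n - IZR n0)).
  { rewrite <- minus_IZR, <- abs_IZR. apply IZR_le. lia. }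
  replace (Im u + IZR n * Im tau) with
    ((IZR n - IZR n0) * Im tau - - (Im u + IZR n0 * Im tau)) by ring.
  pose proof (Rabs_triang_inv ((IZR n - IZR n0) * Im tau) (- (Im u + IZR n0 * Im tau))) as T.
  rewrite Rabs_Ropp, Rabs_mult, (Rabs_pos_eq (Im tau)) in T by lra. nra.
Qed.

Lemma phi_lattice_bounded (u tau : C) : 0 < Im tau ->
  exists b, forall n, Cmod (phi (u + zc n * tau)) <= b.
Proof.
  intros Ht.
  assert (Hex : exists n0, Rabs (Im u + IZR n0 * Im tau) <= Im tau / 2).
  { set (y := - Im u / Im tau + / 2). exists (Int_part y).
    destruct (base_Int_part y) as [H1 H2].
    set (k := IZR (Int_part y)) in *.
    replace (Im u + k * Im tau) with ((k - (y - / 2)) * Im tau) by (unfold y; field; lra).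
    rewrite Rabs_mult, (Rabs_pos_eq (Im tau)) by lra.
    assert (Rabs (k - (y - / 2)) <= / 2) by (apply Rabs_le; lra). nra. }
  destruct Hex as [n0 H0].
  exists (Rmax (/ (1 - exp (- PI * (Im tau / 2)))) (Cmod (phi (u + zc n0 * tau)))).
  intros n. destruct (Z.eq_dec n n0) as [->|Hn]; [apply Rmax_r|].
  eapply Rle_trans; [|apply Rmax_l]. now apply phi_lattice_bound with n0.
Qed.

Lemma Lcoef_bounded (u tau : C) : 0 < Im tau ->
  exists b, forall n, Cmod (epi (zc n) * phi (u + zc n * tau)) <= b.
Proof.
  intros Ht. destruct (phi_lattice_bounded u tau Ht) as [b Hb]. exists b. intros n.
  rewrite Cmod_mult, Cmod_epi. simpl Im. rewrite Rmult_0_r, exp_0, Rmult_1_l. apply Hb.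
Qed.

Lemma Lser_summable (u v tau : C) : 0 < Im tau ->
  zsummable (fun n => (epi (zc n) * phi (u + zc n * tau)) *
     epi (zc n * zc n * tau + 2 * zc n * - v))%C.
Proof.
  intros Ht. destruct (Lcoef_bounded u tau Ht) as [b Hb].
  exact (gser_summable _ b tau (- v) Ht Hb).
Qed.

Lemma Lser_entire (u tau : C) : 0 < Im tau -> entire (fun v => Lser u v tau).
Proof.
  intros Ht. destruct (Lcoef_bounded u tau Ht) as [b Hb].
  apply (entire_comp (gser (fun n => epi (zc n) * phi (u + zc n * tau))%C tau));
    [exact (gser_entire _ b tau Ht Hb)|auto with entire_db].
Qed.

Lemma phi_denominator (u tau : C) (n : Z) : ~ in_lattice tau u ->
  (1 - epi (2 * (u + zc n * tau)))%C <> RtoC 0.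
Proof.
  intros Hu E. apply Hu.
  destruct (epi_eq1 (2 * (u + zc n * tau))) as [k Hk].
  { replace (epi (2 * (u + zc n * tau))) with
      (1 - (1 - epi (2 * (u + zc n * tau))))%C by ring. rewrite E. ring. }
  exists k, (- n)%Z. rewrite zc_opp.
  assert (H2 : RtoC 2 <> RtoC 0) by (apply RtoC_neq; lra).
  assert (E2 : (u + zc n * tau)%C = zc k) by (apply Cmult_neq_inv_l with (RtoC 2); auto).
  rewrite <- E2. ring.
Qed.

Lemma phi_eq (w : C) : (1 - epi (2 * w))%C <> RtoC 0 ->
  (phi w - epi (2 * w) * phi w)%C = epi w.
Proof. intros H. unfold phi. field. exact H. Qed.

Lemma Lser_add1 (u v tau : C) : Lser u (v + 1) tau = Lser u v tau.
Proof.
  apply sumZ_ext. intros n. f_equal. apply epi_congr with (- n)%Z. rewrite zc_opp. ring.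
Qed.

(** The twist by e^(2 pi i u) cancels the denominator term by term, since phi w - e^(2 pi i w) phi w
    = e^(pi i w). *)
Lemma Lser_subtau (u v tau : C) : 0 < Im tau -> ~ in_lattice tau u ->
  (Lser u v tau - epi (2 * u) * Lser u (v - tau) tau)%C =
  (epi u * th3 tau (- v + tau / 2 + / 2))%C.
Proof.
  intros Ht Hu. unfold Lser, th3, gser.
  rewrite <- !sumZ_scal, <- sumZ_minus; auto using th3_summable, Lser_summable, zsummable_scal.
  apply sumZ_ext. intros n.
  pose proof (phi_eq _ (phi_denominator u tau n Hu)) as E.
  set (p := phi (u + zc n * tau)) in *.
  replace (zc n * zc n * tau + 2 * zc n * - (v - tau))%C with
    (zc n * zc n * tau + 2 * zc n * - v + 2 * (zc n * tau))%C by ring.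
  replace (zc n * zc n * tau + 2 * zc n * (- v + tau / 2 + / 2))%C with
    (zc n * zc n * tau + 2 * zc n * - v + zc n * tau + zc n)%C by field.
  rewrite (epi_plus _ (2 * (zc n * tau))), (epi_plus _ (zc n)), (epi_plus _ (zc n * tau)).
  replace (2 * (u + zc n * tau))%C with (2 * u + 2 * (zc n * tau))%C in E by ring.
  rewrite (epi_plus (2 * u)), (epi_plus u) in E.
  set (e0 := epi (zc n * zc n * tau + 2 * zc n * - v)).
  transitivity (epi (zc n) * e0 * (p - epi (2 * u) * epi (2 * (zc n * tau)) * p))%C; [ring|].
  rewrite E. ring.
Qed.

(** The inverted sum. Its Gaussian prefactor is chosen so that v -> v - tau multiplies it by exactly
    e^(-2 pi i u), the homogeneous multiplier of [Lser] under the same translation. *)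
Definition Tser (u v tau : C) : C :=
  (epi ((u * u + 2 * u * v) / tau) * Lser (u / tau) (v / tau) (- / tau))%C.

Lemma Tser_entire (u tau : C) : 0 < Im tau -> entire (fun v => Tser u v tau).
Proof.
  intros Ht. apply entire_mult; [auto 7 with entire_db|].
  apply (entire_comp (fun v => Lser (u / tau) v (- / tau)));
    [now apply Lser_entire, neg_inv_upper|auto with entire_db].
Qed.

Lemma Tser_subtau (u v tau : C) : 0 < Im tau ->
  (epi (2 * u) * Tser u (v - tau) tau)%C = Tser u v tau.
Proof.
  intros Ht. pose proof (upper_neq0 tau Ht) as Ht0. unfold Tser.
  rewrite <- (Lser_add1 _ ((v - tau) / tau)).
  replace ((v - tau) / tau + 1)%C with (v / tau)%C by (field; exact Ht0).
  rewrite Cmult_assoc, <- epi_plus. do 2 f_equal. field. exact Ht0.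
Qed.

Lemma in_lattice_inv (u tau : C) : 0 < Im tau -> ~ in_lattice tau u ->
  ~ in_lattice (- / tau) (u / tau).
Proof.
  intros Ht Hu [a [b E]]. apply Hu. pose proof (upper_neq0 tau Ht) as Ht0.
  exists (- b)%Z, a. rewrite zc_opp.
  replace u with (u / tau * tau)%C by (field; exact Ht0). rewrite E. field. exact Ht0.
Qed.

(** Translating v by 1 translates v/tau by minus the inverted modulus -1/tau, so the inhomogeneous
    term is a theta function at -1/tau, which [th3_inversion] brings back to tau. *)
Lemma Tser_add1 (u v tau c : C) : 0 < Im tau -> is_sqrt_tau c tau -> ~ in_lattice tau u ->
  Tser u (v + 1) tau =
  (Tser u v tau - epi ((u + v + / 2) * (u + v + / 2) / tau) * c * vartheta v tau)%C.
Proof.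
  intros Ht Hc Hu. pose proof (upper_neq0 tau Ht) as Ht0.
  pose proof (neg_inv_upper tau Ht) as Hs.
  pose proof (Lser_subtau (u / tau) (v / tau) (- / tau) Hs (in_lattice_inv u tau Ht Hu)) as H.
  replace (v / tau - - / tau)%C with ((v + 1) / tau)%C in H by (field; exact Ht0).
  unfold Tser.
  replace ((u * u + 2 * u * (v + 1)) / tau)%C with
    ((u * u + 2 * u * v) / tau + 2 * (u / tau))%C by (field; exact Ht0).
  rewrite epi_plus.
  replace (- (v / tau) + - / tau / 2 + / 2)%C with ((- (v + / 2 - tau / 2)) / tau)%C in H
    by (field; exact Ht0).
  rewrite (th3_inversion tau c _ Ht Hc), th3_even in H by exact Ht.
  rewrite vartheta_th3 by exact Ht.
  replace (v + tau / 2 + / 2)%C with (v + / 2 - tau / 2 + tau)%C by field.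
  rewrite th3_addtau by exact Ht.
  set (X := th3 tau (v + / 2 - tau / 2)) in *.
  set (e1 := epi ((u * u + 2 * u * v) / tau)).
  transitivity (e1 * (Lser (u / tau) (v / tau) (- / tau) - (Lser (u / tau) (v / tau) (- / tau)
    - epi (2 * (u / tau)) * Lser (u / tau) ((v + 1) / tau) (- / tau))))%C; [ring|].
  rewrite H.
  rewrite <- epi_half.
  transitivity (e1 * Lser (u / tau) (v / tau) (- / tau) - (epi ((u * u + 2 * u * v) / tau)
    * epi (u / tau) * epi (- (v + / 2 - tau / 2) * - (v + / 2 - tau / 2) / tau)) * c * X)%C;
    [unfold e1; ring|].
  transitivity (e1 * Lser (u / tau) (v / tau) (- / tau) -
    (epi ((u + v + / 2) * (u + v + / 2) / tau) * epi (RtoC (/ 2)) * epi (v + tau / 4) *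
     epi (- tau - 2 * (v + / 2 - tau / 2))) * c * X)%C; [|ring].
  rewrite <- !epi_plus. do 4 f_equal. rewrite RtoC_half. field. exact Ht0.
Qed.

(** * Order estimates at 0, inversion up to a constant, and the constant *)

Definition bigO (k : nat) (f : R -> C) : Prop :=
  exists K d, 0 <= K /\ 0 < d <= 1 /\ forall t, 0 < t < d -> Cmod (f t) <= K * t ^ k.

Lemma bigO_plus (k : nat) (f g : R -> C) :
  bigO k f -> bigO k g -> bigO k (fun t => f t + g t)%C.
Proof.
  intros [K [d [HK [Hd Hf]]]] [K' [d' [HK' [Hd' Hg]]]].
  exists (K + K'), (Rmin d d'). split; [lra|].
  assert (0 < Rmin d d') by (apply Rmin_pos; lra).
  pose proof (Rmin_l d d'). pose proof (Rmin_r d d'). split; [lra|]. intros t Ht.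
  eapply Rle_trans; [apply Cmod_triangle|].
  specialize (Hf t ltac:(lra)). specialize (Hg t ltac:(lra)). lra.
Qed.

Lemma bigO_mult (k l : nat) (f g : R -> C) :
  bigO k f -> bigO l g -> bigO (k + l) (fun t => f t * g t)%C.
Proof.
  intros [K [d [HK [Hd Hf]]]] [K' [d' [HK' [Hd' Hg]]]].
  exists (K * K'), (Rmin d d'). split; [nra|].
  assert (0 < Rmin d d') by (apply Rmin_pos; lra).
  pose proof (Rmin_l d d'). pose proof (Rmin_r d d'). split; [lra|]. intros t Ht.
  rewrite Cmod_mult, pow_add.
  specialize (Hf t ltac:(lra)). specialize (Hg t ltac:(lra)).
  replace (K * K' * (t ^ k * t ^ l)) with ((K * t ^ k) * (K' * t ^ l)) by ring.
  apply Rmult_le_compat; auto using Cmod_ge_0.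
Qed.

Lemma bigO_ext (k : nat) (f g : R -> C) (d : R) : 0 < d ->
  (forall t, 0 < t < d -> f t = g t) -> bigO k f -> bigO k g.
Proof.
  intros Hd E [K [d' [HK [Hd' Hf]]]]. exists K, (Rmin d d'). split; [exact HK|].
  assert (0 < Rmin d d') by (apply Rmin_pos; lra).
  pose proof (Rmin_l d d'). pose proof (Rmin_r d d'). split; [lra|].
  intros t Ht. rewrite <- E by lra. apply Hf. lra.
Qed.

Lemma bigO_weaken (k : nat) (f : R -> C) : bigO (S k) f -> bigO k f.
Proof.
  intros [K [d [HK [Hd Hf]]]]. exists K, d. split; [exact HK|]. split; [exact Hd|].
  intros t Ht. eapply Rle_trans; [now apply Hf|]. simpl.
  assert (0 <= t ^ k) by (apply pow_le; lra). apply Rmult_le_compat_l; nra.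
Qed.

Lemma bigO_const (c : C) : bigO 0 (fun _ => c).
Proof.
  exists (Cmod c), 1. split; [apply Cmod_ge_0|]. split; [lra|]. intros t _. simpl. lra.
Qed.

Lemma bigO_id : bigO 1 (fun t => RtoC t).
Proof.
  exists 1, 1. split; [lra|]. split; [lra|]. intros t Ht.
  rewrite Cmod_R, Rabs_pos_eq by lra. simpl. lra.
Qed.

Lemma bigO_cexp (f : R -> C) : bigO 1 f -> bigO 2 (fun t => cexp (f t) - 1 - f t)%C.
Proof.
  intros [K [d [HK [Hd Hf]]]]. exists (6 * K ^ 2 * exp K), d.
  assert (0 <= K ^ 2) by apply pow2_ge_0. pose proof (exp_pos K).
  split; [repeat apply Rmult_le_pos; lra|]. split; [exact Hd|]. intros t Ht.
  specialize (Hf t Ht). rewrite pow_1 in Hf. pose proof (Cmod_ge_0 (f t)).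
  eapply Rle_trans; [apply cexp_taylor|].
  assert (exp (Cmod (f t)) <= exp K) by (apply exp_le_mono; nra).
  assert (Cmod (f t) ^ 2 <= K ^ 2 * t ^ 2).
  { rewrite <- Rpow_mult_distr. apply pow_incr. lra. }
  pose proof (pow2_ge_0 (Cmod (f t))). pose proof (exp_pos (Cmod (f t))).
  replace (6 * K ^ 2 * exp K * t ^ 2) with (6 * (K ^ 2 * t ^ 2) * exp K) by ring.
  apply Rmult_le_compat; lra.
Qed.

Lemma bigO_scal (k : nat) (c : C) (f : R -> C) : bigO k f -> bigO k (fun t => c * f t)%C.
Proof. apply (bigO_mult 0 k). apply bigO_const. Qed.

Lemma bigO_epi2 (a : C) : bigO 2 (fun t => epi (a * RtoC t) - 1 - PI * Ci * a * RtoC t)%C.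
Proof.
  apply (bigO_ext 2 (fun t => cexp (PI * Ci * a * RtoC t) - 1 - PI * Ci * a * RtoC t)%C _ 1);
    [lra| |].
  - intros t _. unfold epi. do 2 f_equal. f_equal. ring.
  - apply (bigO_cexp (fun t => PI * Ci * a * RtoC t)%C). apply bigO_scal, bigO_id.
Qed.

Lemma bigO_epi1 (f : R -> C) : bigO 1 f -> bigO 1 (fun t => epi (f t) - 1)%C.
Proof.
  intros Hf.
  assert (H : bigO 1 (fun t => PI * Ci * f t)%C) by now apply bigO_scal.
  apply (bigO_ext 1 (fun t => (cexp (PI * Ci * f t) - 1 - PI * Ci * f t) + PI * Ci * f t)%C _ 1);
    [lra| |].
  - intros t _. unfold epi. ring.
  - apply bigO_plus; [|exact H].
    apply bigO_weaken. now apply (bigO_cexp (fun t => PI * Ci * f t)%C).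
Qed.

(** Near u = 0 only the term n = 0 is singular; the others are bounded uniformly by
    [phi_lattice_bound] with n0 = 0. *)
Lemma Lser_near0 (tau : C) : 0 < Im tau -> exists M, 0 <= M /\ forall u,
  Rabs (Im u) <= Im tau / 2 -> Cmod (Lser u 0 tau - phi u) <= M.
Proof.
  intros Ht. destruct major_exp_abs as [_ [S HS]].
  set (b := / (1 - exp (- PI * (Im tau / 2)))).
  assert (Hb : 0 < b).
  { apply Rinv_0_lt_compat. pose proof PI_RGT_0.
    assert (exp (- PI * (Im tau / 2)) < exp 0) by (apply exp_increasing; nra).
    rewrite exp_0 in H0. lra. }
  assert (Hg := gbound_pos tau (2 * 0)).
  assert (HS0 : 0 <= S) by (eapply Rle_trans; [|apply (HS 0%Z O)]; simpl; lra).
  exists (b * gbound tau (2 * 0) * S).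
  assert (Hbg : 0 <= b * gbound tau (2 * 0)) by nra.
  split; [now apply Rmult_le_pos|]. intros u Hu.
  set (B := fun n => if Z.eq_dec n 0 then RtoC 0 else (epi (zc n) * phi (u + zc n * tau))%C).
  assert (HB : forall n, Cmod (B n) <= b).
  { intros n. unfold B. destruct (Z.eq_dec n 0); [rewrite Cmod_0; lra|].
    rewrite Cmod_mult, Cmod_epi. simpl Im. rewrite Rmult_0_r, exp_0, Rmult_1_l.
    apply phi_lattice_bound with 0%Z; auto. rewrite Rmult_0_l, Rplus_0_r. exact Hu. }
  assert (Hz0 : Rabs (Im (- 0)) <= 0).
  { unfold Im, Copp, RtoC; simpl. rewrite Ropp_0, Rabs_R0. lra. }
  pose proof (gser_dom B b tau (- 0) 0 Ht HB Hz0) as HD.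
  pose proof (gser_summable B b tau (- 0) Ht HB) as HSu.
  assert (Hd : zsummable (fun n => if Z.eq_dec n 0 then phi u else RtoC 0)).
  { eapply dom_summable with (g := fun n => Cmod (phi u) * exp 0 * exp (- Rabs (IZR n))).
    - intros n. destruct (Z.eq_dec n 0) as [->|H].
      + rewrite Rabs_R0, Ropp_0, exp_0. lra.
      + rewrite Cmod_0. apply Rmult_le_pos; [|left; apply exp_pos].
        apply Rmult_le_pos; [apply Cmod_ge_0|left; apply exp_pos].
    - apply major_scal; [|apply major_exp_abs].
      apply Rmult_le_pos; [apply Cmod_ge_0|left; apply exp_pos]. }
  replace (Lser u 0 tau - phi u)%C with
    (sumZ (fun n => B n * epi (zc n * zc n * tau + 2 * zc n * - 0))%C).
  - apply Cmod_sumZ_le; [exact HSu|]. intros a n.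
    eapply Rle_trans; [apply (Rsum_from_le _ _ a n HD)|].
    rewrite Rsum_from_scal. now apply Rmult_le_compat_l.
  - assert (E : sumZ (fun n => if Z.eq_dec n 0 then phi u else RtoC 0) = phi u).
    { apply is_zsum_sumZ. apply (is_zsum_single (fun n => if Z.eq_dec n 0 then phi u else RtoC 0) 0).
      intros m Hm. now destruct (Z.eq_dec m 0). }
    assert (EL : Lser u 0 tau =
      (sumZ (fun n => B n * epi (zc n * zc n * tau + 2 * zc n * - 0)) + phi u)%C);
      [|rewrite EL; ring].
    rewrite <- E, <- sumZ_plus by auto. apply sumZ_ext.
    + intros n. unfold B. destruct (Z.eq_dec n 0) as [->|H].
      * replace (zc 0 * zc 0 * tau + 2 * zc 0 * - 0)%C with (RtoC 0) by ring.
        replace (u + zc 0 * tau)%C with u by ring. rewrite epi_0. ring.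
      * ring.
Qed.

Section AppellInversion.
Context (tau c k : C) (Ht : 0 < Im tau) (Hc : is_sqrt_tau c tau)
  (Hk : forall w, (epi w * mordell_h w tau + epi (- w - tau) * mordell_h (w + tau) tau)%C = k).

(** The normalisation in which the expected constant k = 2 e^(-pi i tau/4) becomes 1. *)
Let kappa : C := (k / 2 * epi (tau / 4))%C.

Lemma appell_inversion_kappa (u v : C) : ~ in_lattice tau u ->
  (kappa * Lser u v tau = / tau * Tser u v tau
    + Ci / 2 * (vartheta v tau * mordell_h (u + v) tau))%C.
Proof.
  intros Hu. pose proof (upper_neq0 tau Ht) as Ht0.
  pose proof (sqrt_tau_neq0 c tau Hc) as Hc0.
  set (E := fun v => (kappa * Lser u v tau - (/ tau * Tser u v tau
    + Ci / 2 * (vartheta v tau * mordell_h (u + v) tau)))%C).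
  apply Ceq_minus. change (E v = 0).
  assert (HE : entire E).
  { unfold E. apply entire_minus; [|apply entire_plus; apply entire_mult]; auto with entire_db.
    - apply entire_mult; [apply entire_const|now apply Lser_entire].
    - now apply Tser_entire.
    - apply entire_mult; [now apply vartheta_entire|].
      apply (entire_comp (fun w => mordell_h w tau)); [now apply mordell_h_entire|].
      auto with entire_db. }
  assert (Hper : forall z, E (z + 1)%C = E z).
  { intros z. unfold E. rewrite Lser_add1, (Tser_add1 u z tau c Ht Hc Hu), vartheta_add1 by exact Ht.
    replace (u + (z + 1))%C with (u + z + 1)%C by ring.
    destruct Hc as [Hc1 Hc2].
    rewrite (mordell_h_add1 tau c _ Ht Hc1 Hc2), RtoC_half.
    set (G := epi ((u + z + / 2) * (u + z + / 2) / tau)).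
    set (th := vartheta z tau). set (h := mordell_h (u + z) tau).
    (* The Gaussian from [Tser] and the one from the Mordell integral cancel because c^2 = -i
       tau. *)
    assert (H0 : (/ tau * (G * c * th) + Ci / 2 * (th * (2 / c * G)) = 0)%C).
    { transitivity (G * th * (c * c + Ci * tau) / (c * tau))%C; [field; auto|].
      rewrite Hc2. field. auto. }
    replace (kappa * Lser u z tau - (/ tau * (Tser u z tau - G * c * th) +
      Ci / 2 * (- th * (2 / c * G - h))))%C with
      (kappa * Lser u z tau - (/ tau * Tser u z tau + Ci / 2 * (th * h)) +
       (/ tau * (G * c * th) + Ci / 2 * (th * (2 / c * G))))%C by (field; auto).
    rewrite H0. ring. }
  (* [Tser] is homogeneous here; the theta term of [Lser] and the constant k of the Mordell integral
     balance precisely for the factor [kappa]. *)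
  assert (Htau : forall z, (epi (2 * u) * E (z - tau)%C)%C = E z).
  { intros z. apply Ceq_minus. unfold E.
    pose proof (Lser_subtau u z tau Ht Hu) as EL.
    pose proof (Tser_subtau u z tau Ht) as ET.
    pose proof (Hk (u + (z - tau))) as Eh.
    rewrite (vartheta_subtau z tau Ht).
    replace (u + (z - tau) + tau)%C with (u + z)%C in Eh by ring.
    replace (- (u + (z - tau)) - tau)%C with (- (u + z))%C in Eh by ring.
    replace (u + (z - tau))%C with (u + z - tau)%C in * by ring.
    rewrite (th3_vartheta z tau Ht) in EL.
    set (h' := mordell_h (u + z - tau) tau) in *. set (h := mordell_h (u + z) tau) in *.
    set (th := vartheta z tau) in *.
    assert (Eh2 : (epi (2 * u) * epi (2 * z - tau) * h' + h = k * epi (u + z))%C).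
    { rewrite <- Eh. transitivity ((epi (u + z - tau) * epi (u + z)) * h'
        + (epi (- (u + z)) * epi (u + z)) * h)%C; [|ring].
      rewrite <- !epi_plus. replace (- (u + z) + (u + z))%C with (RtoC 0) by ring.
      rewrite epi_0. replace (u + z - tau + (u + z))%C with (2 * u + (2 * z - tau))%C by ring.
      ring. }
    transitivity ((- kappa) * (Lser u z tau - epi (2 * u) * Lser u (z - tau) tau)
      - / tau * (epi (2 * u) * Tser u (z - tau) tau - Tser u z tau)
      + Ci / 2 * th * (epi (2 * u) * epi (2 * z - tau) * h' + h))%C; [ring|].
    rewrite EL, ET, Eh2. unfold kappa.
    transitivity (Ci / 2 * th * k * (epi (u + z) - epi (tau / 4) * epi u * epi (z - tau / 4)))%C;
      [field; exact Ht0|].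
    rewrite <- !epi_plus. replace (tau / 4 + u + (z - tau / 4))%C with (u + z)%C by ring. ring. }
  apply (fourier_unique E HE). intros w n.
  rewrite (fourier_translate E w n HE Hper).
  set (a := CRInt (fun x => E (RtoC x) * epi (- (2 * zc n * RtoC x)))%C 0 1).
  assert (Ea : (epi (2 * u) * (epi (2 * zc n * - tau) * a) = a)%C).
  { unfold a at 1. rewrite <- (fourier_translate E (- tau) n HE Hper).
    rewrite <- CRInt_scal.
    - apply CRInt_ext. intros x. rewrite <- (Htau (RtoC x)). unfold Cminus. ring.
    - apply Ccont_mult; [now apply Ccont_translate|].
      apply (Ccont_ext (fun x => epi ((- (2 * zc n)) * RtoC x)%C)).
      + intros; f_equal; ring.
      + apply Ccont_epi_lin. }
  assert (Ha : a = 0).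
  { apply Cmult_neq_inv_l with (1 - epi (2 * (u + zc (- n) * tau)))%C.
    - now apply phi_denominator.
    - replace (2 * (u + zc (- n) * tau))%C with (2 * u + 2 * zc n * - tau)%C
        by (rewrite zc_opp; ring).
      rewrite epi_plus. transitivity (a - epi (2 * u) * (epi (2 * zc n * - tau) * a))%C; [ring|].
      rewrite Ea. ring. }
  rewrite Ha. ring.
Qed.
End AppellInversion.

(* The unknown constant is read off from the simple poles at [u = 0] on both sides, along the
   line [v = 0] on which the theta function vanishes. *)
Lemma mordell_constant (tau c k : C) : 0 < Im tau -> is_sqrt_tau c tau ->
  (forall w, (epi w * mordell_h w tau + epi (- w - tau) * mordell_h (w + tau) tau)%C = k) ->
  (k / 2 * epi (tau / 4))%C = 1.
Proof.
  intros Ht Hc Hk. pose proof (upper_neq0 tau Ht) as Ht0.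
  set (kappa := (k / 2 * epi (tau / 4))%C).
  pose proof PI_RGT_0 as HPI.
  assert (Hpc : (PI * Ci)%C <> RtoC 0).
  { apply Cneq_mult; [apply RtoC_neq; lra|apply Ci_neq0]. }
  set (s := (- / tau)%C). assert (Hs : 0 < Im s) by now apply neg_inv_upper.
  destruct (Lser_near0 tau Ht) as [M1 [HM1 H1]].
  destruct (Lser_near0 s Hs) as [M2 [HM2 H2]].
  (* For 0 < t < d0 the number t is not a lattice point, and t/tau lies in the strip where
     [Lser_near0] applies to the modulus s. *)
  set (d0 := Rmin 1 (Im s / 2 / (Cmod (/ tau) + 1))).
  pose proof (Cmod_ge_0 (/ tau)) as Pt.
  assert (Hd0 : 0 < d0).
  { apply Rmin_pos; [lra|]. repeat apply Rdiv_lt_0_compat; lra. }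
  assert (Hd01 : d0 <= 1) by apply Rmin_l.
  assert (Hd02 : d0 * (Cmod (/ tau) + 1) <= Im s / 2).
  { replace (Im s / 2) with (Im s / 2 / (Cmod (/ tau) + 1) * (Cmod (/ tau) + 1)) by (field; lra).
    apply Rmult_le_compat_r; [lra|apply Rmin_r]. }
  assert (Hlat : forall t, 0 < t < d0 -> ~ in_lattice tau (RtoC t)).
  { intros t Htt [a [b E]].
    assert (Eb := f_equal Im E). unfold Im, Cmult, Cplus, RtoC in Eb; simpl in Eb.
    unfold Im in Ht. assert (Hb : IZR b = 0) by nra. rewrite Hb in E.
    assert (E2 : RtoC t = zc a) by (rewrite E; ring). injection E2 as E3.
    assert (0 < a)%Z by (apply lt_IZR; lra). assert (a < 1)%Z by (apply lt_IZR; lra). lia. }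
  set (R1 := fun t => (Lser (RtoC t) 0 tau - phi (RtoC t))%C).
  set (R2 := fun t => (Lser (RtoC t / tau) 0 s - phi (RtoC t / tau))%C).
  assert (HR1 : bigO 0 R1).
  { exists M1, 1. split; [exact HM1|]. split; [lra|]. intros t Htt. rewrite pow_O, Rmult_1_r.
    unfold R1. apply H1. simpl. rewrite Rabs_R0. lra. }
  assert (HR2 : bigO 0 R2).
  { exists M2, d0. split; [exact HM2|]. split; [lra|]. intros t Htt. rewrite pow_O, Rmult_1_r.
    unfold R2. apply H2. eapply Rle_trans; [apply im_le_Cmod|]. unfold Cdiv.
    rewrite Cmod_mult, Cmod_R, Rabs_pos_eq by lra. nra. }
  (* [D1] and [D2] are the denominators of [phi] at t and at t/tau. They vanish to first order at t
     = 0, with slopes -2 pi i and -2 pi i/tau. *)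
  set (D1 := fun t => (1 - epi (2 * RtoC t))%C).
  set (D2 := fun t => (1 - epi (2 * / tau * RtoC t))%C).
  assert (HD1 : bigO 2 (fun t => D1 t + 2 * (PI * Ci) * RtoC t)%C).
  { apply (bigO_ext 2 (fun t => (- (1)) * (epi (2 * RtoC t) - 1 - PI * Ci * 2 * RtoC t))%C _ 1);
      [lra|intros t _; unfold D1; ring|]. apply bigO_scal, bigO_epi2. }
  assert (HD2 : bigO 2 (fun t => D2 t + 2 * (PI * Ci) / tau * RtoC t)%C).
  { apply (bigO_ext 2 (fun t => (- (1)) * (epi (2 * / tau * RtoC t) - 1
      - PI * Ci * (2 * / tau) * RtoC t))%C _ 1); [lra|intros t _; unfold D2, Cdiv; ring|].
    apply bigO_scal, bigO_epi2. }
  assert (Hlin : forall a, bigO 1 (fun t => a * RtoC t)%C) by (intros; apply bigO_scal, bigO_id).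
  assert (HD11 : bigO 1 D1).
  { apply (bigO_ext 1 (fun t => (D1 t + 2 * (PI * Ci) * RtoC t)
      + (- (2 * (PI * Ci))) * RtoC t)%C _ 1); [lra|intros; ring|].
    apply bigO_plus; [now apply bigO_weaken|apply Hlin]. }
  assert (HD21 : bigO 1 D2).
  { apply (bigO_ext 1 (fun t => (D2 t + 2 * (PI * Ci) / tau * RtoC t)
      + (- (2 * (PI * Ci) / tau)) * RtoC t)%C _ 1); [lra|intros; ring|].
    apply bigO_plus; [now apply bigO_weaken|apply Hlin]. }
  set (A := fun t => (epi (RtoC t) - 1 + D1 t * R1 t)%C).
  set (B := fun t => (epi (RtoC t * RtoC t * / tau + / tau * RtoC t) - 1 +
    epi (RtoC t * RtoC t * / tau) * (D2 t * R2 t))%C).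
  assert (Hsq : bigO 1 (fun t => RtoC t * RtoC t * / tau)%C).
  { apply bigO_weaken. apply (bigO_ext 2 (fun t => / tau * (RtoC t * RtoC t))%C _ 1);
      [lra|intros; ring|]. apply bigO_scal, (bigO_mult 1 1); apply bigO_id. }
  assert (HA : bigO 1 A).
  { apply bigO_plus.
    - apply (bigO_epi1 (fun t => RtoC t)), bigO_id.
    - now apply (bigO_mult 1 0). }
  assert (HB : bigO 1 B).
  { apply bigO_plus.
    - apply (bigO_epi1 (fun t => RtoC t * RtoC t * / tau + / tau * RtoC t)%C).
      apply bigO_plus; [exact Hsq|apply Hlin].
    - apply (bigO_mult 0 1); [|now apply (bigO_mult 1 0)].
      apply (bigO_ext 0 (fun t => (epi (RtoC t * RtoC t * / tau) - 1) + 1)%C _ 1);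
        [lra|intros; ring|].
      apply bigO_plus; [|apply bigO_const]. apply bigO_weaken. now apply bigO_epi1. }
  (* With both denominators cleared the identity reads kappa (1 + A) D2 = (1 + B) D1/tau, where A
     and B are O(t); hence its linear part is O(t^2) and must vanish. *)
  assert (Hmain : bigO 2 (fun t => (2 * (PI * Ci) / tau * (kappa - 1)) * RtoC t)%C).
  { apply (bigO_ext 2 (fun t =>
      kappa * (D2 t + 2 * (PI * Ci) / tau * RtoC t)
      + (- / tau) * (D1 t + 2 * (PI * Ci) * RtoC t)
      + kappa * (A t * D2 t) + (- / tau) * (B t * D1 t))%C _ d0 Hd0).
    - intros t Htt.
      pose proof (appell_inversion_kappa tau c k Ht Hc Hk (RtoC t) 0 (Hlat t Htt)) as E.
      rewrite vartheta_0, Cmult_0_l, Cmult_0_r, Cplus_0_r in E by exact Ht.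
      unfold Tser in E. replace (0 / tau)%C with (RtoC 0) in E by (field; exact Ht0).
      fold s in E. fold kappa in E.
      replace (Lser (RtoC t) 0 tau) with (phi (RtoC t) + R1 t)%C in E by (unfold R1; ring).
      replace (Lser (RtoC t / tau) 0 s) with (phi (RtoC t / tau) + R2 t)%C in E
        by (unfold R2; ring).
      replace ((RtoC t * RtoC t + 2 * RtoC t * 0) / tau)%C with (RtoC t * RtoC t * / tau)%C in E
        by (field; exact Ht0).
      assert (N1 : D1 t <> RtoC 0).
      { pose proof (phi_denominator (RtoC t) tau 0 (Hlat t Htt)) as N.
        replace (RtoC t + 0 * tau)%C with (RtoC t) in N by ring. exact N. }
      assert (N2 : D2 t <> RtoC 0).
      { pose proof (phi_denominator (RtoC t / tau) s 0
          (in_lattice_inv _ tau Ht (Hlat t Htt))) as N.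
        replace (2 * (RtoC t / tau + 0 * s))%C with (2 * / tau * RtoC t)%C in N
          by (unfold Cdiv; ring). exact N. }
      assert (P1 : (phi (RtoC t) * D1 t)%C = epi (RtoC t)) by (unfold phi, D1; field; exact N1).
      assert (P2 : (phi (RtoC t / tau) * D2 t)%C = epi (/ tau * RtoC t)).
      { unfold phi, D2. replace (2 * (RtoC t / tau))%C with (2 * / tau * RtoC t)%C
          by (unfold Cdiv; ring).
        replace (RtoC t / tau)%C with (/ tau * RtoC t)%C by (unfold Cdiv; ring).
        field. exact N2. }
      assert (E' : (kappa * (epi (RtoC t) + D1 t * R1 t) * D2 t =
        / tau * (epi (RtoC t * RtoC t * / tau + / tau * RtoC t)
          + epi (RtoC t * RtoC t * / tau) * (D2 t * R2 t)) * D1 t)%C).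
      { rewrite epi_plus, <- P1, <- P2.
        transitivity (kappa * (phi (RtoC t) + R1 t) * (D1 t * D2 t))%C; [ring|].
        rewrite E. ring. }
      apply Ceq_minus.
      transitivity (kappa * (epi (RtoC t) + D1 t * R1 t) * D2 t -
        / tau * (epi (RtoC t * RtoC t * / tau + / tau * RtoC t)
          + epi (RtoC t * RtoC t * / tau) * (D2 t * R2 t)) * D1 t)%C.
      + unfold A, B. field. exact Ht0.
      + rewrite E'. ring.
    - repeat apply bigO_plus; try (apply bigO_scal; assumption);
        apply bigO_scal; now apply (bigO_mult 1 1). }
  assert (Hz : (2 * (PI * Ci) / tau * (kappa - 1))%C = 0).
  { destruct Hmain as [K [d [HK [Hd HO]]]]. apply Cmod_small_0. intros eps Heps.
    set (t := Rmin (d / 2) (eps / (K + 1))).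
    assert (Htp : 0 < t) by (apply Rmin_pos; [lra|apply Rdiv_lt_0_compat; lra]).
    assert (Htd : t <= d / 2) by apply Rmin_l.
    assert (Hte : t * (K + 1) <= eps).
    { replace eps with (eps / (K + 1) * (K + 1)) by (field; lra).
      apply Rmult_le_compat_r; [lra|apply Rmin_r]. }
    specialize (HO t ltac:(lra)). rewrite Cmod_mult, Cmod_R, Rabs_pos_eq in HO by lra.
    apply Rmult_le_reg_r with t; [exact Htp|]. eapply Rle_trans; [exact HO|]. nra. }
  apply Ceq_minus. apply Cmult_neq_inv_l with (2 * (PI * Ci) / tau)%C.
  - unfold Cdiv. apply Cneq_mult; [apply Cneq_mult; [apply RtoC_neq; lra|exact Hpc]|].
    apply Cmod_gt_0. rewrite Cmod_inv by exact Ht0. apply Rinv_0_lt_compat.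
    now apply Cmod_gt_0.
  - rewrite Hz. ring.
Qed.

Theorem appell_inversion (tau c u v : C) : 0 < Im tau -> is_sqrt_tau c tau ->
  ~ in_lattice tau u ->
  (Lser u v tau = / tau * Tser u v tau
    + Ci / 2 * (vartheta v tau * mordell_h (u + v) tau))%C.
Proof.
  intros Ht Hc Hu. destruct Hc as [Hc1 Hc2].
  destruct (mordell_h_addtau_const tau c Ht Hc1 Hc2) as [k Hk].
  rewrite <- (appell_inversion_kappa tau c k Ht (conj Hc1 Hc2) Hk u v Hu).
  rewrite (mordell_constant tau c k Ht (conj Hc1 Hc2) Hk). ring.
Qed.

(** * Zeros of theta: a finite Jacobi triple product *)

(** The first factor is peeled off, so that the estimates go by induction over shifted sequences;
    [qprod_last] gives access to the other end. *)
Fixpoint qprod (w : nat -> C) (k : nat) : C :=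
  match k with O => RtoC 1 | S k' => ((1 - w O) * qprod (fun i => w (S i)) k')%C end.

Lemma qprod_last (w : nat -> C) (k : nat) : qprod w (S k) = (qprod w k * (1 - w k))%C.
Proof.
  revert w; induction k as [|k IH]; intros w; [simpl; ring|].
  change (qprod w (S (S k))) with ((1 - w O) * qprod (fun i => w (S i)) (S k))%C.
  rewrite IH. simpl. ring.
Qed.

Lemma one_minus_ge_exp (t : R) : 0 <= t <= / 2 -> exp (- (2 * t)) <= 1 - t.
Proof.
  intros Ht. rewrite exp_Ropp. pose proof (exp_ineq1_le (2 * t)) as H.
  apply Rmult_le_reg_l with (exp (2 * t)); [apply exp_pos|].
  rewrite Rinv_r by (pose proof (exp_pos (2 * t)); lra). nra.
Qed.

(** Once K r^n <= 1/2, the inequality 1 - t >= e^(-2t) and a geometric series bound the tail from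
    below; the finitely many factors before it are nonzero. The bound is uniform in the length of
    the product. *)
Lemma qprod_lower (r K : R) (w : nat -> C) : 0 < r < 1 -> 0 <= K ->
  (forall i, Cmod (w i) <= K * r ^ i) -> (forall i, w i <> RtoC 1) ->
  exists d, 0 < d /\ forall k, d <= Cmod (qprod w k).
Proof.
  intros Hr HK Hw H1.
  assert (Hsmall : forall L v, 0 <= L <= / 2 -> (forall i, Cmod (v i) <= L * r ^ i) ->
    forall k, exp (- (2 * (L / (1 - r)))) <= Cmod (qprod v k)).
  { intros L v HL Hv k. revert L v HL Hv. induction k as [|k IH]; intros L v HL Hv.
    - simpl. rewrite Cmod_1. rewrite <- exp_0 at 2. apply exp_le_mono.
      assert (0 <= L / (1 - r)) by (apply Rmult_le_pos; [lra|left; apply Rinv_0_lt_compat; lra]).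
      lra.
    - simpl. rewrite Cmod_mult.
      assert (E0 : exp (- (2 * L)) <= Cmod (1 - v O)).
      { eapply Rle_trans; [apply one_minus_ge_exp; exact HL|].
        pose proof (Cmod_triangle_rev 1 (v O)) as T. rewrite Cmod_1 in T.
        specialize (Hv O). simpl in Hv. lra. }
      assert (E1 : exp (- (2 * (L * r / (1 - r)))) <= Cmod (qprod (fun i => v (S i)) k)).
      { apply IH; [nra|]. intros i. eapply Rle_trans; [apply Hv|]. simpl. right; ring. }
      replace (- (2 * (L / (1 - r)))) with (- (2 * L) + - (2 * (L * r / (1 - r))))
        by (field; lra).
      rewrite exp_plus. apply Rmult_le_compat; auto; left; apply exp_pos. }
  assert (Hgen : forall n L v, 0 <= L -> L * r ^ n <= / 2 -> (forall i, Cmod (v i) <= L * r ^ i) ->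
    (forall i, v i <> RtoC 1) -> exists d, 0 < d /\ forall k, d <= Cmod (qprod v k)).
  { induction n as [|n IH]; intros L v HL HLn Hv Hv1.
    - exists (exp (- (2 * (L / (1 - r))))). split; [apply exp_pos|].
      apply Hsmall; [simpl in HLn; lra|exact Hv].
    - destruct (IH (L * r) (fun i => v (S i))) as [d [Hd Hk]].
      + nra. + simpl in HLn. lra.
      + intros i. eapply Rle_trans; [apply Hv|]. simpl. right; ring.
      + auto.
      + assert (Hm : 0 < Cmod (1 - v O)).
        { apply Cmod_gt_0. intros E. apply (Hv1 O).
          replace (v O) with (1 - (1 - v O))%C by ring. rewrite E. ring. }
        exists (Rmin 1 (Cmod (1 - v O) * d)). split; [apply Rmin_pos; [lra|nra]|].
        intros [|k]; simpl.
        * rewrite Cmod_1. apply Rmin_l.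
        * rewrite Cmod_mult. eapply Rle_trans; [apply Rmin_r|].
          apply Rmult_le_compat_l; [lra|apply Hk]. }
  destruct (pow_lt_1_zero r ltac:(rewrite Rabs_pos_eq; lra) (/ 2 / (K + 1))) as [N HN].
  { apply Rdiv_lt_0_compat; lra. }
  specialize (HN N (le_n N)). rewrite Rabs_pos_eq in HN by (apply pow_le; lra).
  apply (Hgen N K w HK); auto.
  assert (0 <= r ^ N) by (apply pow_le; lra).
  apply Rle_trans with ((K + 1) * (/ 2 / (K + 1))); [nra|]. right; field; lra.
Qed.

Lemma qprod_upper (r K : R) (w : nat -> C) : 0 < r < 1 -> 0 <= K ->
  (forall i, Cmod (w i) <= K * r ^ i) -> forall k, Cmod (qprod w k) <= exp (K / (1 - r)).
Proof.
  intros Hr HK Hw k. revert K w HK Hw. induction k as [|k IH]; intros K w HK Hw; simpl.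
  - rewrite Cmod_1. rewrite <- exp_0 at 1. apply exp_le_mono.
    apply Rmult_le_pos; [lra|left; apply Rinv_0_lt_compat; lra].
  - rewrite Cmod_mult.
    assert (E0 : Cmod (1 - w O) <= exp K).
    { eapply Rle_trans; [apply Cmod_triangle|]. rewrite Cmod_opp, Cmod_1.
      specialize (Hw O). simpl in Hw. pose proof (exp_ineq1_le K). lra. }
    assert (E1 : Cmod (qprod (fun i => w (S i)) k) <= exp (K * r / (1 - r))).
    { apply IH; [nra|]. intros i. eapply Rle_trans; [apply Hw|]. simpl. right; ring. }
    replace (K / (1 - r)) with (K + K * r / (1 - r)) by (field; lra).
    rewrite exp_plus. apply Rmult_le_compat; auto using Cmod_ge_0.
Qed.

Section TripleProduct.
Context (tau v : C) (Ht : 0 < Im tau) (Hv : ~ in_lattice tau v).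

Let qz (k : Z) : C := epi (2 * zc k * tau).
Let r : R := exp (- PI * (2 * Im tau)).

Lemma qz_plus (a b : Z) : qz (a + b) = (qz a * qz b)%C.
Proof. unfold qz. rewrite <- epi_plus, zc_plus. f_equal. ring. Qed.

Lemma nome_range : 0 < r < 1.
Proof.
  split; [apply exp_pos|]. unfold r. rewrite <- exp_0. apply exp_increasing.
  pose proof PI_RGT_0. nra.
Qed.

Lemma Cmod_qz (k : Z) : Cmod (qz k) = exp (- PI * (2 * IZR k * Im tau)).
Proof.
  unfold qz. rewrite Cmod_epi. do 2 f_equal.
  replace (2 * zc k)%C with (RtoC (2 * IZR k)) by apply RtoC_mult. apply Im_mult_R.
Qed.

Lemma Cmod_qz_nat (k : nat) : Cmod (qz (Z.of_nat k)) = r ^ k.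
Proof.
  rewrite Cmod_qz, <- INR_IZR_INZ. induction k as [|k IH].
  - simpl. rewrite Rmult_0_r, Rmult_0_l, Rmult_0_r. apply exp_0.
  - rewrite S_INR. simpl. rewrite <- IH. unfold r. rewrite <- exp_plus. f_equal. ring.
Qed.

Definition qfact (k : nat) : C := qprod (fun i => qz (Z.of_nat (S i))) k.

Lemma qfact_S (k : nat) : qfact (S k) = (qfact k * (1 - qz (Z.of_nat (S k))))%C.
Proof. apply (qprod_last (fun i => qz (Z.of_nat (S i)))). Qed.

Lemma qz_dom (i : nat) : Cmod (qz (Z.of_nat (S i))) <= 1 * r ^ i.
Proof.
  rewrite Cmod_qz_nat. simpl. pose proof nome_range.
  assert (0 <= r ^ i) by (apply pow_le; lra). nra.
Qed.

Lemma qfact_lower : exists d, 0 < d /\ forall k, d <= Cmod (qfact k).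
Proof.
  apply (qprod_lower r 1); [apply nome_range|lra|apply qz_dom|].
  intros i E. apply (f_equal Cmod) in E. rewrite Cmod_qz_nat, Cmod_1 in E.
  pose proof nome_range. assert (r ^ S i < 1); [|lra].
  apply pow_lt_1_compat; [lra|lia].
Qed.

Lemma qfact_neq0 (k : nat) : qfact k <> RtoC 0.
Proof.
  destruct qfact_lower as [d [Hd Hk]]. apply Cmod_gt_0. specialize (Hk k). lra.
Qed.

(** The extension of 1/(q;q)_k by zero is the one for which [qfinv_pred] holds at every integer; it
    also truncates the Gaussian binomials by itself. *)
Definition qfinv (k : Z) : C := if Z_lt_dec k 0 then RtoC 0 else (/ qfact (Z.to_nat k))%C.

Lemma qfinv_pred (k : Z) : qfinv (k - 1) = ((1 - qz k) * qfinv k)%C.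
Proof.
  unfold qfinv. destruct (Z_lt_dec (k - 1) 0), (Z_lt_dec k 0); try lia.
  - ring.
  - replace k with 0%Z by lia.
    replace (qz 0) with (RtoC 1); [ring|].
    unfold qz. replace (2 * 0 * tau)%C with (RtoC 0) by ring. symmetry; apply epi_0.
  - replace (Z.to_nat k) with (S (Z.to_nat (k - 1))) by lia.
    rewrite qfact_S. replace (Z.of_nat (S (Z.to_nat (k - 1)))) with k by lia.
    pose proof (qfact_neq0 (Z.to_nat (k - 1))) as H1.
    pose proof (qfact_neq0 (Z.to_nat k)) as H2.
    replace (Z.to_nat k) with (S (Z.to_nat (k - 1))) in H2 by lia.
    rewrite qfact_S in H2. replace (Z.of_nat (S (Z.to_nat (k - 1)))) with k in H2 by lia.
    assert (H3 : (1 - qz k)%C <> RtoC 0).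
    { intros E. apply H2. rewrite E. ring. }
    field. split; assumption.
Qed.

Lemma qfinv_bounded : exists V, 0 <= V /\ forall k, Cmod (qfinv k) <= V.
Proof.
  destruct qfact_lower as [d [Hd Hk]]. exists (/ d).
  assert (0 < / d) by now apply Rinv_0_lt_compat. split; [lra|]. intros k. unfold qfinv.
  destruct (Z_lt_dec k 0); [rewrite Cmod_0; lra|].
  rewrite Cmod_inv by apply qfact_neq0. apply Rinv_le_contravar; auto.
Qed.

(* The Gaussian binomial coefficient [2m choose m + n]. *)
Definition gbin (m : nat) (n : Z) : C :=
  (qfact (2 * m) * (qfinv (Z.of_nat m + n) * qfinv (Z.of_nat m - n)))%C.

Lemma gbin_bounded : exists W, 0 <= W /\ forall m n, Cmod (gbin m n) <= W.
Proof.
  destruct qfinv_bounded as [V [HV Hb]].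
  exists (exp (1 / (1 - r)) * (V * V)).
  split; [apply Rmult_le_pos; [left; apply exp_pos|nra]|]. intros m n.
  unfold gbin. rewrite !Cmod_mult.
  apply Rmult_le_compat; auto using Cmod_ge_0.
  - apply Rmult_le_pos; apply Cmod_ge_0.
  - apply (qprod_upper r 1); [apply nome_range|lra|apply qz_dom].
  - apply Rmult_le_compat; auto using Cmod_ge_0.
Qed.

(** Two Pascal steps at once, since [triple] gains a factor at each end. Expressed through [X] and
    [Y], the reciprocal factorials of m + 1 + n and m + 1 - n, it is a polynomial identity in powers
    of q. *)
Lemma gbin_rec (m : nat) (n : Z) : gbin (S m) n =
  ((1 + qz (2 * Z.of_nat m + 1)) * gbin m n
   + qz (Z.of_nat m + 1 - n) * gbin m (n - 1)
   + qz (Z.of_nat m + 1 + n) * gbin m (n + 1))%C.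
Proof.
  unfold gbin. replace (2 * S m)%nat with (S (S (2 * m))) by lia. rewrite !qfact_S.
  set (M := Z.of_nat m).
  replace (Z.of_nat (S m)) with (M + 1)%Z by lia.
  replace (Z.of_nat (S (2 * m))) with (2 * M + 1)%Z by lia.
  replace (Z.of_nat (S (S (2 * m)))) with ((M + 1 + n) + (M + 1 - n))%Z by lia.
  set (X := qfinv (M + 1 + n)). set (Y := qfinv (M + 1 - n)).
  assert (E1 : qfinv (M + n) = ((1 - qz (M + 1 + n)) * X)%C).
  { unfold X. rewrite <- qfinv_pred. f_equal. lia. }
  assert (E2 : qfinv (M - n) = ((1 - qz (M + 1 - n)) * Y)%C).
  { unfold Y. rewrite <- qfinv_pred. f_equal. lia. }
  assert (E3 : qfinv (M + (n - 1)) = ((1 - qz (M + n)) * qfinv (M + n))%C).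
  { rewrite <- qfinv_pred. f_equal. lia. }
  assert (E4 : qfinv (M - (n + 1)) = ((1 - qz (M - n)) * qfinv (M - n))%C).
  { rewrite <- qfinv_pred. f_equal. lia. }
  replace (M - (n - 1))%Z with (M + 1 - n)%Z by lia.
  replace (M + (n + 1))%Z with (M + 1 + n)%Z by lia.
  fold X Y. rewrite E3, E4, E1, E2.
  replace (2 * M + 1)%Z with ((M + n) + (M + 1 - n))%Z by lia.
  replace (M + 1 + n)%Z with ((M + n) + 1)%Z by lia.
  replace (M + 1 - n)%Z with ((M - n) + 1)%Z by lia.
  rewrite !qz_plus. ring.
Qed.

Let x : C := epi (2 * v).
Let term (n : Z) : C := epi (zc n + (zc n * zc n + zc n) * tau + 2 * zc n * v).

Lemma term_summable (B : Z -> C) (W : R) : (forall n, Cmod (B n) <= W) ->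
  zsummable (fun n => B n * term n)%C.
Proof.
  intros HB.
  apply (zsummable_ext (fun n => B n * epi (zc n * zc n * tau +
    2 * zc n * (v + tau / 2 + / 2)))%C).
  - intros n. unfold term. do 2 f_equal. field.
  - exact (gser_summable B W tau _ Ht HB).
Qed.

Definition triple (m : nat) : C :=
  (qprod (fun i => x * qz (Z.of_nat (S i))) m * qprod (fun i => / x * qz (Z.of_nat i)) m)%C.

(** A finite form of Jacobi's identity. In the induction the new pair of factors multiplies the
    theta terms by x and 1/x, that is, shifts their index by one ([T1], [T2]), and [gbin_rec]
    collects the coefficients. *)
Lemma triple_expansion (m : nat) : triple m = sumZ (fun n => gbin m n * term n)%C.
Proof.
  destruct gbin_bounded as [W [HW HB]].
  assert (Hx : x <> RtoC 0) by apply epi_neq0.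
  induction m as [|m IH].
  - symmetry. apply is_zsum_sumZ.
    replace (triple 0) with ((fun n => gbin 0 n * term n)%C 0%Z).
    + apply (is_zsum_single (fun n => gbin 0 n * term n)%C 0). intros n Hn. unfold gbin, qfinv.
      destruct (Z_lt_dec (Z.of_nat 0 + n) 0), (Z_lt_dec (Z.of_nat 0 - n) 0); try ring; lia.
    + unfold triple, gbin, qfinv, term. simpl.
      replace (0 + (0 * 0 + 0) * tau + 2 * 0 * v)%C with (RtoC 0) by ring. rewrite epi_0.
      change (qfact 0) with (RtoC 1). field.
  - set (M := Z.of_nat m).
    assert (E : triple (S m) =
      (triple m * (1 + qz (2 * M + 1) - x * qz (M + 1) - / x * qz M))%C).
    { unfold triple. rewrite !qprod_last.
      replace (Z.of_nat (S m)) with (M + 1)%Z by lia. fold M.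
      replace (2 * M + 1)%Z with ((M + 1) + M)%Z by lia. rewrite (qz_plus (M + 1)).
      field. exact Hx. }
    rewrite E, IH.
    assert (S0 : zsummable (fun n => gbin m n * term n)%C) by (apply (term_summable _ W); auto).
    assert (T1 : forall n, (x * qz (M + 1) * term (n - 1) = - (qz (M + 1 - n) * term n))%C).
    { intros n. unfold x, qz, term.
      replace (- (epi (2 * zc (M + 1 - n) * tau) * epi (zc n + (zc n * zc n + zc n) * tau
        + 2 * zc n * v)))%C with (epi (- (1)) * (epi (2 * zc (M + 1 - n) * tau) *
        epi (zc n + (zc n * zc n + zc n) * tau + 2 * zc n * v)))%C.
      - rewrite <- !epi_plus. f_equal. rewrite !zc_minus, !zc_plus. ring.
      - rewrite (epi_opp 1), epi_1. field. }
    assert (T2 : forall n, (/ x * qz M * term (n + 1) = - (qz (M + 1 + n) * term n))%C).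
    { intros n. unfold x, qz, term. rewrite <- epi_opp.
      replace (- (epi (2 * zc (M + 1 + n) * tau) * epi (zc n + (zc n * zc n + zc n) * tau
        + 2 * zc n * v)))%C with (epi 1 * (epi (2 * zc (M + 1 + n) * tau) *
        epi (zc n + (zc n * zc n + zc n) * tau + 2 * zc n * v)))%C.
      - rewrite <- !epi_plus. f_equal. rewrite !zc_plus. ring.
      - rewrite epi_1. ring. }
    assert (S1 : zsummable (fun n => gbin m (n - 1) * term (n - 1))%C)
      by exact (zsummable_shift _ (-1) S0).
    assert (S2 : zsummable (fun n => gbin m (n + 1) * term (n + 1))%C)
      by exact (zsummable_shift _ 1 S0).
    assert (Q1 : sumZ (fun n => gbin m (n - 1) * term (n - 1))%C =
      sumZ (fun n => gbin m n * term n)%C)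
      by exact (sumZ_shift (fun n => gbin m n * term n)%C (-1) S0).
    assert (Q2 : sumZ (fun n => gbin m (n + 1) * term (n + 1))%C =
      sumZ (fun n => gbin m n * term n)%C)
      by exact (sumZ_shift (fun n => gbin m n * term n)%C 1 S0).
    rewrite (sumZ_ext (fun n => gbin (S m) n * term n)%C (fun n => ((1 + qz (2 * M + 1)) * (gbin m n * term n)
      + (- (x * qz (M + 1))) * (gbin m (n - 1) * term (n - 1)))
      + (- (/ x * qz M)) * (gbin m (n + 1) * term (n + 1)))%C).
    + rewrite !sumZ_plus, !sumZ_scal; auto using zsummable_plus, zsummable_scal.
      rewrite Q1, Q2. ring.
    + intros n. rewrite gbin_rec. fold M.
      transitivity ((1 + qz (2 * M + 1)) * (gbin m n * term n)
        + - (- (qz (M + 1 - n) * term n)) * gbin m (n - 1)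
        + - (- (qz (M + 1 + n) * term n)) * gbin m (n + 1))%C; [ring|].
      rewrite <- T1, <- T2. ring.
Qed.

(** A factor can vanish only if v is a lattice point, and both halves have geometrically decaying
    deviations from 1. *)
Lemma triple_lower : exists d, 0 < d /\ forall m, d <= Cmod (triple m).
Proof.
  assert (Hx : x <> RtoC 0) by apply epi_neq0. pose proof nome_range as Hr.
  destruct (qprod_lower r (Cmod x) (fun i => x * qz (Z.of_nat (S i)))%C Hr (Cmod_ge_0 x))
    as [d1 [Hd1 H1]].
  { intros i. rewrite Cmod_mult. apply Rmult_le_compat_l; [apply Cmod_ge_0|].
    pose proof (qz_dom i). lra. }
  { intros i E. apply (phi_denominator v tau (Z.of_nat (S i)) Hv).
    replace (2 * (v + zc (Z.of_nat (S i)) * tau))%C with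
      (2 * v + 2 * zc (Z.of_nat (S i)) * tau)%C by ring.
    rewrite epi_plus. fold x. fold (qz (Z.of_nat (S i))). rewrite E. ring. }
  destruct (qprod_lower r (Cmod (/ x)) (fun i => / x * qz (Z.of_nat i))%C Hr (Cmod_ge_0 _))
    as [d2 [Hd2 H2]].
  { intros i. rewrite Cmod_mult, Cmod_qz_nat. lra. }
  { intros i E. apply (phi_denominator v tau (- Z.of_nat i) Hv).
    replace (2 * (v + zc (- Z.of_nat i) * tau))%C with
      (- (- (2 * v) + 2 * zc (Z.of_nat i) * tau))%C by (rewrite zc_opp; ring).
    rewrite epi_opp, epi_plus, epi_opp. fold x. fold (qz (Z.of_nat i)). rewrite E. field. }
  exists (d1 * d2). split; [nra|]. intros m. unfold triple. rewrite Cmod_mult.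
  apply Rmult_le_compat; auto; lra.
Qed.

(** The difference of neighbouring coefficients carries a power of q that grows with m. Comparison
    with the central coefficient replaces the computation of their common limit. *)
Lemma gbin_diff_lim (n : Z) : forall eps, 0 < eps -> exists M : nat, forall m, (M <= m)%nat ->
  Cmod (gbin m n - gbin m 0) < eps.
Proof.
  destruct qfinv_bounded as [V [HV Hb]].
  set (U := exp (1 / (1 - r))).
  assert (HU : forall k, Cmod (qfact k) <= U).
  { intros k. apply (qprod_upper r 1); [apply nome_range|lra|apply qz_dom]. }
  assert (HU0 : 0 < U) by apply exp_pos.
  assert (Hq : forall a eps, 0 < eps -> exists M : nat, forall m, (M <= m)%nat ->
    Cmod (qz (Z.of_nat m + a)) < eps).
  { intros a eps Heps. pose proof nome_range as Hr.
    destruct (pow_lt_1_zero r ltac:(rewrite Rabs_pos_eq; lra) eps Heps) as [N HN].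
    exists (N + Z.to_nat (Z.abs a))%nat. intros m Hm.
    replace (Z.of_nat m + a)%Z with (Z.of_nat (Z.to_nat (Z.of_nat m + a))) by lia.
    rewrite Cmod_qz_nat. specialize (HN (Z.to_nat (Z.of_nat m + a)) ltac:(lia)).
    rewrite Rabs_pos_eq in HN by (apply pow_le; lra). exact HN. }
  assert (Hstep : forall n eps, 0 < eps -> exists M : nat, forall m, (M <= m)%nat ->
    Cmod (gbin m (n + 1) - gbin m n) < eps).
  { intros p eps Heps.
    set (L := U * (V * V) + 1). assert (HL : 0 < L) by (unfold L; nra).
    destruct (Hq (p + 1)%Z (eps / (2 * L))) as [M1 H1]; [apply Rdiv_lt_0_compat; lra|].
    destruct (Hq (- p)%Z (eps / (2 * L))) as [M2 H2]; [apply Rdiv_lt_0_compat; lra|].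
    exists (Nat.max M1 M2). intros m Hm.
    specialize (H1 m ltac:(lia)). specialize (H2 m ltac:(lia)).
    assert (E : (gbin m (p + 1) - gbin m p)%C =
      (qfact (2 * m) * (qfinv (Z.of_nat m + (p + 1)) * qfinv (Z.of_nat m - p)) *
        (qz (Z.of_nat m + (p + 1)) - qz (Z.of_nat m + - p)))%C).
    { unfold gbin.
      replace (Z.of_nat m - (p + 1))%Z with (Z.of_nat m - p - 1)%Z by lia.
      replace (Z.of_nat m + p)%Z with (Z.of_nat m + (p + 1) - 1)%Z by lia.
      rewrite !qfinv_pred. unfold Z.sub. ring. }
    rewrite E, !Cmod_mult.
    assert (B1 : Cmod (qfact (2 * m)) * (Cmod (qfinv (Z.of_nat m + (p + 1))) *
      Cmod (qfinv (Z.of_nat m - p))) <= L).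
    { apply Rle_trans with (U * (V * V)); [|unfold L; lra].
      apply Rmult_le_compat; auto using Cmod_ge_0; [apply Rmult_le_pos; apply Cmod_ge_0|].
      apply Rmult_le_compat; auto using Cmod_ge_0. }
    assert (B2 : Cmod (qz (Z.of_nat m + (p + 1)) - qz (Z.of_nat m + - p)) < eps / L).
    { eapply Rle_lt_trans; [apply Cmod_triangle|]. rewrite Cmod_opp.
      replace (eps / L) with (eps / (2 * L) + eps / (2 * L)) by (field; lra). lra. }
    replace eps with (L * (eps / L)) by (field; lra).
    eapply Rle_lt_trans; [apply Rmult_le_compat_r; [apply Cmod_ge_0|exact B1]|].
    apply Rmult_lt_compat_l; lra. }
  apply (Z.peano_ind (fun n => forall eps, 0 < eps -> exists M : nat, forall m,
    (M <= m)%nat -> Cmod (gbin m n - gbin m 0) < eps)).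
  - intros eps Heps. exists O. intros m _.
    replace (gbin m 0 - gbin m 0)%C with (RtoC 0) by ring. now rewrite Cmod_0.
  - intros p IH eps Heps. destruct (IH (eps / 2)) as [M1 H1]; [lra|].
    destruct (Hstep p (eps / 2)) as [M2 H2]; [lra|].
    exists (Nat.max M1 M2). intros m Hm.
    specialize (H1 m ltac:(lia)). specialize (H2 m ltac:(lia)). unfold Z.succ.
    replace (gbin m (p + 1) - gbin m 0)%C with
      ((gbin m (p + 1) - gbin m p) + (gbin m p - gbin m 0))%C by ring.
    eapply Rle_lt_trans; [apply Cmod_triangle|]. lra.
  - intros p IH eps Heps. destruct (IH (eps / 2)) as [M1 H1]; [lra|].
    destruct (Hstep (Z.pred p) (eps / 2)) as [M2 H2]; [lra|].
    exists (Nat.max M1 M2). intros m Hm.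
    specialize (H1 m ltac:(lia)). specialize (H2 m ltac:(lia)).
    replace (Z.pred p + 1)%Z with p in H2 by lia.
    replace (gbin m (Z.pred p) - gbin m 0)%C with
      (- (gbin m p - gbin m (Z.pred p)) + (gbin m p - gbin m 0))%C by ring.
    eapply Rle_lt_trans; [apply Cmod_triangle|]. rewrite Cmod_opp. lra.
Qed.

(* If theta vanished, subtracting [gbin m 0] times its series from the expansion of the finite
   product would make the latter tend to zero. *)
Lemma vartheta_neq0 : vartheta v tau <> RtoC 0.
Proof.
  intros E0. rewrite vartheta_th3 in E0 by exact Ht.
  assert (E1 : th3 tau (v + tau / 2 + / 2) = 0).
  { apply Cmult_neq_inv_l with (Ci * epi (v + tau / 4))%C.
    - apply Cneq_mult; [apply Ci_neq0|apply epi_neq0].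
    - rewrite E0. ring. }
  assert (E2 : sumZ (fun n => 1 * term n)%C = 0).
  { rewrite <- E1. apply sumZ_ext. intros n. unfold term. do 2 f_equal. field. }
  destruct gbin_bounded as [W [HW HB]].
  destruct triple_lower as [d [Hd Hlow]].
  assert (Hbd : forall m n, Cmod (gbin m n - gbin m 0) <= 2 * W).
  { intros m n. eapply Rle_trans; [apply Cmod_triangle|]. rewrite Cmod_opp.
    pose proof (HB m n). pose proof (HB m 0%Z). lra. }
  assert (S1 : zsummable (fun n => 1 * term n)%C).
  { apply (term_summable (fun _ => RtoC 1) 1). intros; rewrite Cmod_1; lra. }
  assert (Et : forall m, triple m = sumZ (fun n => (gbin m n - gbin m 0) * term n)%C).
  { intros m. rewrite triple_expansion.
    rewrite (sumZ_ext (fun n => (gbin m n - gbin m 0) * term n)%C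
      (fun n => gbin m n * term n - gbin m 0 * (1 * term n))%C) by (intros; ring).
    rewrite sumZ_minus, sumZ_scal, E2; auto.
    - ring.
    - now apply (term_summable _ W).
    - now apply zsummable_scal. }
  assert (Hmaj : major (fun n => 2 * W * Cmod (1 * term n))) by (apply major_scal; [lra|exact S1]).
  assert (Hdom : forall m, dom (fun n => (gbin m n - gbin m 0) * term n)%C
    (fun n => 2 * W * Cmod (1 * term n))).
  { intros m n. rewrite Cmod_mult, Cmult_1_l.
    apply Rmult_le_compat_r; [apply Cmod_ge_0|apply Hbd]. }
  destruct (tannery (fun m n => (gbin m n - gbin m 0) * term n)%C (fun _ => RtoC 0) _ Hmaj Hdom)
    with (eps := d / 3) as [K HK].
  - intros n eps Heps. set (c := Cmod (term n)). assert (0 <= c) by apply Cmod_ge_0.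
    destruct (gbin_diff_lim n (eps / (c + 1))) as [M HM]; [apply Rdiv_lt_0_compat; lra|].
    exists M. intros m Hm. specialize (HM m Hm).
    replace ((gbin m n - gbin m 0) * term n - 0)%C with ((gbin m n - gbin m 0) * term n)%C by ring.
    rewrite Cmod_mult. fold c. pose proof (Cmod_ge_0 (gbin m n - gbin m 0)).
    apply Rle_lt_trans with (Cmod (gbin m n - gbin m 0) * (c + 1)); [nra|].
    replace eps with (eps / (c + 1) * (c + 1)) by (field; lra).
    apply Rmult_lt_compat_r; lra.
  - lra.
  (* Tannery makes the truncated sum smaller than d/3, and the uniform tail bound puts the full sum
     within d/3 of it, against the lower bound d. *)
  - destruct (zsum_uniform _ Hmaj (d / 3)) as [K' HK']; [lra|].
    set (N := Nat.max K K').
    specialize (HK N N N ltac:(lia) ltac:(lia) ltac:(lia)).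
    specialize (HK' _ (Hdom N) N N ltac:(lia) ltac:(lia)).
    specialize (Hlow N). rewrite Et in Hlow.
    assert (Hz : sumZ (fun _ => RtoC 0) = 0).
    { apply is_zsum_sumZ. apply (is_zsum_single (fun _ => RtoC 0) 0). auto. }
    rewrite Hz in HK.
    set (A := Zsum (fun n => (gbin N n - gbin N 0) * term n)%C N N) in *.
    set (S := sumZ (fun n => (gbin N n - gbin N 0) * term n)%C) in *.
    replace S with ((A - 0) - (A - S))%C in Hlow by ring.
    pose proof (Cmod_triangle (A - 0) (- (A - S))) as T. rewrite Cmod_opp in T.
    unfold Cminus at 1 in Hlow. lra.
Qed.
End TripleProduct.

(** * Convolutions and multiple sums *)

Fixpoint iprod (t : nat -> C) (j d : nat) : C :=
  match d with O => RtoC 1 | S d' => (t j * iprod t (S j) d')%C end.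

Fixpoint isum (t : nat -> C) (j d : nat) : C :=
  match d with O => RtoC 0 | S d' => (t j + isum t (S j) d')%C end.

Fixpoint lprod (a : nat -> Z -> C) (j : nat) (l : list Z) : C :=
  match l with nil => RtoC 1 | cons m l' => (a j m * lprod a (S j) l')%C end.

(** The coefficient of total degree m in the product of the d Laurent series with coefficients a_j,
    ..., a_(j+d-1). Peeling off the first series matches the recursions of [mu_prod] and
    [boxsum]. *)
Fixpoint conv (a : nat -> Z -> C) (j d : nat) (m : Z) : C :=
  match d with
  | O => if Z.eq_dec m 0 then RtoC 1 else RtoC 0
  | S d' => sumZ (fun k => a j k * conv a (S j) d' (m - k)%Z)%C
  end.

Lemma Rsum_from_exchange (G : Z -> Z -> R) (a b : Z) (n p : nat) :
  Rsum_from (fun m => Rsum_from (fun k => G k m) b p) a n =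
  Rsum_from (fun k => Rsum_from (G k) a n) b p.
Proof.
  revert a; induction n as [|n IH]; intros a; cbn [Rsum_from].
  - revert b; induction p as [|p IHp]; intros b; cbn [Rsum_from]; [reflexivity|].
    rewrite <- IHp. ring.
  - rewrite IH. rewrite <- Rsum_from_plus. reflexivity.
Qed.

(** Infinite inner sums are replaced by one common finite window, after which the double sums of
    absolute values are finite and can be exchanged. *)
Lemma Rsum_Cmod_sumZ_approx (F : Z -> Z -> C) (n : nat) : (forall m, zsummable (F m)) ->
  forall a e, 0 < e -> exists K : nat,
    Rsum_from (fun m => Cmod (sumZ (F m))) a n <=
    Rsum_from (fun m => Cmod (Zsum (F m) K K)) a n + e.
Proof.
  intros HF a e He.
  assert (H : exists K : nat, forall K', (K <= K')%nat ->
    Rsum_from (fun m => Cmod (sumZ (F m))) a n <=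
    Rsum_from (fun m => Cmod (Zsum (F m) K' K')) a n + e).
  { revert a e He. induction n as [|n IH]; intros a e He; cbn [Rsum_from].
    - exists O. intros; lra.
    - destruct (IH (a + 1)%Z (e / 2)) as [K1 H1]; [lra|].
      destruct (sumZ_correct _ (HF a) (e / 2)) as [K2 H2]; [lra|].
      exists (Nat.max K1 K2). intros K' HK.
      specialize (H1 K' ltac:(lia)). specialize (H2 K' K' ltac:(lia) ltac:(lia)).
      rewrite Cmod_minus_sym in H2.
      pose proof (Cmod_triangle_rev (sumZ (F a)) (Zsum (F a) K' K')). lra. }
  destruct H as [K HK]. exists K. now apply HK.
Qed.

Lemma summable_shift_mult (c f : Z -> C) (b : R) (k : Z) :
  zsummable c -> (forall m, Cmod (f m) <= b) ->
  zsummable (fun m => c (m - k)%Z * f m)%C.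
Proof.
  intros Hc Hf.
  assert (Hb : 0 <= b) by (eapply Rle_trans; [apply Cmod_ge_0|apply (Hf 0%Z)]).
  eapply dom_summable with (g := fun m => b * Cmod (c (m - k)%Z)).
  - intros m. rewrite Cmod_mult, Rmult_comm. apply Rmult_le_compat_r; auto using Cmod_ge_0.
  - apply major_scal; [exact Hb|]. exact (major_shift _ (- k) Hc).
Qed.

Lemma summable_mult_bounded (a f : Z -> C) (b : R) :
  zsummable a -> (forall m, Cmod (f m) <= b) -> zsummable (fun m => a m * f m)%C.
Proof.
  intros Ha Hf. apply (zsummable_ext (fun m => a (m - 0)%Z * f m)%C).
  - intros m. now rewrite Z.sub_0_r.
  - now apply summable_shift_mult with b.
Qed.

Lemma summable_bounded (c : Z -> C) : zsummable c -> exists b, forall m, Cmod (c m) <= b.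
Proof.
  intros [_ [b Hb]]. exists b. intros m. pose proof (Hb m 1%nat) as H. simpl in H. lra.
Qed.

Lemma convolution_summable (a c : Z -> C) : zsummable a -> zsummable c ->
  zsummable (fun m => sumZ (fun k => a k * c (m - k)%Z)%C).
Proof.
  intros Ha Hc. destruct (summable_bounded c Hc) as [M HM].
  assert (HF : forall m, zsummable (fun k => a k * c (m - k)%Z)%C).
  { intros m. apply (summable_mult_bounded a (fun k => c (m - k)%Z) M Ha). auto. }
  pose proof Ha as [_ [A HA]]. pose proof Hc as [_ [B HB]].
  assert (HB0 : 0 <= B) by (eapply Rle_trans; [|apply (HB 0%Z O)]; simpl; lra).
  split; [intros; apply Cmod_ge_0|]. exists (A * B). intros s n.
  apply Rle_plus_epsilon. intros e He.
  destruct (Rsum_Cmod_sumZ_approx (fun m k => a k * c (m - k)%Z)%C n HF s e He) as [K HK].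
  eapply Rle_trans; [exact HK|]. apply Rplus_le_compat_r.
  eapply Rle_trans.
  { apply Rsum_from_le. intros m. unfold Zsum.
    apply Cmod_Csum_from_le with (g := fun k => Cmod (a k) * Cmod (c (m - k)%Z)).
    intros k. rewrite Cmod_mult. lra. }
  rewrite (Rsum_from_exchange (fun k m => Cmod (a k) * Cmod (c (m - k)%Z))).
  eapply Rle_trans.
  { apply Rsum_from_le with (h := fun k => B * Cmod (a k)). intros k.
    rewrite Rsum_from_scal, Rmult_comm.
    rewrite (Rsum_from_shift (fun m => Cmod (c m)) (- k)).
    apply Rmult_le_compat_r; [apply Cmod_ge_0|apply HB]. }
  rewrite Rsum_from_scal, Rmult_comm. apply Rmult_le_compat_r; [exact HB0|apply HA].
Qed.

(** The bounded weight [f] sees only the total index. With f = 1 this is multiplicativity of sums;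
    with f a value of [phi] it regroups the sum for mu_N by total degree. *)
Lemma convolution_sum (a c f : Z -> C) (b : R) : zsummable a -> zsummable c ->
  (forall m, Cmod (f m) <= b) ->
  sumZ (fun k => a k * sumZ (fun m => c m * f (k + m)%Z))%C =
  sumZ (fun m => sumZ (fun k => a k * c (m - k)%Z) * f m)%C.
Proof.
  intros Ha Hc Hf. destruct (summable_bounded c Hc) as [M HM].
  assert (Hb : 0 <= b) by (eapply Rle_trans; [apply Cmod_ge_0|apply (Hf 0%Z)]).
  pose proof Hc as [_ [B HB]].
  assert (HB0 : 0 <= B) by (eapply Rle_trans; [|apply (HB 0%Z O)]; simpl; lra).
  set (F := fun k m => (a k * (c (m - k)%Z * f m))%C).
  assert (HFk : forall k, zsummable (F k)).
  { intros k. apply zsummable_scal. now apply summable_shift_mult with b. }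
  assert (Hac : forall m, zsummable (fun k => a k * c (m - k)%Z)%C).
  { intros m. apply (summable_mult_bounded a (fun k => c (m - k)%Z) M Ha). auto. }
  assert (HFm : forall m, zsummable (fun k => F k m)).
  { intros m. apply (zsummable_ext (fun k => f m * (a k * c (m - k)%Z))%C).
    - intros; unfold F; ring.
    - now apply zsummable_scal. }
  assert (Hg : forall k s n, Rsum_from (fun m => Cmod (F k m)) s n <= b * B * Cmod (a k)).
  { intros k s n. eapply Rle_trans.
    - apply Rsum_from_le with (h := fun m => (b * Cmod (a k)) * Cmod (c (m - k)%Z)).
      intros m. unfold F. rewrite !Cmod_mult. specialize (Hf m).
      pose proof (Cmod_ge_0 (a k)). pose proof (Cmod_ge_0 (c (m - k)%Z)).
      pose proof (Rmult_le_pos _ _ H H0). nra.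
    - rewrite Rsum_from_scal, (Rsum_from_shift (fun m => Cmod (c m)) (- k)).
      replace (b * B * Cmod (a k)) with (b * Cmod (a k) * B) by ring.
      apply Rmult_le_compat_l; [|apply HB]. apply Rmult_le_pos; [exact Hb|apply Cmod_ge_0]. }
  pose proof (sumZ_fubini F (fun k => b * B * Cmod (a k))
    ltac:(apply major_scal; [nra|exact Ha]) HFk Hg HFm) as HFub.
  apply is_zsum_sumZ in HFub.
  transitivity (sumZ (fun k => sumZ (F k))).
  - apply sumZ_ext. intros k. unfold F. rewrite sumZ_scal.
    + f_equal.
      rewrite (sumZ_ext (fun m => c m * f (k + m)%Z)%C
        (fun m => c (m + k - k)%Z * f (m + k)%Z)%C)
        by (intros m; now rewrite Z.add_simpl_r, Z.add_comm).
      apply (sumZ_shift (fun m => c (m - k)%Z * f m)%C k).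
      now apply summable_shift_mult with b.
    + now apply summable_shift_mult with b.
  - rewrite <- HFub. apply sumZ_ext. intros m. unfold F.
    rewrite (sumZ_ext _ (fun k => f m * (a k * c (m - k)%Z))%C) by (intros; ring).
    rewrite sumZ_scal by auto. ring.
Qed.

Lemma conv_summable (a : nat -> Z -> C) (d : nat) : (forall j, zsummable (a j)) ->
  forall j, zsummable (conv a j d).
Proof.
  intros Ha. induction d as [|d IH]; intros j; cbn [conv].
  - apply (zsummable_ext (fun m => if Z.eq_dec m 0 then RtoC 1 else RtoC 0));
      [reflexivity|].
    eapply dom_summable; [|apply major_exp_abs]. intros m. cbv beta.
    destruct (Z.eq_dec m 0) as [->|H].
    + rewrite Cmod_1, Rabs_R0, Ropp_0, exp_0. lra.
    + rewrite Cmod_0. left; apply exp_pos.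
  - apply convolution_summable; auto.
Qed.

Lemma conv_sum (a : nat -> Z -> C) (d : nat) : (forall j, zsummable (a j)) ->
  forall j, sumZ (conv a j d) = iprod (fun i => sumZ (a i)) j d.
Proof.
  intros Ha. induction d as [|d IH]; intros j; cbn [conv iprod].
  - apply is_zsum_sumZ.
    apply (is_zsum_single (fun m => if Z.eq_dec m 0 then RtoC 1 else RtoC 0) 0).
    intros m Hm. now destruct (Z.eq_dec m 0).
  - pose proof (convolution_sum (a j) (conv a (S j) d) (fun _ => RtoC 1) 1 (Ha j)
      (conv_summable a d Ha (S j)) ltac:(intros; cbv beta; rewrite Cmod_1; lra)) as H.
    rewrite (sumZ_ext (fun m => sumZ (fun k => a j k * conv a (S j) d (m - k)%Z)%C)
      (fun m => sumZ (fun k => a j k * conv a (S j) d (m - k)%Z) * 1)%C) by (intros; ring).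
    rewrite <- H.
    rewrite (sumZ_ext (fun m => conv a (S j) d m * 1)%C (conv a (S j) d)) by (intros; ring).
    rewrite IH.
    rewrite (sumZ_ext _ (fun k => iprod (fun i => sumZ (a i)) (S j) d * a j k)%C)
      by (intros; ring).
    rewrite sumZ_scal by auto. ring.
Qed.

Lemma conv_ext (a b : nat -> Z -> C) (d j : nat) :
  (forall i k, (j <= i)%nat -> a i k = b i k) -> forall m, conv a j d m = conv b j d m.
Proof.
  revert j. induction d as [|d IH]; intros j H m; cbn [conv]; [reflexivity|].
  apply sumZ_ext. intros k. rewrite H, (IH (S j)) by auto with arith. reflexivity.
Qed.

Lemma iprod_ext (f g : nat -> C) (d j : nat) :
  (forall i, (j <= i < j + d)%nat -> f i = g i) -> iprod f j d = iprod g j d.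
Proof.
  revert j. induction d as [|d IH]; intros j H; cbn [iprod]; [reflexivity|].
  rewrite H, (IH (S j)) by (intros; try apply H; lia). reflexivity.
Qed.

Lemma iprod_mult (f g : nat -> C) (j d : nat) :
  iprod (fun i => f i * g i)%C j d = (iprod f j d * iprod g j d)%C.
Proof. revert j; induction d as [|d IH]; intros j; cbn [iprod]; [ring|]. rewrite IH. ring. Qed.

Lemma iprod_epi (f : nat -> C) (j d : nat) :
  iprod (fun i => epi (f i)) j d = epi (isum f j d).
Proof.
  revert j; induction d as [|d IH]; intros j; cbn [iprod isum].
  - symmetry; apply epi_0.
  - now rewrite IH, epi_plus.
Qed.

Lemma iprod_neq0 (f : nat -> C) (d j : nat) :
  (forall i, (j <= i < j + d)%nat -> f i <> RtoC 0) -> iprod f j d <> RtoC 0.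
Proof.
  revert j. induction d as [|d IH]; intros j H; cbn [iprod]; [apply RtoC_neq; lra|].
  apply Cneq_mult; [apply H; lia|]. apply IH. intros; apply H; lia.
Qed.

Lemma iprod_inv (f : nat -> C) (d j : nat) :
  (forall i, (j <= i < j + d)%nat -> f i <> RtoC 0) ->
  iprod (fun i => / f i)%C j d = (/ iprod f j d)%C.
Proof.
  revert j. induction d as [|d IH]; intros j H; cbn [iprod]; [field|].
  rewrite IH by (intros; apply H; lia).
  field. split; [apply iprod_neq0; intros|]; apply H; lia.
Qed.

Lemma isum_ext (f g : nat -> C) (d j : nat) : (forall i, f i = g i) -> isum f j d = isum g j d.
Proof.
  intros H. revert j; induction d as [|d IH]; intros j; cbn [isum]; [reflexivity|].
  now rewrite H, IH.
Qed.

Lemma isum_scal (a : C) (u : nat -> C) (j d : nat) :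
  isum (fun i => u i * a)%C j d = (isum u j d * a)%C.
Proof.
  revert j; induction d as [|d IH]; intros j; cbn [isum]; [ring|]. rewrite IH. ring.
Qed.

Lemma isum_const (a : C) (j d : nat) : isum (fun _ => a) j d = (zc (Z.of_nat d) * a)%C.
Proof.
  revert j; induction d as [|d IH]; intros j; cbn [isum]; [simpl; ring|].
  rewrite IH. replace (Z.of_nat (S d)) with (Z.of_nat d + 1)%Z by lia. rewrite zc_plus. ring.
Qed.

Lemma isum_add_const (a : C) (u : nat -> C) (j d : nat) :
  isum (fun i => a + u i)%C j d = (zc (Z.of_nat d) * a + isum u j d)%C.
Proof.
  rewrite <- (isum_const a j). revert j; induction d as [|d IH]; intros j; cbn [isum]; [ring|].
  rewrite IH. ring.
Qed.

(** k -> e^(pi i k y) is a character, so its product over all indices depends on the total degree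
    only. *)
Lemma conv_twist (a : nat -> Z -> C) (t : nat -> C) (y : C) (d : nat) :
  (forall j, zsummable (a j)) -> forall j m,
  conv (fun i k => t i * (epi (zc k * y) * a i k))%C j d m =
  (iprod t j d * (epi (zc m * y) * conv a j d m))%C.
Proof.
  intros Ha. induction d as [|d IH]; intros j m; cbn [conv iprod].
  - destruct (Z.eq_dec m 0) as [->|H].
    + replace (zc 0 * y)%C with (RtoC 0) by ring. rewrite epi_0. ring.
    + ring.
  - rewrite (sumZ_ext _ (fun k => (t j * iprod t (S j) d * epi (zc m * y)) *
      (a j k * conv a (S j) d (m - k)%Z))%C).
    + rewrite sumZ_scal.
      * ring.
      * destruct (summable_bounded _ (conv_summable a d Ha (S j))) as [M HM].
        apply (summable_mult_bounded (a j) (fun k => conv a (S j) d (m - k)%Z) M (Ha j)). auto.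
    + intros k. rewrite IH.
      replace (zc m * y)%C with (zc k * y + zc (m - k) * y)%C by (rewrite zc_minus; ring).
      rewrite epi_plus. ring.
Qed.

Lemma conv_modulate (a : nat -> Z -> C) (y : C) (d j : nat) (m : Z) :
  (forall j, zsummable (a j)) ->
  conv (fun i k => epi (zc k * y) * a i k)%C j d m = (epi (zc m * y) * conv a j d m)%C.
Proof.
  intros Ha. transitivity (conv (fun i k => epi 0 * (epi (zc k * y) * a i k))%C j d m).
  - apply conv_ext. intros. rewrite epi_0. ring.
  - rewrite (conv_twist a (fun _ => epi 0)) by exact Ha.
    rewrite iprod_epi, isum_const, Cmult_0_r, epi_0. ring.
Qed.

(** Raising each of the d indices by one raises the degree by d. The exponents of the multipliers
    are affine in the indices with the same slope, so their sum depends on the total degree only and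
    leaves the convolution. *)
Lemma conv_shift (a : nat -> Z -> C) (u : nat -> C) (tau : C) (d : nat) :
  (forall j, zsummable (a j)) ->
  (forall j k, a j (k + 1)%Z = (epi (1 - 2 * u j + (2 * zc k + 1) * tau) * a j k)%C) ->
  forall j m, conv a j d (m + Z.of_nat d)%Z =
    (epi (zc (Z.of_nat d) - 2 * isum u j d + (2 * zc m + zc (Z.of_nat d)) * tau)
      * conv a j d m)%C.
Proof.
  intros Ha Hu. induction d as [|d IH]; intros j m; cbn [conv isum].
  - rewrite Z.add_0_r. destruct (Z.eq_dec m 0) as [->|H]; [|ring].
    simpl. replace (0 - 2 * 0 + (2 * 0 + 0) * tau)%C with (RtoC 0) by ring.
    rewrite epi_0. ring.
  - destruct (summable_bounded _ (conv_summable a d Ha (S j))) as [M HM].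
    rewrite <- sumZ_scal.
    2: { apply (summable_mult_bounded (a j) (fun k => conv a (S j) d (m - k)%Z) M (Ha j)). auto. }
    rewrite <- (sumZ_shift _ 1).
    2: { apply (summable_mult_bounded (a j)
           (fun k => conv a (S j) d (m + Z.of_nat (S d) - k)%Z) M (Ha j)). auto. }
    apply sumZ_ext. intros k. rewrite Hu.
    replace (m + Z.of_nat (S d) - (k + 1))%Z with (m - k + Z.of_nat d)%Z by lia.
    rewrite IH.
    replace (Z.of_nat (S d)) with (Z.of_nat d + 1)%Z by lia. rewrite zc_plus, zc_minus.
    replace (zc (Z.of_nat d) + zc 1 - 2 * (u j + isum u (S j) d) +
      (2 * zc m + (zc (Z.of_nat d) + zc 1)) * tau)%C with
      ((1 - 2 * u j + (2 * zc k + 1) * tau) + (zc (Z.of_nat d) - 2 * isum u (S j) d +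
       (2 * (zc m - zc k) + zc (Z.of_nat d)) * tau))%C by ring.
    rewrite (epi_plus (1 - 2 * u j + (2 * zc k + 1) * tau)). ring.
Qed.

Lemma boxsum_ext (d K : nat) : forall f g, (forall l, f l = g l) -> boxsum d K f = boxsum d K g.
Proof.
  induction d as [|d IH]; intros f g H; cbn [boxsum]; [apply H|].
  apply Csum_from_ext. intros m _. apply IH. auto.
Qed.

Lemma boxsum_scal (d K : nat) (c : C) : forall f,
  boxsum d K (fun l => c * f l)%C = (c * boxsum d K f)%C.
Proof.
  induction d as [|d IH]; intros f; cbn [boxsum]; [reflexivity|].
  unfold Zpart. rewrite <- Csum_from_scal. apply Csum_from_ext. intros m _. apply IH.
Qed.

(** Induction over the dimension. The offset [m0] records the indices already chosen, and the bound
    [M], uniform in the box and in the offset, is the majorant that [tannery] requires in the next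
    dimension. *)
Lemma boxsum_lim (a : nat -> Z -> C) (d : nat) : (forall j, zsummable (a j)) ->
  forall (j : nat) (f : Z -> C) (b : R), (forall m, Cmod (f m) <= b) ->
  (exists M, forall K m0, Cmod (boxsum d K (fun l => f (m0 + Zlsum l)%Z * lprod a j l)%C) <= M) /\
  (forall m0 eps, 0 < eps -> exists K0 : nat, forall K, (K0 <= K)%nat ->
    Cmod (boxsum d K (fun l => f (m0 + Zlsum l)%Z * lprod a j l)%C -
      sumZ (fun m => conv a j d m * f (m0 + m)%Z))%C < eps).
Proof.
  intros Ha. induction d as [|d IH]; intros j f b Hf.
  - cbn [boxsum lprod Zlsum fold_right conv]. split.
    + exists b. intros _ m0. rewrite Z.add_0_r, Cmult_1_r. apply Hf.
    + intros m0 eps Heps. exists O. intros K _.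
      replace (sumZ (fun m => (if Z.eq_dec m 0 then RtoC 1 else RtoC 0) * f (m0 + m)%Z)%C) with
        (f (m0 + 0)%Z).
      * replace (f (m0 + 0)%Z * 1 - f (m0 + 0)%Z)%C with (RtoC 0) by ring.
        now rewrite Cmod_0.
      * symmetry. apply is_zsum_sumZ.
        pose proof (is_zsum_single (fun m => (if Z.eq_dec m 0 then RtoC 1 else RtoC 0)
          * f (m0 + m)%Z)%C 0) as H.
        cbv beta in H. simpl Z.eq_dec in H. cbn iota in H. rewrite Cmult_1_l in H. apply H.
        intros m Hm. destruct (Z.eq_dec m 0); [easy|ring].
  - destruct (IH (S j) f b Hf) as [[M HM] Hlim].
    assert (HM0 : 0 <= M) by (eapply Rle_trans; [apply Cmod_ge_0|apply (HM O 0%Z)]).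
    assert (E : forall K m0, boxsum (S d) K (fun l => f (m0 + Zlsum l)%Z * lprod a j l)%C =
      Zpart (fun m => a j m * boxsum d K (fun l => f (m0 + m + Zlsum l)%Z
        * lprod a (S j) l))%C K).
    { intros K m0. cbn [boxsum]. apply Csum_from_ext. intros m _.
      rewrite <- boxsum_scal. apply boxsum_ext. intros l. cbn [lprod Zlsum fold_right].
      fold (Zlsum l). rewrite Z.add_assoc. ring. }
    assert (Hmaj : major (fun m => M * Cmod (a j m))) by (apply major_scal; auto; apply Ha).
    assert (Hd : forall K m0, dom (fun m => a j m * boxsum d K (fun l => f (m0 + m + Zlsum l)%Z
        * lprod a (S j) l))%C (fun m => M * Cmod (a j m))).
    { intros K m0 m. rewrite Cmod_mult, Rmult_comm.
      apply Rmult_le_compat_r; [apply Cmod_ge_0|apply HM]. }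
    split.
    + destruct Hmaj as [_ [B HB]]. exists B. intros K m0. rewrite E.
      eapply Rle_trans; [apply Cmod_Csum_from_le, Hd|apply HB].
    + intros m0 eps Heps.
      destruct (tannery (fun K m => a j m * boxsum d K (fun l => f (m0 + m + Zlsum l)%Z
          * lprod a (S j) l))%C (fun m => a j m * sumZ (fun p => conv a (S j) d p
          * f (m0 + m + p)%Z))%C _ Hmaj (fun K => Hd K m0)) with (eps := eps) as [K0 HK0].
      * intros m e He. set (c := Cmod (a j m)). assert (0 <= c) by apply Cmod_ge_0.
        destruct (Hlim (m0 + m)%Z (e / (c + 1))) as [K1 H1]; [apply Rdiv_lt_0_compat; lra|].
        exists K1. intros K HK. specialize (H1 K HK).
        match goal with |- Cmod (_ * ?x - _ * ?y)%C < _ =>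
          replace (a j m * x - a j m * y)%C with (a j m * (x - y))%C by ring;
          set (z := (x - y)%C) in * end.
        rewrite Cmod_mult. fold c. pose proof (Cmod_ge_0 z).
        apply Rle_lt_trans with ((c + 1) * Cmod z); [nra|].
        replace e with ((c + 1) * (e / (c + 1))) by (field; lra).
        apply Rmult_lt_compat_l; lra.
      * exact Heps.
      * exists K0. intros K HK. rewrite E, Zpart_Zsum.
        specialize (HK0 K K (S K) HK HK ltac:(lia)).
        rewrite (sumZ_ext _ (fun m => a j m * sumZ (fun p => conv a (S j) d p
          * f (m0 + (m + p))%Z))%C) in HK0
          by (intros m; f_equal; apply sumZ_ext; intros p; now rewrite Z.add_assoc).
        rewrite (convolution_sum (a j) (conv a (S j) d) (fun m => f (m0 + m)%Z) b) in HK0;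
          auto using conv_summable.
Qed.

Lemma sumZd_conv (a : nat -> Z -> C) (d : nat) (f : Z -> C) (b : R) (j : nat) :
  (forall j, zsummable (a j)) -> (forall m, Cmod (f m) <= b) ->
  sumZd d (fun l => f (Zlsum l) * lprod a j l)%C = sumZ (fun m => conv a j d m * f m)%C.
Proof.
  intros Ha Hf. apply Clim_of. exact (proj2 (boxsum_lim a d Ha j f b Hf) 0%Z).
Qed.

(** * Residue classes and uniqueness of trigonometric series *)

Lemma Csumn_ext (n : nat) (f g : nat -> C) : (forall i, (i < n)%nat -> f i = g i) ->
  Csumn n f = Csumn n g.
Proof.
  induction n as [|n IH]; intros H; simpl; [reflexivity|].
  rewrite IH, H; auto.
Qed.

Lemma Csumn_scal (n : nat) (c : C) (f : nat -> C) :
  Csumn n (fun i => c * f i)%C = (c * Csumn n f)%C.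
Proof. induction n as [|n IH]; simpl; [ring|]. rewrite IH. ring. Qed.

Lemma Csumn_plus (n : nat) (f g : nat -> C) :
  Csumn n (fun i => f i + g i)%C = (Csumn n f + Csumn n g)%C.
Proof. induction n as [|n IH]; simpl; [ring|]. rewrite IH. ring. Qed.

Lemma Csumn_exchange (n p : nat) (f : nat -> nat -> C) :
  Csumn n (fun i => Csumn p (f i)) = Csumn p (fun k => Csumn n (fun i => f i k)).
Proof.
  induction n as [|n IH]; simpl.
  - induction p as [|p IHp]; simpl; [reflexivity|]. rewrite <- IHp. ring.
  - rewrite IH, <- Csumn_plus. reflexivity.
Qed.

Lemma sumZ_Csumn (n : nat) (F : nat -> Z -> C) : (forall i, zsummable (F i)) ->
  zsummable (fun m => Csumn n (fun i => F i m)) /\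
  sumZ (fun m => Csumn n (fun i => F i m)) = Csumn n (fun i => sumZ (F i)).
Proof.
  intros HF. induction n as [|n [IH1 IH2]]; cbn [Csumn].
  - split.
    + apply (zsummable_ext (fun m => 0 * F O m)%C); [intros; ring|]. now apply zsummable_scal.
    + rewrite (sumZ_ext _ (fun m => 0 * F O m)%C) by (intros; ring).
      rewrite sumZ_scal by auto. ring.
  - split; [now apply zsummable_plus|]. now rewrite sumZ_plus, IH2.
Qed.

Lemma Csum_from_block (F : Z -> C) (N : nat) (a : Z) (n : nat) :
  Csum_from F (Z.of_nat N * a) (N * n) =
  Csumn N (fun r => Csum_from (fun p => F (Z.of_nat r + Z.of_nat N * p)%Z) a n).
Proof.
  revert a; induction n as [|n IH]; intros a; cbn [Csum_from].
  - rewrite Nat.mul_0_r. simpl. clear. induction N as [|N IHN]; simpl; [reflexivity|].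
    rewrite <- IHN. ring.
  - replace (N * S n)%nat with (N + N * n)%nat by lia.
    rewrite Csum_from_app, Csumn_plus.
    replace (Z.of_nat N * a + Z.of_nat N)%Z with (Z.of_nat N * (a + 1))%Z by lia.
    rewrite IH. f_equal. generalize (Z.of_nat N * a)%Z. intros b. clear.
    induction N as [|N IHN]; [reflexivity|].
    rewrite Csum_from_last, IHN. cbn [Csumn]. f_equal. f_equal. lia.
Qed.

Lemma Rsum_from_sub (g : Z -> R) (N r : nat) (a : Z) (n : nat) : (r < N)%nat ->
  (forall m, 0 <= g m) ->
  Rsum_from (fun p => g (Z.of_nat r + Z.of_nat N * p)%Z) a n <=
  Rsum_from g (Z.of_nat N * a) (N * n).
Proof.
  intros Hr Hg. revert a; induction n as [|n IH]; intros a; cbn [Rsum_from].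
  - rewrite Nat.mul_0_r. simpl. lra.
  - replace (N * S n)%nat with (r + (1 + ((N - r - 1) + N * n)))%nat by nia.
    rewrite !Rsum_from_app. cbn [Rsum_from Nat.add].
    specialize (IH (a + 1)%Z).
    replace (Z.of_nat N * a + Z.of_nat r + Z.of_nat 1 + Z.of_nat (N - r - 1))%Z with
      (Z.of_nat N * (a + 1))%Z by lia.
    replace (Z.of_nat N * a + Z.of_nat r)%Z with (Z.of_nat r + Z.of_nat N * a)%Z by lia.
    pose proof (Rsum_from_nonneg g (Z.of_nat N * a) r Hg).
    pose proof (Rsum_from_nonneg g (Z.of_nat r + Z.of_nat N * a + Z.of_nat 1) (N - r - 1) Hg).
    lra.
Qed.

Lemma zsummable_sub (F : Z -> C) (N r : nat) : (r < N)%nat -> zsummable F ->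
  zsummable (fun p => F (Z.of_nat r + Z.of_nat N * p)%Z).
Proof.
  intros Hr [Hp [b Hb]]. split; [intros; apply Cmod_ge_0|]. exists b. intros a n.
  eapply Rle_trans; [|apply (Hb (Z.of_nat N * a)%Z (N * n)%nat)].
  apply (Rsum_from_sub (fun m => Cmod (F m)) N r a n Hr Hp).
Qed.

(** Windows from -N A to N B consist of complete blocks and split exactly into residue classes; the
    limit may be read along them. *)
Lemma sumZ_mod (F : Z -> C) (N : nat) : (1 <= N)%nat -> zsummable F ->
  sumZ F = Csumn N (fun r => sumZ (fun p => F (Z.of_nat r + Z.of_nat N * p)%Z)).
Proof.
  intros HN HF.
  assert (Hlim : forall n, (n <= N)%nat -> is_zsum (fun p => Csumn n (fun r =>
      F (Z.of_nat r + Z.of_nat N * p)%Z))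
    (Csumn n (fun r => sumZ (fun p => F (Z.of_nat r + Z.of_nat N * p)%Z)))).
  { induction n as [|n IH]; intros Hn; cbn [Csumn].
    - apply (is_zsum_single (fun _ => RtoC 0) 0). auto.
    - apply is_zsum_plus; [apply IH; lia|]. apply sumZ_correct.
      apply zsummable_sub; [lia|exact HF]. }
  specialize (Hlim N (le_n N)).
  eapply is_zsum_unique; [|exact Hlim].
  intros eps Heps. destruct (sumZ_correct F HF eps Heps) as [K HK].
  exists K. intros A B HA HB.
  specialize (HK (N * A)%nat (N * B)%nat ltac:(nia) ltac:(nia)).
  unfold Zsum in *. rewrite <- Nat.mul_add_distr_l in HK.
  replace (- Z.of_nat (N * A))%Z with (Z.of_nat N * - Z.of_nat A)%Z in HK by lia.
  rewrite Csum_from_block in HK.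
  replace (Csum_from (fun p => Csumn N (fun r => F (Z.of_nat r + Z.of_nat N * p)%Z))
    (- Z.of_nat A) (A + B)) with
    (Csumn N (fun r => Csum_from (fun p => F (Z.of_nat r + Z.of_nat N * p)%Z)
      (- Z.of_nat A) (A + B))); [exact HK|].
  generalize (- Z.of_nat A)%Z (A + B)%nat. clear. intros a n. revert a.
  induction n as [|n IH]; intros a; cbn [Csum_from].
  - clear. induction N as [|N IHN]; simpl; [reflexivity|]. rewrite IHN. ring.
  - rewrite Csumn_plus, IH. reflexivity.
Qed.

Lemma Ccont_trig_series (c : Z -> C) : zsummable c ->
  Ccont (fun x => sumZ (fun m => c m * epi (2 * zc m * RtoC x))%C).
Proof.
  intros Hc x eps Heps.
  set (f := fun x m => (c m * epi (2 * zc m * RtoC x))%C).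
  assert (Hd : forall x, dom (f x) (fun m => Cmod (c m))).
  { intros y m. unfold f. rewrite Cmod_mult, Cmod_epi.
    replace (2 * zc m * RtoC y)%C with (RtoC (2 * IZR m * y)) by (rewrite !RtoC_mult; reflexivity).
    simpl. rewrite Rmult_0_r, exp_0. lra. }
  destruct (zsum_uniform _ Hc (eps / 4)) as [K HK]; [lra|].
  destruct (Csum_from_CRInt (fun m x => f x m) (- Z.of_nat K) (K + K) 0 1) as [HC _].
  { intros m. unfold f. apply Ccont_mult; [apply Ccont_const|apply Ccont_epi_lin]. }
  destruct (HC x (eps / 4)) as [d [Hdp Hy]]; [lra|].
  exists d. split; [exact Hdp|]. intros y Hxy. specialize (Hy y Hxy).
  change (Cmod (Zsum (f y) K K - Zsum (f x) K K) < eps / 4) in Hy.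
  pose proof (HK (f y) (Hd y) K K (le_n _) (le_n _)) as E1.
  pose proof (HK (f x) (Hd x) K K (le_n _) (le_n _)) as E2.
  change (Cmod (sumZ (f y) - sumZ (f x)) < eps).
  replace (sumZ (f y) - sumZ (f x))%C with (- (Zsum (f y) K K - sumZ (f y)) +
    ((Zsum (f y) K K - Zsum (f x) K K) + (Zsum (f x) K K - sumZ (f x))))%C by ring.
  eapply Rle_lt_trans; [apply Cmod_triangle|].
  eapply Rle_lt_trans; [apply Rplus_le_compat_l, Cmod_triangle|].
  rewrite Cmod_opp. lra.
Qed.

Lemma trig_series_unique (c b : Z -> C) : zsummable c -> zsummable b ->
  (forall x : R, sumZ (fun m => c m * epi (2 * zc m * RtoC x))%C =
     sumZ (fun m => b m * epi (2 * zc m * RtoC x))%C) ->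
  forall n, c n = b n.
Proof.
  intros Hc Hb H n.
  rewrite <- (fourier_coeff c n Hc (Ccont_trig_series c Hc)).
  rewrite <- (fourier_coeff b n Hb (Ccont_trig_series b Hb)).
  apply CRInt_ext. intros x. now rewrite H.
Qed.

(** * Reduction of the multivariable sum to level one *)

(** (-1)^k q^(k^2/2) e^(-2 pi i k u_j). The factor q^(k/2) also present in mu_N depends on the total
    degree after multiplication and goes into [phi]. *)
Definition gcoef (us : nat -> C) (tau : C) (j : nat) (k : Z) : C :=
  epi (zc k + zc k * zc k * tau - 2 * zc k * us j).

Definition coefs (N : nat) (us : nat -> C) (tau : C) : Z -> C := conv (gcoef us tau) 1 N.

Definition Xser (N : nat) (u0 : C) (us : nat -> C) (tau : C) : C :=
  sumZ (fun m => coefs N us tau m * phi (u0 + zc m * tau))%C.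

Lemma gcoef_summable (us : nat -> C) (tau : C) (j : nat) : 0 < Im tau ->
  zsummable (gcoef us tau j).
Proof.
  intros Ht. eapply zsummable_ext; [|apply (th3_summable tau (- us j + / 2) Ht)].
  intros k. unfold gcoef. rewrite Cmult_1_l. f_equal. field.
Qed.

Lemma gcoef_shift (us : nat -> C) (tau : C) (j : nat) (k : Z) :
  gcoef us tau j (k + 1) = (epi (1 - 2 * us j + (2 * zc k + 1) * tau) * gcoef us tau j k)%C.
Proof. unfold gcoef. rewrite <- epi_plus, zc_plus. f_equal. ring. Qed.

Lemma coefs_summable (N : nat) (us : nat -> C) (tau : C) : 0 < Im tau ->
  zsummable (coefs N us tau).
Proof. intros Ht. apply conv_summable. intros; now apply gcoef_summable. Qed.

Lemma Xser_summable (N : nat) (u0 : C) (us : nat -> C) (tau : C) : 0 < Im tau ->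
  zsummable (fun m => coefs N us tau m * phi (u0 + zc m * tau))%C.
Proof.
  intros Ht. destruct (phi_lattice_bounded u0 tau Ht) as [b Hb].
  apply summable_mult_bounded with b; [now apply coefs_summable|exact Hb].
Qed.

Lemma sumZd_ext (d : nat) (f g : list Z -> C) : (forall l, f l = g l) -> sumZd d f = sumZd d g.
Proof.
  intros H. unfold sumZd. f_equal. apply FunctionalExtensionality.functional_extensionality.
  intros K. now apply boxsum_ext.
Qed.

(** The trivial factor [epi (zc k * 0)] gives the coefficients the shape expected by [conv_twist],
    with y = 0. *)
Lemma mu_prod_lprod (us : nat -> C) (tau : C) (l : list Z) : forall j,
  mu_prod us tau j l = (epi (zc (Zlsum l) * tau) *
    lprod (fun i k => / vartheta (us i) tau * (epi (zc k * 0) * gcoef us tau i k)) j l)%C.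
Proof.
  induction l as [|m l IH]; intros j; cbn [mu_prod lprod Zlsum fold_right].
  - replace (0 * tau)%C with (RtoC 0) by ring. rewrite epi_0. ring.
  - fold (Zlsum l). rewrite IH, msign_epi. unfold qpow. rewrite !ee_epi, zc_plus.
    replace ((zc m + zc (Zlsum l)) * tau)%C with (zc m * tau + zc (Zlsum l) * tau)%C by ring.
    replace (zc m * 0)%C with (RtoC 0) by ring.
    rewrite epi_plus, epi_0. unfold gcoef, Cdiv.
    assert (E : (epi (zc m) * epi (2 * - (zc m * us j)) *
      epi (2 * (RtoC (IZR m * (IZR m + 1) / 2) * tau)) = epi (zc m * tau) *
      epi (zc m + zc m * zc m * tau - 2 * zc m * us j))%C).
    { rewrite <- !epi_plus. f_equal.
      rewrite RtoC_div, RtoC_mult, RtoC_plus by lra. field. }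
    rewrite E. ring.
Qed.

Lemma muN_Xser (N : nat) (us : nat -> C) (tau : C) : 0 < Im tau ->
  muN N us tau = (iprod (fun j => / vartheta (us j) tau) 1 N * Xser N (us O) us tau)%C.
Proof.
  intros Ht. destruct (phi_lattice_bounded (us O) tau Ht) as [b Hb].
  set (a := fun i k => (/ vartheta (us i) tau * (epi (zc k * 0) * gcoef us tau i k))%C).
  assert (Ha : forall j, zsummable (a j)).
  { intros j. apply zsummable_scal.
    eapply zsummable_ext; [|apply (gcoef_summable us tau j Ht)].
    intros k. replace (zc k * 0)%C with (RtoC 0) by ring. rewrite epi_0. ring. }
  transitivity (sumZ (fun m => conv a 1 N m * phi (us O + zc m * tau))%C).
  - unfold muN.
    rewrite <- (sumZd_conv a N (fun m => phi (us O + zc m * tau)) b 1 Ha Hb).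
    apply sumZd_ext. intros l. rewrite mu_prod_lprod. fold a.
    unfold phi, qpow. rewrite !ee_epi. fold (epi (us O)).
    replace (2 * (us O + zc (Zlsum l) * tau))%C with
      (2 * us O + 2 * (zc (Zlsum l) * tau))%C by ring.
    rewrite (epi_plus (2 * us O)), (epi_plus (us O)). unfold Cdiv. ring.
  - unfold Xser. rewrite <- sumZ_scal by now apply Xser_summable.
    apply sumZ_ext. intros m. unfold a, coefs.
    rewrite (conv_twist (gcoef us tau) (fun i => / vartheta (us i) tau)%C 0)
      by (intros; now apply gcoef_summable).
    replace (zc m * 0)%C with (RtoC 0) by ring. rewrite epi_0. ring.
Qed.

(** [conv_shift] iterated p times; the linear exponents accumulate to a quadratic one. Negative p
    are reached by cancelling the nonzero multiplier. *)
Lemma coefs_block (N : nat) (us : nat -> C) (tau : C) (r p : Z) : 0 < Im tau ->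
  coefs N us tau (r + Z.of_nat N * p) =
  (epi (zc (Z.of_nat N) * zc p - 2 * zc p * isum us 1 N + 2 * zc p * zc r * tau
     + zc p * zc p * (zc (Z.of_nat N) * tau)) * coefs N us tau r)%C.
Proof.
  intros Ht. set (s := isum us 1 N). set (n := zc (Z.of_nat N)).
  assert (Hs : forall m, coefs N us tau (m + Z.of_nat N) =
    (epi (n - 2 * s + (2 * zc m + n) * tau) * coefs N us tau m)%C).
  { intros m. apply conv_shift; intros; [now apply gcoef_summable|apply gcoef_shift]. }
  assert (Hstep : forall q, coefs N us tau (r + Z.of_nat N * (q + 1)) =
    (epi (n - 2 * s + (2 * (zc r + n * zc q) + n) * tau) *
      coefs N us tau (r + Z.of_nat N * q))%C).
  { intros q. replace (r + Z.of_nat N * (q + 1))%Z with (r + Z.of_nat N * q + Z.of_nat N)%Z by lia.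
    rewrite Hs, zc_plus, zc_mult. reflexivity. }
  apply (Z.peano_ind (fun p => coefs N us tau (r + Z.of_nat N * p) =
    (epi (n * zc p - 2 * zc p * s + 2 * zc p * zc r * tau + zc p * zc p * (n * tau))
      * coefs N us tau r)%C)).
  - rewrite Z.mul_0_r, Z.add_0_r.
    replace (n * 0 - 2 * 0 * s + 2 * 0 * zc r * tau + 0 * 0 * (n * tau))%C with (RtoC 0) by ring.
    rewrite epi_0. ring.
  - intros q IH. unfold Z.succ. rewrite Hstep, IH, (Cmult_assoc (epi _) (epi _)), <- epi_plus, zc_plus.
    do 2 f_equal. ring.
  - intros q IH. pose proof (Hstep (Z.pred q)) as H.
    replace (Z.pred q + 1)%Z with q in H by lia. rewrite IH in H.
    apply Cmult_neq_inv_l with (epi (n - 2 * s + (2 * (zc r + n * zc (Z.pred q)) + n) * tau)).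
    + apply epi_neq0.
    + rewrite <- H, (Cmult_assoc (epi _) (epi _)), <- epi_plus. do 2 f_equal.
      replace (zc q) with (zc (Z.pred q) + 1)%C.
      * ring.
      * rewrite <- (zc_plus (Z.pred q) 1). do 2 f_equal. lia.
Qed.

Lemma Im_scale_pos (N : nat) (tau : C) : (1 <= N)%nat -> 0 < Im tau ->
  0 < Im (zc (Z.of_nat N) * tau).
Proof.
  intros HN Ht. rewrite Im_mult_R. apply Rmult_lt_0_compat; [apply IZR_lt; lia|exact Ht].
Qed.

(** The elliptic variable v of the r-th level-one sum. The half-integer (N - 1)/2 turns the sign
    (-1)^(N p) of a block into the (-1)^p of [Lser]. Its sum with u_0 + r tau is u - (N - 1)/2 for
    every r, which is where the argument of h comes from. *)
Definition wshift (N : nat) (us : nat -> C) (tau : C) (r : nat) : C :=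
  (isum us 1 N - zc (Z.of_nat r) * tau - (zc (Z.of_nat N) - 1) / 2)%C.

Lemma Xser_Lser (N : nat) (u0 : C) (us : nat -> C) (tau : C) : (1 <= N)%nat -> 0 < Im tau ->
  Xser N u0 us tau = Csumn N (fun r => coefs N us tau (Z.of_nat r) *
    Lser (u0 + zc (Z.of_nat r) * tau) (wshift N us tau r) (zc (Z.of_nat N) * tau))%C.
Proof.
  intros HN Ht. unfold Xser. rewrite (sumZ_mod _ N HN (Xser_summable N u0 us tau Ht)).
  apply Csumn_ext. intros r _. unfold Lser, gser.
  rewrite <- sumZ_scal by now apply Lser_summable, Im_scale_pos.
  apply sumZ_ext. intros p. rewrite coefs_block by exact Ht.
  rewrite zc_plus, zc_mult. unfold wshift.
  replace (u0 + (zc (Z.of_nat r) + zc (Z.of_nat N) * zc p) * tau)%C with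
    (u0 + zc (Z.of_nat r) * tau + zc p * (zc (Z.of_nat N) * tau))%C by ring.
  set (ph := phi _).
  transitivity (coefs N us tau (Z.of_nat r) * ph * (epi (zc p) *
    epi (zc p * zc p * (zc (Z.of_nat N) * tau) + 2 * zc p *
    - (isum us 1 N - zc (Z.of_nat r) * tau - (zc (Z.of_nat N) - 1) / 2))))%C; [|ring].
  rewrite <- epi_plus.
  replace (zc p + (zc p * zc p * (zc (Z.of_nat N) * tau) + 2 * zc p *
    - (isum us 1 N - zc (Z.of_nat r) * tau - (zc (Z.of_nat N) - 1) / 2)))%C with
    (zc (Z.of_nat N) * zc p - 2 * zc p * isum us 1 N + 2 * zc p * zc (Z.of_nat r) * tau +
     zc p * zc p * (zc (Z.of_nat N) * tau))%C by field. ring.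
Qed.

(* Up to a common factor, both sides are [sum_m c_m q^(m/2)]. *)
Lemma theta_product (N : nat) (us : nat -> C) (tau : C) : (1 <= N)%nat -> 0 < Im tau ->
  Csumn N (fun r => coefs N us tau (Z.of_nat r) *
    vartheta (wshift N us tau r) (zc (Z.of_nat N) * tau))%C =
  (epi (zc (Z.of_nat N) - 1) * iprod (fun j => vartheta (us j) tau) 1 N)%C.
Proof.
  intros HN Ht. set (n := zc (Z.of_nat N)).
  assert (HNt : 0 < Im (n * tau)) by now apply Im_scale_pos.
  set (s := isum us 1 N).
  (* Weighting degree m by q^(m/2) is a modulation, so it distributes over the N factors and turns
     each of them into the theta series of [th3_vartheta]. *)
  set (g := fun i k => (epi (zc k * tau) * gcoef us tau i k)%C).
  assert (Hg : forall j, zsummable (g j)).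
  { intros j. apply (zsummable_ext (fun k => 1 * epi (zc k * zc k * tau + 2 * zc k *
      (- us j + tau / 2 + / 2)))%C); [|now apply th3_summable].
    intros k. unfold g, gcoef. rewrite <- epi_plus, Cmult_1_l. f_equal. field. }
  assert (Hc : forall m, conv g 1 N m = (epi (zc m * tau) * coefs N us tau m)%C).
  { intros m. apply conv_modulate. intros; now apply gcoef_summable. }
  assert (E1 : sumZ (fun m => epi (zc m * tau) * coefs N us tau m)%C =
    (epi (n * (/ 2 - tau / 4) + s) * iprod (fun j => vartheta (us j) tau) 1 N)%C).
  { rewrite <- (sumZ_ext _ _ Hc), conv_sum by exact Hg.
    unfold n, s. rewrite <- isum_add_const, <- iprod_epi, <- iprod_mult.
    apply iprod_ext. intros i _.
    transitivity (th3 tau (- us i + tau / 2 + / 2)).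
    - apply sumZ_ext. intros k. unfold g, gcoef. rewrite <- epi_plus, Cmult_1_l. f_equal. field.
    - rewrite th3_vartheta by exact Ht. f_equal.
      rewrite <- epi_half, <- epi_plus, RtoC_half. f_equal. field. }
  (* The same sum split modulo N: each residue class is a theta series of modulus N tau, with a
     prefactor that is the same for every r. *)
  rewrite (sumZ_mod _ N HN) in E1.
  2: { apply (zsummable_ext _ _ Hc). now apply conv_summable. }
  rewrite (Csumn_ext N _ (fun r => epi (/ 2 + s - (n - 1) / 2 - n * tau / 4) *
     (coefs N us tau (Z.of_nat r) * vartheta (wshift N us tau r) (n * tau)))%C) in E1.
  - rewrite Csumn_scal in E1.
    apply Cmult_neq_inv_l with (epi (/ 2 + s - (n - 1) / 2 - n * tau / 4)); [apply epi_neq0|].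
    rewrite E1, Cmult_assoc, <- epi_plus. do 2 f_equal. field.
  - intros r _.
    transitivity (coefs N us tau (Z.of_nat r) * epi (zc (Z.of_nat r) * tau) *
      th3 (n * tau) (- wshift N us tau r + n * tau / 2 + / 2))%C.
    + unfold th3, gser. rewrite <- sumZ_scal by now apply th3_summable.
      apply sumZ_ext. intros p. rewrite coefs_block by exact Ht. fold n s.
      rewrite zc_plus, zc_mult. fold n. unfold wshift. fold n s.
      set (X := coefs N us tau (Z.of_nat r)). rewrite Cmult_1_l.
      transitivity (X * (epi ((zc (Z.of_nat r) + n * zc p) * tau) *
        epi (n * zc p - 2 * zc p * s + 2 * zc p * zc (Z.of_nat r) * tau +
          zc p * zc p * (n * tau))))%C; [ring|].
      rewrite <- (Cmult_assoc X), <- !epi_plus. do 2 f_equal. field.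
    + rewrite th3_vartheta by exact HNt. rewrite <- epi_half.
      transitivity (coefs N us tau (Z.of_nat r) * vartheta (wshift N us tau r) (n * tau) *
        (epi (zc (Z.of_nat r) * tau) * (epi (RtoC (/ 2)) *
         epi (wshift N us tau r - n * tau / 4))))%C; [ring|].
      rewrite <- !epi_plus.
      replace (zc (Z.of_nat r) * tau + (RtoC (/ 2) + (wshift N us tau r - n * tau / 4)))%C with
        (/ 2 + s - (n - 1) / 2 - n * tau / 4)%C
        by (unfold wshift; fold n s; rewrite RtoC_half; field). ring.
Qed.

Lemma vartheta_addZ (v tau : C) (k : Z) : 0 < Im tau ->
  vartheta (v + zc k) tau = (epi (zc k) * vartheta v tau)%C.
Proof.
  intros Ht. rewrite !vartheta_th3 by exact Ht.
  replace (v + zc k + tau / 2 + / 2)%C with (v + tau / 2 + / 2 + zc k)%C by ring.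
  replace (v + zc k + tau / 4)%C with (v + tau / 4 + zc k)%C by ring.
  rewrite th3_addZ, (epi_plus _ (zc k)). ring.
Qed.

Lemma th3_half_inversion (tau c v : C) : 0 < Im tau -> is_sqrt_tau c tau ->
  th3 (- / tau) (v / tau + / 2) = (c * epi (v * v / tau) * vartheta (v - / 2) tau)%C.
Proof.
  intros Ht Hc. pose proof (upper_neq0 tau Ht) as Ht0.
  replace (v / tau + / 2)%C with ((v + tau / 2) / tau)%C by (field; exact Ht0).
  rewrite (th3_inversion tau c _ Ht Hc), vartheta_th3 by exact Ht.
  replace (v - / 2 + tau / 2 + / 2)%C with (v + tau / 2)%C by field.
  rewrite <- epi_half.
  transitivity (c * (epi (v * v / tau) * epi (RtoC (/ 2)) * epi (v - / 2 + tau / 4))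
    * th3 tau (v + tau / 2))%C; [|ring].
  rewrite <- !epi_plus. do 3 f_equal. rewrite RtoC_half. field. exact Ht0.
Qed.

Lemma phi_addZ (w : C) (k : Z) : phi (w + zc k) = (epi (zc k) * phi w)%C.
Proof.
  unfold phi. replace (2 * (w + zc k))%C with (2 * w + 2 * zc k)%C by ring.
  rewrite epi_periodic, epi_plus. unfold Cdiv. ring.
Qed.

Lemma isum_square (us : nat -> C) (x tau : C) (j d : nat) : tau <> RtoC 0 ->
  isum (fun i => (us i - x * tau) * (us i - x * tau) / tau)%C j d =
  (isum (fun i => us i * us i / tau)%C j d - 2 * x * isum us j d
    + zc (Z.of_nat d) * (x * x * tau))%C.
Proof.
  intros Ht0. revert j; induction d as [|d IH]; intros j; cbn [isum]; [simpl; ring|].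
  rewrite IH. replace (Z.of_nat (S d)) with (Z.of_nat d + 1)%Z by lia. rewrite zc_plus.
  field. exact Ht0.
Qed.

Lemma coefs_translate (N : nat) (us : nat -> C) (tau y : C) (m : Z) : 0 < Im tau ->
  coefs N (fun i => us i - y)%C tau m = (epi (2 * zc m * y) * coefs N us tau m)%C.
Proof.
  intros Ht. unfold coefs.
  rewrite (conv_ext _ (fun i k => epi (zc k * (2 * y)) * gcoef us tau i k)%C).
  - rewrite conv_modulate by (intros; now apply gcoef_summable). do 2 f_equal. ring.
  - intros i k _. unfold gcoef. rewrite <- !epi_plus. f_equal. ring.
Qed.

(* Compare Fourier coefficients in [x] of [prod_j Theta(u_j / tau - x; -1/tau)], expanded
   directly and through the inversion of the individual factors. *)
Lemma coefs_inversion (N : nat) (us : nat -> C) (tau c cN : C) (m : Z) :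
  (1 <= N)%nat -> 0 < Im tau ->
  is_sqrt_tau c tau -> is_sqrt_tau cN (zc (Z.of_nat N) * tau) ->
  coefs N (fun i => us i / tau)%C (- / tau) m =
  (iprod (fun _ => c) 1 N * epi (isum (fun i => us i * us i / tau)%C 1 N) / cN *
   Csumn N (fun r => coefs N us tau (Z.of_nat r) * epi (zc (Z.of_nat r)) *
     epi (zc m - (isum us 1 N - zc (Z.of_nat r) * tau + zc m) *
       (isum us 1 N - zc (Z.of_nat r) * tau + zc m) / (zc (Z.of_nat N) * tau))))%C.
Proof.
  intros HN Ht Hc HcN. set (n := zc (Z.of_nat N)) in *. set (s := isum us 1 N).
  set (S2 := isum (fun i => us i * us i / tau)%C 1 N).
  assert (HNt : 0 < Im (n * tau)) by now apply Im_scale_pos.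
  pose proof (upper_neq0 tau Ht) as Ht0. pose proof (upper_neq0 _ HNt) as HNt0.
  assert (Hn0 : n <> RtoC 0) by (intros E; apply HNt0; rewrite E; ring).
  pose proof (neg_inv_upper tau Ht) as Hs. pose proof (neg_inv_upper _ HNt) as HsN.
  pose proof (sqrt_tau_neq0 cN _ HcN) as HcN0.
  set (q := fun r : nat => (s - zc (Z.of_nat r) * tau)%C).
  set (K := (iprod (fun _ => c) 1 N * epi S2 / cN)%C).
  set (b := fun r (k : Z) => (coefs N us tau (Z.of_nat r) * epi (zc (Z.of_nat r)) *
     epi (zc k - (q r + zc k) * (q r + zc k) / (n * tau)))%C).
  assert (Hb : forall r k, b r k = (coefs N us tau (Z.of_nat r) * epi (zc (Z.of_nat r)) *
     epi (- (q r * q r / (n * tau))) * (1 * epi (zc k * zc k * - / (n * tau)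
       + 2 * zc k * (- (q r / (n * tau)) + / 2))))%C).
  { intros r k. unfold b. rewrite Cmult_1_l, <- (Cmult_assoc _ (epi (- (q r * q r / (n * tau))))).
    rewrite <- epi_plus. do 2 f_equal. field. auto. }
  assert (Hbs : forall r, zsummable (b r)).
  { intros r. eapply zsummable_ext; [intros k; symmetry; apply Hb|].
    apply zsummable_scal, th3_summable, HsN. }
  destruct (sumZ_Csumn N b Hbs) as [HBs _].
  apply (trig_series_unique _ (fun k => K * Csumn N (fun r => b r k))%C).
  - now apply coefs_summable.
  - apply zsummable_scal, HBs.
  - clear m. intros x.
    transitivity (sumZ (conv (fun i k => 1 * (epi (zc k * (2 * RtoC x)) *
      gcoef (fun i => us i / tau)%C (- / tau) i k))%C 1 N)).
    { apply sumZ_ext. intros m.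
      rewrite (conv_twist (gcoef (fun i => us i / tau)%C (- / tau)) (fun _ => RtoC 1))
        by (intros; now apply gcoef_summable).
      replace (zc m * (2 * RtoC x))%C with (2 * zc m * RtoC x)%C by ring.
      transitivity (1 * (epi (2 * zc m * RtoC x) *
        coefs N (fun i => us i / tau)%C (- / tau) m))%C; [ring|]. unfold coefs. f_equal.
      generalize 1%nat. clear. induction N as [|N IH]; intros j; cbn [iprod]; [reflexivity|].
      rewrite <- IH. ring. }
    set (y := fun i => (us i - RtoC x * tau)%C).
    assert (Hterm : forall i k, (1 * (epi (zc k * (2 * RtoC x)) *
      gcoef (fun i => us i / tau)%C (- / tau) i k) = 1 * epi (zc k * zc k * - / tau
        + 2 * zc k * - (y i / tau + - / 2)))%C).
    { intros i k. unfold gcoef, y. rewrite <- epi_plus. do 2 f_equal. field. exact Ht0. }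
    rewrite conv_sum.
    2: { intros i. eapply zsummable_ext; [intros k; symmetry; apply Hterm|].
         now apply th3_summable. }
    rewrite (iprod_ext _ (fun i => c * (epi (y i * y i / tau) * vartheta (us i - (RtoC x * tau + / 2)) tau))%C).
    2: { intros i _. transitivity (th3 (- / tau) (- (y i / tau + - / 2))).
         - apply sumZ_ext. intros k. apply Hterm.
         - rewrite th3_even by exact Hs. rewrite <- th3_add1.
           replace (y i / tau + - / 2 + 1)%C with (y i / tau + / 2)%C by (field; exact Ht0).
           rewrite (th3_half_inversion tau c _ Ht Hc).
           replace (y i - / 2)%C with (us i - (RtoC x * tau + / 2))%C by (unfold y; ring). ring. }
    rewrite !iprod_mult, iprod_epi. unfold y. rewrite isum_square by exact Ht0. fold S2 s n.
    (* The product at tau becomes a sum of N theta functions of modulus N tau, and each of these is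
       inverted back with the root [cN]; the result is a trigonometric series in x. *)
    pose proof (theta_product N (fun i => us i - (RtoC x * tau + / 2))%C tau HN Ht) as HP.
    fold n in HP.
    assert (HP' : iprod (fun i => vartheta (us i - (RtoC x * tau + / 2)) tau) 1 N =
      Csumn N (fun r => epi (- (n - 1)) * (epi (2 * zc (Z.of_nat r) * (RtoC x * tau + / 2)) *
        coefs N us tau (Z.of_nat r) * (epi (- (n - 1)) *
          (epi (- ((q r - n * RtoC x * tau) * (q r - n * RtoC x * tau) / (n * tau))) / cN *
          th3 (- / (n * tau)) ((q r - n * RtoC x * tau) / (n * tau) + / 2)))))%C).
    { rewrite Csumn_scal. apply Cmult_neq_inv_l with (epi (n - 1)); [apply epi_neq0|].
      rewrite <- HP, Cmult_assoc, <- epi_plus.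
      replace (n - 1 + - (n - 1))%C with (RtoC 0) by ring. rewrite epi_0, Cmult_1_l.
      apply Csumn_ext. intros r _. rewrite coefs_translate by exact Ht. f_equal.
      rewrite (th3_half_inversion (n * tau) cN _ HNt HcN).
      set (z := (q r - n * RtoC x * tau)%C).
      replace (wshift N (fun i => us i - (RtoC x * tau + / 2))%C tau r) with
        (z - / 2 + zc (- (Z.of_nat N - 1)))%C.
      - rewrite vartheta_addZ by exact HNt. rewrite zc_opp, zc_minus. fold n.
        rewrite (epi_opp (z * z / (n * tau))). field. split; auto using epi_neq0.
      - unfold wshift. fold n.
        replace (isum (fun i => us i - (RtoC x * tau + / 2))%C 1 N) with
          (n * (- (RtoC x * tau + / 2)) + s)%C.
        + rewrite zc_opp, zc_minus. fold n. unfold z, q. field.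
        + unfold n, s. rewrite <- isum_add_const. apply isum_ext. intros i. ring. }
    rewrite HP'.
    rewrite (sumZ_ext _ (fun k => Csumn N (fun r => K * (epi (2 * zc k * RtoC x) * b r k)))%C).
    2: { intros k. rewrite !Csumn_scal. ring. }
    assert (Hbx : forall r, (fun k => epi (2 * zc k * RtoC x) * b r k)%C = (fun k =>
      coefs N us tau (Z.of_nat r) * epi (zc (Z.of_nat r)) * epi (- (q r * q r / (n * tau))) *
      (1 * epi (zc k * zc k * - / (n * tau)
       + 2 * zc k * (- ((q r - n * RtoC x * tau) / (n * tau)) + / 2))))%C).
    { intros r. apply FunctionalExtensionality.functional_extensionality. intros k.
      rewrite Hb, !Cmult_1_l.
      transitivity (coefs N us tau (Z.of_nat r) * epi (zc (Z.of_nat r)) *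
        epi (- (q r * q r / (n * tau))) * (epi (2 * zc k * RtoC x) *
         epi (zc k * zc k * - / (n * tau) + 2 * zc k * (- (q r / (n * tau)) + / 2))))%C; [ring|].
      rewrite <- epi_plus. do 2 f_equal. field. auto. }
    assert (Hbxs : forall r, zsummable (fun k => epi (2 * zc k * RtoC x) * b r k)%C).
    { intros r. rewrite Hbx. apply zsummable_scal, th3_summable, HsN. }
    rewrite (proj2 (sumZ_Csumn N (fun r k => K * (epi (2 * zc k * RtoC x) * b r k))%C
      (fun r => zsummable_scal K _ (Hbxs r)))).
    rewrite Cmult_assoc, <- Csumn_scal. apply Csumn_ext. intros r _.
    rewrite sumZ_scal by apply Hbxs.
    rewrite Hbx, sumZ_scal by apply th3_summable, HsN.
    set (z := (q r - n * RtoC x * tau)%C).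
    fold (gser (fun _ => RtoC 1) (- / (n * tau)) (- (z / (n * tau)) + / 2)).
    fold (th3 (- / (n * tau)) (- (z / (n * tau)) + / 2)).
    replace (th3 (- / (n * tau)) (- (z / (n * tau)) + / 2)) with
      (th3 (- / (n * tau)) (z / (n * tau) + / 2)).
    2: { rewrite <- (th3_even (- / (n * tau)) (z / (n * tau) + / 2) HsN).
         rewrite <- (th3_add1 _ (- (z / (n * tau) + / 2))). f_equal. field. auto. }
    set (TH := th3 (- / (n * tau)) (z / (n * tau) + / 2)).
    unfold K.
    transitivity (iprod (fun _ => c) 1 N / cN * coefs N us tau (Z.of_nat r) * TH *
      (epi (S2 - 2 * RtoC x * s + n * (RtoC x * RtoC x * tau)) *
       epi (2 * zc (Z.of_nat r) * (RtoC x * tau + / 2)) * epi (- (z * z / (n * tau))) *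
       (epi (- (n - 1)) * epi (- (n - 1)))))%C; [field; exact HcN0|].
    transitivity (iprod (fun _ => c) 1 N / cN * coefs N us tau (Z.of_nat r) * TH *
      (epi S2 * epi (zc (Z.of_nat r)) * epi (- (q r * q r / (n * tau)))))%C;
      [|field; exact HcN0].
    (* The two factors e^(-pi i (N - 1)), one from [theta_product] and one from the integer part of
       [wshift], combine to an even exponent. *)
    rewrite <- !epi_plus. f_equal. apply epi_congr with (- (Z.of_nat N - 1))%Z.
    rewrite zc_opp, zc_minus. fold n. unfold z, q. field. auto.
Qed.

(** The geometric sum is the quotient of 1 - e^(-2 pi i N y) by 1 - e^(-2 pi i y), so it trades the
    denominator of [phi] at N y for the one at y. This links the poles at modulus -1/tau with those
    at -1/(N tau). *)
Lemma phi_geometric (N : nat) (y : C) : (1 <= N)%nat ->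
  (1 - epi (2 * (zc (Z.of_nat N) * y)))%C <> RtoC 0 ->
  (phi (zc (Z.of_nat N) * y) * Csumn N (fun k => epi (- (2 * zc (Z.of_nat k) * y))))%C =
  (epi (- ((zc (Z.of_nat N) - 1) * y)) * phi y)%C.
Proof.
  intros HN Hy.
  assert (Hgeo : forall n, (Csumn n (fun k => epi (- (2 * zc (Z.of_nat k) * y))) *
     (1 - epi (- (2 * y))) = 1 - epi (- (2 * (zc (Z.of_nat n) * y))))%C).
  { induction n as [|n IH]; cbn [Csumn].
    - simpl. replace (- (2 * (0 * y)))%C with (RtoC 0) by ring. rewrite epi_0. ring.
    - rewrite Cmult_plus_distr_r, IH.
      replace (Z.of_nat (S n)) with (Z.of_nat n + 1)%Z by lia. rewrite zc_plus.
      replace (- (2 * ((zc (Z.of_nat n) + 1) * y)))%C with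
        (- (2 * zc (Z.of_nat n) * y) + - (2 * y))%C by ring.
      replace (2 * (zc (Z.of_nat n) * y))%C with (2 * zc (Z.of_nat n) * y)%C by ring.
      rewrite (epi_plus _ (- (2 * y))). ring. }
  specialize (Hgeo N). set (S := Csumn N _) in *. set (n := zc (Z.of_nat N)) in *.
  (* If e^(2 pi i y) were 1, so would be its N-th power, against [Hy]. *)
  assert (Hy1 : (1 - epi (2 * y))%C <> RtoC 0).
  { intros E.
    assert (E1 : epi (2 * y) = 1).
    { replace (epi (2 * y)) with (1 - (1 - epi (2 * y)))%C by ring. rewrite E. ring. }
    destruct (epi_eq1 _ E1) as [k Hk].
    apply Hy. replace (2 * (n * y))%C with (n * (2 * y))%C by ring. rewrite Hk. unfold n.
    replace (zc (Z.of_nat N) * (2 * zc k))%C with (2 * zc (Z.of_nat N * k))%C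
      by (rewrite zc_mult; ring).
    rewrite epi_even. ring. }
  rewrite !epi_opp in Hgeo. unfold phi.
  set (A := epi (2 * (n * y))) in *. set (B := epi (2 * y)) in *.
  assert (HA0 : A <> RtoC 0) by apply epi_neq0. assert (HB0 : B <> RtoC 0) by apply epi_neq0.
  assert (HS : (S * A * (1 - B) = B * (1 - A))%C).
  { transitivity (- (A * B) * (S * (1 - / B)))%C; [field; auto|].
    rewrite Hgeo. field. auto. }
  apply Cmult_neq_inv_l with (A * (1 - B) * (1 - A))%C.
  - apply Cneq_mult; [apply Cneq_mult|]; auto.
  - transitivity (epi (n * y) * (S * A * (1 - B)))%C; [field; auto|]. rewrite HS.
    transitivity ((1 - A) * (epi (n * y) * B))%C; [ring|].
    transitivity ((1 - A) * (A * epi (- ((n - 1) * y)) * epi y))%C; [|field; auto].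
    f_equal. unfold A, B. rewrite <- !epi_plus. f_equal. ring.
Qed.

Lemma Xser_addZ (N : nat) (u0 : C) (us : nat -> C) (tau : C) (k : Z) : 0 < Im tau ->
  Xser N (u0 + zc k) us tau = (epi (zc k) * Xser N u0 us tau)%C.
Proof.
  intros Ht. unfold Xser. rewrite <- sumZ_scal by now apply Xser_summable.
  apply sumZ_ext. intros m.
  replace (u0 + zc k + zc m * tau)%C with (u0 + zc m * tau + zc k)%C by ring.
  rewrite phi_addZ. ring.
Qed.

(** Both sides are sums over m, and they agree term by term. Expanding the dual coefficients by
    [coefs_inversion] produces -k^2/(N tau) in the exponent; the weight on the left cancels it and
    leaves an exponent linear in k. *)
Lemma Xser_dual_sum (N : nat) (u0 : C) (us : nat -> C) (tau c cN : C) :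
  (1 <= N)%nat -> 0 < Im tau -> ~ in_lattice tau u0 ->
  is_sqrt_tau c tau -> is_sqrt_tau cN (zc (Z.of_nat N) * tau) ->
  Csumn N (fun k => epi (zc (Z.of_nat k) - 2 * zc (Z.of_nat k) * (u0 + isum us 1 N)
      / (zc (Z.of_nat N) * tau)
      + zc (Z.of_nat k) * zc (Z.of_nat k) / (zc (Z.of_nat N) * tau)) *
    Xser N (u0 / tau - zc (Z.of_nat k) / tau) (fun i => us i / tau) (- / tau))%C =
  (iprod (fun _ => c) 1 N * epi (isum (fun i => us i * us i / tau)%C 1 N) / cN *
   epi (- ((u0 + isum us 1 N) * (u0 + isum us 1 N) / (zc (Z.of_nat N) * tau))) *
   Csumn N (fun r => coefs N us tau (Z.of_nat r) *
     Tser (u0 + zc (Z.of_nat r) * tau) (wshift N us tau r) (zc (Z.of_nat N) * tau)))%C.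
Proof.
  intros HN Ht Hu Hc HcN.
  pose proof (coefs_inversion N us tau c cN) as HI.
  set (n := zc (Z.of_nat N)) in *. set (s := isum us 1 N) in *.
  set (S2 := isum (fun i => us i * us i / tau)%C 1 N) in *.
  assert (HNt : 0 < Im (n * tau)) by now apply Im_scale_pos.
  pose proof (upper_neq0 tau Ht) as Ht0. pose proof (upper_neq0 _ HNt) as HNt0.
  assert (Hn0 : n <> RtoC 0) by (intros E; apply HNt0; rewrite E; ring).
  pose proof (neg_inv_upper tau Ht) as Hs. pose proof (neg_inv_upper _ HNt) as HsN.
  set (K := (iprod (fun _ => c) 1 N * epi S2 / cN)%C) in *.
  set (c' := coefs N (fun i => us i / tau)%C (- / tau)) in *.
  set (e := fun k : nat => epi (zc (Z.of_nat k) - 2 * zc (Z.of_nat k) * (u0 + s) / (n * tau)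
      + zc (Z.of_nat k) * zc (Z.of_nat k) / (n * tau))).
  (* The index is shifted by k so that the pole no longer depends on k and the sum over k acts on
     the coefficients alone. *)
  set (G := fun (k : nat) (m : Z) => (c' (m - Z.of_nat k)%Z * phi ((u0 - zc m) / tau))%C).
  destruct (phi_lattice_bounded (u0 / tau) (- / tau) Hs) as [b Hb].
  assert (Hphi : forall m, ((u0 - zc m) / tau)%C = (u0 / tau + zc m * - / tau)%C)
    by (intros; field; exact Ht0).
  assert (HG : forall k, zsummable (G k)).
  { intros k. unfold G. apply summable_shift_mult with b.
    - now apply coefs_summable.
    - intros m. rewrite Hphi. apply Hb. }
  assert (HX : forall k : nat, Xser N (u0 / tau - zc (Z.of_nat k) / tau)
     (fun i => us i / tau)%C (- / tau) = sumZ (G k)).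
  { intros k. rewrite <- (sumZ_shift (G k) (Z.of_nat k) (HG k)).
    apply sumZ_ext. intros m. unfold G. fold c'. rewrite Z.add_simpl_r, zc_plus.
    do 2 f_equal. field. exact Ht0. }
  transitivity (sumZ (fun m => Csumn N (fun k => e k * G k m)%C)).
  { rewrite (proj2 (sumZ_Csumn N (fun k m => e k * G k m)%C
      (fun k => zsummable_scal (e k) _ (HG k)))).
    apply Csumn_ext. intros k _. now rewrite sumZ_scal, HX. }
  set (KK := (K * epi (- ((u0 + s) * (u0 + s) / (n * tau))))%C).
  set (H := fun (r : nat) (m : Z) => (epi (((u0 + zc (Z.of_nat r) * tau) * (u0 + zc (Z.of_nat r) * tau)
      + 2 * (u0 + zc (Z.of_nat r) * tau) * wshift N us tau r) / (n * tau)) *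
    ((epi (zc m) * phi ((u0 + zc (Z.of_nat r) * tau) / (n * tau) + zc m * - / (n * tau))) *
     epi (zc m * zc m * - / (n * tau) + 2 * zc m * - (wshift N us tau r / (n * tau)))))%C).
  assert (HH : forall r, zsummable (H r)).
  { intros r. unfold H. apply zsummable_scal.
    apply (Lser_summable ((u0 + zc (Z.of_nat r) * tau) / (n * tau)) (wshift N us tau r / (n * tau))
      (- / (n * tau)) HsN). }
  assert (HT : forall r : nat, Tser (u0 + zc (Z.of_nat r) * tau) (wshift N us tau r) (n * tau)
     = sumZ (H r)).
  { intros r. unfold Tser, Lser, gser, H. rewrite sumZ_scal; [reflexivity|].
    apply (Lser_summable ((u0 + zc (Z.of_nat r) * tau) / (n * tau)) (wshift N us tau r / (n * tau))
      (- / (n * tau)) HsN). }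
  transitivity (sumZ (fun m => Csumn N (fun r => KK * coefs N us tau (Z.of_nat r) * H r m)%C)).
  2: { rewrite (proj2 (sumZ_Csumn N (fun r m => KK * coefs N us tau (Z.of_nat r) * H r m)%C
        (fun r => zsummable_scal (KK * coefs N us tau (Z.of_nat r)) _ (HH r)))).
       rewrite <- Csumn_scal. apply Csumn_ext. intros r _. rewrite sumZ_scal, HT by auto.
       ring. }
  apply sumZ_ext. intros m.
  assert (Hlat : (1 - epi (2 * ((u0 - zc m) / tau)))%C <> RtoC 0).
  { rewrite Hphi. apply phi_denominator. now apply in_lattice_inv. }
  set (q := fun r : nat => (s - zc (Z.of_nat r) * tau + zc m)%C).
  set (Y := fun r : nat => ((u0 + zc (Z.of_nat r) * tau - zc m) / (n * tau))%C).
  rewrite (Csumn_ext N _ (fun k => Csumn N (fun r => K * coefs N us tau (Z.of_nat r)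
     * epi (zc (Z.of_nat r)) * epi (zc m - q r * q r / (n * tau)) * phi ((u0 - zc m) / tau)
     * epi (- (2 * zc (Z.of_nat k) * Y r))))%C).
  2: { intros k _. unfold G. unfold c' at 1. rewrite HI by auto. fold K.
       transitivity (Csumn N (fun r => (K * e k * phi ((u0 - zc m) / tau)) *
         (coefs N us tau (Z.of_nat r) * epi (zc (Z.of_nat r)) *
         epi (zc (m - Z.of_nat k) - (s - zc (Z.of_nat r) * tau + zc (m - Z.of_nat k)) *
         (s - zc (Z.of_nat r) * tau + zc (m - Z.of_nat k)) / (n * tau))))%C).
       - rewrite Csumn_scal. ring.
       - apply Csumn_ext. intros r _.
         set (cr := coefs N us tau (Z.of_nat r)). set (ph := phi ((u0 - zc m) / tau)).
         set (er := epi (zc (Z.of_nat r))). unfold e.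
         match goal with |- (K * ?a * ph * (cr * er * ?b) = _ * ?a' * ph * ?b')%C =>
           transitivity (K * ph * cr * er * (a * b))%C; [ring|];
           transitivity (K * ph * cr * er * (a' * b'))%C; [|ring] end.
         rewrite <- !epi_plus. do 2 f_equal. rewrite zc_minus. unfold q, Y. field. auto. }
  rewrite Csumn_exchange. apply Csumn_ext. intros r _. rewrite Csumn_scal.
  assert (EY : (zc (Z.of_nat N) * Y r)%C = ((u0 - zc m) / tau + zc (Z.of_nat r))%C)
    by (unfold Y; fold n; field; auto).
  (* N times [Y r] is the argument of the dual sum plus the integer r, while [Y r] itself is the
     argument in the inverted level-one sum. *)
  pose proof (phi_geometric N (Y r) HN) as Hgeo. rewrite EY, phi_addZ in Hgeo.
  specialize (Hgeo ltac:(replace (2 * ((u0 - zc m) / tau + zc (Z.of_nat r)))%C with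
    (2 * ((u0 - zc m) / tau) + 2 * zc (Z.of_nat r))%C by ring; rewrite epi_periodic; exact Hlat)).
  fold n in Hgeo.
  transitivity (K * coefs N us tau (Z.of_nat r) * epi (zc m - q r * q r / (n * tau)) *
    (epi (zc (Z.of_nat r)) * phi ((u0 - zc m) / tau) *
     Csumn N (fun k => epi (- (2 * zc (Z.of_nat k) * Y r)))))%C; [ring|].
  rewrite Hgeo. unfold H, KK.
  replace ((u0 + zc (Z.of_nat r) * tau) / (n * tau) + zc m * - / (n * tau))%C with (Y r)
    by (unfold Y; field; auto).
  set (cr := coefs N us tau (Z.of_nat r)).
  transitivity (K * cr * phi (Y r) * (epi (zc m - q r * q r / (n * tau)) *
    epi (- ((n - 1) * Y r))))%C; [ring|].
  match goal with |- _ = (K * ?a * cr * (?x * ((?y * phi (Y r)) * ?z)))%C =>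
    transitivity (K * cr * phi (Y r) * (a * x * y * z))%C; [|ring] end.
  rewrite <- !epi_plus. do 2 f_equal. unfold q, Y, wshift. fold n s. field. auto.
Qed.

(** * Principal roots, inversion of the multivariable sum, and the theorem *)

(** -i tau has real part Im tau > 0, so the root has strictly positive real part; the sign test on
    the imaginary part -Re tau settles the sign of the cross term. *)
Lemma Csqrt_is_sqrt (tau : C) : 0 < Im tau -> is_sqrt_tau (Csqrt (- Ci * tau)) tau.
Proof.
  intros Ht. destruct tau as [p q]. unfold Im in Ht; simpl in Ht.
  assert (Ez : (- Ci * (p, q))%C = (q, - p)).
  { unfold Cmult, Copp, Ci; simpl. f_equal; ring. }
  unfold is_sqrt_tau. rewrite Ez. unfold Csqrt. simpl Re. simpl Im.
  set (m := Cmod (q, - p)).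
  assert (Hm2 : m * m = q * q + p * p).
  { unfold m, Cmod. simpl fst. simpl snd. rewrite sqrt_def; [ring|nra]. }
  assert (Hm : Rabs q <= m) by apply (re_le_Cmod (q, - p)).
  rewrite Rabs_pos_eq in Hm by lra.
  assert (H1 : 0 < (m + q) / 2) by lra. assert (H2 : 0 <= (m - q) / 2) by lra.
  split; [simpl; now apply sqrt_lt_R0|].
  set (x := sqrt ((m + q) / 2)). set (y := sqrt ((m - q) / 2)).
  assert (Hx : x * x = (m + q) / 2) by (apply sqrt_def; lra).
  assert (Hy : y * y = (m - q) / 2) by (apply sqrt_def; lra).
  assert (Hxy : x * y = Rabs p / 2).
  { unfold x, y. rewrite <- sqrt_mult by lra.
    replace ((m + q) / 2 * ((m - q) / 2)) with (Rsqr (p / 2)).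
    - rewrite sqrt_Rsqr_abs. unfold Rdiv. rewrite Rabs_mult, (Rabs_pos_eq (/ 2)); lra.
    - unfold Rsqr. nra. }
  unfold Cmult; simpl. f_equal; destruct (Rlt_dec (- p) 0) as [h|h].
  - nra.
  - nra.
  - rewrite Rabs_pos_eq in Hxy by lra. nra.
  - rewrite Rabs_left1 in Hxy by lra. nra.
Qed.

(** The origin of sqrt N in the inversion formula. *)
Lemma is_sqrt_scale (N : nat) (c tau : C) : (1 <= N)%nat -> is_sqrt_tau c tau ->
  is_sqrt_tau (RtoC (sqrt (INR N)) * c) (zc (Z.of_nat N) * tau).
Proof.
  intros HN [H1 H2]. rewrite <- INR_IZR_INZ.
  assert (HN' : 0 < INR N) by (apply lt_0_INR; lia). split.
  - rewrite Re_mult_R. apply Rmult_lt_0_compat; [now apply sqrt_lt_R0|exact H1].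
  - transitivity (RtoC (sqrt (INR N)) * RtoC (sqrt (INR N)) * (c * c))%C; [ring|].
    rewrite H2, <- RtoC_mult, sqrt_def by lra. ring.
Qed.

(* The case [j = 0] of the inversion formula, with the products of thetas cleared. *)
Lemma Xser_inversion (N : nat) (u0 : C) (us : nat -> C) (tau c : C) :
  (1 <= N)%nat -> 0 < Im tau -> ~ in_lattice tau u0 -> is_sqrt_tau c tau ->
  Xser N u0 us tau =
  (- Ci * epi ((u0 + isum us 1 N) * (u0 + isum us 1 N) / (zc (Z.of_nat N) * tau)) /
     (RtoC (sqrt (INR N)) * c * iprod (fun i => c * epi (us i * us i / tau)) 1 N) *
   Csumn N (fun k => epi (zc (Z.of_nat k) - 2 * zc (Z.of_nat k) * (u0 + isum us 1 N)
      / (zc (Z.of_nat N) * tau)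
      + zc (Z.of_nat k) * zc (Z.of_nat k) / (zc (Z.of_nat N) * tau)) *
    Xser N (u0 / tau - zc (Z.of_nat k) / tau) (fun i => us i / tau) (- / tau))
   + Ci / 2 * epi (zc (Z.of_nat N) - 1) * iprod (fun j => vartheta (us j) tau) 1 N *
     mordell_h (u0 + isum us 1 N - (zc (Z.of_nat N) - 1) / 2) (zc (Z.of_nat N) * tau))%C.
Proof.
  intros HN Ht Hu Hc.
  pose proof (is_sqrt_scale N c tau HN Hc) as HcN.
  rewrite (Xser_dual_sum N u0 us tau c _ HN Ht Hu Hc HcN).
  pose proof (theta_product N us tau HN Ht) as HP.
  rewrite (Xser_Lser N u0 us tau HN Ht).
  set (n := zc (Z.of_nat N)) in *. set (s := isum us 1 N).
  assert (HNt : 0 < Im (n * tau)) by now apply Im_scale_pos.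
  pose proof (upper_neq0 tau Ht) as Ht0. pose proof (upper_neq0 _ HNt) as HNt0.
  assert (Hn0 : n <> RtoC 0) by (intros E; apply HNt0; rewrite E; ring).
  pose proof (sqrt_tau_neq0 c _ Hc) as Hc0. pose proof (sqrt_tau_neq0 _ _ HcN) as HcN0.
  assert (Hsq0 : RtoC (sqrt (INR N)) <> RtoC 0).
  { intros E. apply HcN0. rewrite E. ring. }
  assert (Hc1 : iprod (fun _ => c) 1 N <> RtoC 0) by (apply iprod_neq0; auto).
  (* The level-one inversion is applied in each residue class. The argument of h is the same for
     every r, so the integral factors out and [theta_product] evaluates the remaining sum. *)
  rewrite (Csumn_ext N _ (fun r => / (n * tau) * (coefs N us tau (Z.of_nat r) *
      Tser (u0 + zc (Z.of_nat r) * tau) (wshift N us tau r) (n * tau)) +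
    Ci / 2 * mordell_h (u0 + s - (n - 1) / 2) (n * tau) * (coefs N us tau (Z.of_nat r) *
      vartheta (wshift N us tau r) (n * tau)))%C).
  - rewrite Csumn_plus, !Csumn_scal, HP, iprod_mult, iprod_epi.
    set (T := Csumn N _). set (P := iprod (fun _ => c) 1 N) in *.
    set (S2 := epi (isum (fun i => us i * us i / tau)%C 1 N)).
    assert (HS2 : S2 <> RtoC 0) by apply epi_neq0.
    rewrite epi_opp. set (G := epi ((u0 + s) * (u0 + s) / (n * tau))).
    assert (HG : G <> RtoC 0) by apply epi_neq0.
    assert (E : (- Ci * G / (RtoC (sqrt (INR N)) * c * (P * S2)) *
      (P * S2 / (RtoC (sqrt (INR N)) * c) * / G * T) = / (n * tau) * T)%C).
    { transitivity (- Ci / ((RtoC (sqrt (INR N)) * c) * (RtoC (sqrt (INR N)) * c)) * T)%C;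
        [field; auto 10|].
      rewrite (proj2 HcN). fold n. field. auto using Ci_neq0. }
    rewrite E. ring.
  - intros r _.
    rewrite (appell_inversion (n * tau) _ _ (wshift N us tau r) HNt HcN).
    + replace (u0 + zc (Z.of_nat r) * tau + wshift N us tau r)%C with (u0 + s - (n - 1) / 2)%C
        by (unfold wshift; fold n s; ring). ring.
    (* The lattice for N tau is contained in the one for tau, and r tau is a lattice point of the
       latter. *)
    + intros [a [b E]]. apply Hu. exists a, (Z.of_nat N * b - Z.of_nat r)%Z.
      rewrite zc_minus, zc_mult. fold n.
      transitivity (u0 + zc (Z.of_nat r) * tau - zc (Z.of_nat r) * tau)%C; [ring|].
      rewrite E. ring.
Qed.

Lemma usum_isum (N : nat) (us : nat -> C) : usum N us = (us O + isum us 1 N)%C.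
Proof.
  assert (H : forall d j, isum us j (S d) = (isum us j d + us (j + d)%nat)%C).
  { induction d as [|d IH]; intros j.
    - simpl. rewrite Nat.add_0_r. ring.
    - change (isum us j (S (S d))) with (us j + isum us (S j) (S d))%C. rewrite IH.
      change (isum us j (S d)) with (us j + isum us (S j) d)%C.
      replace (S j + d)%nat with (j + S d)%nat by lia. ring. }
  induction N as [|N IH]; [simpl; ring|].
  cbn [usum]. rewrite IH, H. replace (1 + N)%nat with (S N) by lia. ring.
Qed.

Lemma Cpown_epi (a : C) (m : nat) : Cpown (epi a) m = epi (zc (Z.of_nat m) * a).
Proof.
  induction m as [|m IH]; cbn [Cpown].
  - simpl. rewrite Cmult_0_l. symmetry; apply epi_0.
  - rewrite IH, <- epi_plus. f_equal.
    replace (Z.of_nat (S m)) with (Z.of_nat m + 1)%Z by lia. rewrite zc_plus. ring.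
Qed.

Lemma Cpown_iprod (a : C) (d : nat) : forall j, Cpown a d = iprod (fun _ => a) j d.
Proof. induction d as [|d IH]; intros j; cbn [Cpown iprod]; [reflexivity|]. now rewrite <- IH. Qed.

Lemma MN_Xser (N : nat) (us : nat -> C) (tau : C) (k : nat) : (1 <= N)%nat -> 0 < Im tau ->
  MN N us tau k = (epi (zc (Z.of_nat k) - 2 * zc (Z.of_nat k) * (us O + isum us 1 N)
      / zc (Z.of_nat N) - zc (Z.of_nat k) * zc (Z.of_nat k) * tau / zc (Z.of_nat N)) *
    (iprod (fun j => / vartheta (us j) tau) 1 N *
     Xser N (us O + zc (Z.of_nat k) * tau) us tau))%C.
Proof.
  intros HN Ht. unfold MN. rewrite muN_Xser by exact Ht.
  assert (Hn0 : zc (Z.of_nat N) <> RtoC 0) by (apply RtoC_neq, not_0_IZR; lia).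
  assert (Hsh : forall i, (1 <= i)%nat -> shift0 us (RtoC (INR k) * tau) i = us i).
  { intros i Hi. unfold shift0. destruct (Nat.eqb i 0) eqn:E; [|reflexivity].
    apply Nat.eqb_eq in E. lia. }
  replace (shift0 us (RtoC (INR k) * tau) O) with (us O + zc (Z.of_nat k) * tau)%C
    by (now rewrite <- INR_IZR_INZ).
  rewrite (iprod_ext _ (fun j => / vartheta (us j) tau)%C)
    by (intros i Hi; now rewrite Hsh by lia).
  assert (EX : Xser N (us O + zc (Z.of_nat k) * tau) (shift0 us (RtoC (INR k) * tau)) tau =
    Xser N (us O + zc (Z.of_nat k) * tau) us tau).
  { apply sumZ_ext. intros m. f_equal. apply conv_ext. intros i p Hi. unfold gcoef.
    now rewrite Hsh. }
  rewrite EX, msign_epi, usum_isum, !INR_IZR_INZ. f_equal.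
  match goal with |- (_ * cexp ?x)%C = _ => replace x with
    (PI * Ci * (- (2 * zc (Z.of_nat k) * (us O + isum us 1 N) / zc (Z.of_nat N)
      + zc (Z.of_nat k) * zc (Z.of_nat k) * tau / zc (Z.of_nat N))))%C by (field; exact Hn0) end.
  fold (epi (- (2 * zc (Z.of_nat k) * (us O + isum us 1 N) / zc (Z.of_nat N)
      + zc (Z.of_nat k) * zc (Z.of_nat k) * tau / zc (Z.of_nat N)))).
  rewrite <- epi_plus. f_equal. field. exact Hn0.
Qed.

(** For nu = m + 1/2 one has nu^2 = m (m + 1) + 1/4, and m (m + 1) is even; only the quarter
    survives. *)
Lemma vartheta_addtau1 (v tau : C) : 0 < Im tau ->
  vartheta v (tau + 1) = (epi (/ 4) * vartheta v tau)%C.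
Proof.
  intros Ht. assert (Ht' : 0 < Im (tau + 1)) by (rewrite Im_plus; simpl; lra).
  rewrite !vartheta_th3 by assumption.
  replace (th3 (tau + 1) (v + (tau + 1) / 2 + / 2)) with (th3 tau (v + tau / 2 + / 2)).
  - replace (v + (tau + 1) / 4)%C with (/ 4 + (v + tau / 4))%C by field.
    rewrite epi_plus. ring.
  - rewrite <- (th3_add1 (tau + 1)). apply sumZ_ext. intros m. f_equal.
    rewrite <- (epi_periodic _ (- m)). symmetry.
    assert (Hm : exists k, (m * m + m = 2 * k)%Z).
    { destruct (Z.Even_or_Odd m) as [[k Hk]|[k Hk]]; subst m;
        [exists (2 * k * k + k)%Z|exists (2 * k * k + 3 * k + 1)%Z]; ring. }
    destruct Hm as [k Hk]. apply epi_congr with (k + 2 * m)%Z.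
    assert (E : (zc m * zc m + zc m)%C = (2 * zc k)%C)
      by (rewrite <- zc_mult, <- zc_plus, Hk, zc_mult; reflexivity).
    rewrite zc_opp, zc_plus, zc_mult.
    transitivity (zc m * zc m * tau + 2 * zc m * (v + tau / 2 + / 2) + (zc m * zc m + zc m)
      + 2 * zc m)%C; [field|]. rewrite E. ring.
Qed.

(** Since p^2 - p is even, the coefficient of degree m acquires (-1)^m, while [phi] acquires (-1)^(m
    + k); the two powers (-1)^m cancel. *)
Lemma Xser_addtau1 (N : nat) (u0 : C) (us : nat -> C) (tau : C) (k : Z) : 0 < Im tau ->
  Xser N (u0 + zc k * (tau + 1)) us (tau + 1) = (epi (zc k) * Xser N (u0 + zc k * tau) us tau)%C.
Proof.
  intros Ht. unfold Xser. rewrite <- sumZ_scal by now apply Xser_summable.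
  apply sumZ_ext. intros m.
  assert (E : coefs N us (tau + 1) m = (epi (zc m) * coefs N us tau m)%C).
  { unfold coefs.
    rewrite (conv_ext _ (fun i p => epi (zc p * 1) * gcoef us tau i p)%C).
    - rewrite conv_modulate by (intros; now apply gcoef_summable). now rewrite Cmult_1_r.
    - intros i p _. unfold gcoef. rewrite <- !epi_plus.
      assert (Hp : exists q, (p * p - p = 2 * q)%Z).
      { destruct (Z.Even_or_Odd p) as [[q Hq]|[q Hq]]; subst p;
          [exists (2 * q * q - q)%Z|exists (2 * q * q + q)%Z]; ring. }
      destruct Hp as [q Hq]. apply epi_congr with q.
      assert (E : (zc p * zc p - zc p)%C = (2 * zc q)%C)
        by (rewrite <- zc_mult, <- zc_minus, Hq, zc_mult; reflexivity).
      rewrite <- E. ring. }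
  rewrite E.
  replace (u0 + zc k * (tau + 1) + zc m * (tau + 1))%C with
    (u0 + zc k * tau + zc m * tau + zc k + zc m)%C by ring.
  rewrite !phi_addZ.
  transitivity (epi (zc m) * epi (zc m) * (epi (zc k) * (coefs N us tau m *
    phi (u0 + zc k * tau + zc m * tau))))%C; [ring|]. rewrite epi_zc_sqr. ring.
Qed.

Theorem theorem1p4 (N : nat) (us : nat -> C) (tau : C) :
  0 < Im tau ->
  (1 <= N)%nat ->
  (forall j : nat, (j <= N)%nat ->
     ~ in_lattice tau (us j) /\ ~ in_lattice (- / tau)%C (us j / tau)%C) ->
  let u := usum N us in
  (* (i) *)
  (forall j : nat, (j < N)%nat ->
     MN N us tau j =
     (cexp (PI * Ci * RtoC (INR N) / 4)
       * (msign (Z.of_nat j) * Cpown (zeta (2 * N)) (j * j))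
       * MN N us (tau + 1)%C j)%C)
  /\
  (* (ii) *)
  (forall j : nat, (j < N)%nat ->
     MN N us tau j =
     ((Cpown (- Ci) (N + 1) * cexp (PI * Ci * u * u / (RtoC (INR N) * tau))
        / (RtoC (sqrt (INR N)) * Csqrt (- Ci * tau)))
       * Csumn N (fun k =>
           / Cpown (zeta N) (j * k)
           * MN N (fun i => us i / tau) (- / tau) k)
      - (msign (Z.of_nat N) * Ci / 2)
        * (msign (Z.of_nat j)
           * cexp (- (2 * PI * Ci * RtoC (INR j) * u / RtoC (INR N)))
           * qpow tau (- (INR j ^ 2) / (2 * INR N))
           * mordell_h (u + RtoC (INR j) * tau - RtoC ((INR N - 1) / 2))
                       (RtoC (INR N) * tau)))%C).
Proof.
  intros Ht HN Hlat u.
  set (n := zc (Z.of_nat N)). set (s := isum us 1 N).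
  assert (Eu : u = (us O + s)%C) by apply usum_isum.
  assert (HN0 : INR N <> 0) by (apply not_0_INR; lia).
  assert (En : RtoC (INR N) = n) by (unfold n; now rewrite <- INR_IZR_INZ).
  assert (Hn0 : n <> RtoC 0) by (rewrite <- En; now apply RtoC_neq).
  pose proof (upper_neq0 tau Ht) as Ht0.
  assert (Hth : forall i, (1 <= i < 1 + N)%nat -> vartheta (us i) tau <> RtoC 0).
  { intros i Hi. apply vartheta_neq0; [exact Ht|]. apply Hlat. lia. }
  split; intros j Hj; set (J := zc (Z.of_nat j)).
  - assert (Ht' : 0 < Im (tau + 1)) by (rewrite Im_plus; simpl; lra).
    rewrite !MN_Xser by auto. rewrite Xser_addtau1 by exact Ht. fold n s J.
    set (X := Xser N (us O + J * tau) us tau).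
    rewrite (iprod_ext (fun i => / vartheta (us i) (tau + 1))%C
      (fun i => epi (- / 4) * / vartheta (us i) tau)%C).
    2: { intros i Hi. rewrite vartheta_addtau1, epi_opp by exact Ht.
         field. split; [now apply Hth|apply epi_neq0]. }
    rewrite iprod_mult, iprod_epi.
    replace (isum (fun _ => (- / 4)%C) 1 N) with (- (n / 4))%C
      by (rewrite isum_const; fold n; field).
    set (P := iprod _ 1 N).
    replace (PI * Ci * RtoC (INR N) / 4)%C with (PI * Ci * (n / 4))%C by (rewrite En; field).
    fold (epi (n / 4)). rewrite msign_epi. fold J. unfold zeta. rewrite ee_epi, Cpown_epi.
    rewrite Nat2Z.inj_mul, zc_mult. fold J.
    replace (RtoC (/ INR (2 * N))) with (/ (2 * n))%C.
    2: { rewrite RtoC_inv by (apply not_0_INR; lia).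
         rewrite mult_INR, RtoC_mult, En. reflexivity. }
    transitivity (P * X * epi (J - 2 * J * (us O + s) / n - J * J * tau / n))%C; [ring|].
    transitivity (P * X * (epi (n / 4) * epi J * epi (J * J * (2 * / (2 * n))) *
      epi (J - 2 * J * (us O + s) / n - J * J * (tau + 1) / n) * epi (- (n / 4)) * epi J))%C;
      [|ring].
    (* The power of zeta_2N cancels the quadratic phase created by tau + 1, the factor e^(pi i N/4)
       cancels the theta factors, and the two signs (-1)^j leave the even exponent 2 j. *)
    rewrite <- !epi_plus. f_equal. symmetry. apply epi_congr with (Z.of_nat j).
    fold J. field. exact Hn0.
  - set (c := Csqrt (- Ci * tau)). pose proof (Csqrt_is_sqrt tau Ht) as Hc. fold c in Hc.
    pose proof (sqrt_tau_neq0 c tau Hc) as Hc0.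
    pose proof (neg_inv_upper tau Ht) as Hs.
    (* The entry j is [Xser_inversion] at u_0 + j tau, which is off the lattice together with
       u_0. *)
    assert (Hu : ~ in_lattice tau (us O + J * tau)).
    { intros [a [b E]]. apply (proj1 (Hlat O ltac:(lia))). exists a, (b - Z.of_nat j)%Z.
      rewrite zc_minus. fold J. transitivity (us O + J * tau - J * tau)%C; [ring|].
      rewrite E. ring. }
    assert (Hsq0 : RtoC (sqrt (INR N)) <> RtoC 0).
    { apply RtoC_neq. assert (0 < sqrt (INR N)); [|lra]. apply sqrt_lt_R0, lt_0_INR. lia. }
    rewrite MN_Xser by auto. fold n s J.
    rewrite (Xser_inversion N (us O + J * tau) us tau c HN Ht Hu Hc). fold n s J.
    set (P := iprod (fun i => vartheta (us i) tau) 1 N).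
    assert (HP : P <> RtoC 0) by (apply iprod_neq0; exact Hth).
    rewrite (iprod_inv _ _ _ Hth). fold P.
    set (Q := iprod (fun i => c * epi (us i * us i / tau))%C 1 N).
    assert (HQ : Q <> RtoC 0).
    { apply iprod_neq0. intros. apply Cneq_mult; [exact Hc0|apply epi_neq0]. }
    set (M := Cpown (- Ci) N).
    assert (HM : M <> RtoC 0).
    { unfold M. rewrite (Cpown_iprod _ _ 1). apply iprod_neq0. intros _ _ E. apply Ci_neq0.
      replace Ci with (- - Ci)%C by ring. rewrite E. ring. }
    (* Inverting the N thetas yields [M], the power (-i)^N; one more -i comes from [Xser_inversion],
       which makes the exponent N + 1. *)
    assert (EP' : iprod (fun i => vartheta (us i / tau) (- / tau)) 1 N = (M * Q * P)%C).
    { unfold M, Q, P. rewrite (Cpown_iprod _ _ 1), <- !iprod_mult. apply iprod_ext.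
      intros i _. rewrite (vartheta_inversion tau c _ Ht Hc). ring. }
    assert (Hth' : forall i, (1 <= i < 1 + N)%nat -> vartheta (us i / tau) (- / tau) <> RtoC 0).
    { intros i Hi. apply vartheta_neq0; [exact Hs|]. apply Hlat. lia. }
    set (Y := fun k : nat => Xser N (us O / tau - zc (Z.of_nat k) / tau)
       (fun i => us i / tau)%C (- / tau)).
    (* After division by tau the shift j tau is the integer j, which costs only the sign (-1)^j. *)
    assert (EY : forall k : nat, Xser N ((us O + J * tau) / tau - zc (Z.of_nat k) / tau)
       (fun i => us i / tau)%C (- / tau) = (epi J * Y k)%C).
    { intros k. unfold Y. rewrite <- (Xser_addZ N _ _ _ (Z.of_nat j) Hs). fold J. f_equal.
      field. exact Ht0. }
    assert (Eis : isum (fun i => us i / tau)%C 1 N = (s / tau)%C) by apply isum_scal.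
    (* The phase -2 j k/N is what j tau contributes to the linear weight in k of [Xser_inversion];
       it is exactly zeta_N^(-jk). *)
    assert (EM : forall k : nat, (/ Cpown (zeta N) (j * k) *
       MN N (fun i => us i / tau)%C (- / tau) k)%C =
      (/ (M * Q * P) * (epi (zc (Z.of_nat k) - 2 * J * zc (Z.of_nat k) / n
         - 2 * zc (Z.of_nat k) * (us O + s) / (n * tau) +
         zc (Z.of_nat k) * zc (Z.of_nat k) / (n * tau)) * Y k))%C).
    { intros k. rewrite MN_Xser by auto.
      rewrite (iprod_inv _ _ _ Hth'), EP', Eis. fold n.
      replace (us O / tau + zc (Z.of_nat k) * - / tau)%C with
        (us O / tau - zc (Z.of_nat k) / tau)%C by (field; exact Ht0).
      fold (Y k). unfold zeta. rewrite ee_epi, Cpown_epi, <- epi_opp.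
      rewrite Nat2Z.inj_mul, zc_mult. fold J.
      rewrite RtoC_inv, En by exact HN0.
      match goal with |- (?a * (?b * (?p * ?y)))%C = _ =>
        transitivity (p * (a * b * y))%C; [ring|] end.
      rewrite <- epi_plus. do 3 f_equal. field. auto. }
    rewrite (Csumn_ext N _ _ (fun k _ => EM k)), Csumn_scal.
    rewrite (Csumn_ext N (fun k => epi (zc (Z.of_nat k) - 2 * zc (Z.of_nat k) *
        (us O + J * tau + s) / (n * tau) + zc (Z.of_nat k) * zc (Z.of_nat k) / (n * tau)) *
        Xser N ((us O + J * tau) / tau - zc (Z.of_nat k) / tau) (fun i => us i / tau) (- / tau))%C
      (fun k => epi J * (epi (zc (Z.of_nat k) - 2 * J * zc (Z.of_nat k) / n
         - 2 * zc (Z.of_nat k) * (us O + s) / (n * tau) +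
         zc (Z.of_nat k) * zc (Z.of_nat k) / (n * tau)) * Y k))%C).
    2: { intros k _. rewrite EY.
         replace (zc (Z.of_nat k) - 2 * zc (Z.of_nat k) * (us O + J * tau + s) / (n * tau)
           + zc (Z.of_nat k) * zc (Z.of_nat k) / (n * tau))%C with
           (zc (Z.of_nat k) - 2 * J * zc (Z.of_nat k) / n
           - 2 * zc (Z.of_nat k) * (us O + s) / (n * tau) +
           zc (Z.of_nat k) * zc (Z.of_nat k) / (n * tau))%C by (field; auto). ring. }
    rewrite Csumn_scal. set (SS := Csumn N _).
    replace (PI * Ci * u * u / (RtoC (INR N) * tau))%C with
      (PI * Ci * ((us O + s) * (us O + s) / (n * tau)))%C
      by (rewrite Eu, En; field; auto).
    fold (epi ((us O + s) * (us O + s) / (n * tau))).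
    replace (- (2 * PI * Ci * RtoC (INR j) * u / RtoC (INR N)))%C with
      (PI * Ci * (- (2 * J * (us O + s) / n)))%C
      by (rewrite Eu, En, (INR_IZR_INZ j); unfold J; field; auto).
    fold (epi (- (2 * J * (us O + s) / n))).
    unfold qpow. rewrite ee_epi, !msign_epi. fold n J.
    replace (RtoC (- (INR j ^ 2) / (2 * INR N))) with (- (J * J) / (2 * n))%C.
    2: { rewrite RtoC_div, RtoC_opp, RtoC_mult, En, (INR_IZR_INZ j) by lra.
         rewrite <- zc_sq. reflexivity. }
    rewrite En. replace (RtoC (INR j)) with J by (unfold J; now rewrite <- INR_IZR_INZ).
    replace (RtoC ((INR N - 1) / 2)) with ((n - 1) / 2)%C.
    2: { rewrite RtoC_div, RtoC_minus, En by lra. reflexivity. }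
    rewrite Eu.
    replace (us O + s + J * tau - (n - 1) / 2)%C with (us O + J * tau + s - (n - 1) / 2)%C by ring.
    set (h := mordell_h _ _).
    replace (Cpown (- Ci) (N + 1)) with (- Ci * M)%C by (rewrite Nat.add_1_r; reflexivity).
    set (sq := RtoC (sqrt (INR N))) in *.
    (* The prefactor of the entry j completes the Gaussian at u + j tau to the one at u. *)
    assert (E1 : (epi (J - 2 * J * (us O + s) / n - J * J * tau / n) *
      epi ((us O + J * tau + s) * (us O + J * tau + s) / (n * tau)) * epi J)%C =
      epi ((us O + s) * (us O + s) / (n * tau))).
    { rewrite <- !epi_plus. apply epi_congr with (Z.of_nat j). fold J. field. auto. }
    rewrite <- E1.
    (* e^(pi i (N - 1)) = -(-1)^N is the sign in front of the Mordell term. *)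
    assert (E2 : (epi (J - 2 * J * (us O + s) / n - J * J * tau / n) * epi (n - 1))%C =
      (- (epi n * (epi J * epi (- (2 * J * (us O + s) / n)) *
        epi (2 * (- (J * J) / (2 * n) * tau)))))%C).
    { transitivity (epi (- (1)) * (epi n * (epi J * epi (- (2 * J * (us O + s) / n)) *
        epi (2 * (- (J * J) / (2 * n) * tau)))))%C.
      - rewrite <- !epi_plus. f_equal. field. auto.
      - rewrite (epi_opp 1), epi_1. field. }
    set (e1 := epi (J - 2 * J * (us O + s) / n - J * J * tau / n)) in *.
    transitivity (e1 * epi ((us O + J * tau + s) * (us O + J * tau + s) / (n * tau)) * epi J *
      (- Ci / (sq * c * Q * P)) * SS + (e1 * epi (n - 1)) * (Ci / 2 * h))%C;
      [field; auto|].
    rewrite E2. field. auto 10.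
Qed.
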